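(* Let $X$ be a complex manifold and let $Y\subset X$ be a non-singular compact hypersurface whose normal bundle $N_{Y/X}$ is unitary flat. Let $r\in\{2,3,4,\dots\}\cup\{\infty\}$ and assume that the line bundle $[Y]$ on $X$ associated with the divisor $Y$ is $C^r$-semipositive. Then, for every positive integer $m$ with $\max\{3,2m\}\le r$, the Ueda type of the pair $(Y,X)$ is larger than or equal to $m+1$; that is, there exist open subsets $V_j$ of $X$ which together cover $Y$, a holomorphic defining function $w_j$ of $V_j\cap Y$ on each $V_j$, and constants $t_{jk}\in\mathrm{U}(1)$, such that $$t_{jk}w_k=w_j+O(w_j^{m+2})$$ holds on each $V_j\cap V_k$.
   Context: $\mathrm{U}(1)=\{t\in\mathbb{C}: |t|=1\}$. A holomorphic line bundle is unitary flat if, for a suitable system of local trivializations, its transition functions are locally constant functions with values in $\mathrm{U}(1)$. A holomorphic line bundle $L$ on $X$ is $C^r$-semipositive if it admits a Hermitian metric $h$ of class $C^r$ whose Chern curvature $\sqrt{-1}\Theta_h$ is positive semi-definite at every point of $X$. A holomorphic defining function of $V_j\cap Y$ on $V_j$ is a holomorphic function on $V_j$ whose zero divisor is $V_j\cap Y$ (with multiplicity one). $t_{jk}w_k=w_j+O(w_j^{m+2})$ means that $t_{jk}w_k-w_j$ vanishes to order at least $m+2$ along $V_j\cap V_k\cap Y$. Ueda type: a system $\{(V_j,w_j)\}$ of local defining functions of $Y$ is of type $\ell$ if for some constants $t_{jk}\in\mathrm{U}(1)$ one has $t_{jk}w_k=w_j+O(w_j^{\ell+1})$ on each $V_j\cap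 V_k$. When a system of type $\ell$ exists, the coefficients of $w_j^{\ell+1}$ in the expansions of $t_{jk}w_k$ define a class $u_\ell(Y,X)\in H^1(Y,N_{Y/X}^{-\ell})$ (well-defined up to the action of $\mathrm{U}(1)$), and a system of type $\ell+1$ exists if and only if $u_\ell(Y,X)=0$. The Ueda type of $(Y,X)$ is the $\ell$ for which a system of type $\ell$ exists and $u_\ell(Y,X)\neq 0$, and is $\infty$ if there is no such $\ell$. *)

(* Defs.v *)
From HB Require Import structures.
From mathcomp Require Import all_boot all_order all_algebra.
From mathcomp Require Import all_classical all_reals all_analysis.
From mathcomp Require Import complex.

Set Implicit Arguments.
Unset Strict Implicit.
Unset Printing Implicit Defensive.

Import Order.TTheory GRing.Theory Num.Theory.
Import numFieldNormedType.Exports.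

Local Open Scope classical_set_scope.
Local Open Scope ring_scope.
Local Open Scope complex_scope.

(* R[i] packaged as a numClosedFieldType: it is through this packaging that
   'rV[Cplx R]_n.+1 is inferred to be a normed module over Cplx R, so that
   [differentiable] below is complex differentiability. *)
Definition Cplx (R : realType) : numClosedFieldType := R[i].

(* Complex manifolds of pure dimension n.+1.  Only the values of [chart a] on
   [chart_dom a] and of [chart_inv a] on [chart a @` chart_dom a] matter. *)
Record complexManifold (R : realType) (n : nat) := ComplexManifold {
  cm_space :> topologicalType;
  cm_hausdorff : hausdorff_space cm_space;
  cm_second_countable : @second_countable cm_space;
  chart_index : Type;
  chart_dom : chart_index -> set cm_space;
  chart : chart_index -> cm_space -> 'rV[Cplx R]_n.+1;
  chart_inv : chart_index -> 'rV[Cplx R]_n.+1 -> cm_space;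
  chart_dom_open : forall a, open (chart_dom a);
  chart_dom_cover : forall p, exists a, chart_dom a p;
  chart_img_open : forall a, open (chart a @` chart_dom a);
  chartK : forall a p, chart_dom a p -> chart_inv a (chart a p) = p;
  chart_continuous : forall a p, chart_dom a p -> {for p, continuous (chart a)};
  chart_inv_continuous : forall a p, chart_dom a p ->
    {for chart a p, continuous (chart_inv a)};
  chart_holomorphic : forall a b p, chart_dom a p -> chart_dom b p ->
    differentiable (chart b \o chart_inv a) (chart a p) }.

(* C^r functions of real variables on open subsets of C^n.+1 *)
Section RealCalculus.
Variables (R : realType) (n : nat).
Local Notation C := (Cplx R).
Local Notation V := 'rV[C]_n.+1.

Definition real_curve (f : V -> R) (v z : V) : R -> R :=
  fun t => f (z + (t%:C : C) *: v).

Definition dirD (v : V) (f : V -> R) (z : V) : R := derive1 (real_curve f v z) 0.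

(* v ranges over all real directions of C^n.+1, in particular over those of the
   coordinates x_j and y_j, where z_j = x_j + i y_j. *)
Fixpoint Ck (k : nat) (U : set V) (f : V -> R) : Prop :=
  (forall z, U z -> {for z, continuous f}) /\
  (if k is k'.+1 then
     forall v : V, (forall z, U z -> derivable (real_curve f v z) 0 1) /\
                   Ck k' U (dirD v f)
   else True).

(* Regularity orders in {0, 1, 2, ...} or infinity; None is infinity. *)
Definition le_order (k : nat) (r : option nat) : bool :=
  if r is Some r' then (k <= r')%N else true.

Definition Cr (r : option nat) (U : set V) (f : V -> R) : Prop :=
  forall k, le_order k r -> Ck k U f.

Definition dirDC (v : V) (F : V -> C) (z : V) : C :=
  dirD v (fun w => complex.Re (F w)) z +i* dirD v (fun w => complex.Im (F w)) z.

(* The Wirtinger operators d/dz_j and d/d(conj z_j) *)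
Definition dz (j : 'I_n.+1) (F : V -> C) (z : V) : C :=
  (dirDC (delta_mx 0 j) F z - 'i%R * dirDC ('i%R *: delta_mx 0 j) F z) / 2.

Definition dzbar (j : 'I_n.+1) (F : V -> C) (z : V) : C :=
  (dirDC (delta_mx 0 j) F z + 'i%R * dirDC ('i%R *: delta_mx 0 j) F z) / 2.

(* Coefficients of the Chern curvature of the weight h (the squared norm of a
   holomorphic frame):
   Theta_h = - d dbar (log h) = \sum_(j, k) chern_coef h j k dz_j /\ dzbar_k. *)
Definition chern_coef (h : V -> R) (j k : 'I_n.+1) (z : V) : C :=
  - dz j (dzbar k (fun w => (ln (h w))%:C)) z.

(* On Cplx R, 0 <= x means that x is real and nonnegative. *)
Definition chern_semipositive_at (h : V -> R) (z : V) : Prop :=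
  forall xi : V,
    0 <= \sum_(j < n.+1) \sum_(k < n.+1)
           chern_coef h j k z * xi 0 j * (xi 0 k)^*%R.

End RealCalculus.

Section Geometry.
Variables (R : realType) (n : nat) (X : complexManifold R n).
Local Notation C := (Cplx R).

Definition holo_at (f : X -> C) (p : X) : Prop :=
  forall a, chart_dom a p -> differentiable (f \o chart_inv a) (chart a p).

Definition holo (U : set X) (f : X -> C) : Prop :=
  forall p, U p -> holo_at f p.

(* Sections over S `&` U of the structure sheaf of the submanifold S of X:
   local restrictions of holomorphic functions of X. *)
Definition holo_on (S U : set X) (f : X -> C) : Prop :=
  forall p, S p -> U p ->
    exists F : X -> C, \forall q \near p, holo_at F q /\ (S q -> F q = f q).

Definition chart_diff (a : chart_index X) (f : X -> C) (p : X) (v : 'rV[C]_n.+1) : C :=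
  'd (f \o chart_inv a) (chart a p) v.

(* The zero divisor of w on V is V `&` Y with multiplicity one: w vanishes
   exactly on Y, and its differential has no zero along Y. *)
Definition defining_function (Y V : set X) (w : X -> C) : Prop :=
  [/\ holo V w,
      forall p, V p -> (w p = 0 <-> Y p) &
      forall a p, V p -> Y p -> chart_dom a p -> exists v, chart_diff a w p v != 0].

Definition nonsingular_hypersurface (Y : set X) : Prop :=
  closed Y /\
  forall p, Y p -> exists V w, [/\ open V, V p & defining_function Y V w].

(* Holomorphic line bundles on a submanifold S of X (S = setT for X itself),
   given by local trivializations over the S `&` lb_dom i.  Fibre coordinates
   are related by xi_i = lb_trans i j * xi_j. *)
Record line_bundle (S : set X) := LineBundle {
  lb_index : Type;
  lb_dom : lb_index -> set X;
  lb_trans : lb_index -> lb_index -> X -> C;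
  lb_dom_open : forall i, open (lb_dom i);
  lb_dom_cover : forall p, S p -> exists i, lb_dom i p;
  lb_trans_holo : forall i j, holo_on S (lb_dom i `&` lb_dom j) (lb_trans i j);
  lb_trans_id : forall i p, S p -> lb_dom i p -> lb_trans i i p = 1;
  lb_trans_cocycle : forall i j k p,
    S p -> lb_dom i p -> lb_dom j p -> lb_dom k p ->
    lb_trans i j p * lb_trans j k p = lb_trans i k p }.

(* c i' i is the expression xi'_i' = c i' i * xi_i of the isomorphism in the
   trivializations i of L and i' of L'. *)
Definition lb_isomorphic (S : set X) (L L' : line_bundle S) : Prop :=
  exists c : lb_index L' -> lb_index L -> X -> C,
    [/\ forall i' i, holo_on S (lb_dom i' `&` lb_dom i) (c i' i),
        forall i' i p, S p -> lb_dom i' p -> lb_dom i p -> c i' i p != 0 &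
        forall i' j' i j p,
          S p -> lb_dom i' p -> lb_dom j' p -> lb_dom i p -> lb_dom j p ->
          c i' i p * lb_trans i j p = lb_trans i' j' p * c j' j p].

Definition unitary_flat (S : set X) (L : line_bundle S) : Prop :=
  exists2 L' : line_bundle S, lb_isomorphic L L' &
    forall (i j : lb_index L') p, S p -> lb_dom i p -> lb_dom j p ->
      `|lb_trans i j p| = 1 /\
      \forall q \near p, S q -> lb_trans i j q = lb_trans i j p.

(* L is the line bundle [Y] of the divisor Y: local defining functions f_i of Y
   form a section, i.e. the transition functions are f_i / f_j. *)
Definition is_divisor_bundle (Y : set X) (L : line_bundle [set: X]) : Prop :=
  exists f : lb_index L -> X -> C,
    (forall i, defining_function Y (lb_dom i) (f i)) /\
    forall i j p, lb_dom i p -> lb_dom j p ->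
      f i p = lb_trans i j p * f j p.

(* N is the normal bundle (TX restricted to Y) / TY: since TY is the kernel
   along Y of df_i for a local defining function f_i of Y, df_i induces a
   trivialization of the normal bundle over Y `&` lb_dom i. *)
Definition is_normal_bundle (Y : set X) (N : line_bundle Y) : Prop :=
  exists f : lb_index N -> X -> C,
    (forall i, defining_function Y (lb_dom i) (f i)) /\
    forall i j a p v, Y p -> lb_dom i p -> lb_dom j p -> chart_dom a p ->
      chart_diff a (f i) p v = lb_trans i j p * chart_diff a (f j) p v.

(* h i is the squared norm of the frame xi_i = 1 of L over lb_dom i. *)
Definition hermitian_metric (r : option nat) (L : line_bundle [set: X])
    (h : lb_index L -> X -> R) : Prop :=
  [/\ forall i p, lb_dom i p -> 0 < h i p,
      forall i j p, lb_dom i p -> lb_dom j p ->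
        (h j p)%:C = (`|lb_trans i j p| ^+ 2 * (h i p)%:C : C) &
      forall i a,
        Cr r (chart a @` (chart_dom a `&` lb_dom i)) (h i \o chart_inv a)].

Definition semipositive (r : option nat) (L : line_bundle [set: X]) : Prop :=
  exists2 h : lb_index L -> X -> R, hermitian_metric r h &
    forall i a p, lb_dom i p -> chart_dom a p ->
      chern_semipositive_at (h i \o chart_inv a) (chart a p).

(* f = O(w ^ k) on V *)
Definition vanishes_to_order (V : set X) (w : X -> C) (k : nat) (f : X -> C) :
    Prop :=
  exists2 g : X -> C, holo V g & forall p, V p -> f p = g p * w p ^+ k.

(* A system {(V_j, w_j)} of local defining functions of Y, with constants t_jk,
   of type l: t_jk w_k = w_j + O(w_j^(l+1)). *)
Definition system_of_type (Y : set X) (l : nat) (J : Type) (V : J -> set X)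
    (w : J -> X -> C) (t : J -> J -> C) : Prop :=
  [/\ forall j, open (V j),
      Y `<=` \bigcup_j V j,
      forall j, defining_function Y (V j) (w j),
      forall j k, `|t j k| = 1 &
      forall j k, vanishes_to_order (V j `&` V k) (w j) l.+1
                    (fun p => t j k * w k p - w j p)].

End Geometry.

(* Main.v *)
(** Write f for the canonical section of [Y] and h for its metric. In a local
    coordinate w = u f, the function psi = |w|^2 / |f|_h^2 satisfies
    sqrt(-1) d dbar log psi >= 0, so psi has the sub-mean value property on
    every complex disc. Unitary flatness of the normal bundle makes |dw|
    independent of the coordinate chosen, so psi restricted to Y is a global
    plurisubharmonic function, hence constant, and w can be normalized to have
    psi = 1 on Y.

    Suppose that the coordinates satisfy
    psi = 1 + sum_(k, l > 0) a_kl w^k conj(w)^l + O(w^m) with constant a_kl.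
    Comparing two of them gives w_q = tau w_p + O(w_p^(m+1)) with |tau| = 1.
    Increase the degree N = k + l from 0 to 2m - 1 in the expansion of psi, with
    coefficients a_kl depending on the point z of Y.  By the sub-mean inequality
    on the discs t -> (z + t nu, w), the leading part of degree N of
    mean psi - psi is a nonnegative form in w; its mean over |w| = 1 is the
    defect of a_kk for 2k = N, and a_kk is a global subharmonic function on Y,
    hence constant, so all the a_kl have the mean value property; for k, l < m
    moreover |a_kl|^2 is global and subharmonic, so a_kl is constant.  Tilting
    the disc to (z + t nu, eta^2 + t sigma eta^(2m-1)), the term of order
    eta^(4m-3) in the sub-mean inequality is 2m Re(sigma mean(a_m0(z + t nu) t)),
    which must therefore vanish: a_m0 is holomorphic, and w (1 - a_m0 w^m)
    satisfies the hypothesis with m + 1 in place of m. *)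

From HB Require Import structures.
From mathcomp Require Import all_boot all_order all_algebra.
From mathcomp Require Import all_classical all_reals all_analysis.
From mathcomp Require Import complex.
From mathcomp Require Import ring lra zify.
Require Import Defs.
Set Implicit Arguments.
Unset Strict Implicit.
Unset Printing Implicit Defensive.
Import Order.TTheory GRing.Theory Num.Theory.
Import numFieldNormedType.Exports.
Local Open Scope classical_set_scope.
Local Open Scope ring_scope.

(** * Real-valued norms and complex numbers *)

Section ComplexNorm.
Variable R : realType.
Local Notation C := (Cplx R).

(** The regularity of [h] shapes the argument: at stage m only the Taylor expansion of psi with
    remainder O(|w|^(2m)) is at hand. Differentiating psi twice would cost two orders, so positivity
    is passed on as a sub-mean inequality for psi itself, the logarithm being removed by convexity
    of the exponential, and is then applied to the truncated expansion. The exponents: with |w| =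
    eta^2 the tilt eta^(2m-1) is |w|^(m - 1/2). The wanted term, linear in the tilt, has order
    eta^(4m-3); terms quadratic in the tilt have order eta^(4m-2), the other linear ones that
    survive averaging at least eta^(4m-1), the remainder eta^(4m), or eta^2 when m = 1. So the
    wanted term dominates, and rotating sigma turns the inequality into an equation. A coefficient
    a_kl is multiplied by a mere power of tau and conj(tau) under a change of coordinates only if
    the lower ones are constant: otherwise their variation along the new normal direction enters.
    Hence the induction on N inside the induction on m, carrying constancy together with the mean
    value property. *)

Definition rc (x : R) : C := (x%:C)%C.
Definition cre (z : C) : R := complex.Re z.
Definition cim (z : C) : R := complex.Im z.
(** The norm of a normed module over [C] takes its values in [C]; [nr] reads it in [R], where the
    order is total and linear arithmetic applies. On row vectors it is the maximum norm, so that
    balls are polydiscs and dropping a coordinate stays inside. *)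
Definition nr (T : normedZmodType C) (v : T) : R := cre `|v|.

Lemma rcD x y : rc (x + y) = rc x + rc y. Proof. exact: (rmorphD (@real_complex R)). Qed.
Lemma rcN x : rc (- x) = - rc x. Proof. exact: (rmorphN (@real_complex R)). Qed.
Lemma rcB x y : rc (x - y) = rc x - rc y. Proof. by rewrite rcD rcN. Qed.
Lemma rcM x y : rc (x * y) = rc x * rc y. Proof. exact: (rmorphM (@real_complex R)). Qed.
Lemma rc0 : rc 0 = 0. Proof. by []. Qed.
Lemma rc1 : rc 1 = 1. Proof. by []. Qed.
Lemma rcX x k : rc (x ^+ k) = rc x ^+ k. Proof. exact: (rmorphXn (@real_complex R)). Qed.
Lemma rcV x : rc x^-1 = (rc x)^-1. Proof. exact: (fmorphV (@real_complex R)). Qed.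
Lemma rc_nat k : rc k%:R = k%:R. Proof. exact: (rmorph_nat (@real_complex R)). Qed.
Lemma rc_inj x y : rc x = rc y -> x = y. Proof. by case. Qed.
Lemma cre_rc x : cre (rc x) = x. Proof. by []. Qed.
Lemma cim_rc x : cim (rc x) = 0. Proof. by []. Qed.
Lemma creD x y : cre (x + y) = cre x + cre y. Proof. by case: x y => [a b] [c d]. Qed.
Lemma cimD x y : cim (x + y) = cim x + cim y. Proof. by case: x y => [a b] [c d]. Qed.
Lemma creN x : cre (- x) = - cre x. Proof. by case: x. Qed.
Lemma cimN x : cim (- x) = - cim x. Proof. by case: x. Qed.
Lemma creB x y : cre (x - y) = cre x - cre y. Proof. by rewrite creD creN. Qed.
Lemma cimB x y : cim (x - y) = cim x - cim y. Proof. by rewrite cimD cimN. Qed.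
Lemma creM x y : cre (x * y) = cre x * cre y - cim x * cim y.
Proof. by case: x y => [a b] [c d]. Qed.
Lemma cimM x y : cim (x * y) = cre x * cim y + cim x * cre y.
Proof. by case: x y => [a b] [c d]; rewrite /= addrC. Qed.
Lemma creJ (x : C) : cre x^* = cre x. Proof. by case: x. Qed.
Lemma cimJ (x : C) : cim x^* = - cim x. Proof. by case: x. Qed.
Lemma cre_sum I (r : seq I) P (F : I -> C) :
  cre (\sum_(i <- r | P i) F i) = \sum_(i <- r | P i) cre (F i).
Proof. by apply: (big_morph cre creD). Qed.
Lemma rc_sum I (r : seq I) P (F : I -> R) :
  rc (\sum_(i <- r | P i) F i) = \sum_(i <- r | P i) rc (F i).
Proof. by apply: (big_morph rc rcD). Qed.
Lemma c_eq (x y : C) : cre x = cre y -> cim x = cim y -> x = y.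
Proof. by case: x y => [a b] [c d] /= -> ->. Qed.
Lemma cre_i : cre 'i%R = 0. Proof. by rewrite -complexiE. Qed.
Lemma cim_i : cim 'i%R = 1. Proof. by rewrite -complexiE. Qed.
Lemma cE (z : C) : z = rc (cre z) + 'i%R * rc (cim z).
Proof.
by apply: c_eq; rewrite ?(creD, cimD, creM, cimM, cre_rc, cim_rc, cre_i, cim_i); ring.
Qed.
Lemma rcJ x : (rc x)^* = rc x.
Proof. by apply: c_eq; rewrite ?creJ ?cimJ // /= oppr0. Qed.
Lemma cle0E (z : C) : (0 <= z) = (cim z == 0) && (0 <= cre z).
Proof. by rewrite lecE. Qed.
Lemma rc_le x y : (rc x <= rc y) = (x <= y).
Proof. by rewrite lecE eqxx. Qed.
Lemma rc_lt x y : (rc x < rc y) = (x < y).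
Proof. by rewrite ltcE eqxx. Qed.

Lemma mulrx2 (x : R) : x * 2 = x + x. Proof. by ring. Qed.

Section NormedZmod.
Variable T : normedZmodType C.
Implicit Types v w : T.

Lemma nrE v : `|v| = rc (nr v).
Proof.
have := normr_ge0 v; rewrite cle0E => /andP[/eqP h _].
by apply: c_eq; rewrite ?h.
Qed.
Lemma nr_ge0 v : 0 <= nr v.
Proof. by have := normr_ge0 v; rewrite nrE -rc0 rc_le. Qed.
Lemma nr0 : nr (0 : T) = 0. Proof. by rewrite /nr normr0. Qed.
Lemma nr_eq0 v : (nr v == 0) = (v == 0).
Proof.
apply/eqP/eqP => [h|->]; last exact: nr0.
by apply/eqP; rewrite -normr_eq0 nrE h.
Qed.
Lemma nr_gt0 v : (0 < nr v) = (v != 0).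
Proof. by rewrite lt_neqAle nr_ge0 andbT eq_sym nr_eq0. Qed.
Lemma nrN v : nr (- v) = nr v. Proof. by rewrite /nr normrN. Qed.
Lemma nrBC v w : nr (v - w) = nr (w - v). Proof. by rewrite -nrN opprB. Qed.
Lemma nrD v w : nr (v + w) <= nr v + nr w.
Proof. by rewrite -rc_le rcD -!nrE ler_normD. Qed.
Lemma nrB v w : nr (v - w) <= nr v + nr w.
Proof. by rewrite -(nrN w) nrD. Qed.
Lemma nr_tri u v w : nr (v - w) <= nr (v - u) + nr (u - w).
Proof. by apply: le_trans (nrD _ _); rewrite addrA subrK. Qed.
Lemma nr_sub v w : nr v - nr w <= nr (v - w).
Proof. by rewrite lerBlDr; apply: le_trans (nrD _ _); rewrite subrK. Qed.
Lemma nr_sum I (r : seq I) P (F : I -> T) :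
  nr (\sum_(i <- r | P i) F i) <= \sum_(i <- r | P i) nr (F i).
Proof. by rewrite -rc_le rc_sum -nrE (eq_bigr _ (fun i _ => esym (nrE (F i)))) ler_norm_sum. Qed.
End NormedZmod.

Implicit Types z : C.
Lemma nrM z (z' : C) : nr (z * z') = nr z * nr z'.
Proof. by apply: rc_inj; rewrite rcM -!nrE normrM. Qed.
Lemma nrX z k : nr (z ^+ k) = nr z ^+ k.
Proof. by apply: rc_inj; rewrite rcX -!nrE normrX. Qed.
Lemma nrV z : nr z^-1 = (nr z)^-1.
Proof. by apply: rc_inj; rewrite rcV -!nrE normfV. Qed.
Lemma nr1 : nr (1 : C) = 1. Proof. by rewrite /nr normr1. Qed.
Lemma nrJ z : nr z^* = nr z.
Proof. by rewrite /nr norm_conjC. Qed.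
Lemma nr_rc x : nr (rc x) = `|x|.
Proof.
have [h|h] := ger0P x; first by rewrite /nr ger0_norm // -rc0 rc_le.
by rewrite /nr ltr0_norm -?rc0 ?rc_lt // -rcN.
Qed.
Lemma nr_i : nr ('i%R : C) = 1. Proof. by rewrite /nr normCi. Qed.
Lemma nr_sqr z : rc (nr z ^+ 2) = z * z^*.
Proof. by rewrite rcX -nrE normCK. Qed.
Lemma nr_sqrE z : nr z ^+ 2 = cre z ^+ 2 + cim z ^+ 2.
Proof. by have := congr1 cre (nr_sqr z); rewrite creM creJ cimJ cre_rc => ->; ring. Qed.
Lemma cre_le z : `|cre z| <= nr z.
Proof.
by rewrite -(@ler_pXn2r _ 2) // ?nnegrE ?nr_ge0 // real_normK ?num_real // nr_sqrE lerDl sqr_ge0.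
Qed.
Lemma cim_le z : `|cim z| <= nr z.
Proof.
by rewrite -(@ler_pXn2r _ 2) // ?nnegrE ?nr_ge0 // real_normK ?num_real // nr_sqrE lerDr sqr_ge0.
Qed.
Lemma cre_ler z : cre z <= nr z. Proof. exact: le_trans (ler_norm _) (cre_le z). Qed.
Lemma nr_le z : nr z <= `|cre z| + `|cim z|.
Proof.
rewrite {1}(cE z); apply: le_trans (nrD _ _) _.
by rewrite nrM nr_i mul1r !nr_rc.
Qed.
Lemma cjD (z z' : C) : (z + z')^* = z^* + z'^*. Proof. exact: rmorphD. Qed.
Lemma cjN (z : C) : (- z)^* = - z^*. Proof. exact: rmorphN. Qed.
Lemma cjB (z z' : C) : (z - z')^* = z^* - z'^*. Proof. exact: rmorphB. Qed.
Lemma cjM (z z' : C) : (z * z')^* = z^* * z'^*. Proof. exact: rmorphM. Qed.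
Lemma cjX (z : C) k : (z ^+ k)^* = z^* ^+ k. Proof. exact: rmorphXn. Qed.
Lemma cjV (z : C) : (z^-1)^* = (z^*)^-1. Proof. exact: fmorphV. Qed.
Lemma cj0 : (0 : C)^* = 0. Proof. exact: rmorph0. Qed.
Lemma cj1 : (1 : C)^* = 1. Proof. exact: rmorph1. Qed.
Lemma cj_i : ('i%R : C)^* = - 'i%R. Proof. exact: conjCi. Qed.
Lemma cjK (z : C) : (z^*)^* = z. Proof. exact: conjCK. Qed.
Lemma cj_sum I (r : seq I) P (F : I -> C) :
  (\sum_(i <- r | P i) F i)^* = \sum_(i <- r | P i) (F i)^*.
Proof. exact: rmorph_sum. Qed.
Lemma cre_addJ z : z + z^* = rc (2 * cre z).
Proof. by apply: c_eq; rewrite ?creD ?cimD ?creJ ?cimJ ?cre_rc ?cim_rc; ring. Qed.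

Section Modules.
Variable T : normedModType C.
Lemma nrZ a (v : T) : nr (a *: v) = nr a * nr v.
Proof. by apply: rc_inj; rewrite rcM -!nrE normrZ. Qed.

Lemma near_nr (x : T) (P : T -> Prop) :
  (\forall y \near x, P y) <-> exists2 e : R, 0 < e & forall y, nr (y - x) < e -> P y.
Proof.
rewrite nbhs_normP; split.
  move=> [e /= e0 h]; exists (cre e).
    by move: e0; rewrite ltcE => /andP[].
  move=> y hy; apply: h; rewrite /= distrC nrE.
  move: e0; rewrite !ltcE => /andP[/eqP he _].
  by rewrite he eqxx.
move=> [e e0 h]; exists (rc e); first by rewrite /= -rc0 rc_lt.
by move=> y /=; rewrite distrC nrE rc_lt; apply: h.
Qed.

End Modules.

Definition ctn (T S : normedModType C) (f : S -> T) (x : S) := forall e : R, 0 < e ->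
  exists2 d : R, 0 < d & forall y, nr (y - x) < d -> nr (f y - f x) < e.

Lemma ctnP (T S : normedModType C) (f : S -> T) (x : S) :
  {for x, continuous f} <-> ctn f x.
Proof.
split.
  move=> h e e0.
  have hA : nbhs (f x) [set y | nr (y - f x) < e] by apply/near_nr; exists e.
  have /near_nr[d d0 hd] : \forall y \near x, nr (f y - f x) < e by apply: h hA.
  by exists d.
move=> h A /near_nr[e e0 he]; have [d d0 hd] := h _ e0.
by apply/near_nr; exists d => // y /hd; apply: he.
Qed.

Lemma cont_nr (T S : normedModType C) (f : S -> T) (x : S) :
  ctn f x <-> forall e : R, 0 < e ->
  exists2 d : R, 0 < d & forall y, nr (y - x) < d -> nr (f y - f x) < e.
Proof. by []. Qed.

Lemma ctn_comp (T S U : normedModType C) (f : S -> T) (g : T -> U) x :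
  ctn f x -> ctn g (f x) -> ctn (fun y => g (f y)) x.
Proof.
move=> hf hg e /hg[d /hf[d' d0' hd'] hd]; exists d' => // y hy.
exact/hd/hd'.
Qed.

Lemma cont_nrR (S : normedModType C) (f : S -> R) (x : S) :
  {for x, continuous f} <->
  forall e : R, 0 < e -> exists2 d : R, 0 < d & forall y, nr (y - x) < d -> `|f y - f x| < e.
Proof.
split.
  move=> /cvgrPdist_lt h e e0.
  have /near_nr[d d0 hd] := h _ e0.
  by exists d => // y /hd; rewrite distrC.
move=> h; apply/cvgrPdist_lt => e e0; have [d d0 hd] := h _ e0.
by apply/near_nr; exists d => // y /hd; rewrite distrC.
Qed.

Section RowVectors.
Variable n : nat.
Local Notation V := 'rV[C]_n.+1.
Lemma nr_coord (v : V) j : nr (v 0 j) <= nr v.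
Proof.
rewrite -rc_le -!nrE [leRHS]mx_normE.
exact: (le_bigmax _ (fun i : 'I_1 * 'I_n.+1 => (widen_itv `|v i.1 i.2|%:itv : {nonneg C})) (0, j)).
Qed.
Lemma nr_rV (v : V) e : 0 <= e -> (forall j, nr (v 0 j) <= e) -> nr v <= e.
Proof.
move=> e0 h.
case: (eqVneq v 0) => [->|v0]; first by rewrite nr0.
have [i hi] : exists i : 'I_1 * 'I_n.+1, mx_norm v = `|v i.1 i.2|.
  by apply: mx_norm_neq0; apply: contraNneq v0 => /mx_norm_eq0 ->.
by rewrite -rc_le -nrE [`|v|]hi (ord1 i.1) nrE rc_le.
Qed.
Lemma nr_delta j : nr (delta_mx 0 j : V) = 1.
Proof.
apply/eqP; rewrite eq_le; apply/andP; split.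
  by apply: nr_rV => // k; rewrite mxE eqxx /=; case: (k == j); rewrite ?nr1 ?nr0.
by apply: le_trans (nr_coord _ j); rewrite mxE !eqxx nr1.
Qed.
End RowVectors.

(** The same [d] serves as radius and as parameter of [P]. With a conclusion of the form
    [... <= d^-1] the lemma yields a uniform bound along with a uniform radius. *)
Lemma compact_unif (T : normedModType C) (K : set T) (P : R -> T -> Prop) :
  compact K -> (forall d d' x, 0 < d' -> d' <= d -> P d x -> P d' x) ->
  (forall x, K x -> exists2 d, 0 < d & forall y, nr (y - x) < d -> P d y) ->
  exists2 d, 0 < d & forall x, K x -> P d x.
Proof.
move=> /compact_near_coveringP hK hm h.
have [x Kx|d /= d0 hd] := hK R (0^'+) P _ _.
- have [d d0 hd] := h x Kx.
  exists ([set y | nr (y - x) < d], [set e | 0 < e <= d]) => /=.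
    split; first by apply/near_nr; exists d.
    exists d => // e /=; rewrite sub0r normrN => he e0.
    by rewrite e0 /= -(gtr0_norm e0) ltW.
  by move=> [y e] /= [hy /andP[e0 ed]]; apply: (hm d) => //; apply: hd.
exists (d / 2); first by rewrite divr_gt0.
move=> x; apply: hd => /=; last by rewrite divr_gt0.
by rewrite sub0r normrN gtr0_norm ?divr_gt0 // ltr_pdivrMr // mulrx2 ltrDl.
Qed.

Lemma compact_disc (r : R) : compact [set z : C | nr z <= r].
Proof.
pose f (p : R * R) : C := rc p.1 + 'i%R * rc p.2.
have hf : continuous f.
  move=> [a b] A /near_nr[e e0 he].
  have e2 : 0 < e / 2 by rewrite divr_gt0.
  exists (ball a (e / 2), ball b (e / 2)).
    by split; apply: nbhsx_ballx.
  move=> [c d] [/= hc hd]; apply: he; rewrite /f /=.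
  have -> : rc c + 'i%R * rc d - (rc a + 'i%R * rc b) = rc (c - a) + 'i%R * rc (d - b).
    by rewrite !rcB; ring.
  apply: le_lt_trans (nrD _ _) _; rewrite nrM nr_i mul1r !nr_rc.
  by rewrite distrC (distrC d) (splitr e) ltrD.
have hK : compact (f @` (`[- r, r]%classic `*` `[- r, r]%classic)).
  apply: continuous_compact; first exact: continuous_subspaceT.
  by apply: compact_setX; apply: segment_compact.
apply: subclosed_compact hK _.
- move=> z hz; rewrite /= leNgt; apply/negP => hlt.
  have /hz [y [/= hy]] : nbhs z [set y | nr (y - z) < nr z - r].
    by apply/(@near_nr C); exists (nr z - r) => //; rewrite subr_gt0.
  by rewrite nrBC => /(le_lt_trans (nr_sub _ _)); rewrite ltrD2l ltrN2 => /lt_le_trans/(_ hy); rewrite ltxx.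
- move=> z hz; exists (cre z, cim z); last by rewrite /f /= -cE.
  by split => /=; rewrite in_itv /= -ler_norml; apply: le_trans hz; [exact: cre_le|exact: cim_le].
Qed.

End ComplexNorm.

(** * Integrals and circle means *)

Section DyadicIntegral.
Variable R : realType.
Local Notation C := (Cplx R).
Implicit Types (u v : R -> C) (s t : R).

(** Real induction: the supremum of the points reached from 0 can be passed unless it is 1. Uniform
    continuity and the two mean value inequalities below are instances. *)
Lemma cousin (Q : R -> R -> Prop) :
  (forall a b c, a <= b -> b <= c -> Q a b -> Q b c -> Q a c) ->
  (forall s, 0 <= s <= 1 -> exists2 d, 0 < d & forall a b, 0 <= a -> a <= s -> s <= b ->
     b <= 1 -> s - d < a -> b < s + d -> Q a b) -> Q 0 1.
Proof.
move=> tr loc.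
pose S := [set x | 0 <= x <= 1 /\ Q 0 x].
have S0 : S 0.
  have [|d d0 hd] := loc 0; first by rewrite lexx ler01.
  by split; [rewrite lexx ler01|apply: hd; rewrite ?lexx ?ler01 ?add0r ?sub0r ?oppr_lt0].
have hS : has_sup S by split; [exists 0|exists 1 => x [/andP[]]].
have t0 : 0 <= sup S by apply: sup_ubound => //; case: hS.
have t1 : sup S <= 1 by apply: sup_le_ub => [|x [/andP[]]] //; exists 0.
have [|d d0 hd] := loc (sup S); first by rewrite t0 t1.
have [x [/andP[x0 x1] Qx] hx] := sup_adherent d0 hS.
have xs : x <= sup S by apply: sup_ubound; [case: hS|split=> //; rewrite x0 x1].
pose t' := Num.min 1 (sup S + d / 2).
have st : sup S <= t' by rewrite le_min t1 lerDl divr_ge0 // ltW.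
have Qt : Q 0 t'.
  apply: (tr 0 x t') => //; first exact: le_trans st.
  apply: hd => //; first by rewrite ge_min lexx.
  by rewrite gt_min ltrD2l ltr_pdivrMr // mulrx2 ltrDl d0 orbT.
have ts : t' <= sup S.
  apply: sup_ubound; first by case: hS.
  by split => //; rewrite ge_min lexx andbT (le_trans t0).
suff -> : (1 = t' :> R) by [].
move: ts; rewrite /t' ge_min => /orP[h|].
  by rewrite min_l // (le_trans h) // lerDl divr_ge0 // ltW.
by rewrite gerDl leNgt divr_gt0.
Qed.

Definition ucont v := forall e, 0 < e -> exists2 d, 0 < d & forall s t,
  0 <= s <= 1 -> 0 <= t <= 1 -> `|s - t| < d -> nr (v s - v t) <= e.

Lemma ucont_pointwise v :
  (forall s, 0 <= s <= 1 -> forall e, 0 < e -> exists2 d, 0 < d & forall t,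
     0 <= t <= 1 -> `|t - s| < d -> nr (v t - v s) <= e) -> ucont v.
Proof.
move=> h e e0.
apply: (cousin (Q := fun a b => exists2 d : R, 0 < d & forall s t, a <= s <= b -> 0 <= t <= 1 ->
   `|s - t| < d -> nr (v s - v t) <= e)) => [a b c ab bc [d d0 hd] [d' d0' hd']|s hs].
  exists (Num.min d d'); first by rewrite lt_min d0.
  move=> s t /andP[sa sc] ht; rewrite lt_min => /andP[h1 h2].
  by case: (leP s b) => sb; [apply: hd|apply: hd'] => //; rewrite ?sa ?sb ?sc ?(ltW sb).
have [d d0 hd] := h s hs (e / 2) ltac:(by rewrite divr_gt0).
exists (d / 2); first by rewrite divr_gt0.
move=> a b a0 as_ sb b1 hda hdb; exists (d / 2); first by rewrite divr_gt0.
move=> x y /andP[ax xb] hy hxy.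
have hx : `|x - s| < d / 2 by rewrite ltr_distl; apply/andP; split; lra.
rewrite (splitr e) (le_trans (nr_tri (v s) _ _)) // lerD //.
  by apply: hd; [apply/andP; split; lra|lra].
rewrite nrBC; apply: hd => //.
have : `|y - s| <= `|x - y| + `|x - s|.
  have -> : y - s = (y - x) + (x - s) by ring.
  by rewrite (distrC x y) ler_normD.
by lra.
Qed.

(* Average of [v] over the points i / 2^k, 0 <= i < 2^k. *)
Fixpoint dsum k v : C :=
  if k is k'.+1 then
    (dsum k' (fun s => v (s / 2)) + dsum k' (fun s => v ((1 + s) / 2))) / 2
  else v 0.

Lemma dsumS k v : dsum k.+1 v =
  (dsum k (fun s => v (s / 2)) + dsum k (fun s => v ((1 + s) / 2))) / 2.
Proof. by []. Qed.

(** Only continuous integrands occur, so limits of dyadic averages suffice. Bisecting the interval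
    is then the recursion of [dsum] itself, which is what the subdivision and reversal of segments
    and the means of powers rely on. *)
Definition has_int v (l : C) := forall e, 0 < e -> exists N, forall k, (N <= k)%N ->
  nr (dsum k v - l) <= e.
Definition int01 v : C := xget 0 [set l | has_int v l].

Lemma half01 s : 0 <= s <= 1 -> 0 <= s / 2 <= 1. Proof. by move=> h; apply/andP; split; lra. Qed.
Lemma half01' s : 0 <= s <= 1 -> 0 <= (1 + s) / 2 <= 1.
Proof. by move=> h; apply/andP; split; lra. Qed.

Lemma dsum_eq k u v : (forall s, 0 <= s <= 1 -> u s = v s) -> dsum k u = dsum k v.
Proof.
elim: k u v => [|k IH] u v h /=; first by apply: h; rewrite lexx ler01.
by congr ((_ + _) / 2); apply: IH => s hs; apply: h; [apply: half01|apply: half01'].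
Qed.
Lemma dsumD k u v : dsum k (fun s => u s + v s) = dsum k u + dsum k v.
Proof. by elim: k u v => [|k IH] u v //=; rewrite !IH; ring. Qed.
Lemma dsumZ k c v : dsum k (fun s => c * v s) = c * dsum k v.
Proof. by elim: k v => [|k IH] v //=; rewrite !IH; ring. Qed.
Lemma dsum_cst k c : dsum k (fun=> c) = c.
Proof. by elim: k => //= k ->; field. Qed.
Lemma nr_half (z : C) : nr (z / 2) = nr z / 2.
Proof. by rewrite nrM nrV -(rc_nat R 2) nr_rc normr_nat. Qed.
Lemma dsum_le k v B : (forall s, 0 <= s <= 1 -> nr (v s) <= B) -> nr (dsum k v) <= B.
Proof.
elim: k v => [|k IH] v h /=; first by apply: h; rewrite lexx ler01.
rewrite nr_half ler_pdivrMr // (le_trans (nrD _ _)) // mulrx2.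
by apply: lerD; apply: IH => s hs; apply: h; [apply: half01|apply: half01'].
Qed.
Lemma cre_half (z : C) : cre (z / 2) = cre z / 2.
Proof. by rewrite -(rc_nat R 2) -rcV creM cre_rc cim_rc mulr0 subr0. Qed.
Lemma dsum_ge k v B : (forall s, 0 <= s <= 1 -> B <= cre (v s)) -> B <= cre (dsum k v).
Proof.
elim: k v => [|k IH] v h /=; first by apply: h; rewrite lexx ler01.
rewrite cre_half creD ler_pdivlMr // mulrx2.
by apply: lerD; apply: IH => s hs; apply: h; [apply: half01|apply: half01'].
Qed.
Lemma dsumJ k v : dsum k (fun s => (v s)^*) = (dsum k v)^*.
Proof.
elim: k v => [//|k IH] v; rewrite !dsumS !IH cjM cjD cjV.
by rewrite -(rc_nat R 2) rcJ.
Qed.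

(** The increments between neighbouring dyadic nodes add up to [v 1 - v 0], and [dsum] divides the
    sum by the number of nodes. *)
Lemma dsum_telescope k v : dsum k (fun s => v (s + 2^-1 ^+ k) - v s) = (v 1 - v 0) * 2^-1 ^+ k.
Proof.
elim: k v => [|k IH] v /=; first by rewrite !expr0 add0r mulr1.
have e1 s : (s + 2^-1 ^+ k) / 2 = s / 2 + 2^-1 ^+ k.+1 :> R by rewrite exprS; ring.
have e2 s : (1 + (s + 2^-1 ^+ k)) / 2 = (1 + s) / 2 + 2^-1 ^+ k.+1 :> R by rewrite exprS; ring.
have := IH (fun s => v (s / 2)); under dsum_eq do rewrite e1.
have := IH (fun s => v ((1 + s) / 2)); under dsum_eq do rewrite e2.
move=> -> ->; rewrite exprS addr0 mul0r.
have -> : (1 + 1) / 2 = 1 :> R by field.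
by ring.
Qed.

Lemma dsum_refine k j v e :
  (forall s t, 0 <= s <= 1 -> 0 <= t <= 1 -> `|s - t| <= 2^-1 ^+ k -> nr (v s - v t) <= e) ->
  nr (dsum (k + j) v - dsum k v) <= e.
Proof.
elim: k v => [|k IH] v h.
  rewrite add0n /= -(dsum_cst j (v 0)) -mulN1r -dsumZ -dsumD.
  apply: dsum_le => s hs; rewrite mulN1r; apply: h; rewrite ?lexx ?ler01 // subr0 expr0.
  by case/andP: hs => a b; rewrite ger0_norm.
rewrite addSn !dsumS -mulrBl opprD addrACA nr_half ler_pdivrMr // (le_trans (nrD _ _)) // mulrx2.
have E s t : s / 2 - t / 2 = (s - t) / 2 by ring.
have E' s t : (1 + s) / 2 - (1 + t) / 2 = (s - t) / 2 by field.
apply: lerD; apply: IH => s t hs ht hst; apply: h.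
- exact: half01.
- exact: half01.
- by rewrite E exprS [X in `|X|]mulrC normrM (gtr0_norm (_ : 0 < 2^-1)) // ler_pM2l.
- exact: half01'.
- exact: half01'.
- by rewrite E' exprS [X in `|X|]mulrC normrM (gtr0_norm (_ : 0 < 2^-1)) // ler_pM2l.
Qed.

Lemma expr_half_lt (d : R) : 0 < d -> exists N, forall k, (N <= k)%N -> 2^-1 ^+ k < d.
Proof.
move=> d0; exists (Num.truncn d^-1).+1 => k hk.
rewrite exprVn invf_plt ?posrE ?exprn_gt0 //.
apply: lt_le_trans (_ : (Num.truncn d^-1).+1%:R <= _); first by rewrite truncnS_gt.
by rewrite -natrX ler_nat (leq_trans hk) // ltnW // ltn_expl.
Qed.

Lemma int_exists v : ucont v -> exists l, has_int v l.
Proof.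
move=> hv.
have hc : forall e, 0 < e -> exists N, forall k, (N <= k)%N -> nr (dsum k v - dsum N v) <= e.
  move=> e e0; have [d d0 hd] := hv e e0; have [N hN] := expr_half_lt d0.
  exists N => k hk; rewrite -(subnKC hk); apply: dsum_refine => s t hs ht hst.
  by apply: hd => //; apply: le_lt_trans hst (hN _ _).
have lim_ex : forall p : C -> R, (forall x y, `|p x - p y| <= nr (x - y)) ->
    exists l, forall e, 0 < e -> exists N, forall k, (N <= k)%N -> `|p (dsum k v) - l| <= e.
  move=> p hp.
  have /cauchy_cvgP/cvg_ex[l /cvgrPdist_le hl] : cauchy ((fun k => p (dsum k v)) @ \oo).
    apply: cauchy_exP => e e0; have [N hN] := hc (e / 2) ltac:(by rewrite divr_gt0).
    exists (p (dsum N v)); exists N => // k /= hk.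
    rewrite -ball_normE /= distrC (le_lt_trans (hp _ _)) // (le_lt_trans (hN _ hk)) //.
    by rewrite ltr_pdivrMr // mulrx2 ltrDl.
  by exists l => e e0; have [N _ hN] := hl e e0; exists N => k hk; rewrite distrC; apply: hN.
have [a ha] := lim_ex (@cre R) (fun x y => ltac:(rewrite -creB; exact: cre_le)).
have [b hb] := lim_ex (@cim R) (fun x y => ltac:(rewrite -cimB; exact: cim_le)).
exists (rc a + 'i%R * rc b) => e e0.
have [N hN] := ha (e / 2) ltac:(by rewrite divr_gt0).
have [N' hN'] := hb (e / 2) ltac:(by rewrite divr_gt0).
exists (maxn N N') => k; rewrite geq_max => /andP[h1 h2].
rewrite (le_trans (nr_le _)) // creB cimB !(creD, cimD, creM, cimM, cre_i, cim_i, cre_rc, cim_rc).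
rewrite (splitr e) lerD //.
  by rewrite mul0r mulr0 subr0 addr0 hN.
by rewrite mulr0 mul1r !add0r hN'.
Qed.

Lemma has_int_uniq v l l' : has_int v l -> has_int v l' -> l = l'.
Proof.
move=> h h'; apply/eqP; rewrite -subr_eq0 -nr_eq0 eq_le nr_ge0 andbT.
apply/ler_addgt0Pl => e e0; rewrite addr0.
have [N hN] := h (e / 2) ltac:(by rewrite divr_gt0).
have [N' hN'] := h' (e / 2) ltac:(by rewrite divr_gt0).
apply: le_trans (nr_tri (dsum (maxn N N') v) _ _) _.
by rewrite (splitr e) lerD // ?hN' ?leq_maxr // nrBC hN // leq_maxl.
Qed.

Lemma int01P v : ucont v -> has_int v (int01 v).
Proof. by move=> /int_exists[l hl]; rewrite /int01; case: xgetP => [y -> //|/(_ l)]. Qed.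
Lemma int01E v l : has_int v l -> int01 v = l.
Proof. by move=> hl; rewrite /int01; case: xgetP => [y -> hy|/(_ l)//]; apply: has_int_uniq hl. Qed.

Lemma int01_eq u v : (forall s, 0 <= s <= 1 -> u s = v s) -> int01 u = int01 v.
Proof.
move=> h; congr (xget _ _); apply/seteqP.
by split=> l /= hl e /hl [N hN]; exists N => k /hN; rewrite (dsum_eq k h).
Qed.
Lemma has_intD u v a b : has_int u a -> has_int v b -> has_int (fun s => u s + v s) (a + b).
Proof.
move=> hu hv e e0.
have [N hN] := hu (e / 2) ltac:(by rewrite divr_gt0).
have [N' hN'] := hv (e / 2) ltac:(by rewrite divr_gt0).
exists (maxn N N') => k; rewrite geq_max => /andP[h1 h2].
by rewrite dsumD opprD addrACA (le_trans (nrD _ _)) // (splitr e) lerD ?hN ?hN'.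
Qed.
Lemma has_intZ c v a : has_int v a -> has_int (fun s => c * v s) (c * a).
Proof.
move=> hv e e0.
have c0 : 0 < nr c + 1 by rewrite ltr_wpDl // nr_ge0.
have [N hN] := hv (e / (nr c + 1)) ltac:(by rewrite divr_gt0).
exists N => k /hN h; rewrite dsumZ -mulrBr nrM.
apply: le_trans (_ : (nr c + 1) * (e / (nr c + 1)) <= _).
  by apply: ler_pM; rewrite ?nr_ge0 // lerDl.
by rewrite mulrC divfK // gt_eqF.
Qed.
Lemma has_int_cst c : has_int (fun=> c) c.
Proof. by move=> e e0; exists 0%N => k _; rewrite dsum_cst subrr nr0 ltW. Qed.
Lemma has_int_le v l B : has_int v l -> (forall s, 0 <= s <= 1 -> nr (v s) <= B) -> nr l <= B.
Proof.
move=> hl h; apply/ler_addgt0Pr => e e0; have [N hN] := hl e e0.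
rewrite -(subrK (dsum N v) l) (le_trans (nrD _ _)) // addrC lerD ?dsum_le //.
by rewrite nrBC hN.
Qed.
Lemma has_int_ge v l B : has_int v l -> (forall s, 0 <= s <= 1 -> B <= cre (v s)) -> B <= cre l.
Proof.
move=> hl h; apply/ler_addgt0Pr => e e0; have [N hN] := hl e e0.
rewrite -lerBlDr; apply: le_trans (_ : cre (dsum N v) - e <= _); first by rewrite lerB ?dsum_ge.
rewrite lerBlDr -lerBlDl -creB (le_trans (cre_ler _)) //.
by apply: hN.
Qed.
Lemma has_intJ v l : has_int v l -> has_int (fun s => (v s)^*) l^*.
Proof. by move=> hl e /hl[N hN]; exists N => k /hN; rewrite dsumJ -rmorphB nrJ. Qed.
Lemma has_int_half v a b : has_int (fun s => v (s / 2)) a -> has_int (fun s => v ((1 + s) / 2)) b ->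
  has_int v ((a + b) / 2).
Proof.
move=> ha hb e e0; have [N hN] := ha e e0; have [N' hN'] := hb e e0.
exists (maxn N N').+1 => -[//|k]; rewrite ltnS geq_max => /andP[h1 h2] /=.
rewrite -mulrBl opprD addrACA nr_half ler_pdivrMr // (le_trans (nrD _ _)) // mulrx2.
by rewrite lerD ?hN ?hN'.
Qed.

Lemma has_int_id : has_int (fun s => rc s) (rc 2^-1).
Proof.
have ds k : dsum k (fun s => rc s) = rc (2^-1 - 2^-1 ^+ k.+1).
  elim: k => [|k IH] /=; first by rewrite expr1 subrr.
  under dsum_eq => s _ do rewrite rcM mulrC.
  have -> : dsum k (fun s => rc ((1 + s) / 2)) = dsum k (fun s => rc 2^-1 + rc 2^-1 * rc s).
    by apply: dsum_eq => s _; rewrite -rcM -rcD; congr rc; field.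
  rewrite dsumD dsum_cst !dsumZ IH -(rc_nat R 2) -rcV -!rcM -!rcD -rcM; congr rc.
  by rewrite !exprS; field.
move=> e e0; have [N hN] := expr_half_lt e0; exists N => k hk.
rewrite ds -rcB nr_rc addrAC subrr add0r normrN gtr0_norm ?exprn_gt0 ?invr_gt0 //.
by rewrite ltW // hN // ltnW.
Qed.

(** At each bisection the half containing [s0] keeps the bump and the other half contributes at
    least 0. The bound does not depend on [k], so it survives in the integral. *)
Lemma dsum_bump k N v (s0 c : R) : (N <= k)%N -> 0 <= s0 <= 1 -> 0 <= c ->
  (forall s, 0 <= s <= 1 -> 0 <= cre (v s)) ->
  (forall s, 0 <= s <= 1 -> `|s - s0| <= 2^-1 ^+ N -> c <= cre (v s)) ->
  c * 2^-1 ^+ N <= cre (dsum k v).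
Proof.
elim: N k v s0 => [|N IH] k v s0.
  move=> _ hs0 c0 _ h; rewrite expr0 mulr1; apply: dsum_ge => s hs; apply: h => //.
  by rewrite expr0 ler_distl; apply/andP; split; lra.
case: k => [//|k]; rewrite ltnS => Nk hs0 c0 h0 h /=; rewrite cre_half creD exprS.
have g0 : 0 <= cre (dsum k (fun s => v (s / 2))) by apply: dsum_ge => s hs; rewrite h0 ?half01.
have g1 : 0 <= cre (dsum k (fun s => v ((1 + s) / 2))) by apply: dsum_ge => s hs; rewrite h0 ?half01'.
have q0 : 0 < 2^-1 :> R by [].
case: (leP s0 (1 / 2)) => hs.
  have := IH k (fun s => v (s / 2)) (2 * s0) Nk.
  have -> : c * (2^-1 * 2^-1 ^+ N) = c * 2^-1 ^+ N / 2 by ring.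
  rewrite ler_pM2r // => g; apply: le_trans (g _ _ _ _) _ => //.
  - by apply/andP; split; lra.
  - by move=> s /half01; apply: h0.
  - move=> s s1 s2; apply: h; first exact: half01.
    have -> : s / 2 - s0 = 2^-1 * (s - 2 * s0) by field.
    by rewrite exprS normrM (gtr0_norm q0) ler_pM2l.
  - by rewrite lerDl.
have := IH k (fun s => v ((1 + s) / 2)) (2 * s0 - 1) Nk.
have -> : c * (2^-1 * 2^-1 ^+ N) = c * 2^-1 ^+ N / 2 by ring.
rewrite ler_pM2r // => g; apply: le_trans (g _ _ _ _) _ => //.
- by apply/andP; split; lra.
- by move=> s /half01'; apply: h0.
- move=> s s1 s2; apply: h; first exact: half01'.
  have -> : (1 + s) / 2 - s0 = 2^-1 * (s - (2 * s0 - 1)) by field.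
  by rewrite exprS normrM (gtr0_norm q0) ler_pM2l.
- by rewrite lerDr.
Qed.

(** The bound [(B + e) * (b - a)] is additive over adjacent intervals, so [cousin] propagates it for
    each [e], which then tends to 0. *)
Lemma mean_value_ineq v B :
  (forall s, 0 <= s <= 1 -> forall e, 0 < e -> exists2 d, 0 < d & forall t,
     0 <= t <= 1 -> `|t - s| < d -> nr (v t - v s) <= (B + e) * `|t - s|) ->
  nr (v 1 - v 0) <= B.
Proof.
move=> h; apply/ler_addgt0Pr => e e0.
rewrite -[leRHS]mulr1 -[X in _ * X]subr0.
apply: (cousin (Q := fun a b => nr (v b - v a) <= (B + e) * (b - a))) => [a b c ab bc h1 h2|s hs].
  apply: le_trans (nr_tri (v b) _ _) _.
  have -> : (B + e) * (c - a) = (B + e) * (c - b) + (B + e) * (b - a) by ring.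
  exact: lerD.
have [d d0 hd] := h s hs e e0; exists d => // a b a0 as_ sb b1 da db.
apply: le_trans (nr_tri (v s) _ _) _.
have -> : (B + e) * (b - a) = (B + e) * (b - s) + (B + e) * (s - a) by ring.
apply: lerD.
  apply: le_trans (hd b _ _) _; rewrite ?ger0_norm ?subr_ge0 //.
    by apply/andP; split; lra.
  by lra.
rewrite nrBC; apply: le_trans (hd a _ _) _; rewrite ?(distrC a) ?ger0_norm ?subr_ge0 //.
  by apply/andP; split; lra.
by lra.
Qed.

Lemma mean_value_ge (f : R -> R) B :
  (forall s, 0 <= s <= 1 -> forall e, 0 < e -> exists2 d, 0 < d & forall a b,
     0 <= a -> a <= s -> s <= b -> b <= 1 -> s - d < a -> b < s + d ->
     (B - e) * (b - a) <= f b - f a) ->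
  B <= f 1 - f 0.
Proof.
move=> h; apply/ler_addgt0Pr => e e0.
rewrite -lerBlDr -[leLHS]mulr1 -[X in _ * X]subr0.
apply: (cousin (Q := fun a b => (B - e) * (b - a) <= f b - f a)) => [a b c ab bc h1 h2|s hs].
  have -> : (B - e) * (c - a) = (B - e) * (c - b) + (B - e) * (b - a) by ring.
  have -> : f c - f a = (f c - f b) + (f b - f a) by ring.
  exact: lerD.
by have [d d0 hd] := h s hs e e0; exists d.
Qed.

End DyadicIntegral.

Section ContinuityRules.
Variable R : realType.
Local Notation C := (Cplx R).
Variable T : normedModType C.
Implicit Types (f g : T -> C) (x : T).

Lemma cont_cst (c : C) x : ctn (fun _ : T => c) x.
Proof. by move=> e e0; exists 1 => // y _; rewrite subrr nr0. Qed.
Lemma contD f g x : ctn f x -> ctn g x ->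
  ctn (fun y => f y + g y) x.
Proof. by move=> /ctnP hf /ctnP hg; apply/ctnP; exact: (cvgD hf hg). Qed.
Lemma contM f g x : ctn f x -> ctn g x ->
  ctn (fun y => f y * g y) x.
Proof. by move=> /ctnP hf /ctnP hg; apply/ctnP; exact: (cvgM hf hg). Qed.
Lemma contN f x : ctn f x -> ctn (fun y => - f y) x.
Proof. by move=> /ctnP hf; apply/ctnP; exact: (cvgN hf). Qed.
Lemma contB f g x : ctn f x -> ctn g x ->
  ctn (fun y => f y - g y) x.
Proof. by move=> /ctnP hf /ctnP hg; apply/ctnP; exact: (cvgB hf hg). Qed.
Lemma contV f x : f x != 0 -> ctn f x -> ctn (fun y => (f y)^-1) x.
Proof. by move=> h /ctnP hf; apply/ctnP; exact: (cvgV h hf). Qed.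
Lemma contX f k x : ctn f x -> ctn (fun y => f y ^+ k) x.
Proof.
move=> hf; elim: k => [|k IH]; first exact: cont_cst.
have -> : (fun y => f y ^+ k.+1) = (fun y => f y * f y ^+ k) by apply/funext => y; rewrite exprS.
exact: (contM hf IH).
Qed.
Lemma contJ f x : ctn f x -> ctn (fun y => (f y)^*) x.
Proof.
move=> /cont_nr h; apply/cont_nr => e /h[d d0 hd]; exists d => // y /hd.
by rewrite -cjB nrJ.
Qed.
Lemma cont_sum I (r : seq I) (F : I -> T -> C) x :
  (forall i, ctn (F i) x) -> ctn (fun y => \sum_(i <- r) F i y) x.
Proof.
move=> h; elim: r => [|i r IH].
  have -> : (fun y => \sum_(i <- [::]) F i y) = (fun=> 0) by apply/funext => y; rewrite big_nil.
  exact: cont_cst.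
have -> : (fun y => \sum_(j <- i :: r) F j y) = (fun y => F i y + \sum_(j <- r) F j y).
  by apply/funext => y; rewrite big_cons.
exact: (contD (h i) IH).
Qed.
Lemma cont_id x : ctn (fun y : T => y) x.
Proof. by move=> e e0; exists e. Qed.
Lemma cont_line (x v : T) (t : C) : ctn (fun t : C => x + t *: v) t.
Proof.
apply/cont_nr => e e0; have v0 : 0 < nr v + 1 by rewrite ltr_wpDl // nr_ge0.
exists (e / (nr v + 1)); first by rewrite divr_gt0.
move=> y; rewrite ltr_pdivlMr // => h.
rewrite opprD addrACA subrr add0r -scalerBl nrZ; apply: le_lt_trans h.
by rewrite ler_wpM2l ?nr_ge0 // lerDl.
Qed.
End ContinuityRules.

(** * Means over the unit circle *)

Section CircleMean.
Variable R : realType.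
Local Notation C := (Cplx R).
Implicit Types (u v : C -> C) (z : C).

Definition expi (s : R) : C := rc (cos (2 * pi * s)) + 'i%R * rc (sin (2 * pi * s)).

Lemma expiD s t : expi (s + t) = expi s * expi t.
Proof.
rewrite /expi !mulrDr cosD sinD.
by apply: c_eq; rewrite !(creD, cimD, creM, cimM, cre_i, cim_i, cre_rc, cim_rc); ring.
Qed.
Lemma expi0 : expi 0 = 1.
Proof. by rewrite /expi mulr0 cos0 sin0 rc0 mulr0 addr0. Qed.
Lemma expi_half : expi 2^-1 = -1.
Proof.
have -> : expi 2^-1 = rc (cos pi) + 'i%R * rc (sin pi).
  by rewrite /expi; congr (rc (cos _) + _ * rc (sin _)); field.
by rewrite cospi sinpi rc0 mulr0 addr0 rcN.
Qed.
Lemma expi1 : expi 1 = 1.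
Proof.
have -> : 1 = 2^-1 + 2^-1 :> R by field.
by rewrite expiD expi_half mulrNN mulr1.
Qed.
Lemma expiX s k : expi s ^+ k = expi (s *+ k).
Proof.
elim: k => [|k IH]; first by rewrite expr0 mulr0n expi0.
by rewrite exprS IH mulrS expiD.
Qed.
Lemma nr_expi s : nr (expi s) = 1.
Proof.
apply/eqP; rewrite -(@eqrXn2 _ 2) ?nr_ge0 // nr_sqrE.
rewrite !(creD, cimD, creM, cimM, cre_i, cim_i, cre_rc, cim_rc).
by rewrite !(mulr0, mul0r, mul1r, add0r, subr0, addr0) cos2Dsin2 expr1n.
Qed.
Lemma circ_conj z : nr z = 1 -> z^* = z^-1.
Proof.
move=> h; have z0 : z != 0 by rewrite -nr_gt0 h.
by apply: (mulfI z0); rewrite -nr_sqr h expr1n divff.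
Qed.
Lemma circ_neq0 z : nr z = 1 -> z != 0. Proof. by move=> h; rewrite -nr_gt0 h. Qed.

Lemma expi_surj z : nr z = 1 -> exists2 s, 0 <= s <= 1 & z = expi s.
Proof.
move=> h; have := nr_sqrE z; rewrite h expr1n => hz.
have hc : -1 <= cre z <= 1 by rewrite -ler_norml -h cre_le.
have p0 := pi_gt0 R.
have [a0 a1] : 0 <= acos (cre z) /\ acos (cre z) <= pi by rewrite acos_ge0 // acos_lepi.
have hs : sin (acos (cre z)) = `|cim z|.
  by rewrite sin_acos // hz addrAC subrr add0r sqrtr_sqr.
have [b0|b0] := leP 0 (cim z).
  exists (acos (cre z) / (2 * pi)).
    apply/andP; split; first by rewrite divr_ge0 // mulr_ge0 // ltW.
    by rewrite ler_pdivrMr ?mulr_gt0 //; lra.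
  have e : 2 * pi * (acos (cre z) / (2 * pi)) = acos (cre z).
    by rewrite mulrC divfK // gt_eqF // mulr_gt0.
  by rewrite /expi e acosK // hs ger0_norm // -cE.
exists (1 - acos (cre z) / (2 * pi)).
  rewrite subr_ge0 gerBl ler_pdivrMr ?mulr_gt0 // divr_ge0 ?mulr_ge0 // ?(ltW p0) // andbT.
  by lra.
have e : 2 * pi * (1 - acos (cre z) / (2 * pi)) = - acos (cre z) + pi *+ 2.
  rewrite mulrBr mulr1 mulrCA divff ?mulr1; last by rewrite gt_eqF // mulr_gt0.
  by rewrite mulr2n; ring.
rewrite /expi e cosD2pi sinD2pi cosN sinN hs acosK // ltr0_norm // opprK -cE //.
Qed.

Lemma cont01_expi s : forall e, 0 < e -> exists2 d : R, 0 < d & forall t,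
  `|t - s| < d -> nr (expi t - expi s) <= e.
Proof.
move=> e e0.
have hc : forall f : R -> R, continuous f -> exists2 d : R, 0 < d & forall t,
    `|t - s| < d -> `|f (2 * pi * t) - f (2 * pi * s)| <= e / 2.
  move=> f hf.
  have hg : {for s, continuous (fun t => f (2 * pi * t))}.
    apply: continuous_comp; last exact: hf.
    by apply: cvgM; [exact: cvg_cst|exact: cvg_id].
  have /cvgrPdist_le/(_ (e / 2) ltac:(by rewrite divr_gt0))/nbhs_ballP[d /= d0 hd] := hg.
  by exists d => // t ht; rewrite distrC; apply: hd; rewrite -ball_normE /= distrC.
have [d d0 hd] := hc _ (@continuous_cos R); have [d' d0' hd'] := hc _ (@continuous_sin R).
exists (Num.min d d'); first by rewrite lt_min d0.
move=> t; rewrite lt_min => /andP[h1 h2]; rewrite /expi.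
have -> : forall a b c d : R, rc a + 'i%R * rc b - (rc c + 'i%R * rc d) =
    rc (a - c) + 'i%R * rc (b - d) by move=> *; rewrite !rcB; ring.
by rewrite (le_trans (nrD _ _)) // nrM nr_i mul1r !nr_rc (splitr e) lerD ?hd ?hd'.
Qed.

Definition circ u := forall z, nr z = 1 -> ctn u z.
Definition mean u : C := int01 (fun s => u (expi s)).
Lemma circ_ucont u : circ u -> ucont (fun s => u (expi s)).
Proof.
move=> hu; apply: ucont_pointwise => s hs e e0.
have /cont_nr/(_ e e0)[d d0 hd] := hu _ (nr_expi s).
have [d' d0' hd'] := cont01_expi s (e := d / 2) ltac:(by rewrite divr_gt0).
exists d' => // t _ /hd' h; apply/ltW/hd; apply: le_lt_trans h _.
by rewrite ltr_pdivrMr // mulrx2 ltrDl.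
Qed.
Lemma meanP u : circ u -> has_int (fun s => u (expi s)) (mean u).
Proof. by move=> /circ_ucont/int01P. Qed.
Lemma mean_eq u v : (forall z, nr z = 1 -> u z = v z) -> mean u = mean v.
Proof. by move=> h; apply: int01_eq => s _; rewrite h // nr_expi. Qed.
Lemma meanD u v : circ u -> circ v -> mean (fun z => u z + v z) = mean u + mean v.
Proof. by move=> hu hv; apply: int01E; apply: has_intD; apply: meanP. Qed.
Lemma meanZ c u : circ u -> mean (fun z => c * u z) = c * mean u.
Proof. by move=> hu; apply: int01E; apply: has_intZ; apply: meanP. Qed.
Lemma meanN u : circ u -> mean (fun z => - u z) = - mean u.
Proof. by move=> hu; rewrite -mulN1r -meanZ //; apply: mean_eq => z _; rewrite mulN1r. Qed.
Lemma circN u : circ u -> circ (fun z => - u z).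
Proof. by move=> h z /h; apply: contN. Qed.
Lemma meanB u v : circ u -> circ v -> mean (fun z => u z - v z) = mean u - mean v.
Proof. by move=> hu hv; rewrite (meanD hu (circN hv)) meanN. Qed.
Lemma mean_cst c : mean (fun=> c) = c.
Proof. by apply: int01E; apply: has_int_cst. Qed.
Lemma meanJ u : circ u -> mean (fun z => (u z)^*) = (mean u)^*.
Proof. by move=> hu; apply: int01E; apply: has_intJ; apply: meanP. Qed.
Lemma mean_le u B : circ u -> (forall z, nr z = 1 -> nr (u z) <= B) -> nr (mean u) <= B.
Proof.
by move=> hu h; apply: (has_int_le (meanP hu)) => s _; rewrite h ?nr_expi.
Qed.
Lemma mean_ge u B : circ u -> (forall z, nr z = 1 -> B <= cre (u z)) -> B <= cre (mean u).
Proof.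
by move=> hu h; apply: (has_int_ge (meanP hu)) => s _; rewrite h ?nr_expi.
Qed.
Lemma circ_sum I (r : seq I) (F : I -> C -> C) :
  (forall i, circ (F i)) -> circ (fun z => \sum_(i <- r) F i z).
Proof. by move=> h z hz; apply: cont_sum => i; apply: h. Qed.
Lemma mean_sum I (r : seq I) (F : I -> C -> C) : (forall i, circ (F i)) ->
  mean (fun z => \sum_(i <- r) F i z) = \sum_(i <- r) mean (F i).
Proof.
move=> h; elim: r => [|i r IH].
  by rewrite big_nil -[RHS](mean_cst 0); apply: mean_eq => z _; rewrite big_nil.
rewrite big_cons -IH -meanD //; last exact: circ_sum.
by apply: mean_eq => z _; rewrite big_cons.
Qed.
(** A positive value at one point of the circle would, by [dsum_bump], keep all fine dyadic averages
    above a fixed positive number. This is the equality case of every sub-mean inequality used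
    later. *)
Lemma mean_posdef u : circ u -> (forall z, nr z = 1 -> 0 <= cre (u z)) ->
  cre (mean u) <= 0 -> forall z, nr z = 1 -> cre (u z) = 0.
Proof.
move=> hu h hm z hz; apply/eqP; rewrite eq_le h // andbT leNgt; apply/negP => c0.
have [s0 hs0 ez] := expi_surj hz.
have /(_ (cre (u z) / 2) ltac:(by rewrite divr_gt0))[d d0 hd] := circ_ucont hu.
have [N hN] := expr_half_lt d0.
have c20 : 0 < cre (u z) / 2 by rewrite divr_gt0.
have hb k : (N <= k)%N -> cre (u z) / 2 * 2^-1 ^+ N <= cre (dsum k (fun s => u (expi s))).
  move=> hk; apply: (@dsum_bump _ _ _ _ s0) => //; first exact: ltW.
    by move=> s hs; rewrite h ?nr_expi.
  move=> s hs hss.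
  have := hd s s0 hs hs0 (le_lt_trans hss (hN _ (leqnn _))).
  rewrite -ez => /(le_trans (cre_le _)); rewrite creB ler_distl => /andP[+ _].
  by move=> hh; apply: le_trans hh; lra.
have p0 : 0 < cre (u z) / 2 * 2^-1 ^+ N by rewrite mulr_gt0 // exprn_gt0 // invr_gt0.
have [M hM] := meanP hu (e := cre (u z) / 2 * 2^-1 ^+ N / 2) ltac:(by rewrite divr_gt0).
have := hM (maxn N M) (leq_maxr _ _); move=> /(le_trans (cre_le _)).
have := hb (maxn N M) (leq_maxl _ _).
rewrite creB ler_distl => h1 /andP[_ h2].
by move: p0 h1 h2 hm; lra.
Qed.

Lemma circ_id : circ id. Proof. by move=> z _; exact: cont_id. Qed.
Lemma circX k : circ (fun z => z ^+ k). Proof. by move=> z _; exact: (contX _ (@cont_id R C z)). Qed.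
Lemma circJX k : circ (fun z => z^* ^+ k).
Proof. by move=> z _; exact: (contX _ (contJ (@cont_id R C z))). Qed.
Lemma circM u v : circ u -> circ v -> circ (fun z => u z * v z).
Proof. by move=> hu hv z hz; exact: (contM (hu z hz) (hv z hz)). Qed.
Lemma circD u v : circ u -> circ v -> circ (fun z => u z + v z).
Proof. by move=> hu hv z hz; exact: (contD (hu z hz) (hv z hz)). Qed.
Lemma circB u v : circ u -> circ v -> circ (fun z => u z - v z).
Proof. by move=> hu hv; exact: (circD hu (circN hv)). Qed.
Lemma circ_cst c : circ (fun=> c). Proof. by move=> z _; exact: cont_cst. Qed.
Lemma circJ u : circ u -> circ (fun z => (u z)^*).
Proof. by move=> hu z /hu; apply: contJ. Qed.

(** Split the circle into two halves. For odd [k] the second half is the negative of the first,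
    since [expi (k%:R / 2) = -1]; for even [k] both halves reproduce the average of the power
    [k./2], and strong induction applies. *)
Lemma meanX k : (0 < k)%N -> mean (fun z => z ^+ k) = 0.
Proof.
move=> k0; apply: int01E.
suff [N hN] : exists N, forall j, (N <= j)%N -> dsum j (fun s => expi s ^+ k) = 0.
  by move=> e e0; exists N => j /hN ->; rewrite subrr nr0 ltW.
elim/ltn_ind: k k0 => k IH k0.
have E s : expi (s / 2) ^+ k = expi (s * (k%:R / 2)) by rewrite expiX -mulr_natr; congr expi; ring.
have E' s : expi ((1 + s) / 2) ^+ k = expi (k%:R / 2) * expi (s * (k%:R / 2)).
  by rewrite expiX -expiD -mulr_natr; congr expi; field.
have [/eqP ok|ok] := boolP (odd k == false).
  have hk : k = (k./2).*2 by rewrite -[LHS](odd_double_half k) ok.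
  have k20 : (0 < k./2)%N by rewrite half_gt0; case: (k) k0 ok => [//|[]].
  have [|//|N hN] := IH k./2 => //.
    by rewrite {2}hk -addnn -[X in (X < _)%N]addn0 ltn_add2l.
  have kr : k%:R / 2 = (k./2)%:R :> R by rewrite {1}hk -muln2 natrM mulfK // pnatr_eq0.
  exists N.+1 => -[//|j]; rewrite ltnS => /hN hj.
  have hd : dsum j (fun s => expi (s * (k%:R / 2))) = 0.
    by rewrite -hj; apply: dsum_eq => s _; rewrite expiX kr mulr_natr.
  rewrite dsumS (dsum_eq _ (fun s _ => E s)) (dsum_eq _ (fun s _ => E' s)) dsumZ hd.
  by rewrite mulr0 addr0 mul0r.
have hk : k = (k./2).*2.+1 by move: (odd_double_half k) ok; case: (odd k) => // {1}<-.
have kr : k%:R / 2 = (k./2)%:R + 2^-1 :> R.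
  by rewrite {1}hk -addn1 natrD -muln2 natrM; field.
have ek : expi (k%:R / 2) = -1.
  rewrite kr expiD expi_half -[(k./2)%:R]/(1 *+ k./2) -expiX expi1 expr1n mul1r //.
exists 1%N => -[//|j] _.
rewrite dsumS (dsum_eq _ (fun s _ => E s)) (dsum_eq _ (fun s _ => E' s)) dsumZ ek.
by rewrite mulN1r subrr mul0r.
Qed.

Lemma mean_mono k l : mean (fun z => z ^+ k * z^* ^+ l) = (k == l)%:R.
Proof.
have [hkl|hkl|->] := ltngtP k l.
- rewrite -(subnKC (ltnW hkl)).
  rewrite (mean_eq (v := fun z => (z ^+ (l - k))^*)); last first.
    move=> z hz; rewrite exprD mulrA -exprMn (circ_conj hz) divff ?circ_neq0 // expr1n mul1r.
    by rewrite cjX circ_conj.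
  by rewrite meanJ ?meanX ?subn_gt0 ?cj0 //; exact: circX.
- rewrite -(subnKC (ltnW hkl)).
  rewrite (mean_eq (v := fun z => z ^+ (k - l))) ?meanX ?subn_gt0 //.
  move=> z hz; rewrite exprD mulrAC -exprMn (circ_conj hz) divff ?circ_neq0 // expr1n mul1r //.
- rewrite (mean_eq (v := fun=> 1)) ?mean_cst // => z hz.
  by rewrite -exprMn (circ_conj hz) divff ?circ_neq0 // expr1n.
Qed.
End CircleMean.

Arguments circ_cst {R} c z _.
Arguments circX {R} k z _.
Arguments circJX {R} k z _.
Arguments circ_id {R} z _.

(** * One complex variable *)

Section Goursat.
Variable R : realType.
Local Notation C := (Cplx R).
Implicit Types (f g : C -> C) (a b c z : C).

Definition cdiff f z := exists c, forall e, 0 < e -> exists2 d : R, 0 < d &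
  forall y, nr (y - z) < d -> nr (f y - f z - c * (y - z)) <= e * nr (y - z).

Definition seg f a b : C := (b - a) * int01 (fun s => f (a + rc s * (b - a))).

Definition convex (O : set C) := forall a b s, O a -> O b -> 0 <= s <= 1 -> O (a + rc s * (b - a)).

Lemma cdiff_cont f z : cdiff f z -> ctn f z.
Proof.
move=> [c h]; apply/cont_nr => e e0; have [d d0 hd] := h 1 ltr01.
have c0 : 0 < 1 + nr c by rewrite ltr_pwDl // nr_ge0.
exists (Num.min d (e / (1 + nr c))); first by rewrite lt_min d0 divr_gt0.
move=> y; rewrite lt_min => /andP[/hd h1]; rewrite ltr_pdivlMr // => h2.
rewrite -(subrK (c * (y - z)) (f y - f z)); apply: le_lt_trans (nrD _ _) _.
by rewrite nrM; apply: le_lt_trans h2; move: h1; lra.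
Qed.

Section Segments.
Variable O : set C.
Hypothesis cO : convex O.

Definition conton f := forall z, O z -> ctn f z.

Lemma seg_ucont f a b : conton f -> O a -> O b -> ucont (fun s => f (a + rc s * (b - a))).
Proof.
move=> hf Oa Ob; apply: ucont_pointwise => s hs e e0.
have /cont_nr/(_ e e0)[d d0 hd] := hf _ (cO Oa Ob hs).
have ab : 0 < nr (b - a) + 1 by rewrite ltr_wpDl // nr_ge0.
exists (d / (nr (b - a) + 1)); first by rewrite divr_gt0.
move=> t ht; rewrite ltr_pdivlMr // => h; apply/ltW/hd.
rewrite opprD addrACA subrr add0r -mulrBl -rcB nrM nr_rc; apply: le_lt_trans h.
by rewrite ler_wpM2l // lerDl.
Qed.

Lemma seg_has f a b : conton f -> O a -> O b ->
  has_int (fun s => f (a + rc s * (b - a))) (int01 (fun s => f (a + rc s * (b - a)))).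
Proof. by move=> hf Oa Ob; apply/int01P/seg_ucont. Qed.

Lemma convex_mid a b : O a -> O b -> O ((a + b) / 2).
Proof.
move=> Oa Ob; have := cO Oa Ob (s := 2^-1) ltac:(apply/andP; split; lra).
by congr O; rewrite rcV rc_nat; field.
Qed.

Lemma seg_mid f a b : conton f -> O a -> O b ->
  seg f a b = seg f a ((a + b) / 2) + seg f ((a + b) / 2) b.
Proof.
move=> hf Oa Ob; set m := (a + b) / 2; have Om : O m by exact: convex_mid.
have h1 := seg_has hf Oa Om; have h2 := seg_has hf Om Ob.
have E1 : (fun s => f (a + rc s * (m - a))) = (fun s => f (a + rc (s / 2) * (b - a))).
  by apply/funext => s; rewrite rcM rcV rc_nat /m; congr f; field.
have E2 : (fun s => f (m + rc s * (b - m))) = (fun s => f (a + rc ((1 + s) / 2) * (b - a))).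
  by apply/funext => s; rewrite rcM rcV rc_nat rcD rc1 /m; congr f; field.
have h : has_int (fun s => f (a + rc s * (b - a))) ((int01 (fun s => f (a + rc s * (m - a))) + int01 (fun s => f (m + rc s * (b - m)))) / 2).
  by apply: has_int_half; [move: h1; rewrite {1}E1|move: h2; rewrite {1}E2].
by rewrite /seg (int01E h) /m; field.
Qed.

Lemma seg_rev f a b : conton f -> O a -> O b -> seg f b a = - seg f a b.
Proof.
move=> hf Oa Ob.
have rv : forall k (v : R -> C), dsum k (fun s => v (1 - s)) = dsum k (fun s => v (s + 2^-1 ^+ k)).
  elim=> [|k IH] v; first by rewrite /= subr0 add0r expr0.
  rewrite !dsumS addrC; congr ((_ + _) / 2).
    rewrite (dsum_eq k (v := fun s => v ((1 - s) / 2))) => [|s _]; last by congr v; field.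
    rewrite (IH (fun s => v (s / 2))).
    by apply: dsum_eq => s _; rewrite exprS; congr v; field.
  rewrite (dsum_eq k (v := fun s => v ((1 + (1 - s)) / 2))) => [|s _]; last by congr v; field.
  rewrite (IH (fun s => v ((1 + s) / 2))).
  by apply: dsum_eq => s _; rewrite exprS; congr v; field.
set v := fun s => f (a + rc s * (b - a)).
have hv : has_int v (int01 v) by exact: seg_has.
have h : has_int (fun s => v (1 - s)) (int01 v).
  move=> e e0.
  have [N hN] := hv (e / 2) ltac:(by rewrite divr_gt0).
  have B0 : 0 < nr (v 1 - v 0) + 1 by rewrite ltr_wpDl // nr_ge0.
  have [M hM] := @expr_half_lt R (e / 2 / (nr (v 1 - v 0) + 1)) ltac:(by rewrite !divr_gt0).
  exists (maxn N M) => k; rewrite geq_max => /andP[/hN h1 /hM h2].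
  rewrite rv -(subrK (dsum k v) (dsum k _)) -addrA (le_trans (nrD _ _)) // (splitr e) lerD //.
  rewrite -mulN1r -dsumZ -dsumD.
  under dsum_eq do rewrite mulN1r.
  rewrite dsum_telescope nrM nrX nrV -(rc_nat R 2) nr_rc normr_nat.
  move: h2; rewrite ltr_pdivlMr // mulrC => /ltW; apply: le_trans.
  by rewrite ler_wpM2r ?exprn_ge0 ?invr_ge0 // lerDl.
have E : (fun s => f (b + rc s * (a - b))) = (fun s => v (1 - s)).
  by apply/funext => s; rewrite /v rcB rc1; congr f; ring.
by rewrite /seg E (int01E h) /v; ring.
Qed.

Lemma seg_le f a b B : conton f -> O a -> O b ->
  (forall s, 0 <= s <= 1 -> nr (f (a + rc s * (b - a))) <= B) -> nr (seg f a b) <= B * nr (b - a).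
Proof.
move=> hf Oa Ob h; rewrite /seg nrM mulrC ler_wpM2r ?nr_ge0 //.
by apply: has_int_le (seg_has hf Oa Ob) h.
Qed.

Lemma segB f g a b : conton f -> conton g -> O a -> O b ->
  seg (fun z => f z - g z) a b = seg f a b - seg g a b.
Proof.
move=> hf hg Oa Ob; rewrite /seg -mulrBr; congr (_ * _); apply: int01E.
have := has_intD (seg_has hf Oa Ob) (has_intZ (-1) (seg_has hg Oa Ob)).
rewrite mulN1r; congr has_int; by apply/funext => s; rewrite mulN1r.
Qed.
End Segments.

Lemma seg_lin p q a b : seg (fun z => p + q * z) a b = p * (b - a) + q * (b ^+ 2 - a ^+ 2) / 2.
Proof.
rewrite /seg.
have -> : (fun s => p + q * (a + rc s * (b - a))) = (fun s => (p + q * a) + (q * (b - a)) * rc s).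
  by apply/funext => s; ring.
rewrite (int01E (has_intD (has_int_cst _) (has_intZ _ (@has_int_id R)))).
by rewrite rcV rc_nat; field.
Qed.

Definition tri f a b c := seg f a b + seg f b c + seg f c a.

Lemma tri_split O f a b c : convex O -> conton O f -> O a -> O b -> O c ->
  tri f a b c = tri f a ((a + b) / 2) ((c + a) / 2) + tri f ((a + b) / 2) b ((b + c) / 2)
   + tri f ((c + a) / 2) ((b + c) / 2) c + tri f ((a + b) / 2) ((b + c) / 2) ((c + a) / 2).
Proof.
move=> cO hf Oa Ob Oc.
have O1 := convex_mid cO Oa Ob; have O2 := convex_mid cO Ob Oc; have O3 := convex_mid cO Oc Oa.
rewrite /tri (seg_mid cO hf Oa Ob) (seg_mid cO hf Ob Oc) (seg_mid cO hf Oc Oa).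
rewrite (seg_rev cO hf O2 O1) (seg_rev cO hf O2 O3) (seg_rev cO hf O3 O1).
ring.
Qed.

Lemma nr_mid a b c (L : R) : nr (b - a) <= L -> nr (c - a) <= L -> nr (c - b) <= L ->
  [/\ nr ((a + b) / 2 - a) <= L / 2, nr ((a + b) / 2 - b) <= L / 2 &
   nr ((a + b) / 2 - (a + c) / 2) <= L / 2].
Proof.
move=> h1 h2 h3; split.
- have -> : (a + b) / 2 - a = (b - a) / 2 by field.
  by rewrite nr_half ler_pM2r.
- have -> : (a + b) / 2 - b = (a - b) / 2 by field.
  by rewrite nr_half ler_pM2r // nrBC.
- have -> : (a + b) / 2 - (a + c) / 2 = (b - c) / 2 by field.
  by rewrite nr_half ler_pM2r // nrBC.
Qed.

(** An affine function integrates to 0 around a triangle, so only the deviation from it counts: at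
    most [e] along a perimeter of at most [3 * L]. The radius [2 * L] around [a] covers the
    triangle. *)
Lemma tri_small O f a b c z e L : convex O -> conton O f -> O a -> O b -> O c ->
  nr (b - a) <= L -> nr (c - b) <= L -> nr (a - c) <= L ->
  (exists k, forall y, nr (y - a) <= 2 * L -> nr (f y - f z - k * (y - z)) <= e) ->
  nr (tri f a b c) <= 3 * L * e.
Proof.
move=> cO hf Oa Ob Oc h1 h2 h3 [k hk].
have L0 : 0 <= L by apply: le_trans h1; exact: nr_ge0.
pose g y := f y - ((f z - k * z) + k * y).
have hl : conton O (fun y => (f z - k * z) + k * y).
  by move=> y _; apply: (contD (@cont_cst _ _ _ _) (contM (@cont_cst _ _ _ _) _)); exact: cont_id.
have hg : conton O g by move=> y Oy; exact: (contB (hf y Oy) (hl y Oy)).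
have -> : tri f a b c = tri g a b c.
  by rewrite /tri /g !(segB cO hf hl) // !seg_lin; field.
have hgb y : nr (y - a) <= 2 * L -> nr (g y) <= e.
  by move=> /hk; congr (nr _ <= _); rewrite /g; ring.
have e0 : 0 <= e.
  by apply: le_trans (hgb a _); [exact: nr_ge0|rewrite subrr nr0; lra].
have hs x y : O x -> O y -> nr (x - a) <= L -> nr (y - x) <= L -> nr (seg g x y) <= e * L.
  move=> Ox Oy hx hy; apply: le_trans (_ : e * nr (y - x) <= _); last exact: ler_wpM2l.
  apply: (seg_le cO) => // s /andP[s0 s1]; apply: hgb.
  rewrite addrAC (le_trans (nrD _ _)) // nrM nr_rc ger0_norm //.
  have : s * nr (y - x) <= 1 * L by apply: ler_pM => //; exact: nr_ge0.
  by move: hx; lra.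
rewrite /tri; have -> : 3 * L * e = e * L + e * L + e * L by ring.
apply: le_trans (nrD _ _) _; apply: lerD; last first.
  by apply: hs; rewrite // nrBC.
apply: le_trans (nrD _ _) _; apply: lerD; apply: hs => //.
by rewrite subrr nr0.
Qed.

Theorem goursat O f a b c : convex O -> compact O -> (forall z, O z -> cdiff f z) ->
  O a -> O b -> O c -> tri f a b c = 0.
Proof.
move=> cO kO df Oa Ob Oc.
have hf : conton O f by move=> z /df; exact: cdiff_cont.
(* A triangle in [O] with sides at most [L] whose integral exceeds [e * L ^+ 2]. Quartering halves
   the sides and divides the threshold by 4, so one of the four pieces is again bad. *)
pose bad (e L : R) (t : C * C * C) := [/\ O t.1.1 /\ O t.1.2 /\ O t.2,
  nr (t.1.2 - t.1.1) <= L, nr (t.2 - t.1.2) <= L, nr (t.1.1 - t.2) <= L &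
  e * L ^+ 2 < nr (tri f t.1.1 t.1.2 t.2)].
have step e L t : bad e L t -> exists t', bad e (L / 2) t' /\ nr (t'.1.1 - t.1.1) <= L.
  move: t => [[x y] z] [/= [Ox [Oy Oz]] h1 h2 h3 hT].
  have O1 := convex_mid cO Ox Oy; have O2 := convex_mid cO Oy Oz; have O3 := convex_mid cO Oz Ox.
  have [a1 a2 a3] : [/\ nr ((x + y) / 2 - x) <= L / 2, nr ((x + y) / 2 - y) <= L / 2 &
      nr ((x + y) / 2 - (x + z) / 2) <= L / 2] by apply: nr_mid; rewrite // nrBC.
  have [b1 b2 b3] : [/\ nr ((y + z) / 2 - y) <= L / 2, nr ((y + z) / 2 - z) <= L / 2 &
      nr ((y + z) / 2 - (y + x) / 2) <= L / 2] by apply: nr_mid; rewrite // nrBC.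
  have [c1 c2 c3] : [/\ nr ((z + x) / 2 - z) <= L / 2, nr ((z + x) / 2 - x) <= L / 2 &
      nr ((z + x) / 2 - (z + y) / 2) <= L / 2] by apply: nr_mid; rewrite // nrBC.
  rewrite (addrC y x) in b3; rewrite (addrC z y) in c3; rewrite (addrC x z) in a3.
  have L0 : 0 <= L by apply: le_trans h1; exact: nr_ge0.
  move: hT; rewrite (tri_split cO hf Ox Oy Oz).
  set T1 := tri f _ _ _; set T2 := tri f _ _ _; set T3 := tri f _ _ _; set T4 := tri f _ _ _ => hT.
  have hT' : e * L ^+ 2 < nr T1 + nr T2 + nr T3 + nr T4.
    by apply: lt_le_trans hT _; do 3! [apply: le_trans (nrD _ _) _; rewrite lerD2r].
  have q : (L / 2) ^+ 2 = L ^+ 2 / 4 by field.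
  have le2 : L / 2 <= L by lra.
  have [g1|g1] := ltP (e * (L / 2) ^+ 2) (nr T1).
    exists (x, (x + y) / 2, (z + x) / 2); split; last by rewrite /= subrr nr0.
    by split=> //=; rewrite nrBC.
  have [g2|g2] := ltP (e * (L / 2) ^+ 2) (nr T2).
    exists ((x + y) / 2, y, (y + z) / 2); split; last by rewrite /=; exact: le_trans a1 _.
    by split=> //=; rewrite nrBC.
  have [g3|g3] := ltP (e * (L / 2) ^+ 2) (nr T3).
    exists ((z + x) / 2, (y + z) / 2, z); split; last by rewrite /=; exact: le_trans c2 _.
    by split=> //=; rewrite nrBC.
  have [g4|g4] := ltP (e * (L / 2) ^+ 2) (nr T4).
    exists ((x + y) / 2, (y + z) / 2, (z + x) / 2); split; last by rewrite /=; exact: le_trans a1 _.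
    by split=> //=; rewrite nrBC.
  by move: g1 g2 g3 g4 hT'; rewrite q; lra.
apply/eqP; rewrite -nr_eq0 eq_le nr_ge0 andbT leNgt; apply/negP => T0.
pose L := 1 + nr (b - a) + nr (c - b) + nr (a - c).
have := nr_ge0 (b - a); have := nr_ge0 (c - b); have := nr_ge0 (a - c) => n1 n2 n3.
have L0 : 0 < L by rewrite /L; lra.
pose e := nr (tri f a b c) / 2 / L ^+ 2.
have e0 : 0 < e by rewrite !divr_gt0 // exprn_gt0.
have bad0 : bad e L (a, b, c).
  split=> //=; rewrite ?/L; try lra.
  by rewrite -/L /e divfK ?gt_eqF ?exprn_gt0 // ltr_pdivrMr // mulrx2 ltrDl.
have [s s0 hs] : exists2 s : nat -> C * C * C, s 0%N = (a, b, c) &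
    forall k, bad e (L / 2 ^+ k) (s k) /\ nr ((s k.+1).1.1 - (s k).1.1) <= L / 2 ^+ k.
  have /choice[F hF] : forall p : R * (C * C * C), exists t', bad e p.1 p.2 ->
      bad e (p.1 / 2) t' /\ nr (t'.1.1 - p.2.1.1) <= p.1.
    move=> p; have [/step[t' ht]|nb] := pselect (bad e p.1 p.2); first by exists t'.
    by exists p.2.
  pose s := fix s k := if k is k'.+1 then F (L / 2 ^+ k', s k') else (a, b, c).
  have hb k : bad e (L / 2 ^+ k) (s k).
    elim: k => [|k IH]; first by rewrite expr0 divr1.
    have [+ _] := hF (L / 2 ^+ k, s k) IH.
    by rewrite /= exprS invfM mulrA mulrAC.
  exists s => // k; split=> //.
  by have [_] := hF (L / 2 ^+ k, s k) (hb k).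
have nest k j : nr ((s (k + j)%N).1.1 - (s k).1.1) <= 2 * (L / 2 ^+ k).
  suff : nr ((s (k + j)%N).1.1 - (s k).1.1) <= 2 * (L / 2 ^+ k) - 2 * (L / 2 ^+ (k + j)).
    by move=> h; apply: le_trans h _; rewrite gerBl mulr_ge0 // divr_ge0 ?exprn_ge0 // ltW.
  elim: j => [|j IH]; first by rewrite addn0 !subrr nr0.
  apply: le_trans (nr_tri (s (k + j)%N).1.1 _ _) _; rewrite addnS.
  have := (hs (k + j)%N).2; rewrite exprS.
  set q := L / 2 ^+ (k + j) in IH *.
  have -> : L / (2 * 2 ^+ (k + j)) = q / 2 by rewrite /q invfM mulrCA mulrC.
  by move: IH; lra.
(* Compactness provides the common limit point; the geometric estimate [nest] then keeps the k-th
   first vertex within 3 L / 2^k of it. *)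
have [z [Oz hz]] : O `&` cluster ((fun k => (s k).1.1) @ \oo) !=set0.
  apply: kO; exists 0%N => // k _ /=.
  by have [[[]]] := hs k.
have near_z k : nr ((s k).1.1 - z) <= 3 * (L / 2 ^+ k).
  have Lk : 0 < L / 2 ^+ k by rewrite divr_gt0 // exprn_gt0.
  have [_ [[j /= kj <-] hj]] : ([set (s j).1.1 | j in [set j | (k <= j)%N]] `&` [set y | nr (y - z) < L / 2 ^+ k]) !=set0.
    apply: hz; first by exists k => // j /= hj; exists j.
    by apply/(@near_nr R C); exists (L / 2 ^+ k).
  rewrite nrBC in hj.
  have := nest k (j - k)%N; rewrite subnKC // nrBC.
  have := nr_tri (s j).1.1 (s k).1.1 z; move: hj; rewrite (nrBC z).
  lra.
have [q hq] := df z Oz.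
(* The N-th triangle has sides at most [l] and lies within 5 l of [z]: 3 l by [near_z] and 2 l for
   the triangle. So [tri_small] bounds its integral by 3 l (e / 16) 5 l = (15 / 16) e l^2, which
   contradicts badness. *)
have [d d0 hd] := hq (e / 16) ltac:(by rewrite divr_gt0).
have [N hN] := @expr_half_lt R (d / (5 * L)) ltac:(by rewrite divr_gt0 // mulr_gt0).
have := hN N (leqnn _); rewrite ltr_pdivlMr ?mulr_gt0 // exprVn => hdN.
have [[[p1 [p2 p3]] h1 h2 h3 hT] _] := hs N.
set l := L / 2 ^+ N in h1 h2 h3 hT.
have l0 : 0 < l by rewrite divr_gt0 // exprn_gt0.
have hl : 5 * l < d.
  by apply: le_lt_trans hdN; rewrite /l; set q' := 2 ^- N; lra.
have : nr (tri f (s N).1.1 (s N).1.2 (s N).2) <= 3 * l * (e / 16 * (5 * l)).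
  apply: (@tri_small O f _ _ _ z (e / 16 * (5 * l)) l cO hf p1 p2 p3 h1 h2 h3).
  exists q => y hy.
  have hyz : nr (y - z) <= 5 * l.
    by apply: le_trans (nr_tri (s N).1.1 _ _) _; have := near_z N; rewrite -/l; move: hy; lra.
  apply: le_trans (hd y _) _; first exact: le_lt_trans hl.
  by rewrite ler_wpM2l // divr_ge0 // ltW.
apply/negP; rewrite -ltNge; apply: le_lt_trans hT.
have -> : 3 * l * (e / 16 * (5 * l)) = 15 / 16 * (e * l ^+ 2) by field.
have : 0 < e * l ^+ 2 by rewrite mulr_gt0 // exprn_gt0.
by set q' := e * l ^+ 2; lra.
Qed.

End Goursat.

(** * Cauchy's formula and Taylor expansion with explicit remainder *)

Section Cauchy.
Variable R : realType.
Local Notation C := (Cplx R).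
Implicit Types (f g : C -> C) (a b c z t : C).

Lemma convex_disc r : convex [set z : C | nr z <= r].
Proof.
move=> a b s /= ha hb /andP[s0 s1].
have -> : a + rc s * (b - a) = rc (1 - s) * a + rc s * b by rewrite rcB rc1; ring.
apply: le_trans (nrD _ _) _; rewrite !nrM !nr_rc !ger0_norm ?subr_ge0 //.
have := ler_wpM2l s0 hb; have : (1 - s) * nr a <= (1 - s) * r by rewrite ler_wpM2l ?subr_ge0.
lra.
Qed.

Lemma convex_halfplane (w : C) k : convex [set z : C | k <= cre (z * w)].
Proof.
move=> a b s /= ha hb /andP[s0 s1].
have -> : a + rc s * (b - a) = rc (1 - s) * a + rc s * b by rewrite rcB rc1; ring.
rewrite mulrDl creD -!mulrA ![cre (rc _ * _)]creM !cim_rc !mul0r !subr0 !cre_rc.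
have := ler_wpM2l s0 hb; have : (1 - s) * k <= (1 - s) * cre (a * w) by rewrite ler_wpM2l ?subr_ge0.
lra.
Qed.

Lemma convexI (A B : set C) : convex A -> convex B -> convex (A `&` B).
Proof. by move=> hA hB a b s [aA aB] [bA bB] hs; split; [apply: hA|apply: hB]. Qed.
Lemma convex_shift (A : set C) c : convex A -> convex [set z | A (z - c)].
Proof.
move=> hA a b s /= ha hb hs; have := hA _ _ _ ha hb hs.
by congr A; ring.
Qed.

Section ExceptionalPoint.
Variables (g : C -> C) (r : R) (t0 : C).
Hypothesis t0r : nr t0 <= r.
Hypothesis gd : forall z, nr z <= r -> z != t0 -> cdiff g z.
Hypothesis gc : ctn g t0.
Let D := [set z : C | nr z <= r].

Let gcont : conton D g.
Proof. by move=> z Dz; have [->|h] := eqVneq z t0; [exact: gc|apply: cdiff_cont; apply: gd]. Qed.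
Let cD : convex D. Proof. exact: convex_disc. Qed.

(** Cutting off the half-size homothetic triangle at [t0] leaves the quadrilateral [a'], [a], [b],
    [b']. It lies in a half-plane away from [t0], because the side [b - a] is shorter than [a - t0];
    Goursat applies to its two triangles. *)
Let tri_half a b : D a -> D b -> a != t0 -> nr (b - a) < nr (a - t0) ->
  tri g t0 a b = tri g t0 ((t0 + a) / 2) ((t0 + b) / 2).
Proof.
move=> Da Db at0 hab.
pose w := (a - t0)^*.
have ha : cre ((a - t0) * w) = nr (a - t0) ^+ 2 by rewrite /w -nr_sqr cre_rc.
have n0 : 0 < nr (a - t0) by rewrite nr_gt0 subr_eq0.
pose k := Num.min (nr (a - t0) ^+ 2) (cre ((b - t0) * w)) / 2.
have hb : 0 < cre ((b - t0) * w).
  have -> : b - t0 = (a - t0) + (b - a) by ring.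
  rewrite mulrDl creD ha.
  have : `|cre ((b - a) * w)| < nr (a - t0) ^+ 2.
    by apply: le_lt_trans (cre_le _) _; rewrite nrM /w nrJ expr2 ltr_pM2r.
  by rewrite ltr_norml => /andP[h _]; rewrite addrC -ltrBlDr sub0r.
have k0 : 0 < k by rewrite divr_gt0 // lt_min exprn_gt0.
have ka : 2 * k <= nr (a - t0) ^+ 2 by rewrite mulrC divfK // ge_min lexx.
have kb : 2 * k <= cre ((b - t0) * w) by rewrite mulrC divfK // ge_min lexx orbT.
pose O := D `&` [set z | k <= cre ((z - t0) * w)].
have cO : convex O.
  apply: convexI => //; apply: (@convex_shift [set z | k <= cre (z * w)]).
  exact: convex_halfplane.
have kO : compact O.
  apply: compact_closedI; first exact: compact_disc.
  have hc : continuous (fun z : C => (cre ((z - t0) * w) : R)).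
    move=> z; apply/(@cont_nrR R C) => e e0.
    have w0 : 0 < nr w by rewrite nrJ.
    exists (e / nr w); first by rewrite divr_gt0.
    move=> y; rewrite ltr_pdivlMr // => h; rewrite -creB -mulrBl.
    by apply: le_lt_trans (cre_le _) _; rewrite nrM; have -> : y - t0 - (z - t0) = y - z by ring.
  have := closed_comp (f := fun z : C => (cre ((z - t0) * w) : R)) (D := [set x | k <= x]).
  by apply=> //; exact: closed_ge.
have gO z : O z -> cdiff g z.
  move=> [Dz hz]; apply: gd => //; apply/eqP => e; move: hz.
  by rewrite /= e subrr mul0r; apply/negP; rewrite -ltNge.
pose a' := (t0 + a) / 2; pose b' := (t0 + b) / 2.
have Dt : D t0 by exact: t0r.
have [Da' Db'] : D a' /\ D b' by split; apply: (convex_mid cD).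
have hh x : cre (((t0 + x) / 2 - t0) * w) = cre ((x - t0) * w) / 2.
  by rewrite -cre_half; congr cre; field.
have Oa : O a by split=> //=; rewrite ha; lra.
have Ob : O b by split=> //=; lra.
have Oa' : O a' by split=> //=; rewrite hh ha; lra.
have Ob' : O b' by split=> //=; rewrite hh; lra.
have := goursat cO kO gO Oa' Oa Ob; have := goursat cO kO gO Oa' Ob Ob'.
rewrite /tri (seg_mid cD gcont Dt Da) (seg_mid cD gcont Db Dt) (addrC b t0) -/a' -/b'.
rewrite (seg_rev cD gcont Da' Db) (seg_rev cD gcont Da' Db') => h1 h2.
apply/eqP; rewrite -subr_eq0; apply/eqP.
by have := congr2 +%R h1 h2; rewrite addr0 => <-; ring.
Qed.

(** Shrinking the triangle towards the exceptional vertex [t0] does not change the integral by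
    [tri_half], while the perimeter tends to 0 and [g] stays near [g t0]. *)
Lemma tri_except a b : D a -> D b -> nr (b - a) < nr (a - t0) -> tri g t0 a b = 0.
Proof.
move=> Da Db hab.
have n0 : 0 < nr (a - t0) by apply: le_lt_trans hab; exact: nr_ge0.
have at0 : a != t0 by rewrite -subr_eq0 -nr_gt0.
have Dt : D t0 by exact: t0r.
pose sc k x := t0 + (x - t0) * 2^-1 ^+ k.
have scS k x : sc k.+1 x = (t0 + sc k x) / 2 by rewrite /sc exprS; field.
have Dsc k x : D x -> D (sc k x).
  move=> Dx; elim: k => [|k IH]; first by rewrite /sc expr0 mulr1 addrC subrK.
  by rewrite scS; apply: (convex_mid cD).
have nsc k x y : nr (sc k x - sc k y) = nr (x - y) * 2^-1 ^+ k.
  have -> : sc k x - sc k y = (x - y) * 2^-1 ^+ k by rewrite /sc; ring.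
  by rewrite nrM nrX nrV -(rc_nat R 2) nr_rc normr_nat.
have nsc0 k x : nr (sc k x - t0) = nr (x - t0) * 2^-1 ^+ k.
  have -> : sc k x - t0 = (x - t0) * 2^-1 ^+ k by rewrite /sc; ring.
  by rewrite nrM nrX nrV -(rc_nat R 2) nr_rc normr_nat.
have hp k : 0 < 2^-1 ^+ k :> R by rewrite exprn_gt0 // invr_gt0.
have tk k : tri g t0 a b = tri g t0 (sc k a) (sc k b).
  elim: k => [|k ->]; first by rewrite /sc expr0 !mulr1 !(addrC t0) !subrK.
  rewrite !scS; apply: tri_half; rewrite ?nsc ?nsc0 ?ltr_pM2r //; try exact: Dsc.
  by rewrite -subr_eq0 -nr_gt0 nsc0 mulr_gt0.
have /cont_nr/(_ 1 ltr01)[d d0 hd] := gc.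
pose L := nr (a - t0) + nr (b - t0) + nr (b - a) + 1.
have [m1 m2 m3] : [/\ 0 <= nr (a - t0), 0 <= nr (b - t0) & 0 <= nr (b - a)] by split; exact: nr_ge0.
have L0 : 0 < L by rewrite /L; lra.
apply/eqP; rewrite -nr_eq0 eq_le nr_ge0 andbT; apply/ler_addgt0Pl => e e0; rewrite addr0.
have [N hN] := @expr_half_lt R (Num.min (d / (2 * L)) (e / (3 * L))) ltac:(by rewrite lt_min !divr_gt0 ?mulr_gt0).
have := hN N (leqnn _); rewrite lt_min !ltr_pdivlMr ?mulr_gt0 // => /andP[h1 h2].
rewrite (tk N).
have bd (c : R) : 0 <= c -> c <= L -> c * 2^-1 ^+ N <= L * 2^-1 ^+ N by move=> ? ?; rewrite ler_pM2r.
apply: le_trans (_ : 3 * (L * 2^-1 ^+ N) * 1 <= _); last by move: h2; lra.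
apply: (@tri_small R D g t0 (sc N a) (sc N b) t0 1 _ cD gcont Dt (Dsc N a Da) (Dsc N b Db)); rewrite ?nsc ?nsc0.
- by apply: bd => //; rewrite /L; lra.
- by apply: bd => //; rewrite /L; lra.
- by rewrite nrBC nsc0; apply: bd => //; rewrite /L; lra.
- exists 0 => y hy; rewrite mul0r subr0; apply/ltW/hd; apply: le_lt_trans hy _.
  by move: h1; lra.
Qed.

(** The function [G], integrating from [t0] along segments, is a primitive along short chords of the
    circle. Its increments over the dyadic nodes telescope to 0, and each of them is [g] times the
    chord up to [e] times the length of the chord. *)
Lemma loop_zero : nr t0 < r -> mean (fun z => g (rc r * z) * z) = 0.
Proof.
move=> tr.
have r0 : 0 < r by apply: le_lt_trans tr; exact: nr_ge0.
have Dz z : nr z = 1 -> D (rc r * z) by move=> h; rewrite /D /= nrM h mulr1 nr_rc ger0_norm // ltW.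
have hcirc : circ (fun z => g (rc r * z) * z).
  move=> z hz; apply: (contM _ (circ_id z hz)).
  apply: (@ctn_comp R _ _ _ (fun z : C => rc r * z) g); last exact: gcont (Dz z hz).
  exact: (contM (@cont_cst R C (rc r) z) (circ_id z hz)).
apply: (has_int_uniq (meanP hcirc)) => e e0.
have [d d0 hd] : exists2 d : R, 0 < d & forall x, D x -> forall y, D y -> nr (y - x) < d -> nr (g y - g x) <= e.
  apply: (@compact_unif R C D (fun d x => forall y, D y -> nr (y - x) < d -> nr (g y - g x) <= e)).
  - exact: compact_disc.
  - by move=> d d' x _ dd h y Dy hy; apply: h => //; apply: lt_le_trans dd.
  - move=> x Dx; have /cont_nr/(_ (e / 2) ltac:(by rewrite divr_gt0))[d d0 hd] := gcont Dx.
    exists (d / 2); first by rewrite divr_gt0.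
    move=> y hy z Dz' hz; apply/ltW; apply: le_lt_trans (nr_tri (g x) _ _) _.
    have h1 : nr (g z - g x) < e / 2.
      by apply: hd; apply: le_lt_trans (nr_tri y _ _) _; rewrite (splitr d) ltrD.
    have h2 : nr (g x - g y) < e / 2.
      by rewrite nrBC; apply: hd; apply: lt_trans hy _; lra.
    lra.
(* Chords are made shorter than the distance from [t0] to the circle, as [tri_except] requires, and
   shorter than the modulus [d] of uniform continuity. *)
have [d' d0' hd'] := @cont01_expi R 0 (Num.min d (r - nr t0) / (2 * r))
   ltac:(by rewrite divr_gt0 ?mulr_gt0 // lt_min d0 subr_gt0).
have [N hN] := expr_half_lt d0'.
exists N.+1 => k hk; rewrite subr0.
set w := expi (2^-1 ^+ k : R).
have w1 : w - 1 != 0.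
  rewrite subr_eq0; apply/eqP => w1.
  have : w ^+ (2 ^ k.-1) = 1 by rewrite w1 expr1n.
  rewrite /w expiX -[_ *+ (2 ^ _)]mulr_natr natrX; case: (k) hk => // j _ /=.
  rewrite exprS -mulrA -exprMn mulVf // expr1n mulr1 expi_half => /(congr1 (@cre R)).
  by rewrite creN -rc1 cre_rc; lra.
have hw : r * nr (w - 1) <= Num.min d (r - nr t0) / 2.
  have : nr (w - expi 0) <= Num.min d (r - nr t0) / (2 * r).
    apply: hd'; rewrite subr0 ger0_norm ?exprn_ge0 ?invr_ge0 //; apply: hN.
    exact: ltnW.
  by rewrite expi0 invfM mulrA ler_pdivlMr // mulrC.
have mp : 0 < Num.min d (r - nr t0) by rewrite lt_min d0 subr_gt0.
pose G z := seg g t0 z.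
have tel := dsum_telescope k (fun s => G (rc r * expi s)).
have := tel; rewrite expi1 expi0 subrr mul0r.
(* The defect between the increment of [G] over one chord and the Riemann summand; it is the
   integral of [g - g x] along the chord. *)
pose er s := (G (rc r * expi (s + 2^-1 ^+ k)) - G (rc r * expi s)) - rc r * (w - 1) * (g (rc r * expi s) * expi s).
have hD s : D (rc r * expi s) by apply: Dz; exact: nr_expi.
have he s : 0 <= s <= 1 -> nr (er s) <= e * (r * nr (w - 1)).
  move=> _; set x := rc r * expi s; set y := rc r * expi (s + 2^-1 ^+ k).
  have yx : y - x = rc r * expi s * (w - 1) by rewrite /y /x expiD /w; ring.
  have nyx : nr (y - x) = r * nr (w - 1) by rewrite yx !nrM nr_expi mulr1 nr_rc ger0_norm // ltW.
  have xt : r - nr t0 <= nr (x - t0).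
    by have := nr_sub x t0; rewrite /x nrM nr_expi mulr1 nr_rc ger0_norm // ltW.
  have hm1 : Num.min d (r - nr t0) <= d by rewrite ge_min lexx.
  have hm2 : Num.min d (r - nr t0) <= r - nr t0 by rewrite ge_min lexx orbT.
  have yx_lt : nr (y - x) < nr (x - t0) by rewrite nyx; move: hw mp hm2 xt; lra.
  have /eqP := tri_except (hD s) (hD _) yx_lt; rewrite /tri (seg_rev cD gcont t0r (hD _)) subr_eq0 => /eqP hG.
  have -> : er s = seg (fun z => g z - g x) x y.
    rewrite (segB cD gcont (fun z _ => @cont_cst R C (g x) z) (hD _) (hD _)).
    have -> : seg (fun=> g x) x y = g x * (y - x).
      by rewrite -[RHS]addr0 -(mul0r ((y ^+ 2 - x ^+ 2) / 2)) mulrA -seg_lin; congr seg; apply/funext => z; rewrite mul0r addr0.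
    by rewrite /er -/x -/y /G -hG yx /x; ring.
  rewrite -nyx; apply: (seg_le cD); [|exact: (hD _)|exact: (hD _)|].
    by move=> z Dz'; exact: (contB (gcont Dz') (@cont_cst R C (g x) z)).
  move=> u /andP[u0 u1]; apply: hd; first exact: hD.
    by apply: cD; rewrite ?u0 //; exact: hD.
  rewrite addrC addKr nrM nr_rc ger0_norm //; apply: le_lt_trans (_ : nr (y - x) < _).
    by rewrite ler_piMl ?nr_ge0.
  by rewrite nyx; move: hw mp hm1; lra.
have -> : dsum k (fun s => G (rc r * expi (s + 2^-1 ^+ k)) - G (rc r * expi s)) =
    dsum k er + rc r * (w - 1) * dsum k (fun s => g (rc r * expi s) * expi s).
  by rewrite -dsumZ -dsumD; apply: dsum_eq => s _; rewrite /er subrK.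
move=> /eqP; rewrite addrC addr_eq0 => /eqP h.
have := dsum_le k he; rewrite -nrN -h !nrM nr_rc (ger0_norm (ltW r0)) [leLHS]mulrC ler_pM2r //.
by rewrite mulr_gt0 // nr_gt0.
Qed.

End ExceptionalPoint.

Section CauchyFormula.
Variables (f : C -> C) (r : R).
Hypothesis fd : forall z, nr z <= r -> cdiff f z.

Lemma circ_disc (u : C -> C) : 0 < r -> (forall z, nr z = r -> ctn u z) ->
  circ (fun z => u (rc r * z)).
Proof.
move=> r0 hu z hz; apply: (@ctn_comp R _ _ _ (fun z : C => rc r * z) u).
  exact: (contM (@cont_cst R C (rc r) z) (circ_id z hz)).
by apply: hu; rewrite nrM hz mulr1 nr_rc gtr0_norm.
Qed.

Lemma kernel_nz t z : nr t < r -> nr z = 1 -> rc r * z - t != 0.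
Proof.
move=> tr hz; rewrite -nr_gt0; apply: lt_le_trans (nr_sub _ _).
by rewrite nrM hz mulr1 nr_rc subr_gt0 (lt_le_trans tr) // ler_norm.
Qed.

Lemma circ_kernel t : nr t < r -> circ (fun z => rc r * z / (rc r * z - t)).
Proof.
move=> tr z hz; have hm := contM (@cont_cst R C (rc r) z) (circ_id z hz).
apply: (contM hm); apply: contV; first exact: kernel_nz.
exact: (contB hm (@cont_cst R C t z)).
Qed.

(** The finite geometric series for the Cauchy kernel, written with the conjugate of [z], which is
    its inverse on the unit circle. *)
Lemma kernel_expand t z K : nr t < r -> nr z = 1 ->
  rc r * z / (rc r * z - t) = \sum_(k < K) (t / rc r) ^+ k * z^* ^+ k
    + (t / rc r) ^+ K * z^* ^+ K * (rc r * z / (rc r * z - t)).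
Proof.
move=> tr hz.
have r0 : rc r != 0.
  by rewrite -nr_gt0 nr_rc (lt_le_trans (le_lt_trans (nr_ge0 t) tr)) // ler_norm.
have z0 := circ_neq0 hz; have k0 := kernel_nz tr hz.
elim: K => [|K IH]; first by rewrite big_ord0 !expr0 !mul1r add0r.
rewrite {1}IH big_ord_recr /= -addrA; congr (_ + _).
rewrite [(t / rc r) ^+ K.+1]exprS [z^* ^+ K.+1]exprS (circ_conj hz).
set A := (t / rc r) ^+ K; set B := z^-1 ^+ K.
by field; rewrite r0 z0 k0.
Qed.

Lemma nr_kernel t z : nr t <= r / 2 -> 0 < r -> nr z = 1 -> nr (rc r * z / (rc r * z - t)) <= 2.
Proof.
move=> tr r0 hz; rewrite nrM nrV nrM hz mulr1 nr_rc (gtr0_norm r0).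
have h : r / 2 <= nr (rc r * z - t).
  by apply: le_trans (nr_sub _ _); rewrite nrM hz mulr1 nr_rc (gtr0_norm r0); lra.
have h0 : 0 < nr (rc r * z - t) by apply: lt_le_trans h; rewrite divr_gt0.
by rewrite ler_pdivrMr //; lra.
Qed.

(** In the geometric series only the term of index 0 has a nonzero mean, and the remainder tends to
    0 because [nr t < r]. *)
Lemma mean_kernel t : nr t < r -> mean (fun z => rc r * z / (rc r * z - t)) = 1.
Proof.
move=> tr; have r0 : 0 < r by apply: le_lt_trans tr; exact: nr_ge0.
have q1 : nr (t / rc r) < 1 by rewrite nrM nrV nr_rc gtr0_norm // ltr_pdivrMr ?mul1r.
have B0 : forall z, nr z = 1 -> nr (rc r * z / (rc r * z - t)) <= r / (r - nr t).
  move=> z hz; rewrite nrM nrV nrM hz mulr1 nr_rc (gtr0_norm r0) ler_pM2l //.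
  rewrite lef_pV2 ?posrE ?subr_gt0 ?nr_gt0 ?kernel_nz //.
  by apply: le_trans (nr_sub _ _); rewrite nrM hz mulr1 nr_rc (gtr0_norm r0).
have ck := circ_kernel tr.
have hK K : nr (mean (fun z => rc r * z / (rc r * z - t)) - 1) <= nr (t / rc r) ^+ K.+1 * (r / (r - nr t)).
  rewrite (mean_eq (fun z hz => kernel_expand K.+1 tr hz)).
  have c1 k : circ (fun z : C => (t / rc r) ^+ k * z^* ^+ k) by exact: (circM (circ_cst _) (circJX k)).
  rewrite (meanD (@circ_sum R _ _ _ (fun k : 'I_K.+1 => c1 k)) (circM (c1 _) ck)).
    rewrite (mean_sum _ (F := fun (k : 'I_K.+1) z => (t / rc r) ^+ k * z^* ^+ k)); last by move=> k; exact: c1.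
    rewrite big_ord_recl big1 => [|k _]; last first.
      rewrite (meanZ _ (circJX _)) (mean_eq (v := fun z => (z ^+ k.+1)^*)); last first.
        by move=> z _; rewrite cjX.
      by rewrite meanJ ?meanX ?cj0 ?mulr0 //; exact: (circX _).
    rewrite (mean_eq (v := fun=> 1)) => [|z _]; last by rewrite !expr0 mul1r.
    rewrite mean_cst addr0 addrAC subrr add0r.
    apply: mean_le; first exact: (circM (c1 _) ck).
    move=> z hz; rewrite nrM nrM !nrX nrJ hz expr1n mulr1 ler_wpM2l ?B0 //.
    by rewrite exprn_ge0 // nr_ge0.
apply/eqP; rewrite -subr_eq0 -nr_eq0 eq_le nr_ge0 andbT; apply/ler_addgt0Pl => e e0; rewrite addr0.
have Bp : 0 < r / (r - nr t) by rewrite divr_gt0 // subr_gt0.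
have := cvg_expr (z := nr (t / rc r)) _.
rewrite ger0_norm ?nr_ge0 // => /(_ q1)/cvgrPdist_lt/(_ (e / (r / (r - nr t))) ltac:(by rewrite divr_gt0)).
move=> [N _ /(_ N.+1 (leqnSn _))] /=; rewrite sub0r normrN ger0_norm ?exprn_ge0 ?nr_ge0 // ltr_pdivlMr //.
by move=> h; apply: le_trans (hK N) _; exact: ltW.
Qed.

(** [loop_zero] is applied to the difference quotient of [f] at [t], extended by the derivative: it
    is differentiable away from [t] and continuous at [t]. *)
Theorem cauchy_formula t : nr t < r -> f t = mean (fun z => f (rc r * z) * (rc r * z / (rc r * z - t))).
Proof.
move=> tr; have r0 : 0 < r by apply: le_lt_trans tr; exact: nr_ge0.
have [c hc] := fd (ltW tr).
pose g z := if z == t then c else (f z - f t) / (z - t).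
have gz z : z != t -> g z = (f z - f t) / (z - t) by rewrite /g => /negbTE ->.
have gct : ctn g t.
  apply/cont_nr => e e0; have [d d0 hd] := hc (e / 2) ltac:(by rewrite divr_gt0).
  exists d => // y hy; rewrite {2}/g eqxx.
  have [->|yt] := eqVneq y t; first by rewrite /g eqxx subrr nr0.
  have n0 : 0 < nr (y - t) by rewrite nr_gt0 subr_eq0.
  rewrite gz // -(ltr_pM2r n0) -nrM mulrBl divfK ?subr_eq0 //.
  apply: le_lt_trans (hd y hy) _; rewrite ltr_pM2r //; lra.
have gd z : nr z <= r -> z != t -> cdiff g z.
  move=> zr zt; have [c' hc'] := fd zr.
  have zt0 : z - t != 0 by rewrite subr_eq0.
  have n0 : 0 < nr (z - t) by rewrite nr_gt0.
  exists ((c' * (z - t) - (f z - f t)) / (z - t) ^+ 2) => e e0.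
  pose B := nr ((c' * (z - t) - (f z - f t)) / (z - t)).
  have B0 : 0 <= B by exact: nr_ge0.
  have [d d0 hd] := hc' (e * nr (z - t) / 4) ltac:(by rewrite divr_gt0 // mulr_gt0).
  exists (Num.min d (Num.min (nr (z - t) / 2) (e * nr (z - t) ^+ 2 / (4 * (B + 1))))).
    by rewrite !lt_min d0 !divr_gt0 ?mulr_gt0 ?exprn_gt0 // ltr_wpDl.
  move=> y; rewrite !lt_min => /and3P[/hd h1 h2 h3].
  have h4 : nr (z - t) / 2 <= nr (y - t).
    have := nr_sub (z - t) (z - y); have -> : z - t - (z - y) = y - t by ring.
    by rewrite (nrBC z y); move: h2; lra.
  have yt0 : y - t != 0 by rewrite -nr_gt0; apply: lt_le_trans h4; rewrite divr_gt0.
  have yt : y != t by rewrite -subr_eq0.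
  rewrite !gz //.
  have -> : (f y - f t) / (y - t) - (f z - f t) / (z - t)
      - (c' * (z - t) - (f z - f t)) / (z - t) ^+ 2 * (y - z) =
      ((f y - f z - c' * (y - z)) - (c' * (z - t) - (f z - f t)) / (z - t) * ((y - z) ^+ 2 / (z - t))) / (y - t).
    by field; rewrite yt0 zt0.
  rewrite nrM nrV ler_pdivrMr; last by rewrite nr_gt0.
  apply: le_trans (nrB _ _) _; rewrite nrM -/B nrM nrV nrX.
  have n1 := nr_ge0 (y - z).
  apply: le_trans (_ : e * nr (z - t) / 2 * nr (y - z) <= _); last first.
    by have := ler_wpM2l (mulr_ge0 (ltW e0) n1) h4; lra.
  have h5 : B * (nr (y - z) ^+ 2 / nr (z - t)) <= e * nr (z - t) / 4 * nr (y - z).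
    rewrite mulrA ler_pdivrMr // expr2 mulrA.
    have -> : e * nr (z - t) / 4 * nr (y - z) * nr (z - t) = e * nr (z - t) ^+ 2 / 4 * nr (y - z) by ring.
    rewrite ler_wpM2r //.
    move: h3; rewrite ltr_pdivlMr ?mulr_gt0 ?ltr_wpDl // => h3.
    have : 0 <= nr (y - z) by []; move: h3; lra.
  by move: h1 h5; lra.
have := loop_zero (ltW tr) gd gct tr.
have cf : circ (fun z => f (rc r * z)).
  apply: (circ_disc r0) => z hz; apply: cdiff_cont; apply: fd; by rewrite hz.
have ck := circ_kernel tr.
rewrite (mean_eq (v := fun z => (rc r)^-1 * (f (rc r * z) * (rc r * z / (rc r * z - t)) - f t * (rc r * z / (rc r * z - t))))); last first.
  move=> z hz; have nz := kernel_nz tr hz.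
  have r0' : rc r != 0 by rewrite -nr_gt0 nr_rc gtr0_norm.
  rewrite gz; last by rewrite -subr_eq0.
  move: (f _) (f t) (rc r * z - t) nz => A B k nz.
  by field; rewrite r0' nz.
rewrite meanZ; last by exact: (circB (circM cf ck) (circM (circ_cst _) ck)).
rewrite (meanB (circM cf ck) (circM (circ_cst _) ck)) (meanZ _ ck) mean_kernel // mulr1.
move=> /eqP; rewrite mulf_eq0 invr_eq0 subr_eq0 => /orP[|/eqP -> //].
by rewrite -nr_eq0 nr_rc gtr0_norm // gt_eqF.
Qed.

(** Cauchy's integral for the k-th Taylor coefficient at 0. *)
Definition tcoef k : C := mean (fun z => f (rc r * z) * z^* ^+ k) / rc r ^+ k.

(** The remainder is that of the geometric series of the kernel. On the half disc the kernel is at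
    most 2, whence the factor 2; a bound of [f] on the circle alone is used. *)
Theorem taylor_bound t K B : 0 < r -> (forall z, nr z = r -> nr (f z) <= B) -> nr t <= r / 2 ->
  nr (f t - \sum_(k < K) tcoef k * t ^+ k) <= 2 * B * (nr t / r) ^+ K.
Proof.
move=> r0 hB th; have tr : nr t < r by lra.
have cf : circ (fun z => f (rc r * z)).
  apply: (circ_disc r0) => z hz; apply: cdiff_cont; apply: fd; by rewrite hz.
have ck := circ_kernel tr.
have c1 k : circ (fun z : C => f (rc r * z) * ((t / rc r) ^+ k * z^* ^+ k)).
  exact: (circM cf (circM (circ_cst _) (circJX k))).
rewrite {1}(cauchy_formula tr).
rewrite (mean_eq (v := fun z => \sum_(k < K) f (rc r * z) * ((t / rc r) ^+ k * z^* ^+ k)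
   + f (rc r * z) * ((t / rc r) ^+ K * z^* ^+ K * (rc r * z / (rc r * z - t))))); last first.
  by move=> z hz; rewrite {1}(kernel_expand K tr hz) mulrDr mulr_sumr.
have cR : circ (fun z => f (rc r * z) * ((t / rc r) ^+ K * z^* ^+ K * (rc r * z / (rc r * z - t)))).
  exact: (circM cf (circM (circM (circ_cst _) (circJX K)) ck)).
rewrite (meanD (@circ_sum R _ _ _ (fun k : 'I_K => c1 k)) cR).
rewrite (mean_sum _ (F := fun (k : 'I_K) z => f (rc r * z) * ((t / rc r) ^+ k * z^* ^+ k))); last by move=> k; exact: c1.
rewrite (eq_bigr (fun k : 'I_K => tcoef k * t ^+ k)); last first.
  move=> k _; rewrite /tcoef.
  rewrite (mean_eq (v := fun z => (t / rc r) ^+ k * (f (rc r * z) * z^* ^+ k))); last by move=> z _; ring.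
  by rewrite (meanZ _ (circM cf (circJX k))) expr_div_n; ring.
rewrite addrAC subrr add0r; apply: mean_le => // z hz.
have hf : nr (f (rc r * z)) <= B by apply: hB; rewrite nrM hz mulr1 nr_rc gtr0_norm.
move: (rc r * z / (rc r * z - t)) (nr_kernel th r0 hz) => kz hk.
rewrite !nrM !nrX nrM nrJ hz expr1n mulr1 nrV nr_rc (gtr0_norm r0).
have B0 : 0 <= B by apply: le_trans hf; exact: nr_ge0.
have q0 : 0 <= (nr t / r) ^+ K by rewrite exprn_ge0 // divr_ge0 ?nr_ge0 // ltW.
have -> : 2 * B * (nr t / r) ^+ K = B * ((nr t / r) ^+ K * 2) by ring.
apply: ler_pM => //; first exact: nr_ge0.
  by rewrite mulr_ge0 // nr_ge0.
by rewrite ler_wpM2l.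
Qed.

End CauchyFormula.
End Cauchy.

(** * Several complex variables *)

Section Wirtinger.
Variables (R : realType) (n : nat).
Local Notation C := (Cplx R).
Local Notation V := 'rV[C]_n.+1.
Implicit Types (f g : V -> C) (x v A B : V) (h : V -> C).

Definition lito h := forall e, 0 < e -> exists2 d : R, 0 < d & forall v, nr v < d -> nr (h v) <= e * nr v.

Lemma litoD h h' : lito h -> lito h' -> lito (fun v => h v + h' v).
Proof.
move=> hh hh' e e0.
have [d d0 hd] := hh (e / 2) ltac:(by rewrite divr_gt0).
have [d' d0' hd'] := hh' (e / 2) ltac:(by rewrite divr_gt0).
exists (Num.min d d'); first by rewrite lt_min d0.
move=> v; rewrite lt_min => /andP[/hd h1 /hd' h2].
by apply: le_trans (nrD _ _) _; move: h1 h2; lra.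
Qed.
Lemma lito_bd h g (b d : R) : 0 < d -> (forall v, nr v < d -> nr (g v) <= b) -> lito h ->
  lito (fun v => g v * h v).
Proof.
move=> d0 hb hh e e0.
have b0 : 0 < `|b| + 1 by rewrite ltr_wpDl.
have [d' d0' hd'] := hh (e / (`|b| + 1)) ltac:(by rewrite divr_gt0).
exists (Num.min d d'); first by rewrite lt_min d0.
move=> v; rewrite lt_min => /andP[/hb h1 /hd' h2].
rewrite nrM; apply: le_trans (_ : (`|b| + 1) * (e / (`|b| + 1) * nr v) <= _).
  by apply: ler_pM; rewrite ?nr_ge0 // (le_trans h1) // (le_trans (ler_norm _)) // lerDl.
by rewrite mulrA [_ * (e / _)]mulrC divfK // gt_eqF.
Qed.
Lemma lito_small h g (c d : R) : 0 < d -> (forall v, nr v < d -> nr (h v) <= c * nr v) ->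
  (forall e, 0 < e -> exists2 d : R, 0 < d & forall v, nr v < d -> nr (g v) <= e) ->
  lito (fun v => g v * h v).
Proof.
move=> d0 hc hg e e0.
have c0 : 0 < `|c| + 1 by rewrite ltr_wpDl.
have [d' d0' hd'] := hg (e / (`|c| + 1)) ltac:(by rewrite divr_gt0).
exists (Num.min d d'); first by rewrite lt_min d0.
move=> v; rewrite lt_min => /andP[/hc h1 /hd' h2].
rewrite nrM; apply: le_trans (_ : e / (`|c| + 1) * ((`|c| + 1) * nr v) <= _).
  apply: ler_pM; rewrite ?nr_ge0 // (le_trans h1) // ler_wpM2r ?nr_ge0 //.
  by rewrite (le_trans (ler_norm _)) // lerDl.
by rewrite mulrA divfK // gt_eqF.
Qed.
Lemma litoZ h c : lito h -> lito (fun v => c * h v).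
Proof. by apply: (@lito_bd h (fun=> c) (nr c) 1). Qed.
Lemma lito_quad h (c d : R) : 0 < d -> (forall v, nr v < d -> nr (h v) <= c * nr v ^+ 2) -> lito h.
Proof.
move=> d0 hc e e0; have c0 : 0 < `|c| + 1 by rewrite ltr_wpDl.
exists (Num.min d (e / (`|c| + 1))); first by rewrite lt_min d0 divr_gt0.
move=> v; rewrite lt_min => /andP[/hc h1]; rewrite ltr_pdivlMr // => h2.
apply: le_trans h1 _; rewrite expr2 mulrA ler_wpM2r ?nr_ge0 // (le_trans _ (ltW h2)) // mulrC.
by rewrite ler_wpM2l ?nr_ge0 // (le_trans (ler_norm _)) // lerDl.
Qed.
Lemma lito_near h h' (d : R) : 0 < d -> (forall v, nr v < d -> h v = h' v) -> lito h -> lito h'.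
Proof.
move=> d0 hd hh e /hh[d' d0' hd']; exists (Num.min d d'); first by rewrite lt_min d0.
by move=> v; rewrite lt_min => /andP[/hd <- /hd'].
Qed.
Lemma lito_eq h h' : (forall v, h v = h' v) -> lito h -> lito h'.
Proof. by move=> e; apply: (@lito_near _ _ 1). Qed.
Lemma lito0 : lito (fun=> 0).
Proof. by move=> e e0; exists 1 => // v _; rewrite nr0 mulr_ge0 ?nr_ge0 // ltW. Qed.
Lemma lito_sum I (r : seq I) (H : I -> V -> C) : (forall i, lito (H i)) ->
  lito (fun v => \sum_(i <- r) H i v).
Proof.
move=> hH; elim: r => [|i r IH].
  by apply: lito_eq lito0 => v; rewrite big_nil.
by apply: lito_eq (litoD (hH i) IH) => v; rewrite big_cons.
Qed.
Lemma litoJ h : lito h -> lito (fun v => (h v)^*).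
Proof. by move=> hh e /hh[d d0 hd]; exists d => // v /hd; rewrite nrJ. Qed.

(* [wform A B] is the real-linear form with Wirtinger coefficients [A], [B];
   [wd f x A B] says that it is the differential of [f] at [x], so that [vdiff]
   is complex differentiability. *)
Definition wform A B v : C := \sum_j (A 0 j * v 0 j + B 0 j * (v 0 j)^*).
Definition wform_norm A B : R := \sum_j (nr (A 0 j) + nr (B 0 j)).
Definition wd f x A B := lito (fun v => f (x + v) - f x - wform A B v).
Definition vdiff f x := exists A, wd f x A 0.

Lemma wform_norm_ge0 A B : 0 <= wform_norm A B.
Proof. by apply: sumr_ge0 => j _; rewrite addr_ge0 ?nr_ge0. Qed.
Lemma wform_le A B v : nr (wform A B v) <= wform_norm A B * nr v.
Proof.
apply: le_trans (nr_sum _ _ _) _; rewrite /wform_norm mulr_suml; apply: ler_sum => j _.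
apply: le_trans (nrD _ _) _; rewrite !nrM nrJ mulrDl lerD // ler_wpM2l ?nr_ge0 ?nr_coord //.
Qed.
Lemma wlD A B v v' : wform A B (v + v') = wform A B v + wform A B v'.
Proof. by rewrite -big_split; apply: eq_bigr => j _; rewrite mxE cjD /=; ring. Qed.
Lemma wlB A B v v' : wform A B (v - v') = wform A B v - wform A B v'.
Proof. by rewrite -sumrB; apply: eq_bigr => j _; rewrite !mxE cjB /=; ring. Qed.
Lemma wform_lin A A' B B' c c' v :
  c * wform A B v + c' * wform A' B' v = wform (c *: A + c' *: A') (c *: B + c' *: B') v.
Proof. by rewrite !mulr_sumr -big_split; apply: eq_bigr => j _; rewrite !mxE /=; ring. Qed.
Lemma wlZ A B s v : wform A B (s *: v) = s * wform A 0 v + s^* * wform 0 B v.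
Proof. by rewrite !mulr_sumr -big_split; apply: eq_bigr => j _; rewrite !mxE cjM /=; ring. Qed.
Lemma wl00 v : wform 0 0 v = 0.
Proof. by rewrite /wform big1 // => j _; rewrite !mxE !mul0r addr0. Qed.
Lemma wform_delta A B j : wform A B (delta_mx 0 j) = A 0 j + B 0 j.
Proof.
rewrite /wform (bigD1 j) //= big1 => [|k kj]; first by rewrite mxE !eqxx cj1 !mulr1 addr0.
by rewrite mxE eqxx (negbTE kj) cj0 !mulr0 addr0.
Qed.

Lemma wd_ctn f x A B : wd f x A B -> ctn f x.
Proof.
move=> hf e e0; have [d d0 hd] := hf 1 ltr01.
have c0 : 0 < 1 + wform_norm A B by rewrite ltr_pwDl // wform_norm_ge0.
exists (Num.min d (e / (1 + wform_norm A B))); first by rewrite lt_min d0 divr_gt0.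
move=> y; rewrite lt_min => /andP[/hd h1]; rewrite ltr_pdivlMr // => h2.
rewrite (addrC x) subrK in h1.
rewrite -(subrK (wform A B (y - x)) (f y - f x)); apply: le_lt_trans (nrD _ _) _.
by apply: le_lt_trans h2; have := wform_le A B (y - x); move: h1; lra.
Qed.
Lemma vdiff_ctn f x : vdiff f x -> ctn f x. Proof. by move=> [A /wd_ctn]. Qed.

Lemma wd_lip f x A B : wd f x A B -> exists2 d : R, 0 < d &
  forall v, nr v < d -> nr (f (x + v) - f x) <= (1 + wform_norm A B) * nr v.
Proof.
move=> /(_ 1 ltr01)[d d0 hd]; exists d => // v /hd h.
rewrite -(subrK (wform A B v) (f _ - f x)); apply: le_trans (nrD _ _) _.
by have := wform_le A B v; move: h; lra.
Qed.

(** A real-linear form that is o(|v|) vanishes by homogeneity. Its values at a basis vector and at i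
    times that vector then separate the two Wirtinger coefficients. *)
Lemma wd_uniq f x A B A' B' : wd f x A B -> wd f x A' B' -> A = A' /\ B = B'.
Proof.
move=> h h'.
have hl : lito (fun v => wform (A - A') (B - B') v).
  apply: lito_eq (litoD h' (litoZ (-1) h)) => v.
  have -> : wform (A - A') (B - B') v = wform (1 *: A + (-1) *: A') (1 *: B + (-1) *: B') v.
    by rewrite !scale1r !scaleN1r.
  by rewrite -wform_lin; ring.
have z v : wform (A - A') (B - B') v = 0.
  apply/eqP; rewrite -nr_eq0 eq_le nr_ge0 andbT; apply/ler_addgt0Pl => e e0; rewrite addr0.
  have v0 : 0 < nr v + 1 by rewrite ltr_wpDl // nr_ge0.
  have [d d0 hd] := hl (e / (nr v + 1)) ltac:(by rewrite divr_gt0).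
  pose s := d / 2 / (nr v + 1).
  have s0 : 0 < s by rewrite !divr_gt0.
  have sv : s * nr v < d.
    rewrite /s mulrAC ltr_pdivrMr //; have := nr_ge0 v => nv0.
    by have := mulr_ge0 (ltW d0) nv0; lra.
  have := hd (rc s *: v); rewrite nrZ nr_rc gtr0_norm // => /(_ sv).
  rewrite wlZ rcJ -mulrDr nrM nr_rc gtr0_norm // mulrCA ler_pM2l // => h1.
  have -> : wform (A - A') (B - B') v = wform (A - A') 0 v + wform 0 (B - B') v.
    by rewrite -[v in LHS]scale1r wlZ cj1 !mul1r.
  apply: le_trans h1 _; rewrite mulrAC ler_pdivrMr // ler_pM2l // lerDl //.
have e1 j : (A - A') 0 j + (B - B') 0 j = 0 by rewrite -(wform_delta _ _ j) z.
have e2 j : (A - A') 0 j - (B - B') 0 j = 0.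
  have := z ('i%R *: delta_mx 0 j); rewrite wlZ cj_i !wform_delta !mxE => h0; have : 'i%R * ((A 0 j - A' 0 j) - (B 0 j - B' 0 j)) = 0 by rewrite -[RHS]h0; ring.
  by move=> /eqP; rewrite mulf_eq0 (negbTE (neq0Ci _)) /= => /eqP.
split; apply/rowP => j; move: (e1 j) (e2 j); rewrite !mxE => h1 h2.
  by have /eqP : 2 * (A 0 j - A' 0 j) = 0;
    [rewrite -[RHS]addr0 -{1}h1 -h2; ring|rewrite mulf_eq0 pnatr_eq0 /= subr_eq0 => /eqP].
by have /eqP : 2 * (B 0 j - B' 0 j) = 0;
    [rewrite -[RHS]subr0 -{1}h1 -h2; ring|rewrite mulf_eq0 pnatr_eq0 /= subr_eq0 => /eqP].
Qed.

Lemma wd_near f g x A B : (exists2 d : R, 0 < d & forall y, nr (y - x) < d -> f y = g y) ->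
  wd f x A B -> wd g x A B.
Proof.
move=> [d d0 hd]; apply: (lito_near d0) => v hv.
by rewrite -!hd ?subrr ?nr0 // addrAC subrr add0r.
Qed.
Lemma wd_cst c x : wd (fun=> c) x 0 0.
Proof.
apply: lito_eq lito0 => v.
by rewrite subrr sub0r /wform big1 ?oppr0 // => j _; rewrite !mxE !mul0r addr0.
Qed.
Lemma wdD f g x A B A' B' : wd f x A B -> wd g x A' B' ->
  wd (fun y => f y + g y) x (A + A') (B + B').
Proof.
move=> h h'; apply: lito_eq (litoD h h') => v.
by rewrite -[A in RHS]scale1r -[A' in RHS]scale1r -[B in RHS]scale1r -[B' in RHS]scale1r -wform_lin; ring.
Qed.
Lemma wdM f g x A B A' B' : wd f x A B -> wd g x A' B' ->
  wd (fun y => f y * g y) x (g x *: A + f x *: A') (g x *: B + f x *: B').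
Proof.
move=> h h'; have [d d0 hd] := wd_lip h.
have fb v : nr v < Num.min d 1 -> nr (f (x + v)) <= nr (f x) + (1 + wform_norm A B).
  rewrite lt_min => /andP[/hd h1 v1]; rewrite -(subrK (f x) (f (x + v))) addrC (le_trans (nrD _ _)) // lerD2l.
  by apply: le_trans h1 _; rewrite ler_piMr ?addr_ge0 ?wform_norm_ge0 // ltW.
have p1 : 0 < Num.min d 1 by rewrite lt_min d0 ltr01.
have l1 := lito_bd p1 fb h'.
have l2 : lito (fun v => wform A' B' v * (f (x + v) - f x)).
  apply: (lito_small d0 hd) => e e0.
  have w0 : 0 < wform_norm A' B' + 1 by rewrite ltr_wpDl // wform_norm_ge0.
  exists (e / (wform_norm A' B' + 1)); first by rewrite divr_gt0.
  move=> v; rewrite ltr_pdivlMr // => hv; apply: le_trans (wform_le _ _ _) _.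
  by have := nr_ge0 v; move: hv; lra.
apply: lito_eq (litoD (litoD l1 l2) (litoZ (g x) h)) => v.
by rewrite -wform_lin; ring.
Qed.

(** The one-variable counterpart of [wd]. It lets conjugation, inversion and the logarithm enter
    through the single chain rule [wd_outer]. *)
Definition wd1 (k : C -> C) (c p q : C) := forall e, 0 < e -> exists2 d : R, 0 < d &
  forall s, nr s < d -> nr (k (c + s) - k c - (p * s + q * s^*)) <= e * nr s.

Lemma wd_outer k f x A B p q : wd f x A B -> wd1 k (f x) p q ->
  wd (fun y => k (f y)) x (p *: A + q *: map_mx Num.conj B) (p *: B + q *: map_mx Num.conj A).
Proof.
move=> h hk; have [d d0 hd] := wd_lip h.
have c0 : 0 < 1 + wform_norm A B by rewrite ltr_pwDl // wform_norm_ge0.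
have l1 : lito (fun v => k (f (x + v)) - k (f x) - (p * (f (x + v) - f x) + q * (f (x + v) - f x)^*)).
  move=> e e0; have [d' d0' hd'] := hk (e / (1 + wform_norm A B)) ltac:(by rewrite divr_gt0).
  exists (Num.min d (d' / (1 + wform_norm A B))); first by rewrite lt_min d0 divr_gt0.
  move=> v; rewrite lt_min => /andP[/hd h1]; rewrite ltr_pdivlMr // => h2.
  have /hd' : nr (f (x + v) - f x) < d' by apply: le_lt_trans h1 _; rewrite mulrC.
  rewrite [f x + _]addrC subrK => /le_trans; apply.
  by rewrite mulrAC ler_pdivrMr // -mulrA ler_pM2l // mulrC.
apply: lito_eq (litoD l1 (litoD (litoZ p h) (litoZ q (litoJ h)))) => v.
have -> : wform (p *: A + q *: map_mx Num.conj B) (p *: B + q *: map_mx Num.conj A) v =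
   p * wform A B v + q * (wform A B v)^*.
  rewrite -wform_lin; congr (_ + q * _); rewrite /wform cj_sum; apply: eq_bigr => j _.
  by rewrite !mxE cjD !cjM cjK addrC.
by rewrite !cjB; ring.
Qed.

Lemma wdJ f x A B : wd f x A B -> wd (fun y => (f y)^*) x (map_mx Num.conj B) (map_mx Num.conj A).
Proof.
move=> h; have := @wd_outer (fun z => z^*) f x A B 0 1 h.
rewrite !scale0r !add0r !scale1r; apply=> e e0; exists 1 => // s _.
rewrite cjD; have -> : (f x)^* + s^* - (f x)^* - (0 * s + 1 * s^*) = 0 by ring.
by rewrite nr0 mulr_ge0 ?nr_ge0 // ltW.
Qed.

Lemma wd1_inv (c : C) : c != 0 -> wd1 (fun z => z^-1) c (- c^-1 ^+ 2) 0.
Proof.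
move=> c0 e e0; have n0 : 0 < nr c by rewrite nr_gt0.
exists (Num.min (nr c / 2) (e * nr c ^+ 3 / 2)).
  by rewrite lt_min !divr_gt0 // mulr_gt0 // exprn_gt0.
move=> s; rewrite lt_min => /andP[h1 h2].
have h3 : nr c / 2 <= nr (c + s).
  by have := nr_sub c (- s); rewrite opprK nrN; move: h1; lra.
have cs0 : c + s != 0 by rewrite -nr_gt0; apply: lt_le_trans h3; rewrite divr_gt0.
have -> : (c + s)^-1 - c^-1 - (- c^-1 ^+ 2 * s + 0 * s^*) = s * (s / (c ^+ 2 * (c + s))).
  by field; rewrite cs0 c0.
rewrite nrM mulrC ler_wpM2r ?nr_ge0 // nrM nrV nrM nrX ler_pdivrMr; last first.
  by rewrite mulr_gt0 ?exprn_gt0 // nr_gt0.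
apply: le_trans (ltW h2) _.
have := ler_wpM2l (mulr_ge0 (ltW e0) (exprn_ge0 2 (ltW n0))) h3.
by rewrite exprS; lra.
Qed.

Lemma wdV f x A B : f x != 0 -> wd f x A B ->
  wd (fun y => (f y)^-1) x (- (f x)^-1 ^+ 2 *: A) (- (f x)^-1 ^+ 2 *: B).
Proof.
by move=> h0 h; have := wd_outer h (wd1_inv h0); rewrite !scale0r !addr0.
Qed.

(** The inner map is holomorphic, so the two types of Wirtinger coefficients do not mix: one pulls
    back by the gradients, the other by their conjugates. *)
Lemma wd_comp f (X : V -> V) x A B (J : 'I_n.+1 -> V) :
  wd f (X x) A B -> (forall j, wd (fun y => X y 0 j) x (J j) 0) ->
  wd (fun y => f (X y)) x (\sum_j A 0 j *: J j) (\sum_j B 0 j *: map_mx Num.conj (J j)).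
Proof.
move=> h hX.
have [d d0 hd] : exists2 d : R, 0 < d & forall j v, nr v < d ->
    nr (X (x + v) 0 j - X x 0 j) <= (1 + wform_norm (J j) 0) * nr v.
  have /choice[F hF] : forall j, exists r : R, 0 < r /\ forall v, nr v < r ->
     nr (X (x + v) 0 j - X x 0 j) <= (1 + wform_norm (J j) 0) * nr v.
    by move=> j; have [d d0 hd] := wd_lip (hX j); exists d.
  exists (\big[Num.min/1]_j F j).
    by elim/big_ind: _ => // [a b a0 b0|j _]; [rewrite lt_min a0|case: (hF j)].
  move=> j v hv; apply: (hF j).2; apply: lt_le_trans hv _.
  by apply: bigmin_le_cond.
pose K := \sum_j (1 + wform_norm (J j) 0).
have K0 : 0 < K.
  rewrite /K (bigD1 ord0) //= ltr_pwDl //; first by rewrite ltr_pwDl // wform_norm_ge0.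
  by apply: sumr_ge0 => j _; rewrite addr_ge0 // wform_norm_ge0.
have hK v : nr v < d -> nr (X (x + v) - X x) <= K * nr v.
  move=> hv; apply: nr_rV; first by rewrite mulr_ge0 ?nr_ge0 // ltW.
  move=> j; rewrite !mxE; apply: le_trans (hd j v hv) _; rewrite ler_wpM2r ?nr_ge0 //.
  rewrite /K (bigD1 j) //= lerDl; apply: sumr_ge0 => k _; rewrite addr_ge0 // wform_norm_ge0 //.
have l1 : lito (fun v => f (X (x + v)) - f (X x) - wform A B (X (x + v) - X x)).
  move=> e e0; have [d' d0' hd'] := h (e / K) ltac:(by rewrite divr_gt0).
  exists (Num.min d (d' / K)); first by rewrite lt_min d0 divr_gt0.
  move=> v; rewrite lt_min => /andP[/hK h1]; rewrite ltr_pdivlMr // => h2.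
  have /hd' : nr (X (x + v) - X x) < d' by apply: le_lt_trans h1 _; rewrite mulrC.
  rewrite [X x + _]addrC subrK => /le_trans; apply.
  by rewrite mulrAC ler_pdivrMr // -mulrA ler_pM2l // mulrC.
have l2 j := litoD (litoZ (A 0 j) (hX j)) (litoZ (B 0 j) (litoJ (hX j))).
apply: lito_eq (litoD l1 (lito_sum (index_enum 'I_n.+1) l2)) => v.
have -> : wform (\sum_j A 0 j *: J j) (\sum_j B 0 j *: map_mx Num.conj (J j)) v =
   \sum_j (A 0 j * wform (J j) 0 v + B 0 j * (wform (J j) 0 v)^*).
  rewrite /wform big_split /=.
  under [X in _ = X]eq_bigr => j _ do rewrite mulr_sumr cj_sum mulr_sumr -big_split /=.
  rewrite [RHS]exchange_big /= -big_split; apply: eq_bigr => k _ /=.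
  rewrite !summxE !mulr_suml -big_split; apply: eq_bigr => j _ /=.
  by rewrite !mxE cjD !cjM cj0; ring.
set S := \sum_(i <- _) _; set S' := \sum_j _.
suff -> : S = wform A B (X (x + v) - X x) - S' by ring.
rewrite /S /S' [wform A B _]/wform -sumrB; apply: eq_bigr => j _.
rewrite !mxE !cjB; move: (wform (J j) 0 v) => w; ring.
Qed.

Lemma wd_coord j x : wd (fun y => y 0 j) x (delta_mx 0 j) 0.
Proof.
apply: lito_eq lito0 => v; rewrite !mxE /wform (bigD1 j) //= big1.
  rewrite !mxE !eqxx; move: (x 0 j) (v 0 j) => p q; by rewrite mul1r mul0r; ring.
by move=> k kj; rewrite !mxE eqxx (negbTE kj) /= !mul0r addr0.
Qed.

Lemma vdiff_near f g x : (exists2 d : R, 0 < d & forall y, nr (y - x) < d -> f y = g y) ->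
  vdiff f x -> vdiff g x.
Proof. by move=> h [A hA]; exists A; apply: wd_near hA. Qed.
Lemma vdiff_cst c x : vdiff (fun=> c) x. Proof. by exists 0; apply: wd_cst. Qed.
Lemma vdiffD f g x : vdiff f x -> vdiff g x -> vdiff (fun y => f y + g y) x.
Proof. by move=> [A h] [A' h']; exists (A + A'); have := wdD h h'; rewrite addr0. Qed.
Lemma vdiffM f g x : vdiff f x -> vdiff g x -> vdiff (fun y => f y * g y) x.
Proof. by move=> [A h] [A' h']; eexists; have := wdM h h'; rewrite !scaler0 addr0; apply. Qed.
Lemma vdiffV f x : f x != 0 -> vdiff f x -> vdiff (fun y => (f y)^-1) x.
Proof. by move=> h0 [A h]; eexists; have := wdV h0 h; rewrite scaler0; apply. Qed.
Lemma vdiff_comp f (X : V -> V) x : vdiff f (X x) -> (forall j, vdiff (fun y => X y 0 j) x) ->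
  vdiff (fun y => f (X y)) x.
Proof.
move=> [A hA] /choice[J hJ]; eexists; have := wd_comp hA hJ.
by rewrite (_ : \sum_j (0 : V) 0 j *: _ = 0); [apply|apply: big1 => j _; rewrite mxE scale0r].
Qed.
Lemma vdiff_coord j x : vdiff (fun y => y 0 j) x.
Proof. by eexists; exact: wd_coord. Qed.
Lemma vdiffX f k x : vdiff f x -> vdiff (fun y => f y ^+ k) x.
Proof.
move=> hf; elim: k => [|k IH]; first exact: vdiff_cst.
have -> : (fun y => f y ^+ k.+1) = (fun y => f y * f y ^+ k) by apply/funext => y; rewrite exprS.
exact: vdiffM.
Qed.

Lemma wd_line f x A B v : wd f x A B -> forall e, 0 < e -> exists2 d : R, 0 < d &
  forall t : C, nr t < d -> nr (f (x + t *: v) - f x - wform A B (t *: v)) <= e * nr t.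
Proof.
move=> h e e0; have v0 : 0 < nr v + 1 by rewrite ltr_wpDl // nr_ge0.
have [d d0 hd] := h (e / (nr v + 1)) ltac:(by rewrite divr_gt0).
exists (d / (nr v + 1)); first by rewrite divr_gt0.
move=> t; rewrite ltr_pdivlMr // => ht.
have tv : nr (t *: v) <= nr t * (nr v + 1) by rewrite nrZ ler_wpM2l ?nr_ge0 // lerDl.
apply: le_trans (hd _ (le_lt_trans tv ht)) _.
apply: le_trans (ler_wpM2l _ tv) _; first by rewrite divr_ge0 // ltW.
by rewrite mulrCA divfK ?gt_eqF // mulrC.
Qed.

Lemma vdiff_cdiff f x v (t : C) : vdiff f (x + t *: v) -> cdiff (fun t => f (x + t *: v)) t.
Proof.
move=> [A h]; exists (wform A 0 v) => e e0; have [d d0 hd] := wd_line v h e0.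
exists d => // y /hd; rewrite -(addrA x) -(scalerDl v) (addrC t) subrK.
by rewrite wlZ wl00 mulr0 addr0 [wform A 0 v * _]mulrC.
Qed.

Lemma vdiff_ext f g x : (forall y, f y = g y) -> vdiff f x -> vdiff g x.
Proof. by move=> h; apply: vdiff_near; exists 1. Qed.

Lemma diff_wd (f : V -> C) x : differentiable f x -> wd f x (\row_j ('d f x (delta_mx 0 j) : C)) 0.
Proof.
move=> /diff_locallyP[_ /eqaddoP hf] e e0.
have /near_nr[d d0 hd] := hf (rc e) ltac:(by rewrite -rc0 rc_lt).
exists d => // v hv; have := hd v; rewrite subr0 => /(_ hv).
rewrite !fctE /= !nrE -rcM rc_le (addrC v) opprD addrA; congr (nr (_ - _) <= _).
rewrite {1}[v]row_sum_delta linear_sum /=; apply: eq_bigr => j _.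
by rewrite linearZ /= !mxE mul0r addr0 mulrC.
Qed.
End Wirtinger.

(** * Holomorphic functions of several variables through their restrictions to complex lines *)

Section SeveralVariables.
Variables (R : realType) (n : nat).
Local Notation C := (Cplx R).
Local Notation V := 'rV[C]_n.+1.
Implicit Types (f g : V -> C) (x v A B : V) (U : set V).

Definition vopen U := forall x, U x -> exists2 r : R, 0 < r & forall y, nr (y - x) < r -> U y.
Definition hol U f := forall x, U x -> vdiff f x.
Definition grad f x : V := xget 0 [set A | wd f x A 0].

Lemma gradP f x : vdiff f x -> wd f x (grad f x) 0.
Proof. by move=> [A hA]; rewrite /grad; case: xgetP => [a -> //|/(_ A)]. Qed.
Lemma gradE f x A : wd f x A 0 -> grad f x = A.
Proof. by move=> h; have [] := wd_uniq (gradP (ex_intro _ A h)) h. Qed.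

(** Second-order Taylor estimate with constants independent of the base point: [taylor_bound] with
    two terms on the complex line through [x] in the direction [v], evaluated at parameter 1. It
    stands in for bounds on second derivatives in what follows. *)
Lemma hol_quad U f x0 : vopen U -> hol U f -> U x0 -> exists2 r : R, 0 < r &
  exists2 c : R, 0 <= c & forall x v, nr (x - x0) < r -> nr v < r ->
    U (x + v) /\ nr (f (x + v) - f x - wform (grad f x) 0 v) <= c * nr v ^+ 2.
Proof.
move=> oU hf Ux0; have [r1 r10 hr1] := oU _ Ux0.
have [r2 r20 hr2] := vdiff_ctn (hf _ Ux0) ltr01.
pose r := Num.min r1 r2; have r0 : 0 < r by rewrite lt_min r10.
have Ur x : nr (x - x0) < r -> U x by rewrite lt_min => /andP[/hr1].
pose B := nr (f x0) + 1.
have Br x : nr (x - x0) < r -> nr (f x) <= B.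
  rewrite lt_min => /andP[_ /hr2 h]; rewrite -(subrK (f x0) (f x)) (le_trans (nrD _ _)) //.
  by rewrite addrC lerD2l ltW.
exists (r / 8); first by rewrite divr_gt0.
exists (2 * B * (8 / r) ^+ 2).
  have B0 : 0 <= B by rewrite addr_ge0 // nr_ge0.
  by apply: mulr_ge0 (sqr_ge0 _); apply: mulr_ge0 B0.
move=> x v hx hv.
have hxv : nr (x + v - x0) < r.
  have -> : x + v - x0 = (x - x0) + v by rewrite addrAC.
  by apply: le_lt_trans (nrD _ _) _; move: hx hv; lra.
split; first exact: Ur.
have [->|v0] := eqVneq v 0.
  rewrite addr0 subrr add0r /wform big1 ?oppr0 ?nr0; last by move=> j _; rewrite !mxE cj0 !mulr0 addr0.
  by rewrite expr0n mulr0.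
have nv : 0 < nr v by rewrite nr_gt0.
(* The disc of radius [p] on the line has extent [r / 4] in space, and the parameter 1 falls into
   its half disc since [nr v < r / 8]. *)
pose p := r / 4 / nr v; have p0 : 0 < p by rewrite !divr_gt0.
have pv : p * nr v = r / 4 by rewrite /p divfK // gt_eqF.
have hball t : nr t <= p -> nr (x + t *: v - x0) < r.
  move=> ht; have -> : x + t *: v - x0 = (x - x0) + t *: v by rewrite addrAC.
  apply: le_lt_trans (nrD _ _) _; rewrite nrZ.
  by have := ler_wpM2r (ltW nv) ht; rewrite pv; move: hx; lra.
pose F (t : C) := f (x + t *: v).
have Fd t : nr t <= p -> cdiff F t by move=> ht; apply: vdiff_cdiff; apply/hf/Ur/hball.
have FB t : nr t = p -> nr (F t) <= B by move=> ht; apply/Br/hball; rewrite ht.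
have p2 : 1 <= p / 2 by rewrite /p; rewrite ler_pdivlMr // mul1r ler_pdivlMr //; move: hv; lra.
have c0 : tcoef F p 0 = f x.
  have := taylor_bound Fd 1 p0 FB (t := 0); rewrite nr0 mul0r expr1 mulr0 => /(_ ltac:(lra)).
  rewrite big_ord_recl big_ord0 expr0 mulr1 addr0 {1}/F scale0r addr0 => h.
  by apply/esym/eqP; rewrite -subr_eq0 -nr_eq0 eq_le nr_ge0 h.
have Q t : nr t <= p / 2 -> nr (F t - f x - tcoef F p 1 * t) <= 2 * B * (nr t / p) ^+ 2.
  move=> ht; have := taylor_bound Fd 2 p0 FB ht.
  by rewrite !big_ord_recl big_ord0 /= c0 expr0 expr1 mulr1 addr0 opprD addrA.
have xx : nr (x - x0) < r by move: hx; lra.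
have c1 : tcoef F p 1 = wform (grad f x) 0 v.
  apply/eqP; rewrite -subr_eq0 -nr_eq0 eq_le nr_ge0 andbT; apply/ler_addgt0Pl => e e0; rewrite addr0.
  have [d d0 hd] := wd_line v (gradP (hf _ (Ur _ xx))) (e := e / 2) ltac:(by rewrite divr_gt0).
  have B0 : 0 < 2 * B / p ^+ 2 + 1.
    have B0 : 0 <= B by rewrite addr_ge0 // nr_ge0.
    by rewrite ltr_wpDl //; apply: mulr_ge0; [apply: mulr_ge0 B0|rewrite invr_ge0 sqr_ge0].
  pose s := Num.min (Num.min (d / 2) (p / 2)) (e / 2 / (2 * B / p ^+ 2 + 1)).
  have s0 : 0 < s by rewrite !lt_min !divr_gt0.
  have s1 : s <= d / 2 by rewrite !ge_min lexx.
  have s2 : s <= p / 2 by rewrite !ge_min lexx orbT.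
  have s3 : s * (2 * B / p ^+ 2 + 1) <= e / 2 by rewrite -ler_pdivlMr // ge_min lexx orbT.
  have ns : nr (rc s) = s by rewrite nr_rc gtr0_norm.
  have := hd (rc s) ltac:(rewrite ns; lra); have := Q (rc s) ltac:(by rewrite ns).
  rewrite ns wlZ (_ : wform 0 0 v = 0) ?wl00 // mulr0 addr0 -/(F (rc s)) => h1 h2.
  have : nr (rc s * (tcoef F p 1 - wform (grad f x) 0 v)) <= e * s.
    have -> : rc s * (tcoef F p 1 - wform (grad f x) 0 v) =
       (F (rc s) - f x - rc s * wform (grad f x) 0 v) - (F (rc s) - f x - tcoef F p 1 * rc s) by ring.
    apply: le_trans (nrB _ _) _; apply: le_trans (lerD h2 h1) _.
    have : 2 * B * (s / p) ^+ 2 <= e / 2 * s; last by lra.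
    rewrite expr_div_n mulrA mulrAC [s ^+ 2]expr2 mulrA ler_pM2r // mulrC.
    by apply: le_trans s3; rewrite ler_pM2l // lerDl.
  by rewrite nrM ns mulrC ler_pM2r.
have := Q 1 ltac:(by rewrite nr1); rewrite nr1 /F scale1r mulr1 c1 => /le_trans; apply.
rewrite -[2 * B * _ * _]mulrA -exprMn; apply: ler_wpM2l; first by rewrite mulr_ge0 ?addr_ge0 ?nr_ge0.
have q : 1 / p = 4 / r * nr v by rewrite /p; field; rewrite !gt_eqF.
rewrite q !exprMn ler_pM2r ?exprn_gt0 //; have : 0 < r^-1 ^+ 2 by rewrite exprn_gt0 // invr_gt0.
lra.
Qed.

(** The partial derivative is a difference quotient with a fixed step [h] up to an error [c * h]
    uniform in the base point, and difference quotients with a fixed step are continuous. *)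
Lemma grad_ctn U f x0 j : vopen U -> hol U f -> U x0 -> ctn (fun x => grad f x 0 j) x0.
Proof.
move=> oU hf Ux0 e e0; have [r r0 [c c0 hq]] := hol_quad oU hf Ux0.
pose h := Num.min (r / 2) (e / (8 * (c + 1))).
have c1 : 0 < 8 * (c + 1) by lra.
have h0 : 0 < h by rewrite lt_min !divr_gt0.
have hr : h <= r / 2 by rewrite ge_min lexx.
have he : h * (8 * (c + 1)) <= e by rewrite -ler_pdivlMr // ge_min lexx orbT.
pose w : V := rc h *: delta_mx 0 j.
have nw : nr w = h by rewrite nrZ nr_delta mulr1 nr_rc gtr0_norm.
have wlw x : wform (grad f x) 0 w = rc h * grad f x 0 j.
  by rewrite wlZ wform_delta wl00 mulr0 addr0 mxE addr0.
have eh : 0 < e * h / 8 by rewrite divr_gt0 // mulr_gt0.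
have hw : nr w < r by rewrite nw; lra.
have [|Uxw _] := hq x0 w _ hw; first by rewrite subrr nr0.
have [d d0 hd] := vdiff_ctn (hf _ Uxw) eh.
have [d' d0' hd'] := vdiff_ctn (hf _ Ux0) eh.
exists (Num.min r (Num.min d d')); first by rewrite !lt_min r0 d0.
move=> y; rewrite !lt_min => /and3P[yr yd yd'].
have [_ h1] := hq y w yr hw; have [|_ h2] := hq x0 w _ hw; first by rewrite subrr nr0.
rewrite !wlw nw in h1 h2.
have h3 : nr (f (y + w) - f (x0 + w)) < e * h / 8.
  by apply: hd; rewrite opprD addrACA subrr addr0.
have h4 := hd' _ yd'.
have : nr (rc h * (grad f y 0 j - grad f x0 0 j)) < e * h.
  have -> : rc h * (grad f y 0 j - grad f x0 0 j) =
    (f (y + w) - f (x0 + w)) - (f y - f x0) - (f (y + w) - f y - rc h * grad f y 0 j)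
      + (f (x0 + w) - f x0 - rc h * grad f x0 0 j) by ring.
  apply: le_lt_trans (nrD _ _) _; apply: le_lt_trans (lerD (nrB _ _) (lexx _)) _.
  apply: le_lt_trans (lerD (lerD (nrB _ _) (lexx _)) (lexx _)) _.
  have : c * h ^+ 2 <= e * h / 8; last by move: h1 h2 h3 h4; lra.
  by rewrite expr2; have := ler_wpM2r (ltW h0) he; have := mulr_gt0 h0 h0; lra.
by rewrite nrM nr_rc gtr0_norm // mulrC ltr_pM2r.
Qed.

(** Differentiation under the mean: the quadratic remainder of [hol_quad] is uniform over the
    circle. The weight [chi] makes room for the powers of the conjugate in Cauchy's integrals. *)
Lemma hol_mean U f x0 : vopen U -> hol U f -> U x0 -> exists2 r : R, 0 < r &
  forall (u : V) (chi : C -> C), nr u < r -> circ chi ->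
   (forall x, nr (x - x0) < r -> circ (fun z => f (x + z *: u) * chi z)) /\
   forall x, nr (x - x0) < r -> vdiff (fun x => mean (fun z => f (x + z *: u) * chi z)) x.
Proof.
move=> oU hf Ux0; have [r r0 [c c0 hq]] := hol_quad oU hf Ux0.
have Ur x : nr (x - x0) < r -> U x.
  by move=> hx; have [|] := hq x 0 hx; rewrite ?nr0 // addr0.
exists (r / 4); first by rewrite divr_gt0.
move=> u chi hu hchi.
have hin x z : nr (x - x0) < r / 2 -> nr z = 1 -> nr (x + z *: u - x0) < r.
  move=> hx hz; have -> : x + z *: u - x0 = (x - x0) + z *: u by rewrite addrAC.
  by apply: le_lt_trans (nrD _ _) _; rewrite nrZ hz mul1r; lra.
have ci (g : V -> C) x : (forall y, nr (y - x0) < r -> ctn g y) -> nr (x - x0) < r / 2 ->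
    circ (fun z => g (x + z *: u) * chi z).
  move=> gc hx z hz; apply: (contM _ (hchi z hz)).
  exact: (ctn_comp (@cont_line _ _ x u z) (gc _ (hin x z hx hz))).
have fc y : nr (y - x0) < r -> ctn f y by move=> /Ur/hf/vdiff_ctn.
have gc j y : nr (y - x0) < r -> ctn (fun x => grad f x 0 j) y.
  by move=> /Ur; apply: grad_ctn.
split=> [x hx|x hx]; first by apply: (ci f x fc); lra.
have [B B0 hB] : exists2 B : R, 0 <= B & forall z, nr z = 1 -> nr (chi z) <= B.
  have hc z : [set z : C | nr z <= 1] z -> exists2 d : R, 0 < d & forall y, nr (y - z) < d ->
      (nr y = 1 -> nr (chi y) <= d^-1).
    move=> hz; have [z1|z1] := eqVneq (nr z) 1.
      have [d d0 hd] := hchi z z1 1 ltr01.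
      have c10 : 0 < nr (chi z) + 1 by rewrite ltr_wpDl // nr_ge0.
      exists (Num.min d (nr (chi z) + 1)^-1); first by rewrite lt_min d0 invr_gt0.
      move=> y; rewrite lt_min => /andP[/hd h _] _.
      apply: le_trans (_ : nr (chi z) + 1 <= _).
        by rewrite -(subrK (chi z) (chi y)) (le_trans (nrD _ _)) // addrC lerD2l ltW.
      rewrite -[leLHS]invrK lef_pV2 ?posrE ?lt_min ?d0 ?invr_gt0 //.
      by rewrite ge_min lexx orbT.
    have d0 : 0 < 1 - nr z by rewrite subr_gt0 lt_neqAle z1.
    exists (1 - nr z) => // y hy y1; exfalso.
    by have := nr_sub y z; rewrite y1; move: hy; lra.
  have [|d d0 hd] := @compact_unif R C _ (fun d y => nr y = 1 -> nr (chi y) <= d^-1) (@compact_disc R 1) _ hc.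
    by move=> d d' y d0 dd h /h /le_trans; apply; rewrite lef_pV2 ?posrE // (lt_le_trans d0).
  exists d^-1; first by rewrite invr_ge0 ltW.
  by move=> z hz; apply: hd => //=; rewrite hz.
pose A : V := \row_j mean (fun z => grad f (x + z *: u) 0 j * chi z).
exists A; have r40 : 0 < r / 4 by rewrite divr_gt0.
have hx2 : nr (x - x0) < r / 2 by lra.
apply: (@lito_quad R n _ (c * B) (r / 4) r40) => v hv.
have hxv : nr (x + v - x0) < r / 2.
  have -> : x + v - x0 = (x - x0) + v by rewrite addrAC.
  by apply: le_lt_trans (nrD _ _) _; lra.
have c1 := ci f _ fc hxv; have c2 := ci f _ fc hx2.
have c3 j := ci _ _ (gc j) hx2.
have c4 : circ (fun z => \sum_j v 0 j * (grad f (x + z *: u) 0 j * chi z)).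
  by apply: circ_sum => j; exact: (circM (circ_cst _) (c3 j)).
have -> : mean (fun z => f (x + v + z *: u) * chi z) - mean (fun z => f (x + z *: u) * chi z) - wform A 0 v =
  mean (fun z => f (x + v + z *: u) * chi z - f (x + z *: u) * chi z - \sum_j v 0 j * (grad f (x + z *: u) 0 j * chi z)).
  rewrite (meanB (circB c1 c2) c4) (meanB c1 c2); congr (_ - _).
  rewrite (mean_sum _ (fun j => circM (circ_cst (v 0 j)) (c3 j))).
  by rewrite /wform; apply: eq_bigr => j _; rewrite !mxE mul0r addr0 (meanZ _ (c3 j)) mulrC.
apply: mean_le; first exact: (circB (circB c1 c2) c4).
move=> z hz.
have -> : f (x + v + z *: u) * chi z - f (x + z *: u) * chi z - \sum_j v 0 j * (grad f (x + z *: u) 0 j * chi z)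
  = chi z * (f (x + z *: u + v) - f (x + z *: u) - wform (grad f (x + z *: u)) 0 v).
  rewrite [x + v + _]addrAC [RHS]mulrBr; congr (_ - _); first by ring.
  rewrite /wform mulr_sumr; apply: eq_bigr => j _; rewrite !mxE; ring.
rewrite nrM [c * B]mulrC -mulrA; apply: ler_pM; rewrite ?nr_ge0 ?hB //.
by apply: (hq _ _ _ _).2; [exact: hin|lra].
Qed.

(** Taylor coefficients in the direction [e] are circle means of [f], hence by [hol_mean]
    holomorphic functions of the base point; the remainder is uniform because the bound of [f]
    is. *)
Lemma hol_tcoef U f x0 (e : V) : vopen U -> hol U f -> U x0 -> nr e = 1 ->
  exists2 r : R, 0 < r & exists c : nat -> V -> C,
  (forall k x, nr (x - x0) < r -> vdiff (c k) x) /\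
  forall K, exists B : R, forall x t, nr (x - x0) < r -> nr t < r ->
    U (x + t *: e) /\ nr (f (x + t *: e) - \sum_(k < K) c k x * t ^+ k) <= B * nr t ^+ K.
Proof.
move=> oU hf Ux0 e1; have [r1 r10 h1] := hol_mean oU hf Ux0.
have [r2 r20 hr2] := oU _ Ux0.
have [r3 r30 hr3] := vdiff_ctn (hf _ Ux0) ltr01.
pose r := Num.min r1 (Num.min r2 r3).
have r0 : 0 < r by rewrite !lt_min r10 r20.
have rr1 : r <= r1 by rewrite ge_min lexx.
have rr2 : r <= r2 by rewrite !ge_min lexx orbT.
have rr3 : r <= r3 by rewrite !ge_min lexx !orbT.
pose p := r / 4; have p0 : 0 < p by rewrite divr_gt0.
have hball x t : nr (x - x0) < r / 8 -> nr t <= p -> nr (x + t *: e - x0) < r.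
  move=> hx ht; have -> : x + t *: e - x0 = (x - x0) + t *: e by rewrite addrAC.
  by apply: le_lt_trans (nrD _ _) _; rewrite nrZ e1 mulr1; move: ht; rewrite /p; lra.
exists (r / 8); first by rewrite divr_gt0.
exists (fun k x => tcoef (fun t => f (x + t *: e)) p k); split.
  move=> k x hx; rewrite /tcoef.
  have nu : nr (rc p *: e) < r1 by rewrite nrZ e1 mulr1 nr_rc gtr0_norm //; rewrite /p; lra.
  have [_ h] := h1 (rc p *: e) (fun z => z^* ^+ k) nu (circJX k).
  apply: vdiffM; last exact: vdiff_cst.
  apply: vdiff_ext (h x _) => [y|]; last by lra.
  by apply: mean_eq => z _; rewrite scalerA mulrC [z * _]mulrC mulrC.
move=> K; exists (2 * (nr (f x0) + 1) * (p^-1) ^+ K) => x t hx ht.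
have tp : nr t <= p / 2 by rewrite /p; lra.
split; first by apply: hr2; apply: lt_le_trans (hball x t hx _) rr2; lra.
have Fd s : nr s <= p -> cdiff (fun t => f (x + t *: e)) s.
  by move=> hs; apply: vdiff_cdiff; apply: hf; apply: hr2; apply: lt_le_trans (hball x s hx hs) rr2.
have FB s : nr s = p -> nr (f (x + s *: e)) <= nr (f x0) + 1.
  move=> hs; rewrite -(subrK (f x0) (f (x + _))) (le_trans (nrD _ _)) // addrC lerD2l ltW //.
  by apply: hr3; apply: lt_le_trans (hball x s hx _) rr3; rewrite hs.
have := taylor_bound Fd K p0 FB tp; rewrite expr_div_n => /le_trans; apply.
by rewrite exprVn -[leRHS]mulrA [X in _ <= _ * X]mulrC.
Qed.

(** Near each point the partial derivative coincides with the first Taylor coefficient in the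
    direction [delta_mx 0 j], which is holomorphic by [hol_tcoef]. *)
Lemma hol_grad U f j : vopen U -> hol U f -> hol U (fun x => grad f x 0 j).
Proof.
move=> oU hf x0 Ux0.
have [r r0 [c [cd hc]]] := hol_tcoef oU hf Ux0 (nr_delta R j).
have [d d0 hd] := oU _ Ux0.
apply: (vdiff_near (f := c 1%N)); last by apply: cd; rewrite subrr nr0.
exists (Num.min r d); first by rewrite lt_min r0.
move=> x; rewrite lt_min => /andP[xr /hd Ux].
have [B1 h1] := hc 1%N; have [B2 h2] := hc 2%N.
have c0 : c 0%N x = f x.
  have [_] := h1 x 0 xr ltac:(by rewrite nr0).
  rewrite big_ord_recl big_ord0 scale0r addr0 nr0 expr0 mulr1 addr0 expr1 mulr0 => h.
  by apply/esym/eqP; rewrite -subr_eq0 -nr_eq0 eq_le nr_ge0 h.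
apply/eqP; rewrite -subr_eq0 -nr_eq0 eq_le nr_ge0 andbT; apply/ler_addgt0Pl => e e0; rewrite addr0.
have [d' d0' hd'] := wd_line (delta_mx 0 j) (gradP (hf _ Ux)) (e := e / 2) ltac:(by rewrite divr_gt0).
have B0 : 0 < `|B2| + 1 by rewrite ltr_wpDl.
pose s := Num.min (Num.min (d' / 2) (r / 2)) (e / 2 / (`|B2| + 1)).
have s0 : 0 < s by rewrite !lt_min !divr_gt0.
have s1 : s <= d' / 2 by rewrite !ge_min lexx.
have s2 : s <= r / 2 by rewrite !ge_min lexx orbT.
have s3 : s * (`|B2| + 1) <= e / 2 by rewrite -ler_pdivlMr // ge_min lexx orbT.
have ns : nr (rc s) = s by rewrite nr_rc gtr0_norm.
have := hd' (rc s) ltac:(rewrite ns; lra); have [_] := h2 x (rc s) xr ltac:(rewrite ns; lra).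
rewrite ns wlZ wl00 mulr0 addr0 wform_delta mxE addr0 !big_ord_recl big_ord0 /= c0 expr0 mulr1 expr1 addr0 => g1 g2.
have : nr (rc s * (c 1%N x - grad f x 0 j)) <= e * s.
  have -> : rc s * (c 1%N x - grad f x 0 j) =
     (f (x + rc s *: delta_mx 0 j) - f x - rc s * grad f x 0 j) - (f (x + rc s *: delta_mx 0 j) - (f x + c 1%N x * rc s)) by ring.
  apply: le_trans (nrB _ _) _; apply: le_trans (lerD g2 g1) _.
  have : B2 * s ^+ 2 <= e / 2 * s; last by lra.
  rewrite expr2 mulrA ler_pM2r // (le_trans _ s3) // mulrC ler_pM2l // (le_trans (ler_norm _)) // lerDl //.
by rewrite nrM ns mulrC ler_pM2r.
Qed.

End SeveralVariables.

(** * Coefficients of small polynomials in w and its conjugate *)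

Section Polynomials.
Variable R : realType.
Local Notation C := (Cplx R).

(** The lowest surviving coefficient is isolated by dividing by [s ^+ l] and letting [s] tend to
    0. *)
Lemma poly_small (c : nat -> C) K N (B d : R) : 0 < d -> (N <= K)%N ->
  (forall s, 0 < s -> s < d -> nr (\sum_(l < K) c l * rc s ^+ l) <= B * s ^+ N) ->
  forall l, (l < N)%N -> c l = 0.
Proof.
move=> d0 NK h; elim/ltn_ind => l IH lN.
have lK := leq_trans lN NK.
pose D := `|B| + \sum_(j < K) nr (c j) + 1.
have D0 : 0 < D by rewrite ltr_wpDl // addr_ge0 // sumr_ge0 // => j _; exact: nr_ge0.
apply/eqP; rewrite -nr_eq0 eq_le nr_ge0 andbT; apply/ler_addgt0Pl => e e0; rewrite addr0.
pose s := Num.min (Num.min (d / 2) 1) (e / D).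
have s0 : 0 < s by rewrite !lt_min !divr_gt0 // ltr01.
have s1 : s <= 1 by rewrite !ge_min lexx orbT.
have sd : s < d by apply: le_lt_trans (_ : s <= d / 2) _; [rewrite !ge_min lexx|lra].
have se : s * D <= e by rewrite -ler_pdivlMr // ge_min lexx orbT.
have := h s s0 sd.
have -> : \sum_(j < K) c j * rc s ^+ j = rc s ^+ l * (c l + rc s * \sum_(j < K | (l < j)%N) c j * rc s ^+ (j - l.+1)).
  rewrite (bigID (fun j : 'I_K => (j <= l)%N)) /= mulrDr; congr (_ + _).
    rewrite (bigD1 (Ordinal lK)) ?leqnn // big1 /=; first by rewrite addr0 mulrC.
    move=> j /andP[jl jne].
    have jl' : (j < l)%N.
      by rewrite ltn_neqAle jl andbT; apply: contra jne => /eqP e1; apply/eqP/val_inj.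
    by rewrite (IH _ jl' (ltn_trans jl' lN)) mul0r.
  rewrite mulrA -exprSr mulr_sumr; apply: eq_big => [j|j]; rewrite -ltnNge // => lj.
  by rewrite mulrCA -exprD subnKC.
rewrite nrM nrX nr_rc gtr0_norm // -(subnKC (ltnW lN)) exprD mulrCA ler_pM2l ?exprn_gt0 // => h1.
apply: le_trans se.
set Q := \sum_(j < K | _) _ in h1.
have hQ : nr Q <= \sum_(j < K) nr (c j).
  apply: le_trans (nr_sum _ _ _) _; rewrite [leRHS](bigID (fun j : 'I_K => (l < j)%N)) /= ler_wpDr //.
    by apply: sumr_ge0 => j _; exact: nr_ge0.
  apply: ler_sum => j _; rewrite nrM nrX nr_rc gtr0_norm // ler_piMr ?nr_ge0 // exprn_ile1 // ltW //.
have -> : c l = (c l + rc s * Q) - rc s * Q by rewrite addrK.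
apply: le_trans (nrB _ _) _; rewrite nrM nr_rc gtr0_norm // /D mulrDr mulr1 mulrDr.
have h2 : nr (c l + rc s * Q) <= s * `|B|.
  apply: le_trans h1 _; rewrite [s * _]mulrC; apply: le_trans (ler_norm _) _; rewrite normrM.
  apply: ler_wpM2l => //; rewrite ger0_norm ?exprn_ge0 ?(ltW s0) //.
  by rewrite -(subnKC (_ : 0 < N - l)%N) ?subn_gt0 // exprS ler_piMr ?(ltW s0) // exprn_ile1 // ltW.
have := ler_wpM2l (ltW s0) hQ; move: h2; lra.
Qed.

(** On each ray the sum is a polynomial in the radius, so every homogeneous part [H m] with m < N
    vanishes on the unit circle. Within one degree the monomials are separated by the mean against
    the conjugate monomial. *)
Lemma poly2_small (c : nat -> nat -> C) K N (B d : R) : 0 < d ->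
  (forall w, nr w < d -> nr (\sum_(k < K) \sum_(l < K) c k l * w ^+ k * w^* ^+ l) <= B * nr w ^+ N) ->
  forall k l, (k < K)%N -> (l < K)%N -> (k + l < N)%N -> c k l = 0.
Proof.
move=> d0 h k0 l0 kK lK klN.
pose H m z := \sum_(k < K) \sum_(l < K) (if (k + l == m)%N then c k l * z ^+ k * z^* ^+ l else 0).
have Hz m z : nr z = 1 -> (m < N)%N -> H m z = 0.
  move=> hz; apply: (@poly_small (fun m => H m z) (N + (K + K)) N B d d0 (leq_addr _ _)) => s s0 sd.
  have := h (rc s * z); rewrite nrM hz mulr1 nr_rc gtr0_norm // => /(_ sd).
  congr (nr _ <= _); rewrite /H.
  under [RHS]eq_bigr => m' _ do rewrite mulr_suml.
  rewrite [RHS]exchange_big /=; apply: eq_bigr => k _.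
  under [RHS]eq_bigr => m' _ do rewrite mulr_suml.
  rewrite [RHS]exchange_big /=; apply: eq_bigr => l _.
  have hm : (k + l < N + (K + K))%N.
    by rewrite (leq_trans _ (leq_addl _ _)) // -addnS leq_add // ltnW.
  rewrite (bigD1 (Ordinal hm)) //= eqxx big1 => [|m' ne].
    by rewrite addr0 cjM rcJ !exprMn exprD; ring.
  by rewrite ifF ?mul0r //; apply/negbTE; apply: contra ne => /eqP e; apply/eqP/val_inj.
have cH k l : circ (fun z : C => if (k + l == k0 + l0)%N then c k l * z ^+ k * z^* ^+ l * (z^* ^+ k0 * z ^+ l0) else 0).
  case: (_ == _); last exact: (circ_cst _).
  exact: (circM (circM (circM (circ_cst _) (circX _)) (circJX _)) (circM (circJX _) (circX _))).
have : mean (fun z => H (k0 + l0)%N z * (z^* ^+ k0 * z ^+ l0)) = 0.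
  by rewrite -[RHS](mean_cst 0); apply: mean_eq => z hz; rewrite Hz // mul0r.
rewrite (mean_eq (v := fun z => \sum_(k < K) \sum_(l < K) (if (k + l == k0 + l0)%N then c k l * z ^+ k * z^* ^+ l * (z^* ^+ k0 * z ^+ l0) else 0))); last first.
  move=> z _; rewrite /H mulr_suml; apply: eq_bigr => k _; rewrite mulr_suml; apply: eq_bigr => l _.
  by case: ifP => _; rewrite ?mul0r.
rewrite (mean_sum _ (F := fun (k : 'I_K) z => \sum_(l < K) _)); last by move=> k; apply: circ_sum => l; exact: cH.
under eq_bigr => k _ do rewrite (mean_sum _ (F := fun (l : 'I_K) z => _) (fun l : 'I_K => cH k l)).
rewrite (bigD1 (Ordinal kK)) //= (bigD1 (Ordinal lK)) //= eqxx.
rewrite (mean_eq (v := fun=> c k0 l0)) ?mean_cst; last first.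
  move=> z hz; have z0 := circ_neq0 hz; rewrite (circ_conj hz) !exprVn; field.
  by rewrite !expf_neq0.
rewrite big1 ?addr0 => [|l ne]; last first.
  have /negbTE -> : (k0 + l != k0 + l0)%N.
    by rewrite eqn_add2l; apply: contra ne => /eqP e; exact/eqP/val_inj.
  exact: mean_cst.
rewrite big1 ?addr0 // => k ne; apply: big1 => l _; case: (eqVneq (k + l)%N (k0 + l0)%N) => [e|_]; last exact: mean_cst.
rewrite (mean_eq (v := fun z => c k l * (z ^+ (k + l0) * z^* ^+ (l + k0)))); last by move=> z _; rewrite !exprD; ring.
rewrite meanZ; last exact: (circM (circX _) (circJX _)).
rewrite mean_mono; case: eqP => [e'|_]; last by rewrite mulr0.
by case/eqP: ne; apply/val_inj => /=; lia.
Qed.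

Lemma disc_min (g : C -> R) (r : R) : 0 <= r ->
  (forall z, nr z <= r -> forall e, 0 < e -> exists2 d : R, 0 < d & forall y, nr (y - z) < d -> `|g y - g z| < e) ->
  exists2 z0, nr z0 <= r & forall z, nr z <= r -> g z0 <= g z.
Proof.
move=> r0 h; have [|||z] := @compact_EVT_min C R g [set z | nr z <= r].
- by exists 0; rewrite /= nr0.
- exact: compact_disc.
- apply: continuous_in_subspaceT => z; rewrite inE /= => hz.
  by apply/(@cont_nrR R C); exact: h.
by rewrite inE => hz hm; exists z => // y hy; apply: hm; rewrite inE.
Qed.
End Polynomials.

(** * Holomorphic inverse function theorem for one replaced coordinate, and division by a
    coordinate *)

Lemma seg_sub (K : pzRingType) (V : lmodType K) (x y z : V) (s : K) :
  y + s *: (x - y) - z = s *: (x - z) + (1 - s) *: (y - z).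
Proof. by rewrite scalerBl scale1r addrCA -scalerBr opprB addrA subrK addrAC. Qed.
Lemma seg_step (K : pzRingType) (V : lmodType K) (x y : V) (s t : K) :
  y + s *: (x - y) + (t - s) *: (x - y) = y + t *: (x - y).
Proof. by rewrite -addrA -scalerDl addrCA subrr addr0. Qed.

Lemma mv_alg (K : comPzRingType) (w w' a b s t : K) :
  w - t * b - (w' - s * b) = w - w' - (t - s) * a + (t - s) * (a - b).
Proof. by ring. Qed.

Section InverseFunction.
Variables (R : realType) (n : nat).
Local Notation C := (Cplx R).
Local Notation V := 'rV[C]_n.+1.
Implicit Types (f g w : V -> C) (x y v eta : V) (U : set V) (i j : 'I_n.+1).

Lemma fin_radius (I : finType) (P : I -> R -> Prop) :
  (forall a d d', 0 < d' -> d' <= d -> P a d -> P a d') ->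
  (forall a, exists2 d, 0 < d & P a d) -> exists2 d, 0 < d & forall a, P a d.
Proof.
move=> hm h; have /choice[F hF] : forall a, exists d, 0 < d /\ P a d.
  by move=> a; have [d d0 hd] := h a; exists d.
have b0 : 0 < \big[Num.min/1]_a F a.
  by elim/big_ind: _ => // [x y x0 y0|a _]; [rewrite lt_min x0|case: (hF a)].
exists (\big[Num.min/1]_a F a) => // a; apply: (hm a (F a)) => //; last exact: (hF a).2.
by apply: bigmin_le_cond.
Qed.

Lemma wlZ0 (A v : V) (s : C) : wform A 0 (s *: v) = s * wform A 0 v.
Proof. by rewrite wlZ wl00 mulr0 addr0. Qed.

Lemma nr_sub_norm (T : normedZmodType C) (a b : T) : `|nr a - nr b| <= nr (a - b).
Proof. by rewrite ler_norml nr_sub andbT lerNl opprB nrBC nr_sub. Qed.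

Lemma wl0E (A v : V) : wform A 0 v = \sum_j A 0 j * v 0 j.
Proof. by apply: eq_bigr => j _; rewrite [(0 : V) 0 j]mxE mul0r addr0. Qed.
Lemma wform_coord j (v : V) : wform (delta_mx 0 j) 0 v = v 0 j.
Proof.
rewrite /wform (bigD1 j) //= big1; first by rewrite !mxE !eqxx /= mul1r mul0r !addr0.
by move=> k kj; rewrite !mxE eqxx (negbTE kj) /= !mul0r addr0.
Qed.

Lemma lito_sub (h : V -> C) (k : V -> V) (M d : R) : 0 < M -> 0 < d ->
  (forall v, nr v < d -> nr (k v) <= M * nr v) -> lito h -> lito (fun v => h (k v)).
Proof.
move=> M0 d0 hk hh e e0; have [d' d0' hd'] := hh (e / M) ltac:(by rewrite divr_gt0).
exists (Num.min d (d' / M)); first by rewrite lt_min d0 divr_gt0.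
move=> v; rewrite lt_min ltr_pdivlMr // => /andP[/hk h1 h2].
apply: le_trans (hd' _ _) _; first by apply: le_lt_trans h1 _; rewrite mulrC.
by rewrite mulrAC ler_pdivrMr // -mulrA ler_pM2l // mulrC.
Qed.

Definition pr i v : V := \row_j (if j == i then 0 else v 0 j).
Lemma prE i v : v = pr i v + v 0 i *: delta_mx 0 i.
Proof.
apply/rowP => j; rewrite !mxE eqxx /=; case: eqP => [->|_]; first by rewrite mulr1 add0r.
by rewrite mulr0 addr0.
Qed.
Lemma pr_le i v : nr (pr i v) <= nr v.
Proof. by apply: nr_rV => [|j]; rewrite ?nr_ge0 // mxE; case: eqP; rewrite ?nr0 ?nr_ge0 ?nr_coord. Qed.
Lemma pr_id i v : v 0 i = 0 -> pr i v = v.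
Proof. by move=> h; apply/rowP => j; rewrite mxE; case: eqP => // ->. Qed.
Lemma pr_i i v : pr i v 0 i = 0. Proof. by rewrite mxE eqxx. Qed.
Lemma prB i v u : pr i (v - u) = pr i v - pr i u.
Proof. by apply/rowP => j; rewrite !mxE; case: eqP => // _; rewrite subrr. Qed.
Lemma prD i v u : pr i (v + u) = pr i v + pr i u.
Proof. by apply/rowP => j; rewrite !mxE; case: eqP => // _; rewrite addr0. Qed.
Lemma pr_delta i v (t : C) : pr i (v + t *: delta_mx 0 i) = pr i v.
Proof. by apply/rowP => j; rewrite !mxE; case: eqP => //= _; rewrite mulr0 addr0. Qed.
Lemma line_i i v (t : C) : (v + t *: delta_mx 0 i) 0 i = v 0 i + t.
Proof. by rewrite !mxE !eqxx mulr1. Qed.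
Lemma vdiff_pr i j x : vdiff (fun y => pr i y 0 j) x.
Proof.
have [->|ji] := eqVneq j i.
  by apply: vdiff_ext (vdiff_cst 0 x) => y; rewrite pr_i.
by apply: vdiff_ext (vdiff_coord j x) => y; rewrite mxE (negbTE ji).
Qed.

Definition adj_coord w x0 i x : V := \row_j (if j == i then w x else (x - x0) 0 j).

(** Injectivity with a Lipschitz inverse comes from the linear approximation [lin]; surjectivity is
    a problem in one complex variable, since all entries but the i-th are prescribed;
    differentiability of the inverse follows from the Lipschitz bound. *)
Lemma local_coord U w x0 i : vopen U -> hol U w -> U x0 -> w x0 = 0 -> grad w x0 0 i != 0 ->
  exists2 r : R, 0 < r & exists2 rho : R, 0 < rho & exists G : V -> V,
  [/\ (forall eta, nr eta < r -> [/\ nr (G eta - x0) < rho, adj_coord w x0 i (G eta) = eta &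
        forall j, vdiff (fun eta => G eta 0 j) eta]),
     G 0 = x0 &
     forall x, nr (x - x0) < rho -> U x /\
       (nr (adj_coord w x0 i x) < r -> G (adj_coord w x0 i x) = x)].
Proof.
move=> oU hw Ux0 w0 ai0; pose a := grad w x0; pose al := nr (a 0 i).
have al0 : 0 < al by rewrite nr_gt0.
have [r0 r00 hr0] := oU _ Ux0.
have [r1 r10 hr1] : exists2 d : R, 0 < d & forall j p, nr (p - x0) < d ->
    nr (grad w p 0 j - a 0 j) <= al / 2 / n.+1%:R.
  apply: (fin_radius (P := fun j d => forall p, nr (p - x0) < d -> nr (grad w p 0 j - a 0 j) <= al / 2 / n.+1%:R)).
    by move=> j d d' _ dd h p hp; apply: h; apply: lt_le_trans dd.
  move=> j; have [|d d0 hd] := grad_ctn j oU hw Ux0 (e := al / 2 / n.+1%:R).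
    by rewrite !divr_gt0.
  by exists d => // p /hd /ltW.
pose rho := Num.min r0 r1; have rho0 : 0 < rho by rewrite lt_min r00.
have Urho x : nr (x - x0) < rho -> U x by rewrite lt_min => /andP[/hr0].
have grho p : nr (p - x0) < rho -> wform_norm (grad w p - a) 0 <= al / 2.
  rewrite lt_min => /andP[_ hp]; rewrite /wform_norm.
  apply: le_trans (_ : \sum_(j < n.+1) al / 2 / n.+1%:R <= _).
    by apply: ler_sum => j _; rewrite !mxE nr0 addr0; apply: hr1.
  by rewrite sumr_const card_ord -[leLHS]mulr_natr divfK // pnatr_eq0.
have gi p : nr (p - x0) < rho -> grad w p 0 i != 0.
  move=> hp; rewrite -nr_gt0; have := hr1 i p; move: hp; rewrite lt_min => /andP[_ hp] /(_ hp) h.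
  have : al / 2 / n.+1%:R <= al / 2.
    by rewrite ler_pdivrMr // ler_peMr ?divr_ge0 ?(ltW al0) // ler1n.
  move: h; move: (al / 2 / _) => u h hu; have := nr_sub (a 0 i) (grad w p 0 i).
  rewrite (nrBC (a 0 i)) -/al; move: h hu al0; lra.
(* Mean value inequality on the segment from [y] to [x], where the gradient differs from [a] by at
   most [al / 2] in [wform_norm]. *)
have lin x y : nr (x - x0) < rho -> nr (y - x0) < rho ->
    nr (w x - w y - wform a 0 (x - y)) <= al / 2 * nr (x - y).
  move=> hx hy; pose u (s : R) := w (y + rc s *: (x - y)) - rc s * wform a 0 (x - y).
  have -> : w x - w y - wform a 0 (x - y) = u 1 - u 0.
    by rewrite /u !scale1r !scale0r addr0 mul0r subr0 mul1r (addrC y) subrK; ring.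
  apply: mean_value_ineq => s /andP[s0 s1] e e0.
  pose p := y + rc s *: (x - y).
  have hp : nr (p - x0) < rho.
    have -> : p - x0 = rc s *: (x - x0) + rc (1 - s) *: (y - x0).
        by rewrite rcB; exact: seg_sub.
    apply: le_lt_trans (nrD _ _) _; rewrite !nrZ !nr_rc !ger0_norm ?subr_ge0 //.
    have [se|se] := eqVneq s 0; first by rewrite se; lra.
    have sp : 0 < s by rewrite lt_neqAle eq_sym se.
    have := ler_wpM2l (_ : 0 <= 1 - s) (ltW hy); rewrite subr_ge0 => /(_ s1).
    by move: hx; rewrite -(ltr_pM2l sp); lra.
  have [d d0 hd] := wd_line (x - y) (gradP (hw _ (Urho _ hp))) e0.
  exists d => // t _ ht.
  have nts : nr (rc (t - s)) = `|t - s| by rewrite nr_rc.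
  have := hd (rc (t - s)); rewrite nts => /(_ ht) h.
  have -> : u t - u s = (w (p + rc (t - s) *: (x - y)) - w p - wform (grad w p) 0 (rc (t - s) *: (x - y)))
      + rc (t - s) * wform (grad w p - a) 0 (x - y).
    have -> : p + rc (t - s) *: (x - y) = y + rc t *: (x - y).
      by rewrite rcB; exact: seg_step.
    have -> : wform (grad w p - a) 0 (x - y) = wform (grad w p) 0 (x - y) - wform a 0 (x - y).
      have := wform_lin (grad w p) a 0 0 1 (-1) (x - y).
      by rewrite !scale1r !scaleN1r oppr0 addr0 mul1r mulN1r => ->.
    rewrite wlZ0 rcB /u -/p.
    exact: mv_alg.
  apply: le_trans (nrD _ _) _; rewrite nrM nts mulrDl addrC; apply: lerD => //.
  rewrite mulrC ler_wpM2r //; apply: le_trans (wform_le _ _ _) _.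
  by rewrite ler_wpM2r ?nr_ge0 //; exact: grho.
pose Phi := adj_coord w x0 i.
pose S := wform_norm a 0; have S0 : 0 <= S by exact: wform_norm_ge0.
(* Obtained by solving al d <= N + (al / 2) (d + N) + S N for the increment d of the i-th entry,
   then adding N for the other entries. *)
pose M := 2 * (1 + S + al / 2) / al + 1.
have M0 : 0 < M by rewrite /M ltr_wpDl // divr_ge0 ?(ltW al0) //; lra.
have inj x y : nr (x - x0) < rho -> nr (y - x0) < rho -> nr (x - y) <= M * nr (Phi x - Phi y).
  move=> hx hy; set N := nr (Phi x - Phi y).
  have N0 : 0 <= N by exact: nr_ge0.
  have hj j : j != i -> nr ((x - y) 0 j) <= N.
    move=> ji; apply: le_trans (nr_coord _ j); rewrite !mxE (negbTE ji).
    by rewrite opprB addrA subrK.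
  have hi : nr (w x - w y) <= N by apply: le_trans (nr_coord _ i); rewrite !mxE eqxx.
  have nd : nr (x - y) <= nr ((x - y) 0 i) + N.
    apply: nr_rV => [|j]; first by rewrite addr_ge0 ?nr_ge0.
    by have [->|/hj h] := eqVneq j i; [rewrite lerDl|apply: le_trans h _; rewrite lerDr nr_ge0].
  have : al * nr ((x - y) 0 i) <= N + al / 2 * nr (x - y) + S * N.
    rewrite /al -nrM.
    have -> : a 0 i * (x - y) 0 i = (w x - w y) - (w x - w y - wform a 0 (x - y)) - wform a 0 (pr i (x - y)).
      have -> : wform a 0 (x - y) = wform a 0 (pr i (x - y)) + a 0 i * (x - y) 0 i.
        by rewrite {1}(prE i (x - y)) wlD wlZ wform_delta wl00 mulr0 addr0 [(0 : V) 0 i]mxE addr0 mulrC.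
      by ring.
    apply: le_trans (nrB _ _) _; apply: lerD.
      by apply: le_trans (nrB _ _) _; apply: lerD => //; exact: lin.
    apply: le_trans (wform_le _ _ _) _; rewrite ler_wpM2l //.
    apply: nr_rV => // j; rewrite mxE; case: eqP => [_|/eqP /hj //]; by rewrite nr0.
  move=> h; have nd' := nd; apply: le_trans nd _; rewrite /M mulrDl mul1r lerD2r mulrAC ler_pdivlMr //.
  move: h (ler_wpM2l (ltW al0) nd'); move: (nr (x - y)) (nr ((x - y) 0 i)) => D E; lra.
pose q := rho / 4; have q0 : 0 < q by rewrite divr_gt0.
have qM : 0 < q / (4 * M) by rewrite divr_gt0 // mulr_gt0.
have [r2 r20 hr2] := vdiff_ctn (hw _ Ux0) qM.
pose r := Num.min (Num.min r2 (rho / 4)) (q / (4 * M)).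
have rp : 0 < r by rewrite !lt_min r20 divr_gt0.
(* The distance from [w (x t)] to [eta 0 i] is minimised over the disc of radius [q]. On the
   boundary [w] has moved by at least [q / M], so the minimum is interior; a nonzero minimum could
   be lowered. *)
have ex eta : nr eta < r -> exists x, nr (x - x0) < rho /\ Phi x = eta.
  rewrite !lt_min => /andP[/andP[e2 e4] e5].
  pose x (t : C) := x0 + pr i eta + t *: delta_mx 0 i.
  have hx t : nr t <= q -> nr (x t - x0) < rho.
    move=> ht; have -> : x t - x0 = pr i eta + t *: delta_mx 0 i.
      by rewrite /x -(addrA x0) (addrAC x0) subrr add0r.
    apply: le_lt_trans (nrD _ _) _; rewrite nrZ nr_delta mulr1.
    by have := pr_le i eta; move: ht; rewrite /q; move: e4; lra.
  have wc t : nr t <= q -> ctn (fun t => w (x t)) t.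
    move=> ht; exact: (ctn_comp (@cont_line _ _ (x0 + pr i eta) _ t) (vdiff_ctn (hw _ (Urho _ (hx t ht))))).
  have [t1 t1q tm] : exists2 t1, nr t1 <= q & forall t, nr t <= q -> nr (w (x t1) - eta 0 i) <= nr (w (x t) - eta 0 i).
    apply: (@disc_min R (fun t => nr (w (x t) - eta 0 i)) q (ltW q0)) => t ht e e0.
    have [d d0 hd] := wc t ht e e0; exists d => // y /hd; apply: le_lt_trans.
    by apply: le_trans (nr_sub_norm _ _) _; rewrite opprB addrA subrK.
  have w00 : nr (w (x 0)) < q / (4 * M).
    have := hr2 (x 0); rewrite w0 subr0; apply; rewrite /x scale0r addr0 addrC addKr.
    exact: le_lt_trans (pr_le _ _) e2.
  have e5' : nr (eta 0 i) < q / (4 * M) by apply: le_lt_trans e5; exact: nr_coord.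
  have n0q : nr (0 : C) <= q by rewrite nr0 ltW.
  have hq0 := tm 0 n0q.
  have t1lt : nr t1 < q.
    rewrite lt_neqAle t1q andbT; apply/eqP => t1e.
    have := inj (x t1) (x 0) (hx _ t1q) (hx _ n0q).
    have -> : x t1 - x 0 = t1 *: delta_mx 0 i by rewrite /x scale0r addr0 addrC addKr.
    rewrite nrZ nr_delta mulr1 t1e.
    have -> : Phi (x t1) - Phi (x 0) = (w (x t1) - w (x 0)) *: delta_mx 0 i.
      apply/rowP => j; rewrite !mxE eqxx /=; case: eqP => [_|_]; first by rewrite mulr1.
      by rewrite mul0r !mulr0 subrr.
    rewrite nrZ nr_delta mulr1 mulrC -ler_pdivrMr // => h.
    have hqM : q / (4 * M) = q / M / 4 by rewrite invfM mulrA mulrAC.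
    have := nr_tri (eta 0 i) (w (x t1)) (w (x 0)); have := nr_sub (w (x 0)) (w (x t1)).
    have := nrB (w (x 0)) (eta 0 i); have := nrBC (eta 0 i) (w (x 0)).
    have qM' : 0 < q / M by rewrite divr_gt0.
    by move: hq0 w00 e5' h; rewrite hqM; lra.
  exists (x t1); split; first exact: hx.
  have xt1 := hx _ t1q; set g := grad w (x t1) 0 i; have g0 : g != 0 := gi _ xt1.
  suff wx : w (x t1) = eta 0 i.
    apply/rowP => j; rewrite !mxE; case: eqP => [->|ji]; first by rewrite wx.
    by rewrite eqxx /= mulr0 addr0 addrAC subrr add0r.
  apply/eqP; rewrite -subr_eq0; set p := w (x t1) - eta 0 i; apply/negPn/negP => p0.
  have np : 0 < nr p by rewrite nr_gt0.
  have pg : 0 < nr (p / g) by rewrite nr_gt0 mulf_neq0 // invr_neq0.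
  have [d d0 hd] := wd_line (delta_mx 0 i) (gradP (hw _ (Urho _ xt1))) (e := nr g / 2) ltac:(by rewrite divr_gt0 // nr_gt0).
  pose s := Num.min (Num.min 1 ((q - nr t1) / nr (p / g))) (d / 2 / nr (p / g)).
  have s0 : 0 < s by rewrite !lt_min ltr01 !divr_gt0 // subr_gt0.
  have s1 : s <= 1 by rewrite !ge_min lexx.
  have s2 : s * nr (p / g) <= q - nr t1 by rewrite -ler_pdivlMr // !ge_min lexx orbT.
  have s3 : s * nr (p / g) <= d / 2 by rewrite -ler_pdivlMr // !ge_min lexx orbT.
  (* A damped Newton step: [s] keeps it inside the disc and makes the linearisation error at most
     half of s |p|, so |p| would drop at least by the factor 1 - s / 2. *)
  pose h := - (rc s * (p / g)).
  have nh : nr h = s * nr (p / g) by rewrite nrN nrM nr_rc gtr0_norm.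
  have := hd h; rewrite nh => /(_ ltac:(lra)).
  have xe : x t1 + h *: delta_mx 0 i = x (t1 + h) by rewrite /x -addrA -scalerDl.
  rewrite xe wlZ wl00 mulr0 addr0 wform_delta [(0 : V) 0 i]mxE addr0 -/g => hh.
  have hth : nr (t1 + h) <= q by apply: le_trans (nrD _ _) _; rewrite nh; lra.
  have := tm _ hth; apply/negP; rewrite -ltNge.
  have -> : w (x (t1 + h)) - eta 0 i = (w (x (t1 + h)) - w (x t1) - h * g) + rc (1 - s) * p.
    by rewrite /h rcB rc1 /p; field.
  apply: le_lt_trans (nrD _ _) _; rewrite nrM nr_rc ger0_norm ?subr_ge0 // -/p.
  have hpg : nr g / 2 * (s * nr (p / g)) = s * nr p / 2.
    have ng : nr g != 0 by rewrite nr_eq0.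
    by rewrite nrM nrV; move: (nr g) (nr p) ng => a1 a2 a3; field.
  by rewrite hpg in hh; have := mulr_gt0 s0 np; move: hh; lra.
pose G eta := xget x0 [set x | nr (x - x0) < rho /\ Phi x = eta].
have hG eta : nr eta < r -> nr (G eta - x0) < rho /\ Phi (G eta) = eta.
  by move=> /ex[x hx]; rewrite /G; case: xgetP => [y -> //|/(_ x)].
have x0r : nr (x0 - x0) < rho by rewrite subrr nr0.
have GP x : nr (x - x0) < rho -> nr (Phi x) < r -> G (Phi x) = x.
  move=> hx /hG[h1 h2]; apply/eqP; rewrite -subr_eq0 -nr_eq0 eq_le nr_ge0 andbT.
  by apply: le_trans (inj _ _ h1 hx) _; rewrite h2 subrr nr0 mulr0.
have P0 : Phi x0 = 0.
  by apply/rowP => j; rewrite !mxE w0 subrr; case: eqP.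
exists r => //; exists rho => //; exists G; split.
- move=> eta he; have [h1 h2] := hG _ he; split=> // j.
  have re : 0 < r - nr eta by rewrite subr_gt0.
  have inr v : nr v < r - nr eta -> nr (eta + v) < r.
    by move=> hv; apply: le_lt_trans (nrD _ _) _; lra.
  pose k v := G (eta + v) - G eta.
  have hk v : nr v < r - nr eta -> nr (k v) <= M * nr v.
    move=> /inr /hG[h3 h4]; apply: le_trans (inj _ _ h3 h1) _.
    by rewrite h2 h4 [eta + v]addrC addrK.
  have kj v l : nr v < r - nr eta -> l != i -> k v 0 l = v 0 l.
    move=> /inr /hG[_ h4] li; move/rowP/(_ l): h4; move/rowP/(_ l): h2.
    rewrite !mxE (negbTE li) => e1 e2.
    have -> : v 0 l = (eta 0 l + v 0 l) - eta 0 l by rewrite addrAC subrr add0r.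
    by rewrite -e2 -e1 opprB addrA subrK.
  have [ji|ji] := eqVneq j i; last first.
    exists (delta_mx 0 j); apply: (lito_near re) (@lito0 R n) => v hv.
    by have := kj v j hv ji; rewrite !mxE => ->; rewrite wform_coord subrr.
  rewrite {}ji; pose b := grad w (G eta); have b0 : b 0 i != 0 := gi _ h1.
  (* The gradient of the i-th entry of the inverse, found by solving the differential of [w] for the
     i-th increment. *)
  exists (\row_l (if l == i then (b 0 i)^-1 else - (b 0 l / b 0 i))).
  have l1 := lito_sub M0 re hk (gradP (hw _ (Urho _ h1))).
  apply: (lito_near re) (litoZ (- (b 0 i)^-1) l1) => v hv.
  have wG : w (G eta + k v) - w (G eta) = v 0 i.
    have -> : G eta + k v = G (eta + v) by rewrite /k addrC subrK.
    have [_ h4] := hG _ (inr _ hv).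
    move/rowP/(_ i): h4; move/rowP/(_ i): h2; rewrite !mxE eqxx => -> ->; ring.
  rewrite wG -/b.
  have E1 : wform b 0 (k v) = b 0 i * k v 0 i + \sum_(l | l != i) b 0 l * v 0 l.
    by rewrite wl0E (bigD1 i) //=; congr (_ + _); apply: eq_bigr => l li; rewrite kj.
  have E2 : wform (\row_l (if l == i then (b 0 i)^-1 else - (b 0 l / b 0 i))) 0 v =
      (b 0 i)^-1 * v 0 i - (b 0 i)^-1 * \sum_(l | l != i) b 0 l * v 0 l.
    rewrite wl0E (bigD1 i) //= !mxE eqxx mulr_sumr -sumrN; congr (_ + _).
    by apply: eq_bigr => l li; rewrite !mxE (negbTE li); move: (b 0 l) (b 0 i) (v 0 l) => a1 a2 a3; ring.
  rewrite E1 E2; have -> : G (eta + v) 0 i - G eta 0 i = k v 0 i by rewrite /k !mxE.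
  by move: (\sum_(l | l != i) _) (k v 0 i) (v 0 i) => s c c'; field.
- by rewrite -P0; apply: GP; rewrite ?P0 ?nr0.
- by move=> x hx; split; [exact: Urho|exact: GP].
Qed.

(** The order of vanishing may be given pointwise along the slice, with constants depending on the
    point: it only serves to kill the Taylor coefficients of index below [k], whose expansion is
    locally uniform. *)
Lemma hol_div U F z0 i k : vopen U -> hol U F -> U z0 -> z0 0 i = 0 ->
  (exists2 d : R, 0 < d & forall z, nr (z - z0) < d -> z 0 i = 0 -> exists B : R, exists2 d' : R, 0 < d' &
     forall t, nr t < d' -> nr (F (z + t *: delta_mx 0 i)) <= B * nr t ^+ k) ->
  exists2 r : R, 0 < r & exists F1 : V -> C, forall eta, nr (eta - z0) < r ->
    vdiff F1 eta /\ F eta = F1 eta * eta 0 i ^+ k.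
Proof.
move=> oU hF Uz0 zi [d d0 hd].
have [r1 r10 [c [cd hc]]] := hol_tcoef oU hF Uz0 (nr_delta R i).
have [r2 r20 hr2] := oU _ Uz0.
pose r := Num.min d (Num.min r1 r2); have r0 : 0 < r by rewrite !lt_min d0 r10.
have prz eta : nr (eta - z0) < r -> nr (pr i eta - z0) < r.
  by rewrite -{2}(pr_id zi) -prB; apply: le_lt_trans; exact: pr_le.
have c0 z l : nr (z - z0) < r -> z 0 i = 0 -> (l < k)%N -> c l z = 0.
  rewrite !lt_min => /and3P[zd z1 z2] zi0.
  have [B [d' d0' hB]] := hd z zd zi0; have [B' hB'] := hc k.
  have m0 : 0 < Num.min r1 d' by rewrite lt_min r10.
  apply: (@poly_small R (fun l => c l z) k k (B + B') _ m0 (leqnn _)) => s s0.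
  rewrite lt_min => /andP[s1 s2]; have ns : nr (rc s) = s by rewrite nr_rc gtr0_norm.
  have := hB (rc s); rewrite ns => /(_ s2) h1.
  have ss1 : nr (rc s) < r1 by rewrite ns.
  have [_] := hB' z (rc s) z1 ss1; rewrite ns => h2; rewrite mulrDl; set Q := \sum_(_ < _) _ in h2 *.
  have -> : Q = F (z + rc s *: delta_mx 0 i) - (F (z + rc s *: delta_mx 0 i) - Q) by rewrite subKr.
  by apply: le_trans (nrB _ _) _; exact: lerD.
have [B1 hB1] := hc k.+1; have [B2 hB2] := hc k.+2.
(* On the slice the quotient takes the value of the k-th Taylor coefficient in the direction of the
   i-th coordinate. *)
pose F1 eta := if eta 0 i == 0 then c k (pr i eta) else F eta / eta 0 i ^+ k.
exists (r / 2); first by rewrite divr_gt0.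
exists F1 => eta he; have [er er'] : nr (eta - z0) < r /\ nr (eta - z0) < r / 2 by split; lra.
have Fexp y : nr (y - z0) < r -> nr (y 0 i) < r -> nr (F y - c k (pr i y) * y 0 i ^+ k) <= B1 * nr (y 0 i) ^+ k.+1.
  move=> yr yi; have p1 : nr (pr i y - z0) < r1 by move: (prz _ yr); rewrite !lt_min => /and3P[].
  have p2 : nr (y 0 i) < r1 by move: yi; rewrite !lt_min => /and3P[].
  have [_] := hB1 _ _ p1 p2; rewrite -prE; congr (nr (_ - _) <= _); rewrite big_ord_recr /= big1 ?add0r // => l _.
  by rewrite c0 ?mul0r ?pr_i //; exact: prz.
have coordr y : nr (y - z0) < r -> nr (y 0 i) < r.
  by move=> h; apply: le_lt_trans h; rewrite -[y 0 i]subr0 -zi; have := nr_coord (y - z0) i; rewrite !mxE.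
split; last first.
  rewrite /F1; case: eqP => [e0|/eqP e0]; last by rewrite divfK // expf_neq0.
  have := Fexp eta er (coordr _ er); rewrite e0 nr0 exprS mul0r mulr0 => h.
  by apply/eqP; rewrite -subr_eq0 -nr_eq0 eq_le nr_ge0 h.
have Ueta : U eta by apply: hr2; move: er; rewrite !lt_min => /and3P[].
have [e0|e0] := eqVneq (eta 0 i) 0; last first.
  apply: (vdiff_near (f := fun y => F y * (y 0 i ^+ k)^-1)); last first.
    apply: (vdiffM (hF _ Ueta)); apply: vdiffV; first by rewrite expf_neq0.
    exact: (vdiffX _ (vdiff_coord i eta)).
  have ne : 0 < nr (eta 0 i) by rewrite nr_gt0.
  exists (nr (eta 0 i)) => // y hy; rewrite /F1 ifF //; apply/eqP => y0.
  have := nr_coord (y - eta) i; rewrite !mxE y0 sub0r nrN; move: hy; lra.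
have pe : pr i eta = eta by apply: pr_id.
have er1 : nr (eta - z0) < r1 by move: er; rewrite !lt_min => /and3P[].
have hck : vdiff (c k) (pr i eta) by rewrite pe; apply: cd.
have hcp : vdiff (fun y => c k (pr i y)) eta.
  by apply: (vdiff_comp (X := pr i)) => // j; exact: vdiff_pr.
have [A hA] := vdiffD hcp (vdiffM (vdiff_cst (c k.+1 eta) eta) (vdiff_coord i eta)).
(* At a point of the slice [F1] is [c k] plus [c k.+1] times the i-th coordinate, up to a quadratic
   error from the expansion with two more terms; [l1] freezes [c k.+1] at the point. *)
exists A.
have cc : ctn (c k.+1) eta by apply/vdiff_ctn/cd.
have l1 : lito (fun v : V => (c k.+1 (pr i (eta + v)) - c k.+1 eta) * v 0 i).
  apply: (@lito_small R n (fun v => v 0 i) _ 1 1) => // [v _|e e1]; first by rewrite mul1r nr_coord.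
  have [d' d0' hd'] := cc e e1; exists d' => // v hv; apply/ltW/hd'.
  by rewrite prD pe addrC addKr; exact: le_lt_trans (pr_le _ _) hv.
have r20' : 0 < r / 2 by rewrite divr_gt0.
have l2 : lito (fun v => F1 (eta + v) - c k (pr i (eta + v)) - c k.+1 (pr i (eta + v)) * v 0 i).
  apply: (@lito_quad R n _ `|B2| (r / 2) r20') => v hv.
  have yr : nr (eta + v - z0) < r.
    have -> : eta + v - z0 = (eta - z0) + v by rewrite addrAC.
    by apply: le_lt_trans (nrD _ _) _; lra.
  have yi : (eta + v) 0 i = v 0 i by rewrite mxE e0 add0r.
  rewrite /F1 yi; have [v0|v0] := eqVneq (v 0 i) 0.
    by rewrite v0 mulr0 subr0 subrr nr0 mulr_ge0 ?exprn_ge0 ?nr_ge0.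
  have := coordr _ yr; rewrite yi => vr.
  have p1 : nr (pr i (eta + v) - z0) < r1 by move: (prz _ yr); rewrite !lt_min => /and3P[].
  have p2 : nr (v 0 i) < r1 by move: vr; rewrite !lt_min => /and3P[].
  have [_] := hB2 _ _ p1 p2.
  have -> : pr i (eta + v) + v 0 i *: delta_mx 0 i = eta + v by rewrite -yi -prE.
  rewrite !big_ord_recr /= big1 ?add0r => [h|l _]; last by rewrite c0 ?mul0r ?pr_i //; exact: prz.
  have vk : v 0 i ^+ k != 0 by rewrite expf_neq0.
  have nk : 0 < nr (v 0 i ^+ k) by rewrite nr_gt0.
  rewrite -(ler_pM2r nk) -nrM.
  have -> : (F (eta + v) / v 0 i ^+ k - c k (pr i (eta + v)) - c k.+1 (pr i (eta + v)) * v 0 i) * v 0 i ^+ k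
     = F (eta + v) - (c k (pr i (eta + v)) * v 0 i ^+ k + c k.+1 (pr i (eta + v)) * v 0 i ^+ k.+1).
    by rewrite exprS; field.
  apply: le_trans h _; rewrite -[k.+2]/(2 + k)%N exprD mulrA nrX.
  rewrite ler_wpM2r ?exprn_ge0 ?nr_ge0 //.
  apply: le_trans (_ : `|B2| * nr (v 0 i) ^+ 2 <= _).
    by rewrite ler_wpM2r ?exprn_ge0 ?nr_ge0 ?ler_norm.
  by rewrite ler_wpM2l // lerXn2r ?nnegrE ?nr_ge0 ?nr_coord.
apply: lito_eq (litoD l1 (litoD l2 hA)) => v /=.
have -> : F1 eta = c k (pr i eta) by rewrite /F1 e0 eqxx.
rewrite [(eta + v) 0 i]mxE e0 mulr0 addr0 add0r; ring.
Qed.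
End InverseFunction.

(** * Functions of class C^k *)

Section RealDerivative.
Variable R : realType.
Lemma derive1_eps (f : R -> R) a : derivable f a 1 ->
  forall e, 0 < e -> exists2 d : R, 0 < d & forall t, `|t| < d -> `|f (t + a) - f a - t * derive1 f a| <= e * `|t|.
Proof.
move=> hf e e0.
have hc : h^-1 *: (f (h + a) - f a) @[h --> 0^'] --> derive1 f a.
  rewrite derive1E; have := hf; rewrite /derivable => /cvg_ex[l hl].
  have hl' : h^-1 *: (f (h + a) - f a) @[h --> 0^'] --> l.
    by apply: cvg_trans hl; apply: near_eq_cvg; near=> h; rewrite /= [h *: 1]mulr1.
  have -> // : 'D_1 f a = l.
  rewrite /derive; apply: cvg_lim => //.
move/cvgrPdist_le/(_ e e0) : hc => [d /= d0 hd]; exists d => // t ht.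
have [->|t0] := eqVneq t 0; first by rewrite add0r mul0r subr0 subrr normr0 mulr0.
have := hd t; rewrite /ball_ /= sub0r normrN => /(_ ht t0) h.
have -> : f (t + a) - f a - t * derive1 f a = t * (t^-1 * (f (t + a) - f a) - derive1 f a).
  by rewrite mulrBr mulrA mulfV // mul1r.
by rewrite normrM mulrC ler_wpM2r // distrC.
Unshelve. all: by end_near.
Qed.

Lemma derive1_val (f : R -> R) (l : R) :
  (forall e, 0 < e -> exists2 d : R, 0 < d & forall t, `|t| < d -> `|f t - f 0 - t * l| <= e * `|t|) ->
  derive1 f 0 = l.
Proof.
move=> h; apply: cvg_lim => //; apply/cvgrPdist_le => e e0.
have [d d0 hd] := h e e0; exists d; first exact: d0.
move=> t /=; rewrite sub0r normrN => ht t0.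
rewrite addr0 [_ *: _]/(t^-1 * _).
have -> : l - t^-1 * (f t - f 0) = - (t^-1 * (f t - f 0 - t * l)).
  by rewrite [in RHS]mulrBr mulrA mulVf // mul1r opprB.
by rewrite normrN normrM normfV mulrC ler_pdivrMr ?normr_gt0 //; exact: hd.
Qed.
End RealDerivative.

Section Smooth.
Variables (R : realType) (n : nat).
Local Notation C := (Cplx R).
Local Notation V := 'rV[C]_n.+1.
Implicit Types (f F : V -> C) (x v A B : V) (U W : set V) (k : nat).

(* Complex-valued counterpart of [Ck], with Wirtinger derivatives. *)
Fixpoint smooth k U F : Prop := if k is k'.+1 then
    exists A B : V -> V, (forall x, U x -> wd F x (A x) (B x)) /\
      forall j, smooth k' U (fun x => A x 0 j) /\ smooth k' U (fun x => B x 0 j)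
  else forall x, U x -> ctn F x.

Lemma smooth_ctn k U F : smooth k U F -> forall x, U x -> ctn F x.
Proof. by case: k => [//|k] [A [B [h _]]] x /h /wd_ctn. Qed.
Lemma smooth_S k U F : smooth k.+1 U F -> smooth k U F.
Proof.
elim: k F => [|k IH] F; first by move=> h; exact: (smooth_ctn h).
move=> [A [B [h hj]]]; exists A, B; split=> // j; have [h1 h2] := hj j.
by split; apply: IH.
Qed.
Lemma smooth_le k l U F : (l <= k)%N -> smooth k U F -> smooth l U F.
Proof.
move=> lk; rewrite -(subnK lk); elim: (k - l)%N => [//|i IH].
by rewrite addSn => /smooth_S.
Qed.
Lemma smooth_ext k U F F' : (forall x, F x = F' x) -> smooth k U F -> smooth k U F'.
Proof. by move=> e; have -> : F = F' by apply/funext. Qed.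
Lemma smooth_cst k U c : smooth k U (fun=> c).
Proof.
elim: k c => [|k IH] c; first by move=> x _; exact: cont_cst.
exists (fun=> 0), (fun=> 0); split=> [x _|j]; first exact: wd_cst.
by split; exact: IH.
Qed.
Lemma smooth_D k U F F' : smooth k U F -> smooth k U F' -> smooth k U (fun x => F x + F' x).
Proof.
elim: k F F' => [|k IH] F F'; first by move=> h h' x Ux; exact: (contD (h _ Ux) (h' _ Ux)).
move=> [A [B [h hj]]] [A' [B' [h' hj']]].
exists (fun x => A x + A' x), (fun x => B x + B' x); split=> [x Ux|j]; first exact: (wdD (h _ Ux) (h' _ Ux)).
have [h1 h2] := hj j; have [h3 h4] := hj' j.
by split; [apply: smooth_ext (IH _ _ h1 h3)|apply: smooth_ext (IH _ _ h2 h4)] => x; rewrite mxE.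
Qed.
Lemma smooth_M k U F F' : smooth k U F -> smooth k U F' -> smooth k U (fun x => F x * F' x).
Proof.
elim: k F F' => [|k IH] F F'; first by move=> h h' x Ux; exact: (contM (h _ Ux) (h' _ Ux)).
move=> hF hF'; have [A [B [h hj]]] := hF; have [A' [B' [h' hj']]] := hF'.
exists (fun x => F' x *: A x + F x *: A' x), (fun x => F' x *: B x + F x *: B' x).
split=> [x Ux|j]; first exact: (wdM (h _ Ux) (h' _ Ux)).
have [h1 h2] := hj j; have [h3 h4] := hj' j.
split; [apply: smooth_ext (smooth_D (IH _ _ (smooth_S hF') h1) (IH _ _ (smooth_S hF) h3))|
  apply: smooth_ext (smooth_D (IH _ _ (smooth_S hF') h2) (IH _ _ (smooth_S hF) h4))] => x; by rewrite !mxE.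
Qed.
Lemma smooth_Z k U F c : smooth k U F -> smooth k U (fun x => c * F x).
Proof. by move=> h; exact: (smooth_M (smooth_cst _ _ _) h). Qed.
Lemma smooth_sum k U I (r : seq I) (F : I -> V -> C) : (forall i, smooth k U (F i)) ->
  smooth k U (fun x => \sum_(i <- r) F i x).
Proof.
move=> h; elim: r => [|i r IH].
  by apply: smooth_ext (smooth_cst k U 0) => x; rewrite big_nil.
by apply: smooth_ext (smooth_D (h i) IH) => x; rewrite big_cons.
Qed.
Lemma smooth_J k U F : smooth k U F -> smooth k U (fun x => (F x)^*).
Proof.
elim: k F => [|k IH] F; first by move=> h x Ux; exact: (contJ (h _ Ux)).
move=> [A [B [h hj]]]; exists (fun x => map_mx Num.conj (B x)), (fun x => map_mx Num.conj (A x)).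
split=> [x /h /wdJ //|j]; have [h1 h2] := hj j.
by split; [apply: smooth_ext (IH _ h2)|apply: smooth_ext (IH _ h1)] => x; rewrite mxE.
Qed.
Lemma smooth_hol k U F : vopen U -> hol U F -> smooth k U F.
Proof.
move=> oU; elim: k F => [|k IH] F hF; first by move=> x /hF; exact: vdiff_ctn.
exists (grad F), (fun=> 0); split=> [x /hF /gradP //|j]; split; first by apply: IH; exact: hol_grad.
by apply: smooth_ext (smooth_cst k U 0) => x; rewrite mxE.
Qed.
Lemma smooth_V k U F : (forall x, U x -> F x != 0) -> smooth k U F -> smooth k U (fun x => (F x)^-1).
Proof.
move=> F0; elim: k => [|k IH].
  by move=> h x Ux; exact: (contV (F0 _ Ux) (h _ Ux)).
move=> hF; have [A [B [h hj]]] := hF; have hV := IH (smooth_S hF).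
exists (fun x => - (F x)^-1 ^+ 2 *: A x), (fun x => - (F x)^-1 ^+ 2 *: B x).
split=> [x Ux|j]; first exact: (wdV (F0 _ Ux) (h _ Ux)).
have h2 := smooth_Z (-1) (smooth_M hV hV); have [h3 h4] := hj j.
by split; [apply: smooth_ext (smooth_M h2 h3)|apply: smooth_ext (smooth_M h2 h4)] => x; rewrite mxE expr2 mulN1r.
Qed.

Lemma wd1_ln (x : R) : 0 < x -> wd1 (fun z : C => rc (ln (cre z))) (rc x) (rc (2 * x)^-1) (rc (2 * x)^-1).
Proof.
move=> x0 e e0.
have [hd1 hd2] := is_derive1_ln x0.
have [d d0 hd] := derive1_eps hd1 e0.
exists d => // s hs; have hu := cre_le s.
have := hd (cre s) (le_lt_trans hu hs); rewrite derive1E hd2 => h.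
apply: le_trans (_ : e * `|cre s| <= _); last by rewrite ler_wpM2l // ltW.
apply: le_trans h; rewrite -nr_rc creD cre_rc -mulrDr cre_addJ -rcM -!rcB.
have -> : (2 * x)^-1 * (2 * cre s) = cre s / x by field; rewrite gt_eqF.
by rewrite (addrC x).
Qed.

Lemma wd1_ctn g F x p q : ctn F x -> wd1 g (F x) p q -> ctn (fun y => g (F y)) x.
Proof.
move=> hF hg e e0; have [d d0 hd] := hg 1 ltr01.
have c0 : 0 < 1 + nr p + nr q by rewrite !ltr_pwDl ?nr_ge0.
have [d' d0' hd'] := hF (Num.min d (e / (1 + nr p + nr q))) ltac:(by rewrite lt_min d0 divr_gt0).
exists d' => // y /hd'; rewrite lt_min => /andP[/hd h1 h2].
rewrite [F x + _]addrC subrK in h1; rewrite ltr_pdivlMr // in h2; apply: le_lt_trans h2.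
set s := F y - F x in h1 *; rewrite -(subrK (p * s + q * s^*) (g _ - g _)).
apply: le_trans (nrD _ _) _; apply: le_trans (lerD h1 (nrD _ _)) _.
by rewrite !nrM nrJ; move: (nr s) (nr p) (nr q) => *; lra.
Qed.

Lemma smooth_ln k U (f : V -> R) : (forall x, U x -> 0 < f x) -> smooth k U (fun x => rc (f x)) ->
  smooth k U (fun x => rc (ln (f x))).
Proof.
move=> f0; case: k => [|k] hf.
  by move=> x Ux; exact: (wd1_ctn (hf x Ux) (wd1_ln (f0 _ Ux))).
have [A [B [h hj]]] := hf.
exists (fun x => rc (2 * f x)^-1 *: A x + rc (2 * f x)^-1 *: map_mx Num.conj (B x)),
  (fun x => rc (2 * f x)^-1 *: B x + rc (2 * f x)^-1 *: map_mx Num.conj (A x)).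
split=> [x Ux|j]; first exact: (wd_outer (h _ Ux) (wd1_ln (f0 _ Ux))).
have h1 : smooth k U (fun x => rc (2 * f x)^-1).
  apply: smooth_ext (smooth_Z (rc 2^-1) (smooth_V (F := fun x => rc (f x)) _ (smooth_S hf))) => [x|x Ux].
    by rewrite invfM rcM (rcV (f x)).
  by rewrite -nr_gt0 nr_rc normr_gt0 gt_eqF // f0.
have [h2 h3] := hj j.
by split; [apply: smooth_ext (smooth_D (smooth_M h1 h2) (smooth_M h1 (smooth_J h3)))|
  apply: smooth_ext (smooth_D (smooth_M h1 h3) (smooth_M h1 (smooth_J h2)))] => x; rewrite !mxE.
Qed.

Lemma smooth_comp k U W F (G : V -> V) : vopen W -> (forall x, W x -> U (G x)) ->
  (forall j, hol W (fun x => G x 0 j)) -> smooth k U F -> smooth k W (fun x => F (G x)).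
Proof.
move=> oW GU hG; elim: k F => [|k IH] F.
  move=> h x Wx; have hg : ctn G x.
    move=> e e0.
    have [||d d0 hd] := @fin_radius R 'I_n.+1 (fun (j : 'I_n.+1) d => forall y, nr (y - x) < d -> nr (G y 0 j - G x 0 j) <= e / 2).
    - by move=> j d d' _ dd h' y hy; apply: h'; apply: lt_le_trans dd.
    - move=> j; have [d d0 hd] := vdiff_ctn (hG j _ Wx) (e := e / 2) ltac:(by rewrite divr_gt0).
      by exists d => // y /hd /ltW.
    exists d => // y hy; apply: le_lt_trans (_ : e / 2 < _); last by lra.
    by apply: nr_rV => [|j]; [rewrite divr_ge0 // ltW|rewrite !mxE; exact: hd].
  exact: (ctn_comp hg (h _ (GU _ Wx))).
move=> [A [B [h hj]]].
exists (fun x => \sum_j A (G x) 0 j *: grad (fun x => G x 0 j) x),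
  (fun x => \sum_j B (G x) 0 j *: map_mx Num.conj (grad (fun x => G x 0 j) x)).
split=> [x Wx|l].
  by apply: (wd_comp (X := G)) (h _ (GU _ Wx)) _ => j; apply: gradP; exact: hG.
have hgr j : smooth k W (fun x => grad (fun x => G x 0 j) x 0 l).
  by apply: smooth_hol => //; apply: hol_grad.
split.
- apply: smooth_ext (smooth_sum (index_enum 'I_n.+1) (fun j => smooth_M (IH _ (hj j).1) (hgr j))) => x.
  by rewrite summxE; apply: eq_bigr => j _; rewrite mxE.
- apply: smooth_ext (smooth_sum (index_enum 'I_n.+1) (fun j => smooth_M (IH _ (hj j).2) (smooth_J (hgr j)))) => x.
  by rewrite summxE; apply: eq_bigr => j _; rewrite !mxE.
Qed.

Lemma curve_eps (f : V -> R) v z : derivable (real_curve f v z) 0 1 ->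
  forall e, 0 < e -> exists2 d : R, 0 < d & forall t, `|t| < d ->
    `|f (z + rc t *: v) - f z - t * dirD v f z| <= e * `|t|.
Proof.
move=> h e e0; have [d d0 hd] := derive1_eps h e0; exists d => // t /hd.
by rewrite addr0 /real_curve -/(rc t) -/(rc 0) rc0 scale0r addr0.
Qed.

Lemma dirDC_wd F z A B v : wd F z A B -> dirD v (fun w => cre (F w)) z = cre (wform A B v) /\
  dirD v (fun w => cim (F w)) z = cim (wform A B v).
Proof.
move=> h; have wlt t : wform A B (rc t *: v) = rc t * wform A B v.
  by rewrite wlZ rcJ -mulrDr -[v in RHS]scale1r wlZ cj1 !mul1r.
split; apply: derive1_val => e e0; have [d d0 hd] := wd_line v h e0; exists d => // t ht.
- have := hd (rc t); rewrite nr_rc => /(_ ht) h1; apply: le_trans h1; rewrite /real_curve.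
  rewrite -/(rc t) -/(rc 0) rc0 scale0r addr0; apply: le_trans (cre_le _); rewrite !creB.
  by rewrite wlt creM cre_rc cim_rc mul0r subr0.
- have := hd (rc t); rewrite nr_rc => /(_ ht) h1; apply: le_trans h1; rewrite /real_curve.
  rewrite -/(rc t) -/(rc 0) rc0 scale0r addr0; apply: le_trans (cim_le _); rewrite !cimB.
  by rewrite wlt cimM cre_rc cim_rc mul0r addr0.
Qed.

Lemma dz_wd F z A B j : wd F z A B -> dz j F z = A 0 j /\ dzbar j F z = B 0 j.
Proof.
move=> h; have hv v : dirDC v F z = wform A B v.
  by have [h1 h2] := dirDC_wd v h; apply: c_eq; [exact: h1|exact: h2].
have ii : 'i%R * 'i%R = -1 :> C by rewrite -expr2 sqrCi.
have t2 : (2 : C) != 0 by rewrite pnatr_eq0.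
rewrite /dz /dzbar !hv wlZ cj_i !wform_delta ![(0 : V) 0 j]mxE add0r addr0 mulNr mulrBr !mulrA ii.
move: (A 0 j) (B 0 j) => a b.
by split; apply: (mulIf t2); rewrite divfK //; ring.
Qed.

Lemma real_step_alg (K : comPzRingType) (p q D E t s a : K) :
  p - t * a * E - (q - s * a * E) = (p - q - (t - s) * a * D) + (t - s) * a * (D - E).
Proof. by ring. Qed.
Lemma real_step (f : V -> R) x (b : V) (d e a : R) y :
  (forall z, nr (z - x) < d -> derivable (real_curve f b z) 0 1 /\ `|dirD b f z - dirD b f x| <= e) ->
  nr b <= 1 -> nr (y - x) + `|a| < d ->
  `|f (y + rc a *: b) - f y - a * dirD b f x| <= e * `|a|.
Proof.
move=> hb nb ha.
pose u s := rc (f (y + rc (s * a) *: b) - s * a * dirD b f x).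
have -> : `|f (y + rc a *: b) - f y - a * dirD b f x| = nr (u 1 - u 0).
  rewrite /u -rcB nr_rc !mul1r !mul0r rc0 scale0r addr0 subr0.
  by congr (`| _ |); ring.
apply: mean_value_ineq => s /andP[s0 s1] e' e0'.
pose z := y + rc (s * a) *: b.
have hz : nr (z - x) < d.
  have -> : z - x = (y - x) + rc (s * a) *: b by rewrite /z addrAC.
  apply: le_lt_trans (nrD _ _) _; apply: le_lt_trans ha; rewrite lerD2l nrZ nr_rc normrM ger0_norm //.
  have : s * `|a| <= `|a| by rewrite ler_piMl.
  have := ler_wpM2l (mulr_ge0 s0 (normr_ge0 a)) nb; lra.
have [hz1 hz2] := hb _ hz; have a0 : 0 < `|a| + 1 by rewrite ltr_wpDl.
have [d' d0' hd'] := curve_eps hz1 (e := e' / (`|a| + 1)) ltac:(by rewrite divr_gt0).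
exists (d' / (`|a| + 1)); first by rewrite divr_gt0.
move=> t _; rewrite ltr_pdivlMr // => ht.
have hta : `|(t - s) * a| < d'.
  by rewrite normrM; apply: le_lt_trans ht; rewrite ler_wpM2l // lerDl.
have := hd' _ hta.
have -> : z + rc ((t - s) * a) *: b = y + rc (t * a) *: b.
  by rewrite /z -addrA -scalerDl -rcD; congr (_ + rc _ *: _); ring.
move=> h; rewrite /u -rcB nr_rc -/z (real_step_alg _ _ (dirD b f z)).
apply: le_trans (ler_normD _ _) _; rewrite [leRHS]mulrDl addrC; apply: lerD.
  by rewrite !normrM; have := ler_wpM2l (mulr_ge0 (normr_ge0 (t - s)) (normr_ge0 a)) hz2; lra.
apply: le_trans h _; rewrite normrM mulrAC ler_pdivrMr //.
have := normr_ge0 (t - s) => h1; have := mulr_ge0 (ltW e0') h1; lra.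
Qed.

Lemma real_steps (f : V -> R) x (I : Type) (r : seq I) (a : I -> R) (b : I -> V) (d e : R) y :
  (forall i z, nr (z - x) < d -> derivable (real_curve f (b i) z) 0 1 /\ `|dirD (b i) f z - dirD (b i) f x| <= e) ->
  (forall i, nr (b i) <= 1) -> nr (y - x) + \sum_(i <- r) `|a i| < d ->
  `|f (y + \sum_(i <- r) rc (a i) *: b i) - f y - \sum_(i <- r) a i * dirD (b i) f x| <= e * \sum_(i <- r) `|a i|.
Proof.
move=> hb nb; elim: r y => [|i r IH] y.
  by rewrite !big_nil => _; rewrite addr0 subrr subr0 normr0 mulr0.
rewrite !big_cons addrA => h.
have S0 : 0 <= \sum_(i <- r) `|a i| by apply: sumr_ge0.
have h1 : nr (y - x) + `|a i| < d by apply: le_lt_trans h; rewrite lerDl.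
have h2 : nr (y + rc (a i) *: b i - x) + \sum_(i <- r) `|a i| < d.
  apply: le_lt_trans h; rewrite lerD2r addrAC; apply: le_trans (nrD _ _) _.
  by rewrite lerD2l nrZ nr_rc ler_piMr.
have := IH _ h2; have := real_step (hb i) (nb i) h1; rewrite addrA mulrDr.
move: (f (_ + _ + _)) (f (_ + _)) (f y) (a i * dirD _ f x) (\sum_(j <- r) a j * dirD _ f x) => p q q' u v h3 h4.
apply: le_trans (lerD h3 h4); apply: le_trans (ler_normD _ _).
by have -> : p - q' - (u + v) = q - q' - u + (p - q - v) by ring.
Qed.

(** Continuity of the directional derivatives gives total differentiability: the increment is split
    along the 2(n+1) real coordinate directions, and [real_steps] compares each step with the
    derivative at [x]. The real partial derivatives are then recombined into Wirtinger
    coefficients. *)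
Lemma Ck_wd U (f : V -> R) : vopen U -> (forall v, (forall z, U z -> derivable (real_curve f v z) 0 1) /\
    forall z, U z -> ctn (fun z => rc (dirD v f z)) z) ->
  forall x, U x -> wd (fun x => rc (f x)) x
    (\row_j (rc 2^-1 * rc (dirD (delta_mx 0 j) f x) - 'i%R * (rc 2^-1 * rc (dirD ('i%R *: delta_mx 0 j) f x))))
    (\row_j (rc 2^-1 * rc (dirD (delta_mx 0 j) f x) + 'i%R * (rc 2^-1 * rc (dirD ('i%R *: delta_mx 0 j) f x)))).
Proof.
move=> oU hD x Ux e e0.
pose b (p : 'I_n.+1 * bool) : V := (if p.2 then 1 else 'i%R) *: delta_mx 0 p.1.
pose K : R := 2 * n.+1%:R; have K0 : 0 < K by rewrite mulr_gt0.
have [d0 d00 hd0] := oU _ Ux.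
have [||d1 d10 hd1] := @fin_radius R ('I_n.+1 * bool)%type (fun p d => forall z, nr (z - x) < d -> `|dirD (b p) f z - dirD (b p) f x| <= e / K).
- by move=> p d d' _ dd h z hz; apply: h; exact: lt_le_trans dd.
- move=> p; have [d d0' hd] := (hD (b p)).2 _ Ux (e / K) ltac:(by rewrite divr_gt0).
  by exists d => // z /hd; rewrite -rcB nr_rc => /ltW.
pose d := Num.min d0 d1; have dp : 0 < d by rewrite lt_min d00.
exists (d / K); first by rewrite divr_gt0.
move=> v; rewrite ltr_pdivlMr // => hv.
pose a (p : 'I_n.+1 * bool) := if p.2 then cre (v 0 p.1) else cim (v 0 p.1).
have sv : \sum_p rc (a p) *: b p = v.
  rewrite -(pair_bigA _ (fun j c => rc (a (j, c)) *: b (j, c))) /= [RHS]row_sum_delta.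
  by apply: eq_bigr => j _; rewrite big_bool /a /b /= !scalerA -scalerDl mulr1 [v 0 j in RHS]cE [_ * 'i%R]mulrC.
have sa : \sum_p `|a p| <= nr v * K.
  rewrite /K mulrA; apply: le_trans (_ : \sum_(p : 'I_n.+1 * bool) nr v <= _).
    apply: ler_sum => p _; apply: le_trans (nr_coord v p.1); rewrite /a.
    by case: ifP => _; [exact: cre_le|exact: cim_le].
  by rewrite sumr_const card_prod card_ord card_bool -[leLHS]mulr_natr natrM -mulrA [2 * _]mulrC.
have := @real_steps f x _ (index_enum ('I_n.+1 * bool)%type) a b d (e / K) x.
rewrite sv subrr nr0 add0r => h.
have {}h : `|f (x + v) - f x - \sum_p a p * dirD (b p) f x| <= e / K * \sum_p `|a p|.
  apply: h => [p z|p|].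
  - rewrite lt_min => /andP[/hd0 Uz z1]; split; first exact: (hD _).1.
    exact: hd1.
  - by rewrite /b nrZ nr_delta mulr1; case: ifP => _; rewrite ?nr1 ?nr_i.
  - exact: le_lt_trans hv.
apply: le_trans (_ : e / K * (nr v * K) <= _); last first.
  by rewrite [nr v * K]mulrC mulrA divfK // gt_eqF.
apply: le_trans (ler_wpM2l _ sa); last by rewrite divr_ge0 // ltW.
apply: le_trans h; rewrite -[leRHS]nr_rc !rcB.
suff -> : wform (\row_j (rc 2^-1 * rc (dirD (delta_mx 0 j) f x) - 'i%R * (rc 2^-1 * rc (dirD ('i%R *: delta_mx 0 j) f x)))) (\row_j (rc 2^-1 * rc (dirD (delta_mx 0 j) f x) + 'i%R * (rc 2^-1 * rc (dirD ('i%R *: delta_mx 0 j) f x)))) v = rc (\sum_p a p * dirD (b p) f x) by [].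
rewrite rc_sum -(pair_bigA _ (fun j c => rc (a (j, c) * dirD (b (j, c)) f x))) /=.
apply: eq_bigr => j _; rewrite big_bool /a /b /= scale1r !mxE.
move: (dirD _ f x) (dirD _ f x) => p q.
apply: c_eq; rewrite !(creD, cimD, creB, cimB, creN, cimN, creM, cimM, cre_i, cim_i, cre_rc, cim_rc, creJ, cimJ); by field.
Qed.

Lemma Ck_smooth k U (f : V -> R) : vopen U -> Ck k U f -> smooth k U (fun x => rc (f x)).
Proof.
move=> oU; elim: k f => [|k IH] f.
  move=> [h _] x /h /cont_nrR hx e /hx[d d0 hd]; exists d => // y /hd.
  by rewrite -rcB nr_rc.
move=> [_ h].
exists (fun x => \row_j (rc 2^-1 * rc (dirD (delta_mx 0 j) f x) - 'i%R * (rc 2^-1 * rc (dirD ('i%R *: delta_mx 0 j) f x)))),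
  (fun x => \row_j (rc 2^-1 * rc (dirD (delta_mx 0 j) f x) + 'i%R * (rc 2^-1 * rc (dirD ('i%R *: delta_mx 0 j) f x)))).
split=> [|j].
  apply: Ck_wd => // v; split; first exact: (h v).1.
  by apply: (@smooth_ctn k); apply: IH; exact: (h v).2.
have h1 := IH _ (h (delta_mx 0 j)).2; have h2 := IH _ (h ('i%R *: delta_mx 0 j)).2.
split.
- apply: smooth_ext (smooth_D (smooth_Z (rc 2^-1) h1) (smooth_Z (- 'i%R * rc 2^-1) h2)) => x.
  by rewrite mxE !mulNr mulrA.
- apply: smooth_ext (smooth_D (smooth_Z (rc 2^-1) h1) (smooth_Z ('i%R * rc 2^-1) h2)) => x.
  by rewrite mxE mulrA.
Qed.

End Smooth.

(** * Plurisubharmonicity and sub-mean values *)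

Section SubMean.
Variable R : realType.
Local Notation C := (Cplx R).
Implicit Types (v : R -> C) (u : C -> C).

Lemma dsum_sum k v : dsum k v = (\sum_(0 <= j < 2 ^ k) v (j%:R / 2 ^+ k)) / 2 ^+ k.
Proof.
elim: k v => [|k IH] v /=; first by rewrite expn0 big_nat1 expr0 !divr1.
rewrite !IH -mulrDl -mulrA -invfM -exprSr; congr (_ / _).
have -> : (2 ^ k.+1 = 2 ^ k + 2 ^ k)%N by rewrite expnS mul2n addnn.
rewrite [RHS](big_cat_nat (n := 2 ^ k)) ?leq_addr //=; congr (_ + _).
  by apply: eq_bigr => j _; congr v; rewrite exprSr invfM mulrA.
rewrite -{2}[(2 ^ k)%N]add0n big_addn addnK; apply: eq_bigr => j _; congr v.
by rewrite natrD natrX exprS; field; rewrite expf_neq0.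
Qed.

Lemma dsum_shift k v s : (forall s, v (s + 1) = v s) ->
  dsum k (fun t => v (t + (2 ^+ k)^-1 + s)) = dsum k (fun t => v (t + s)).
Proof.
move=> hv; rewrite !dsum_sum; congr (_ / _).
have e j : j%:R / 2 ^+ k + (2 ^+ k)^-1 + s = j.+1%:R / 2 ^+ k + s :> R.
  by rewrite -[j.+1%:R]natr1 mulrDl mul1r.
under eq_bigr => j _ do rewrite e.
have p0 : (0 < 2 ^ k)%N by rewrite expn_gt0.
rewrite -(prednK p0) big_nat_recr //= [RHS]big_nat_recl //= addrC prednK //; congr (_ + _).
by rewrite natrX divff ?expf_neq0 // mul0r add0r addrC hv.
Qed.

Lemma dsum_shiftn k v j : (forall s, v (s + 1) = v s) ->
  dsum k (fun t => v (t + j%:R / 2 ^+ k)) = dsum k v.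
Proof.
move=> hv; elim: j => [|j IH]; first by apply: dsum_eq => s _; rewrite mul0r addr0.
rewrite -IH -(dsum_shift k (j%:R / 2 ^+ k) hv); apply: dsum_eq => s _.
by rewrite -[j.+1%:R]natr1 mulrDl mul1r addrAC addrA.
Qed.

Lemma near_dyadic k (s : R) : 0 <= s -> exists2 j : nat, j%:R / 2 ^+ k <= s & s - j%:R / 2 ^+ k <= 2^-1 ^+ k.
Proof.
move=> s0; have p0 : 0 < 2 ^+ k :> R by rewrite exprn_gt0.
have /andP[h1 h2] := truncn_itv (mulr_ge0 s0 (ltW p0)).
exists (Num.truncn (s * 2 ^+ k)); first by rewrite ler_pdivrMr.
rewrite exprVn -[leRHS]mul1r ler_pdivlMr // mulrBl divfK ?gt_eqF //.
move: h2; rewrite -natr1; lra.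
Qed.

Lemma dsumB k v v' : dsum k v - dsum k v' = dsum k (fun s => v s - v' s).
Proof.
have -> : dsum k (fun s => v s - v' s) = dsum k (fun s => v s + (-1) * v' s).
  by apply: dsum_eq => s _; rewrite mulN1r.
by rewrite dsumD dsumZ mulN1r.
Qed.

(** Rotations by dyadic angles permute the nodes, and every rotation is close to one of them. Hence
    one [k] serves for all rotations [z] at once. *)
Lemma dsum_rot u : circ u -> forall e, 0 < e -> exists k, forall z, nr z = 1 ->
  nr (dsum k (fun s => u (z * expi s)) - mean u) <= e.
Proof.
move=> hu e e0; have e2 : 0 < e / 2 by rewrite divr_gt0.
have [N hN] := meanP hu e2.
(* The angles [s + t] run up to 2. Passing to the square of the variable halves them and brings them
   back into [0, 1], where uniform continuity is available. *)
have hu2 : circ (fun z => u (z ^+ 2)).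
  by move=> z hz; apply: (ctn_comp (contX 2 (@cont_id R C z)) (hu _ _)); rewrite nrX hz expr1n.
have [d d0 hd] := circ_ucont hu2 e2.
have [k hk] := expr_half_lt d0.
exists (maxn N k) => z hz; set K := maxn N k.
have [s /andP[s0 s1] ez] := expi_surj hz.
have [j j1 j2] := near_dyadic K s0.
have j0 : 0 <= j%:R / 2 ^+ K :> R by rewrite divr_ge0 // exprn_ge0.
have per t : u (expi (t + 1)) = u (expi t) by rewrite expiD expi1 mulr1.
rewrite -(subrK (dsum K (fun t => u (expi (t + j%:R / 2 ^+ K)))) (dsum K (fun s => u (z * expi s)))) -addrA.
apply: le_trans (nrD _ _) _; rewrite [e]splitr; apply: lerD; last first.
  rewrite (dsum_shiftn K j (v := fun t => u (expi t)) per); apply: hN; exact: leq_maxl.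
rewrite dsumB; apply: dsum_le => t /andP[t0 t1].
have := hd ((s + t) / 2) ((t + j%:R / 2 ^+ K) / 2).
have tw (x : R) : x / 2 *+ 2 = x by rewrite -mulr_natr divfK.
rewrite !expiX !tw (expiD s t) -ez; apply; [lra|lra|].
have -> : (s + t) / 2 - (t + j%:R / 2 ^+ K) / 2 = (s - j%:R / 2 ^+ K) / 2 by ring.
rewrite ger0_norm; last by lra.
have := hk K (leq_maxr _ _); lra.
Qed.

(* Infinitesimal form of the sub-mean value property along the four directions 1, i, -1, -i. *)
Definition cross (u : C -> R) t := forall e, 0 < e -> exists2 d : R, 0 < d & forall h, nr h < d ->
  4 * u t - e * nr h ^+ 2 <= u (t + h) + u (t + 'i%R * h) + u (t - h) + u (t - 'i%R * h).
Definition ctnR (u : C -> R) t := forall e, 0 < e -> exists2 d : R, 0 < d & forall y, nr (y - t) < d -> `|u y - u t| < e.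

Lemma parallelogram (t h : C) :
  nr (t + h) ^+ 2 + nr (t + 'i%R * h) ^+ 2 + nr (t - h) ^+ 2 + nr (t - 'i%R * h) ^+ 2 = 4 * nr t ^+ 2 + 4 * nr h ^+ 2.
Proof. by rewrite !nr_sqrE !(creD, cimD, creN, cimN, creM, cimM, cre_i, cim_i); ring. Qed.

(** At an interior maximum of u + e |z|^2 the parallelogram identity makes the four-point sum of [u]
    fall below 4 u(t) by at least 4 e |h|^2, whereas [cross] allows a deficit of only e |h|^2. *)
Lemma cross_max (u : C -> R) : (forall t, nr t < 1 -> cross u t) -> (forall t, nr t <= 1 -> ctnR u t) ->
  forall B, (forall z, nr z = 1 -> u z <= B) -> u 0 <= B.
Proof.
move=> hc hu B hB; apply/ler_addgt0Pl => e e0.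
pose v z := - (u z + e * nr z ^+ 2).
have [|t ht hm] := @disc_min R v 1 ler01.
  move=> z hz e' e0'; have [d d0 hd] := hu z hz (e' / 2) ltac:(by rewrite divr_gt0).
  have c0 : 0 < 2 * e * (2 * nr z + 1) by rewrite !mulr_gt0 // ltr_wpDl // mulr_ge0 // nr_ge0.
  exists (Num.min (Num.min d 1) (e' / (2 * e * (2 * nr z + 1)))); first by rewrite !lt_min d0 ltr01 divr_gt0.
  move=> y; rewrite !lt_min ltr_pdivlMr // => /andP[/andP[/hd h1 h2] h3].
  have hy := nr_sub y z; have hy' := nr_sub z y; rewrite nrBC in hy'.
  have n0 := nr_ge0 y; have n1 := nr_ge0 z; have n2 := nr_ge0 (y - z).
  have : `|nr y ^+ 2 - nr z ^+ 2| <= nr (y - z) * (2 * nr z + 1).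
    rewrite subr_sqr normrM; apply: ler_pM => //.
      by rewrite ler_norml; lra.
    by rewrite ger0_norm ?addr_ge0 //; lra.
  move: h1; rewrite /v !ltr_norml !ler_norml => /andP[h4 h5] /andP[h6 h7].
  have := ler_wpM2l (ltW e0) h6; have := ler_wpM2l (ltW e0) h7; lra.
have [t1|t1] : nr t = 1 \/ nr t < 1 by move: ht; rewrite le_eqVlt => /orP[/eqP|]; [left|right].
  have := hm 0; rewrite nr0 ler01 => /(_ isT); rewrite /v nr0 t1 expr0n /= mulr0 addr0 expr1n mulr1 lerN2 => h.
  by apply: le_trans h _; rewrite addrC lerD2l; exact: hB.
exfalso; have [d d0 hd] := hc t t1 e e0.
pose s := Num.min (d / 2) ((1 - nr t) / 2).
have s0 : 0 < s by rewrite lt_min !divr_gt0 // subr_gt0.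
have sd : s <= d / 2 by rewrite ge_min lexx.
have st : s <= (1 - nr t) / 2 by rewrite ge_min lexx orbT.
have ns : nr (rc s) = s by rewrite nr_rc gtr0_norm.
have nis : nr ('i%R * rc s) = s by rewrite nrM nr_i ns mul1r.
have := hd (rc s) ltac:(rewrite ns; lra); have := parallelogram t (rc s); rewrite ns.
have hl h : nr h = s -> u (t + h) <= u t + e * nr t ^+ 2 - e * nr (t + h) ^+ 2.
  move=> hs; have := hm (t + h) ltac:(by apply: le_trans (nrD _ _) _; rewrite hs; lra).
  by rewrite /v lerN2; lra.
have l1 := hl _ ns; have l2 := hl _ nis; have l3 := hl (- rc s) ltac:(by rewrite nrN).
have l4 := hl (- ('i%R * rc s)) ltac:(by rewrite nrN).
move=> par hh; have e2 := mulr_gt0 e0 (exprn_gt0 2 s0).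
have : e * (nr (t + rc s) ^+ 2 + nr (t + 'i%R * rc s) ^+ 2 + nr (t - rc s) ^+ 2 + nr (t - 'i%R * rc s) ^+ 2) =
   e * (4 * nr t ^+ 2 + 4 * s ^+ 2) by rewrite par.
by lra.
Qed.

Lemma cross_avg (u u' : C -> R) t : cross u t -> cross u' t -> cross (fun t => (u t + u' t) / 2) t.
Proof.
move=> hu hu' e e0; have [d d0 hd] := hu e e0; have [d' d0' hd'] := hu' e e0.
exists (Num.min d d'); first by rewrite lt_min d0.
by move=> h; rewrite lt_min => /andP[/hd h1 /hd' h2]; move: h1 h2; lra.
Qed.
Lemma ctnR_avg (u u' : C -> R) t : ctnR u t -> ctnR u' t -> ctnR (fun t => (u t + u' t) / 2) t.
Proof.
move=> hu hu' e e0; have [d d0 hd] := hu e e0; have [d' d0' hd'] := hu' e e0.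
exists (Num.min d d'); first by rewrite lt_min d0.
move=> h; rewrite lt_min => /andP[/hd h1 /hd' h2]; move: h1 h2; rewrite !ltr_norml; lra.
Qed.

(** The average of [u] over the rotations by dyadic angles still satisfies [cross], equals [u 0] at
    the centre and is within [e] of the circle mean on the boundary by [dsum_rot]. The maximum
    principle [cross_max] then compares the two without any Poisson integral. *)
Lemma sub_mean (u : C -> R) : (forall t, nr t < 1 -> cross u t) -> (forall t, nr t <= 1 -> ctnR u t) ->
  u 0 <= cre (mean (fun z => rc (u z))).
Proof.
move=> hc hu; apply/ler_addgt0Pr => e e0.
have cu : circ (fun z => rc (u z)).
  by move=> z hz e' e0'; have [d d0 hd] := hu z ltac:(by rewrite hz) e' e0'; exists d => // y /hd; rewrite -rcB nr_rc.
have [k hk] := dsum_rot cu e0.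
pose S K (w : R -> C -> R) t := cre (dsum K (fun s => rc (w s t))).
have SS K w t : S K.+1 w t = (S K (fun s => w (s / 2)) t + S K (fun s => w ((1 + s) / 2)) t) / 2.
  by rewrite /S dsumS cre_half creD.
have Sc K w t : (forall s, cross (w s) t) -> cross (S K w) t.
  elim: K w => [|K IH] w hw; first exact: hw.
  have -> : S K.+1 w = (fun t => (S K (fun s => w (s / 2)) t + S K (fun s => w ((1 + s) / 2)) t) / 2) by apply/funext => x.
  by apply: cross_avg; apply: IH => s; apply: hw.
have Su K w t : (forall s, ctnR (w s) t) -> ctnR (S K w) t.
  elim: K w => [|K IH] w hw; first exact: hw.
  have -> : S K.+1 w = (fun t => (S K (fun s => w (s / 2)) t + S K (fun s => w ((1 + s) / 2)) t) / 2) by apply/funext => x.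
  by apply: ctnR_avg; apply: IH => s; apply: hw.
have nt t s : nr (t * expi s) = nr t by rewrite nrM nr_expi mulr1.
have := @cross_max (S k (fun s t => u (t * expi s))) _ _ (cre (mean (fun z => rc (u z))) + e).
have -> : S k (fun s t => u (t * expi s)) 0 = u 0.
  rewrite /S (dsum_eq k (v := fun=> rc (u 0))) ?dsum_cst // => s _; by rewrite mul0r.
apply.
- move=> t ht; apply: Sc => s e' e0'; have [d d0 hd] := hc (t * expi s) ltac:(by rewrite nt) e' e0'.
  exists d => // h hh; have := hd (h * expi s); rewrite nt => /(_ hh).
  by rewrite (mulrA 'i%R h) !(mulrDl _ _ (expi s)) !mulNr.
- move=> t ht; apply: Su => s e' e0'; have [d d0 hd] := hu (t * expi s) ltac:(by rewrite nt) e' e0'.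
  by exists d => // y hy; apply: hd; rewrite -mulrBl nt.
- move=> z hz; rewrite -lerBlDl -creB; apply: le_trans (cre_ler _) _.
  exact: hk.
Qed.

End SubMean.

(** * From the Levi form to sub-mean values *)

Section Levi.
Variables (R : realType) (n : nat).
Local Notation C := (Cplx R).
Local Notation V := 'rV[C]_n.+1.
Implicit Types (x v A B nu : V) (U W : set V) (L : V -> R).

Lemma mean_value_der (f : R -> R) (B : R) : (forall s, 0 <= s <= 1 -> exists2 D, B <= D &
    forall e, 0 < e -> exists2 d : R, 0 < d & forall t, `|t - s| < d -> `|f t - f s - (t - s) * D| <= e * `|t - s|) ->
  B <= f 1 - f 0.
Proof.
move=> h; apply: mean_value_ge => s hs e e0; have [D BD hD] := h s hs.
have [d d0 hd] := hD e e0; exists d => // a b a0 as_ sb b1 h1 h2.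
have := hd a ltac:(rewrite ltr_norml; lra); have := hd b ltac:(rewrite ltr_norml; lra).
rewrite (ger0_norm (_ : 0 <= b - s)) ?subr_ge0 // (ler0_norm (_ : a - s <= 0)) ?subr_le0 //.
rewrite !ler_norml => /andP[h3 _] /andP[_ h4].
have := ler_wpM2r (_ : 0 <= b - a) BD; rewrite subr_ge0 (le_trans as_ sb) => /(_ isT).
by move: h3 h4; lra.
Qed.

(* Both members are Wirtinger coefficients of first and second order; the last clause is semipositivity of the Levi form. *)
Definition levi_at L x (B : V -> V) (Ab Bb : 'I_n.+1 -> V) :=
  (forall j, wd (fun y => B y 0 j) x (Ab j) (Bb j)) /\
  forall nu, 0 <= cre (\sum_k (nu 0 k)^* * wform (Ab k) 0 nu).
Definition levi U L := exists A B : V -> V, (forall x, U x -> wd (fun y => rc (L y)) x (A x) (B x)) /\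
  forall x, U x -> exists Ab Bb, levi_at L x B Ab Bb.

Lemma wd_realJ L x A B v : wd (fun y => rc (L y)) x A B -> wform A B v = rc (2 * cre (wform 0 B v)).
Proof.
move=> h; have [|hA hB] := wd_uniq (wd_near (g := fun y => rc (L y)) _ (wdJ h)) h.
  by exists 1 => // y _; rewrite rcJ.
rewrite -[v in LHS]scale1r wlZ cj1 !mul1r -cre_addJ addrC; congr (_ + _).
rewrite -hA /wform cj_sum; apply: eq_bigr => j _.
by rewrite !mxE cjD !cjM cjK cj0 mul0r addr0 add0r.
Qed.

Lemma wform_rc A B (t : R) v : wform A B (rc t *: v) = rc t * wform A B v.
Proof. by rewrite wlZ rcJ -mulrDr -[v in RHS]scale1r wlZ cj1 !mul1r. Qed.

Lemma err4 (a1 a2 a3 a4 b1 b2 b3 b4 r D1 D2 D3 D4 e p : R) :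
  `|a1 - b1 - r * D1| <= e / 4 * p -> `|a2 - b2 - r * D2| <= e / 4 * p ->
  `|a3 - b3 - r * D3| <= e / 4 * p -> `|a4 - b4 - r * D4| <= e / 4 * p ->
  `|a1 + a2 + a3 + a4 - (b1 + b2 + b3 + b4) - r * (D1 + D2 + D3 + D4)| <= e * p.
Proof. rewrite !ler_norml; lra. Qed.

Lemma cross_alg (e H x1 x2 x3 x4 P u v s b : R) : 0 <= P -> - (e / 4 * H) <= 2 * x4 ->
  - (e / 4 * H) <= 2 * x3 -> - (e / 4 * H) <= 2 * x2 -> - (e / 4 * H) <= 2 * x1 ->
  - (e * H) <= 2 * u + 2 * P + 2 * s * b + 2 * x1 + (2 * v + 2 * P + 2 * s * - b + 2 * x2)
     + (2 * - u + 2 * P + 2 * s * b + 2 * x3) + (2 * - v + 2 * P + 2 * s * - b + 2 * x4).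
Proof. lra. Qed.
Lemma exp_alg (F l l1 l2 l3 l4 f1 f2 f3 f4 E : R) : F * (1 + (l1 - l)) <= f1 ->
  F * (1 + (l2 - l)) <= f2 -> F * (1 + (l3 - l)) <= f3 -> F * (1 + (l4 - l)) <= f4 ->
  F * (4 * l) - E <= F * (l1 + l2 + l3 + l4) -> 4 * F - E <= f1 + f2 + f3 + f4.
Proof. lra. Qed.

(** The sum of the four values is differentiated along the ray s in [0, 1], using the first-order
    data at each point and the expansion of [B] at [x]. Over the directions h, ih, -h, -ih the
    constant part of [B] cancels and so does the part in conj(h)^2; the Levi form, times s |h|^2,
    remains together with a small error. *)
Lemma levi_cross U L x nu : vopen U -> levi U L -> U x ->
  forall e, 0 < e -> exists2 d : R, 0 < d & forall h : C, nr h < d ->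
    4 * L x - e * nr h ^+ 2 <=
      L (x + h *: nu) + L (x + ('i%R * h) *: nu) + L (x - h *: nu) + L (x - ('i%R * h) *: nu).
Proof.
move=> oU [A [B [hA hB]]] Ux e e0; have [Ab [Bb [hb hp]]] := hB _ Ux.
have [r r0 hr] := oU _ Ux.
pose b y := wform 0 (B y) nu.
pose b0 := b x; pose al := \sum_k (nu 0 k)^* * wform (Ab k) 0 nu.
pose be (v : V) := \sum_k (nu 0 k)^* * wform (Ab k) (Bb k) v.
have bE y : b y = \sum_k (nu 0 k)^* * B y 0 k.
  by rewrite /b /wform; apply: eq_bigr => k _; rewrite [(0 : V) 0 k]mxE mul0r add0r mulrC.
have lb : lito (fun v => b (x + v) - b x - be v).
  apply: lito_eq (lito_sum (index_enum 'I_n.+1) (fun k => litoZ (nu 0 k)^* (hb k))) => v.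
  rewrite !bE /be -!sumrB; apply: eq_bigr => k _; rewrite -!mulrBr //.
pose N := nr nu + 1; have N0 : 0 < N by rewrite ltr_wpDl // nr_ge0.
have [d d0 hd] := lb (e / (8 * N)) ltac:(by rewrite divr_gt0 // mulr_gt0).
exists (Num.min r d / N); first by rewrite divr_gt0 // lt_min r0.
move=> h hh; have hN : nr h * N < Num.min r d by rewrite -ltr_pdivlMr.
have hv c : nr c <= nr h -> nr (c *: nu) < r /\ nr (c *: nu) < d.
  move=> hc; have : nr (c *: nu) < Num.min r d.
    apply: le_lt_trans hN; rewrite nrZ; apply: ler_pM; rewrite ?nr_ge0 // /N; lra.
  by rewrite lt_min => /andP[].
pose f (s : R) := L (x + (rc s * h) *: nu) + L (x + (rc s * ('i%R * h)) *: nu) + L (x + (rc s * (- h)) *: nu) + L (x + (rc s * (- ('i%R * h))) *: nu).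
have -> : L (x + h *: nu) + L (x + ('i%R * h) *: nu) + L (x - h *: nu) + L (x - ('i%R * h) *: nu) = f 1.
  by rewrite /f !mul1r !scaleNr.
have -> : 4 * L x = f 0 by rewrite /f !mul0r !scale0r addr0; ring.
rewrite lerBlDr -lerBlDl; suff : - (e * nr h ^+ 2) <= f 1 - f 0 by lra.
apply: mean_value_der => s /andP[s0 s1].
have hs c : nr c = nr h -> nr ((rc s * c) *: nu) < r /\ nr ((rc s * c) *: nu) < d.
  by move=> hc; apply: hv; rewrite nrM nr_rc ger0_norm // hc ler_piMl // nr_ge0.
pose D c := 2 * cre (c^* * b (x + (rc s * c) *: nu)).
have Dc c : nr c = nr h -> forall e, 0 < e -> exists2 d : R, 0 < d & forall t, `|t - s| < d ->
    `|L (x + (rc t * c) *: nu) - L (x + (rc s * c) *: nu) - (t - s) * D c| <= e * `|t - s|.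
  move=> hc e' e0'; have Uy : U (x + (rc s * c) *: nu) by apply: hr; rewrite addrAC subrr add0r; exact: (hs c hc).1.
  have [d' d0' hd'] := wd_line (c *: nu) (hA _ Uy) e0'; exists d' => // t ht.
  have := hd' (rc (t - s)); rewrite nr_rc => /(_ ht); rewrite wform_rc (wd_realJ _ (hA _ Uy)) wlZ wl00 mulr0 add0r -/(b _).
  have -> : x + (rc s * c) *: nu + rc (t - s) *: (c *: nu) = x + (rc t * c) *: nu.
    by rewrite scalerA -addrA -scalerDl -mulrDl -rcD (_ : s + (t - s) = t) //; ring.
  by rewrite -rcM -!rcB nr_rc.
have nic : nr ('i%R * h) = nr h by rewrite nrM nr_i mul1r.
have [nmc nmic] : nr (- h) = nr h /\ nr (- ('i%R * h)) = nr h by rewrite !nrN.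
exists (D h + D ('i%R * h) + D (- h) + D (- ('i%R * h))); last first.
  move=> e' e0'.
  have e4 : 0 < e' / 4 by rewrite divr_gt0.
  have [d1 d10 h1] := Dc _ (erefl _) _ e4; have [d2 d20 h2] := Dc _ nic _ e4.
  have [d3 d30 h3] := Dc _ nmc _ e4; have [d4 d40 h4] := Dc _ nmic _ e4.
  exists (Num.min (Num.min d1 d2) (Num.min d3 d4)); first by rewrite !lt_min d10 d20 d30.
  move=> t; rewrite !lt_min => /andP[/andP[/h1 {}h1 /h2 {}h2] /andP[/h3 {}h3 /h4 {}h4]].
  exact: (err4 h1 h2 h3 h4).
have al0 : 0 <= s * nr h ^+ 2 * cre al by exact: mulr_ge0 (mulr_ge0 s0 (exprn_ge0 2 (nr_ge0 h))) (hp nu).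
pose be2 := \sum_k (nu 0 k)^* * wform 0 (Bb k) nu.
have beE c : be (c *: nu) = c * al + c^* * be2.
  by rewrite /be !mulr_sumr -big_split; apply: eq_bigr => k _; rewrite wlZ /=; ring.
pose E c := b (x + (rc s * c) *: nu) - b0 - be ((rc s * c) *: nu).
have EB c : nr c = nr h -> - (e / 4 * nr h ^+ 2) <= 2 * cre (c^* * E c).
  move=> hc; have /hd h1 := (hs c hc).2.
  have := cre_le (c^* * E c); rewrite nrM nrJ hc ler_norml => /andP[h2 _].
  have : nr h * nr (E c) <= e / 8 * nr h ^+ 2; last by move: h2; lra.
  rewrite [_ ^+ 2]expr2 mulrCA; apply: ler_wpM2l; first exact: nr_ge0.
  apply: le_trans h1 _; rewrite nrZ nrM nr_rc ger0_norm // hc.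
  have -> : e / (8 * N) * (s * nr h * nr nu) = e / 8 * nr h * (s * (nr nu / N)) by field; rewrite gt_eqF.
  rewrite ler_piMr ?mulr_ge0 ?divr_ge0 ?nr_ge0 ?(ltW e0) //.
  rewrite mulr_ile1 // ?divr_ge0 ?nr_ge0 ?(ltW N0) // ler_pdivrMr // mul1r /N lerDl //.
have DE c : nr c = nr h -> D c = 2 * cre (c^* * b0) + 2 * (s * nr h ^+ 2 * cre al) + 2 * s * cre (c^* ^+ 2 * be2) + 2 * cre (c^* * E c).
  move=> hc; have cc : c^* * c = rc (nr h ^+ 2) by rewrite -hc nr_sqr mulrC.
  have -> : s * nr h ^+ 2 * cre al = cre (rc s * (c^* * c) * al).
    by rewrite cc -rcM creM cre_rc cim_rc mul0r subr0.
  have -> : 2 * s * cre (c^* ^+ 2 * be2) = 2 * cre (rc s * (c^* ^+ 2 * be2)).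
    by rewrite [cre (rc s * _)]creM cre_rc cim_rc mul0r subr0 mulrA.
  rewrite /D -!mulrDr -!creD; congr (_ * cre _); rewrite /E beE cjM rcJ; ring.
have := EB _ (erefl _); have := EB _ nic; have := EB _ nmc; have := EB _ nmic.
rewrite !DE //; have ii : 'i%R * 'i%R = -1 :> C by rewrite -expr2 sqrCi.
have -> : cre ((- h)^* * b0) = - cre (h^* * b0) by rewrite cjN mulNr creN.
have -> : cre ((- ('i%R * h))^* * b0) = - cre (('i%R * h)^* * b0) by rewrite cjN mulNr creN.
have -> : cre ((- h)^* ^+ 2 * be2) = cre (h^* ^+ 2 * be2) by rewrite cjN sqrrN.
have -> : cre ((- ('i%R * h))^* ^+ 2 * be2) = - cre (h^* ^+ 2 * be2).
  by rewrite cjN sqrrN cjM cj_i exprMn sqrrN sqrCi mulN1r mulNr creN.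
have -> : cre (('i%R * h)^* ^+ 2 * be2) = - cre (h^* ^+ 2 * be2).
  by rewrite cjM cj_i exprMn sqrrN sqrCi mulN1r mulNr creN.
exact: cross_alg.
Qed.

Lemma wdN f x A B : wd f x A B -> wd (fun y => - f y) x (- A) (- B).
Proof.
move=> h; apply: lito_eq (litoZ (-1) h) => v.
have -> : wform (- A) (- B) v = - wform A B v.
  by rewrite /wform -sumrN; apply: eq_bigr => j _; rewrite !mxE; ring.
by ring.
Qed.

Lemma wform_sum (I : Type) (r : seq I) (c : I -> C) (M : I -> V) v :
  wform (\sum_(i <- r) c i *: M i) 0 v = \sum_(i <- r) c i * wform (M i) 0 v.
Proof.
elim: r => [|i r IH]; first by rewrite !big_nil wl00.
have := wform_lin (M i) (\sum_(i <- r) c i *: M i) 0 0 (c i) 1 v.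
by rewrite !big_cons !scale1r !scaler0 addr0 mul1r IH => ->.
Qed.

(** log |u|^2 is pluriharmonic: its conjugate Wirtinger coefficient is antiholomorphic, so it adds
    to [Bb] but not to the Levi coefficients [Ab]. *)
Lemma levi_log U L (u : V -> C) : vopen U -> hol U u -> (forall x, U x -> u x != 0) ->
  levi U L -> levi U (fun x => ln (nr (u x) ^+ 2) + L x).
Proof.
move=> oU hu u0 [A [B [hA hB]]].
pose A0 x := (u x)^-1 *: grad u x.
exists (fun x => A0 x + A x), (fun x => map_mx Num.conj (A0 x) + B x).
have hl x : U x -> wd (fun y => rc (ln (nr (u y) ^+ 2))) x (A0 x) (map_mx Num.conj (A0 x)).
  move=> Ux; have h1 := gradP (hu _ Ux); have h2 := wdM h1 (wdJ h1).
  have p0 : 0 < nr (u x) ^+ 2 by rewrite exprn_gt0 // nr_gt0 u0.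
  have h3 : wd (fun y => rc (nr (u y) ^+ 2)) x ((u x)^* *: grad u x) (u x *: map_mx Num.conj (grad u x)).
    apply: wd_near (_ : wd (fun y => u y * (u y)^*) x _ _).
      by exists 1 => // y _; rewrite nr_sqr.
    have -> : (u x)^* *: grad u x = (u x)^* *: grad u x + u x *: map_mx Num.conj (0 : V).
      by apply/rowP => j; rewrite !mxE cj0 mulr0 addr0.
    by move: h2; rewrite scaler0 add0r.
  have h4 := wd_outer h3 (wd1_ln p0).
  have uj : (u x)^* != 0 by rewrite fmorph_eq0 u0.
  have pE : rc (2 * nr (u x) ^+ 2)^-1 = (2 * (u x * (u x)^*))^-1 by rewrite rcV rcM nr_sqr -(rc_nat R 2).
  have -> : map_mx Num.conj (A0 x) = rc (2 * nr (u x) ^+ 2)^-1 *: (u x *: map_mx Num.conj (grad u x)) + rc (2 * nr (u x) ^+ 2)^-1 *: map_mx Num.conj ((u x)^* *: grad u x).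
    apply/rowP => j; rewrite !mxE !cjM cjV cjK pE; move: ((grad u x 0 j)^*) (u0 _ Ux) uj.
    by move: (u x) (u x)^* => a b c ha hb; field; rewrite ha hb.
  have -> : A0 x = rc (2 * nr (u x) ^+ 2)^-1 *: ((u x)^* *: grad u x) + rc (2 * nr (u x) ^+ 2)^-1 *: map_mx Num.conj (u x *: map_mx Num.conj (grad u x)).
    apply/rowP => j; rewrite !mxE cjM cjK pE; move: (grad u x 0 j) (u0 _ Ux) uj.
    by move: (u x) (u x)^* => a b c ha hb; field; rewrite ha hb.
  exact: h4.
split=> [x Ux|x Ux].
  by apply: wd_near (wdD (hl _ Ux) (hA _ Ux)); exists 1 => // y _; rewrite rcD.
have [Ab [Bb [hb hp]]] := hB _ Ux.
have ha j : vdiff (fun y => A0 y 0 j) x.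
  apply: vdiff_ext (vdiffM (vdiffV (u0 _ Ux) (hu _ Ux)) (hol_grad j oU hu Ux)) => y.
  by rewrite /A0 mxE.
exists (fun j => map_mx Num.conj 0 + Ab j), (fun j => map_mx Num.conj (grad (fun y => A0 y 0 j) x) + Bb j).
split=> [j|nu].
  by apply: wd_near (wdD (wdJ (gradP (ha j))) (hb j)); exists 1 => // y _; rewrite !mxE.
rewrite (eq_bigr (fun k => (nu 0 k)^* * wform (Ab k) 0 nu)) // => k _; congr (_ * wform _ _ _).
by apply/rowP => j; rewrite !mxE cj0 add0r.
Qed.

Lemma wd_sum (I : Type) (r : seq I) (F : I -> V -> C) x (A B : I -> V) : (forall i, wd (F i) x (A i) (B i)) ->
  wd (fun y => \sum_(i <- r) F i y) x (\sum_(i <- r) A i) (\sum_(i <- r) B i).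
Proof.
move=> h; elim: r => [|i r IH].
  rewrite !big_nil; apply: wd_near (wd_cst 0 x); exists 1 => // y _; by rewrite big_nil.
rewrite !big_cons; apply: wd_near (wdD (h i) IH); exists 1 => // y _; by rewrite big_cons.
Qed.

(** The conjugated Jacobian factors are antiholomorphic and contribute nothing to the Levi
    coefficients, so the Levi form at [nu] becomes that of [L] at the image of [nu]. *)
Lemma levi_comp U W L (G : V -> V) : vopen W -> (forall x, W x -> U (G x)) ->
  (forall j, hol W (fun x => G x 0 j)) -> levi U L -> levi W (fun x => L (G x)).
Proof.
move=> oW GU hG [A [B [hA hB]]].
exists (fun x => \sum_j A (G x) 0 j *: grad (fun x => G x 0 j) x),
  (fun x => \sum_j B (G x) 0 j *: map_mx Num.conj (grad (fun x => G x 0 j) x)).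
have hJ x j : W x -> wd (fun x => G x 0 j) x (grad (fun x => G x 0 j) x) 0 by move=> Wx; apply: gradP; exact: hG.
split=> [x Wx|x Wx].
  by apply: (wd_comp (f := fun y => rc (L y)) (X := G) (hA _ (GU _ Wx))) => j; exact: hJ.
have [Ab [Bb [hb hp]]] := hB _ (GU _ Wx).
pose J j := grad (fun x => G x 0 j).
have hJl j l : wd (fun x => (J j x 0 l)^*) x (map_mx Num.conj 0) (map_mx Num.conj (grad (fun x => J j x 0 l) x)).
  by apply: wdJ; apply: gradP; exact: (hol_grad l oW (hG j) Wx).
have hBj j := wd_comp (f := fun y => B y 0 j) (X := G) (hb j) (fun j => hJ x j Wx).
have hS l := wd_sum (index_enum 'I_n.+1) (fun j => wdM (hBj j) (hJl j l)).
do 2 eexists; split.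
  move=> l; apply: wd_near (hS l); exists 1 => // y _; rewrite summxE; apply: eq_bigr => j _.
  by rewrite !mxE.
(* [xi] is the image of [nu] under the differential of [G]. *)
move=> nu /=; pose xi : V := \row_i wform (J i x) 0 nu.
suff -> : \sum_k (nu 0 k)^* * wform (\sum_i ((J i x 0 k)^* *: (\sum_j Ab i 0 j *: grad (fun x => G x 0 j) x) + B (G x) 0 i *: map_mx Num.conj 0)) 0 nu
   = \sum_k (xi 0 k)^* * wform (Ab k) 0 xi by [].
have e i k : (J i x 0 k)^* *: (\sum_j Ab i 0 j *: grad (fun x => G x 0 j) x) + B (G x) 0 i *: map_mx Num.conj 0 =
   (J i x 0 k)^* *: (\sum_j Ab i 0 j *: grad (fun x => G x 0 j) x).
  by apply/rowP => l; rewrite !mxE cj0 mulr0 addr0.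
under eq_bigr => k _ do (under eq_bigr => i _ do rewrite e; rewrite wform_sum mulr_sumr).
rewrite exchange_big; apply: eq_bigr => i _ /=.
rewrite wform_sum [wform (Ab i) 0 xi]wl0E.
rewrite (_ : \sum_j Ab i 0 j * wform (grad (fun x => G x 0 j) x) 0 nu = \sum_j Ab i 0 j * xi 0 j); last first.
  by apply: eq_bigr => j _; rewrite [xi 0 j]mxE.
move: (\sum_j Ab i 0 j * xi 0 j) => q.
rewrite [xi 0 i]mxE wl0E cj_sum mulr_suml; apply: eq_bigr => k _; rewrite cjM; ring.
Qed.

(** The curvature coefficients are the Levi coefficients of - log h; class C^2 provides the
    second-order Wirtinger coefficients, which [dz_wd] identifies with the iterated operators. *)
Lemma chern_levi U (h : V -> R) : vopen U -> (forall x, U x -> 0 < h x) -> Ck 2 U h ->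
  (forall x, U x -> chern_semipositive_at h x) -> levi U (fun x => - ln (h x)).
Proof.
move=> oU h0 hC hs.
have [A [B [hA hAB]]] := smooth_ln h0 (Ck_smooth oU hC).
exists (fun x => - A x), (fun x => - B x); split=> [x Ux|x Ux].
  by apply: wd_near (wdN (hA _ Ux)); exists 1 => // y _; rewrite rcN.
have /choice[Ab hAb] : forall j, exists Ab, exists Bb, wd (fun y => B y 0 j) x Ab Bb.
  by move=> j; have [_ [A' [B' [h' _]]]] := hAB j; exists (A' x), (B' x); exact: h'.
have /choice[Bb hb] := hAb.
exists (fun j => - Ab j), (fun j => - Bb j); split=> [j|nu].
  by apply: wd_near (wdN (hb j)); exists 1 => // y _; rewrite !mxE.
have := hs _ Ux nu; rewrite cle0E => /andP[_]; congr (_ <= cre _).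
rewrite exchange_big; apply: eq_bigr => k _ /=.
rewrite wl0E mulr_sumr; apply: eq_bigr => j _; rewrite /chern_coef.
have -> : dz j (dzbar k (fun w => rc (ln (h w)))) x = Ab k 0 j.
  apply: (dz_wd j (B := Bb k) _).1; apply: wd_near (hb k).
  have [d d0 hd] := oU _ Ux; exists d => // y /hd Uy.
  by rewrite (dz_wd k (hA _ Uy)).2.
by rewrite mxE; ring.
Qed.

(** The tangent line bound exp(x) >= 1 + x turns the four-point inequality for [ln F] into one for
    [F]: this is the step from log-plurisubharmonic to plurisubharmonic. *)
Lemma levi_sub_mean U (F : V -> R) z nu : vopen U -> (forall x, U x -> 0 < F x) ->
  levi U (fun x => ln (F x)) -> (forall t, nr t <= 1 -> U (z + t *: nu)) ->
  F z <= cre (mean (fun t => rc (F (z + t *: nu)))).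
Proof.
move=> oU F0 hL hU.
have FE x y : U x -> U y -> F y = F x * expR (ln (F y) - ln (F x)).
  by move=> Ux Uy; rewrite expRB !lnK ?posrE ?F0 // mulrC divfK // gt_eqF // F0.
have := @sub_mean R (fun t => F (z + t *: nu)); rewrite scale0r addr0; apply.
- move=> t /ltW ht e e0; have Ut := hU t ht; have Ft := F0 _ Ut.
  have [d d0 hd] := levi_cross nu oU hL Ut (e := e / F (z + t *: nu)) ltac:(by rewrite divr_gt0).
  have [d' d0' hd'] := oU _ Ut; have N0 : 0 < nr nu + 1 by rewrite ltr_wpDl // nr_ge0.
  exists (Num.min d (d' / (nr nu + 1))); first by rewrite lt_min d0 divr_gt0.
  move=> h; rewrite lt_min ltr_pdivlMr // => /andP[/hd h1 h2].
  have Uc c : nr c = nr h -> U (z + t *: nu + c *: nu).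
    move=> hc; apply: hd'; rewrite addrAC subrr add0r nrZ hc; apply: le_lt_trans h2.
    by rewrite ler_wpM2l ?nr_ge0 // lerDl.
  have Fc c : nr c = nr h -> F (z + t *: nu) * (1 + (ln (F (z + t *: nu + c *: nu)) - ln (F (z + t *: nu)))) <= F (z + (t + c) *: nu).
    move=> hc; rewrite scalerDl (addrA z) [leRHS](FE _ _ Ut (Uc c hc)) ler_pM2l //; exact: expR_ge1Dx.
  have nic : nr ('i%R * h) = nr h by rewrite nrM nr_i mul1r.
  have := Fc _ (erefl _); have := Fc _ nic; have := Fc (- h) ltac:(by rewrite nrN).
  have := Fc (- ('i%R * h)) ltac:(by rewrite nrN); rewrite !scaleNr.
  have := ler_wpM2l (ltW Ft) h1; rewrite mulrBr.
  have -> : F (z + t *: nu) * (e / F (z + t *: nu) * nr h ^+ 2) = e * nr h ^+ 2 by field; rewrite gt_eqF.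
  by move=> H H4 H3 H2 H1; exact: (exp_alg H1 H2 H3 H4 H).
- move=> t ht e e0; have Ut := hU t ht; have Ft := F0 _ Ut.
  have [A [B [hA _]]] := hL; have hc := wd_ctn (hA _ Ut).
  have := @continuous_expR R 0 => /cvgrPdist_lt /(_ (e / F (z + t *: nu)) ltac:(by rewrite divr_gt0)).
  move=> [d /= d0 hd]; have [d1 d10 hd1] := hc d d0.
  have [d' d0' hd'] := oU _ Ut; have N0 : 0 < nr nu + 1 by rewrite ltr_wpDl // nr_ge0.
  exists (Num.min d1 d' / (nr nu + 1)); first by rewrite divr_gt0 // lt_min d10.
  move=> y; rewrite ltr_pdivlMr // => hy.
  have : nr (z + y *: nu - (z + t *: nu)) < Num.min d1 d'.
    rewrite opprD addrACA subrr add0r -scalerBl nrZ; apply: le_lt_trans hy.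
    by rewrite ler_wpM2l ?nr_ge0 // lerDl.
  rewrite lt_min => /andP[/hd1 h1 /hd' Uy]; rewrite (FE _ _ Ut Uy).
  rewrite -[X in _ * _ - X]mulr1 -mulrBr normrM gtr0_norm // mulrC -ltr_pdivlMr //.
  have := hd (ln (F (z + y *: nu)) - ln (F (z + t *: nu))); rewrite /ball_ /= sub0r normrN expR0 => h2.
  by rewrite distrC; apply: h2; rewrite -nr_rc rcB.
Qed.
End Levi.

(** * Expansions and jets in w and its conjugate *)

Section Expansion.
Variables (R : realType) (n : nat).
Local Notation C := (Cplx R).
Local Notation V := 'rV[C]_n.+1.
Implicit Types (F : V -> C) (x z v : V) (U : set V).

Lemma poly_quad (p : {poly C}) (s : C) : exists2 B : R, 0 <= B & forall t, nr (t - s) <= 1 ->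
  nr (p.[t] - p.[s] - (t - s) * p^`().[s]) <= B * nr (t - s) ^+ 2.
Proof.
elim/poly_ind: p => [|p c [B B0 IH]].
  by exists 0 => // t _; rewrite deriv0 !horner0 mulr0 !subr0 nr0 mul0r.
exists (B * nr s + B + nr (p^`().[s])).
  by rewrite !addr_ge0 ?mulr_ge0 ?nr_ge0.
move=> t ht; have := IH t ht; rewrite derivD derivC addr0 derivM derivX mulr1 !(hornerD, hornerM, hornerX, hornerC).
set r := p.[t] - _ - _ => h; set q := p^`().[s]; set d := t - s in h ht *.
have -> : p.[t] * t + c - (p.[s] * s + c) - d * (q * s + p.[s]) = r * s + (r * d + q * d ^+ 2).
  by rewrite /r /d -/q; ring.
have -> : (B * nr s + B + nr q) * nr d ^+ 2 = B * nr d ^+ 2 * nr s + (B * nr d ^+ 2 + nr q * nr d ^+ 2) by ring.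
apply: le_trans (nrD _ _) _; apply: lerD; first by rewrite nrM ler_wpM2r // nr_ge0.
apply: le_trans (nrD _ _) _; apply: lerD; last by rewrite nrM nrX.
rewrite nrM; apply: le_trans (_ : B * nr d ^+ 2 * 1 <= _); last by rewrite mulr1.
by apply: ler_pM; rewrite ?nr_ge0.
Qed.

Definition esum K (a : nat -> nat -> C) (w : C) : C := \sum_(k < K) \sum_(l < K) a k l * w ^+ k * w^* ^+ l.

Lemma exp_alg2 (F F' A B a b w w' c q q' : C) :
  F - q - (F' - q') = F - F' - c * (w * A + w' * B) + c * (w * (A - a) + w' * (B - b)) - (q - q' - c * (w * a + w' * b)).
Proof. by ring. Qed.

Lemma tri_alg (N X S p q s : C) : N * X = S -> X * p * q * (N * s) = S * p * q * s.
Proof. by move=> <-; ring. Qed.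

Lemma fin_alg (x c p e t : R) : x <= p -> c <= e / 2 * t -> e / 2 * t + x + c <= p + e * t.
Proof. lra. Qed.

(** Induction on the order by integrating along rays: the expansions of the derivatives in w and in
    conj w give that of [F]. The coefficients remain functions of the base point, with [k + l]
    orders of smoothness lost, and the remainder is locally uniform. *)
Lemma expansion K U F i : vopen U -> smooth K U F -> exists a : nat -> nat -> V -> C,
  [/\ forall k l, (K <= k + l)%N -> forall z, a k l z = 0,
      forall k l, smooth (K - (k + l)) U (a k l),
      (0 < K)%N -> forall z, a 0 0 z = F z &
      forall z0, U z0 -> exists2 r : R, 0 < r & exists B : R, forall z (w : C), nr (z - z0) < r -> nr w < r ->
        U (z + w *: delta_mx 0 i) /\
        nr (F (z + w *: delta_mx 0 i) - esum K (fun k l => a k l z) w) <= B * nr w ^+ K].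
Proof.
move=> oU; elim: K F => [|K IH] F hF.
  exists (fun _ _ _ => 0); split=> // [k l|z0 Uz0]; first exact: smooth_cst.
  have [d d0 hd] := hF _ Uz0 1 ltr01; have [d' d0' hd'] := oU _ Uz0.
  exists (Num.min d d' / 2); first by rewrite divr_gt0 // lt_min d0.
  exists (nr (F z0) + 1) => z w hz hw.
  have : nr (z + w *: delta_mx 0 i - z0) < Num.min d d'.
    by rewrite addrAC; apply: le_lt_trans (nrD _ _) _; rewrite nrZ nr_delta mulr1; lra.
  rewrite lt_min => /andP[/hd h1 /hd' h2]; split=> //.
  rewrite /esum big_ord0 subr0 expr0 mulr1 -(subrK (F z0) (F (z + _))) (le_trans (nrD _ _)) // addrC lerD2l ltW //.
have [A [B [hAB hj]]] := hF.
have [al [al0 alS _ alE]] := IH _ (hj i).1; have [be [be0 beS _ beE]] := IH _ (hj i).2.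
(* Euler's identity for homogeneous forms: (k + l) a_kl is the sum of the coefficient (k - 1, l) of
   the derivative in w and the coefficient (k, l - 1) of the derivative in conj w. *)
pose a k l z := if k is k'.+1 then (if l is l'.+1 then (al k' l z + be k l' z) / (k + l)%:R else al k' 0 z / k%:R)
   else if l is l'.+1 then be 0 l' z / l%:R else F z.
have aE k l z : (0 < k + l)%N -> (k + l)%:R * a k l z =
    (if k is k'.+1 then al k' l z else 0) + (if l is l'.+1 then be k l' z else 0).
  case: k l => [|k] [|l] // _; rewrite /a ?addn0 ?add0n ?addr0 ?add0r mulrC divfK ?pnatr_eq0 //.
exists a; split=> //.
- case=> [|k] [|l] // hkl z; rewrite /a.
  + by rewrite be0 ?mul0r.
  + by rewrite al0 ?mul0r //; lia.
  + by rewrite al0 ?be0 ?addr0 ?mul0r //; lia.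
- case=> [|k] [|l]; rewrite /a ?addn0 ?add0n ?subn0 //.
  + by apply: smooth_ext (smooth_Z (l.+1%:R^-1) (beS 0 l)) => z; rewrite mulrC.
  + by rewrite subSS; have := alS k 0; rewrite addn0 => h; apply: smooth_ext (smooth_Z (k.+1%:R^-1) h) => z; rewrite mulrC.
  + have h1 := alS k l.+1; have h2 := beS k.+1 l; rewrite !addSn !addnS in h1 h2 *.
    by apply: smooth_ext (smooth_Z ((k + l).+2%:R^-1) (smooth_D h1 h2)) => z; rewrite mulrC.
move=> z0 Uz0; have [r1 r10 [B1 hB1]] := alE _ Uz0; have [r2 r20 [B2 hB2]] := beE _ Uz0.
exists (Num.min r1 r2); first by rewrite lt_min r10.
exists (`|B1| + `|B2|) => z w; rewrite !lt_min => /andP[z1 z2] /andP[w1 w2].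
split; first exact: (hB1 z w z1 w1).1.
(* The truncated expansion read along the ray: for real s, [q.[rc s]] is its value at s w, and [dq]
   recovers the expansions of the two derivatives. *)
pose q : {poly C} := \sum_(k < K.+1) \sum_(l < K.+1) (a k l z * w ^+ k * w^* ^+ l) *: 'X^(k + l).
have q1 : q.[1] = esum K.+1 (fun k l => a k l z) w.
  rewrite horner_sum; apply: eq_bigr => k _; rewrite horner_sum; apply: eq_bigr => l _.
  by rewrite hornerZ hornerXn expr1n mulr1.
have q0 : q.[0] = F z.
  rewrite horner_sum big_ord_recl horner_sum big_ord_recl /= hornerZ hornerXn !expr0 !mulr1.
  rewrite big1 ?big1 ?addr0 // => [k _|l _]; last by rewrite hornerZ hornerXn /= expr0n mulr0.
  by rewrite horner_sum big1 // => l _; rewrite hornerZ hornerXn /= expr0n mulr0.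
have dq (s : R) : q^`().[rc s] = w * esum K (fun k l => al k l z) (rc s * w) + w^* * esum K (fun k l => be k l z) (rc s * w).
  pose T1 k l := if k is k'.+1 then al k' l z * w ^+ k'.+1 * w^* ^+ l * rc s ^+ (k' + l) else 0.
  pose T2 k l := if l is l'.+1 then be k l' z * w ^+ k * w^* ^+ l'.+1 * rc s ^+ (k + l') else 0.
  have -> : q^`().[rc s] = \sum_(k < K.+1) \sum_(l < K.+1) (T1 k l + T2 k l).
    rewrite /q raddf_sum horner_sum; apply: eq_bigr => k _; rewrite raddf_sum horner_sum; apply: eq_bigr => l _.
    rewrite /= derivZ derivXn hornerZ hornerMn hornerXn -[_ *+ (k + l)]mulr_natl.
    have := aE k l z; case: (nat_of_ord k) => [|k']; case: (nat_of_ord l) => [|l'] /=.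
    - by move=> _; rewrite mul0r mulr0 addr0.
    - move=> /(_ isT); rewrite !add0n /= !add0r => e.
      exact: tri_alg e.
    - move=> /(_ isT); rewrite !addn0 /= !addr0 => e.
      exact: tri_alg e.
    - move=> /(_ isT); rewrite !addSn !addnS /= => e.
      by rewrite (tri_alg _ _ _ e) !mulrDl.
  rewrite (eq_bigr (fun k : 'I_K.+1 => \sum_(l < K.+1) T1 k l + \sum_(l < K.+1) T2 k l)); last by move=> k _; rewrite big_split.
  rewrite big_split /=; congr (_ + _).
    rewrite big_ord_recl /= big1 // add0r mulr_sumr; apply: eq_bigr => k _; rewrite big_ord_recr /= al0 ?leq_addl // !mul0r addr0.
    rewrite mulr_sumr; apply: eq_bigr => l _; rewrite cjM rcJ !exprMn exprD !exprS; ring.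
  rewrite exchange_big big_ord_recl /= big1 // add0r mulr_sumr [RHS](eq_bigr (fun k : 'I_K => \sum_(l < K) w^* * (be k l z * (rc s * w) ^+ k * (rc s * w)^* ^+ l))); last by move=> k _; rewrite mulr_sumr.
  rewrite [RHS]exchange_big /=; apply: eq_bigr => l _; rewrite big_ord_recr /= be0 ?leq_addr // !mul0r addr0.
  apply: eq_bigr => k _; rewrite cjM rcJ !exprMn exprD !exprS; ring.
(* The error along the ray starts from 0, and its derivative is w, respectively conj w, times the
   errors of the two derivative expansions; this gains one power of |w|. *)
pose u (s : R) := F (z + rc s *: (w *: delta_mx 0 i)) - q.[rc s].
have -> : F (z + w *: delta_mx 0 i) - esum K.+1 (fun k l => a k l z) w = u 1 - u 0.
  by rewrite /u rc1 rc0 scale1r scale0r addr0 q1 q0 subrr subr0.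
apply: mean_value_ineq => s /andP[s0 s1] e e0.
have ns : nr (rc s * w) <= nr w by rewrite nrM nr_rc ger0_norm // ler_piMl // nr_ge0.
have [Uy h1] := hB1 z (rc s * w) z1 (le_lt_trans ns w1).
have [_ h2] := hB2 z (rc s * w) z2 (le_lt_trans ns w2).
pose y := z + (rc s * w) *: delta_mx 0 i.
have [d d0 hd] := wd_line (w *: delta_mx 0 i) (hAB _ Uy) (e := e / 2) ltac:(by rewrite divr_gt0).
have [Bq Bq0 hq] := poly_quad q (rc s).
exists (Num.min (Num.min d 1) (e / 2 / (Bq + 1))).
  by rewrite !lt_min d0 ltr01 !divr_gt0 // ltr_wpDl.
move=> t _; rewrite !lt_min => /andP[/andP[t1 t2] t3].
have nts : nr (rc (t - s)) = `|t - s| by rewrite nr_rc.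
have g1 := hd (rc (t - s)) ltac:(by rewrite nts).
have g2 := hq (rc t) ltac:(by rewrite -rcB nts ltW).
rewrite -rcB nts in g1 g2; rewrite wform_rc wlZ !wform_delta ![(0 : V) 0 i]mxE addr0 add0r in g1.
rewrite dq in g2.
have Y : z + (rc s * w) *: delta_mx 0 i + rc (t - s) *: (w *: delta_mx 0 i) = z + rc t *: (w *: delta_mx 0 i).
  by rewrite scalerA -addrA -scalerDl -mulrDl -rcD scalerA (_ : s + (t - s) = t) //; ring.
rewrite Y in g1.
have -> : u t - u s = (F (z + rc t *: (w *: delta_mx 0 i)) - F y - rc (t - s) * (w * A y 0 i + w^* * B y 0 i))
   + rc (t - s) * (w * (A y 0 i - esum K (fun k l => al k l z) (rc s * w)) + w^* * (B y 0 i - esum K (fun k l => be k l z) (rc s * w)))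
   - (q.[rc t] - q.[rc s] - rc (t - s) * (w * esum K (fun k l => al k l z) (rc s * w) + w^* * esum K (fun k l => be k l z) (rc s * w))).
  have hy : z + rc s *: (w *: delta_mx 0 i) = y by rewrite scalerA.
  by rewrite /u hy; exact: exp_alg2.
apply: le_trans (nrB _ _) _; apply: le_trans (lerD (nrD _ _) (lexx _)) _.
apply: le_trans (lerD (lerD g1 (lexx _)) g2) _.
have g3 : nr (rc (t - s) * (w * (A y 0 i - esum K (fun k l => al k l z) (rc s * w)) + w^* * (B y 0 i - esum K (fun k l => be k l z) (rc s * w)))) <= (`|B1| + `|B2|) * nr w ^+ K.+1 * `|t - s|.
  rewrite nrM nts mulrC ler_wpM2r //; apply: le_trans (nrD _ _) _; rewrite !nrM nrJ -mulrDr exprS mulrCA ler_wpM2l ?nr_ge0 //.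
  have hp : nr (rc s * w) ^+ K <= nr w ^+ K by rewrite lerXn2r ?nnegrE ?nr_ge0.
  rewrite mulrDl; apply: lerD.
    apply: le_trans h1 _; apply: le_trans (_ : `|B1| * nr (rc s * w) ^+ K <= _); last by rewrite ler_wpM2l.
    by rewrite ler_wpM2r ?ler_norm // exprn_ge0 // nr_ge0.
  apply: le_trans h2 _; apply: le_trans (_ : `|B2| * nr (rc s * w) ^+ K <= _); last by rewrite ler_wpM2l.
  by rewrite ler_wpM2r ?ler_norm // exprn_ge0 // nr_ge0.
have g4 : Bq * `|t - s| ^+ 2 <= e / 2 * `|t - s|.
  rewrite expr2 mulrA ler_wpM2r //; move: t3; rewrite ltr_pdivlMr ?ltr_wpDl // => t3.
  by have := normr_ge0 (t - s); move: t3; lra.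
by rewrite [leRHS]mulrDl; exact: fin_alg g3 g4.
Qed.
End Expansion.

(** * Jets as polynomials in w and its conjugate *)

Section Jets.
Variables (R : realType).
Local Notation C := (Cplx R).
Implicit Types (f g : C -> C) (P Q : {poly {poly C}}) (w : C).

(* [P`_l`_k] is the coefficient of [w ^+ k * w^* ^+ l]. *)
Definition ev P w : C := (P.[(w^*)%:P]).[w].
Definition jet K f P := exists2 d : R, 0 < d & exists B : R, forall w, nr w < d -> nr (f w - ev P w) <= B * nr w ^+ K.
(** Conjugating a polynomial function exchanges w with its conjugate, so the coefficients are
    conjugated and the two variables swapped. *)
Definition cJ P : {poly {poly C}} := swapXY (map_poly (map_poly Num.conj) P).

Lemma evD P Q w : ev (P + Q) w = ev P w + ev Q w. Proof. by rewrite /ev !hornerD. Qed.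
Lemma evM P Q w : ev (P * Q) w = ev P w * ev Q w. Proof. by rewrite /ev !hornerM. Qed.
Lemma evC (c : C) w : ev c%:P%:P w = c. Proof. by rewrite /ev !hornerC. Qed.
Lemma evC1 (p : {poly C}) w : ev p%:P w = p.[w]. Proof. by rewrite /ev hornerC. Qed.
Lemma cJE P k l : (cJ P)`_l`_k = (P`_k`_l)^*.
Proof. by rewrite /cJ coef_swapXY !coef_map_id0 ?map_poly0 ?rmorph0. Qed.
Lemma evJ P w : ev (cJ P) w = (ev P w)^*.
Proof.
rewrite /ev /cJ horner2_swapXY.
have -> : w%:P = map_poly Num.conj ((w^*)%:P) :> {poly C} by rewrite map_polyC /= cjK.
by rewrite horner_map /= horner_map.
Qed.
Lemma ev_esum P w K : (forall k l, (K <= k)%N || (K <= l)%N -> P`_l`_k = 0) -> ev P w = esum K (fun k l => P`_l`_k) w.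
Proof.
move=> h; have s1 : (size P <= K)%N.
  by apply/leq_sizeP => l hl; apply/polyP => k; rewrite coef0 h // hl orbT.
have s2 l : (size (P`_l)%R <= K)%N by apply/leq_sizeP => k hk; rewrite h // hk.
rewrite /ev (horner_coef_wide _ s1) horner_sum /esum exchange_big; apply: eq_bigr => l _.
rewrite hornerM horner_exp hornerC (horner_coef_wide _ (s2 l)) mulr_suml.
by apply: eq_bigr.
Qed.
Lemma ev_wide P : exists K, forall k l, (K <= k)%N || (K <= l)%N -> P`_l`_k = 0.
Proof.
exists (maxn (size P) (\max_(l < size P) size (P`_l)%R)) => k l; rewrite !geq_max => h.
have [hl|hl] := leqP (size P) l; first by rewrite [P`_l]nth_default ?coef0.
rewrite nth_default //; case/orP: h => /andP[h1 h2]; last by rewrite leqNgt hl in h1.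
by apply: leq_trans h2; exact: (@leq_bigmax _ (fun l : 'I_(size P) => size (P`_l)%R) (Ordinal hl)).
Qed.
Lemma esum_bound K a : exists2 M : R, 0 <= M & forall w, nr w <= 1 -> nr (esum K a w) <= M.
Proof.
exists (\sum_(k < K) \sum_(l < K) nr (a k l)).
  by apply: sumr_ge0 => k _; apply: sumr_ge0 => l _; exact: nr_ge0.
move=> w hw; apply: le_trans (nr_sum _ _ _) _; apply: ler_sum => k _.
apply: le_trans (nr_sum _ _ _) _; apply: ler_sum => l _.
rewrite !nrM !nrX nrJ -mulrA ler_piMr ?nr_ge0 // mulr_ile1 ?exprn_ge0 ?nr_ge0 // exprn_ile1 ?nr_ge0 //.
Qed.
Lemma ev_bound P : exists2 M : R, 0 <= M & forall w, nr w <= 1 -> nr (ev P w) <= M.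
Proof.
have [K hK] := ev_wide P; have [M M0 hM] := esum_bound K (fun k l => P`_l`_k).
by exists M => // w /hM; rewrite (ev_esum _ hK).
Qed.
Lemma jet_near K f g P : (exists2 d : R, 0 < d & forall w, nr w < d -> f w = g w) -> jet K f P -> jet K g P.
Proof.
move=> [d d0 hd] [d' d0' [B hB]]; exists (Num.min d d'); first by rewrite lt_min d0.
by exists B => w; rewrite lt_min => /andP[/hd <- /hB].
Qed.
Lemma jetD K f g P Q : jet K f P -> jet K g Q -> jet K (fun w => f w + g w) (P + Q).
Proof.
move=> [d d0 [B hB]] [d' d0' [B' hB']]; exists (Num.min d d'); first by rewrite lt_min d0.
exists (B + B') => w; rewrite lt_min => /andP[/hB h1 /hB' h2].
by rewrite evD opprD addrACA mulrDl; apply: le_trans (nrD _ _) _; exact: lerD.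
Qed.
Lemma jetM K f g P Q : jet K f P -> jet K g Q -> jet K (fun w => f w * g w) (P * Q).
Proof.
move=> [d d0 [B hB]] [d' d0' [B' hB']]; have [M M0 hM] := ev_bound P; have [M' M0' hM'] := ev_bound Q.
exists (Num.min (Num.min d d') 1); first by rewrite !lt_min d0 d0' ltr01.
exists ((`|B| + M) * `|B'| + `|B| * M') => w; rewrite !lt_min => /andP[/andP[/hB h1 /hB' h2] /ltW w1].
have X0 : 0 <= nr w ^+ K by rewrite exprn_ge0 // nr_ge0.
have X1 : nr w ^+ K <= 1 by rewrite exprn_ile1 // nr_ge0.
have b1 : nr (f w - ev P w) <= `|B| * nr w ^+ K by apply: le_trans h1 _; rewrite ler_wpM2r // ler_norm.
have b2 : nr (g w - ev Q w) <= `|B'| * nr w ^+ K by apply: le_trans h2 _; rewrite ler_wpM2r // ler_norm.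
have b3 : nr (f w) <= `|B| + M.
  rewrite -(subrK (ev P w) (f w)); apply: le_trans (nrD _ _) _; apply: lerD; last exact: hM.
  by apply: le_trans b1 _; rewrite ler_piMr.
have -> : f w * g w - ev (P * Q) w = f w * (g w - ev Q w) + (f w - ev P w) * ev Q w by rewrite evM; ring.
apply: le_trans (nrD _ _) _; rewrite !nrM mulrDl; apply: lerD.
  by rewrite -mulrA; apply: ler_pM; rewrite ?nr_ge0.
by rewrite mulrAC; apply: ler_pM; rewrite ?nr_ge0 // hM'.
Qed.
Lemma jetJ K f P : jet K f P -> jet K (fun w => (f w)^*) (cJ P).
Proof.
move=> [d d0 [B hB]]; exists d => //; exists B => w /hB.
by rewrite evJ -cjB nrJ.
Qed.
Lemma jet_le K K' f P : (K' <= K)%N -> jet K f P -> jet K' f P.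
Proof.
move=> KK [d d0 [B hB]]; exists (Num.min d 1); first by rewrite lt_min d0 ltr01.
exists `|B| => w; rewrite lt_min => /andP[/hB h w1]; apply: le_trans h _.
apply: le_trans (_ : `|B| * nr w ^+ K <= _); first by rewrite ler_wpM2r ?ler_norm // exprn_ge0 // nr_ge0.
by rewrite ler_wpM2l // ler_wiXn2l ?nr_ge0 // ltW.
Qed.
Lemma jet_uniq K f P Q : jet K f P -> jet K f Q -> forall k l, (k + l < K)%N -> P`_l`_k = Q`_l`_k.
Proof.
move=> [d d0 [B hB]] [d' d0' [B' hB']] k l kl.
have [K0 hK0] := ev_wide (P - Q).
have [h|] := boolP ((K0 <= k)%N || (K0 <= l)%N).
  by have := hK0 _ _ h; rewrite !coefB => /eqP; rewrite subr_eq0 => /eqP.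
rewrite negb_or -!ltnNge => /andP[hk hl].
suff : (P - Q)`_l`_k = 0 by rewrite !coefB => /eqP; rewrite subr_eq0 => /eqP.
have m0 : 0 < Num.min d d' by rewrite lt_min d0.
apply: (@poly2_small R (fun k l => (P - Q)`_l`_k) K0 K (B + B') _ m0) => // w.
rewrite lt_min => /andP[/hB h1 /hB' h2];
have -> : \sum_(k < K0) \sum_(l < K0) (P - Q)`_l`_k * w ^+ k * w^* ^+ l = ev (P - Q) w by rewrite (ev_esum w hK0).
have -> : ev (P - Q) w = (f w - ev Q w) - (f w - ev P w) by rewrite /ev !hornerE; ring.
by apply: le_trans (nrB _ _) _; rewrite mulrDl addrC; exact: lerD.
Qed.
Lemma jet_cst K c : jet K (fun=> c) c%:P%:P.
Proof. by exists 1 => //; exists 0 => w _; rewrite evC subrr nr0 mul0r. Qed.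
Lemma jet_id K : jet K id 'X%:P.
Proof. by exists 1 => //; exists 0 => w _; rewrite evC1 hornerX subrr nr0 mul0r. Qed.
Lemma jetX K f P j : jet K f P -> jet K (fun w => f w ^+ j) (P ^+ j).
Proof.
move=> h; elim: j => [|j IH]; first by rewrite expr0; exact: (jet_cst K 1).
rewrite exprS; apply: jet_near (jetM h IH); exists 1 => // w _; by rewrite exprS.
Qed.
Lemma jet_sum K (I : Type) (r : seq I) (f : I -> C -> C) (P : I -> {poly {poly C}}) : (forall i, jet K (f i) (P i)) ->
  jet K (fun w => \sum_(i <- r) f i w) (\sum_(i <- r) P i).
Proof.
move=> h; elim: r => [|i r IH].
  rewrite big_nil; apply: jet_near (jet_cst K 0); exists 1 => // w _; by rewrite big_nil.
rewrite big_cons; apply: jet_near (jetD (h i) IH); exists 1 => // w _; by rewrite big_cons.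
Qed.

Definition bipoly K (a : nat -> nat -> C) : {poly {poly C}} := \poly_(l < K) \poly_(k < K) a k l.
Lemma bpE K a k l : (bipoly K a)`_l`_k = if (k < K)%N && (l < K)%N then a k l else 0.
Proof. by rewrite /bipoly coef_poly; case: (l < K)%N; rewrite ?coef0 ?andbF ?andbT // coef_poly. Qed.
Lemma ev_bipoly K a w : ev (bipoly K a) w = esum K a w.
Proof.
rewrite (@ev_esum _ w K) => [|k l h]; last by rewrite bpE !ltnNge; case/orP: h => ->; rewrite ?andbF.
by apply: eq_bigr => k _; apply: eq_bigr => l _; rewrite bpE !ltn_ord.
Qed.
Lemma jet_esum K f a (r B : R) : 0 < r -> (forall w, nr w < r -> nr (f w - esum K a w) <= B * nr w ^+ K) -> jet K f (bipoly K a).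
Proof. by move=> r0 h; exists r => //; exists B => w /h; rewrite ev_bipoly. Qed.
Lemma jet_hol K f (c : nat -> C) (r B : R) : 0 < r ->
  (forall w, nr w < r -> nr (f w - \sum_(k < K) c k * w ^+ k) <= B * nr w ^+ K) -> jet K f (\poly_(k < K) c k)%:P.
Proof. by move=> r0 h; exists r => //; exists B => w /h; rewrite evC1 horner_poly. Qed.
End Jets.

Lemma diff_coord (R : realType) n (T : 'rV[Cplx R]_n.+1 -> 'rV[Cplx R]_n.+1) x j : differentiable T x ->
  vdiff (fun y => T y 0 j) x.
Proof.
move=> /diff_locallyP[_ /eqaddoP hf]; exists (\row_l (('d T x (delta_mx 0 l) : 'rV[Cplx R]_n.+1) 0 j)) => e e0.
have /near_nr[d d0 hd] := hf (rc e) ltac:(by rewrite -rc0 rc_lt).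
exists d => // v hv; have := hd v; rewrite subr0 => /(_ hv).
rewrite !fctE /= !nrE -rcM rc_le (addrC v) opprD addrA => h; apply: le_trans h.
have E : wform (\row_l (('d T x (delta_mx 0 l) : 'rV[Cplx R]_n.+1) 0 j)) 0 v = ('d T x v : 'rV[Cplx R]_n.+1) 0 j.
  rewrite wl0E {2}[v]row_sum_delta linear_sum /= summxE; apply: eq_bigr => l _.
  by rewrite linearZ /= !mxE mulrC.
by rewrite E; apply: le_trans (nr_coord _ j); rewrite !mxE.
Qed.

Lemma diff_intro (K : numFieldType) (V W : normedModType K) (f : V -> W) (df : {linear V -> W}) x :
  continuous df -> (forall e, 0 < e -> \forall v \near (0 : V), `|f (v + x) - f x - df v| <= e * `|v|) ->
  differentiable f x.
Proof.
move=> cdf h; have fdf : f \o shift x = cst (f x) + df +o_ (0 : V) id.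
  apply/eqaddoP => e e0; apply: filterS (h e e0) => v.
  by rewrite !fctE /= opprD addrA.
by apply/diff_locallyP; rewrite (diff_unique cdf fdf).
Qed.

Lemma vdiff_diff (R : realType) n (f : 'rV[Cplx R]_n.+1 -> Cplx R) x : vdiff f x -> differentiable f x.
Proof.
move=> [A hA].
have lin : linear (fun v : 'rV[Cplx R]_n.+1 => wform A 0 v : Cplx R).
  by move=> c u v; rewrite wlD wlZ0.
pose df : {linear 'rV[Cplx R]_n.+1 -> Cplx R} := HB.pack (fun v : 'rV[Cplx R]_n.+1 => wform A 0 v : Cplx R) (GRing.isLinear.Build _ _ _ _ _ lin).
have cdf : continuous df.
  move=> y; apply/ctnP => e e0; have c0 : 0 < wform_norm A 0 + 1 by rewrite ltr_wpDl // wform_norm_ge0.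
  exists (e / (wform_norm A 0 + 1)); first by rewrite divr_gt0.
  move=> z; rewrite ltr_pdivlMr // => hz; rewrite /df /= -wlB; apply: le_lt_trans (wform_le _ _ _) _.
  by apply: le_lt_trans hz; rewrite mulrC ler_wpM2l ?nr_ge0 // lerDl.
apply: (diff_intro cdf) => e; rewrite -rc0 => e0.
have ee : e = rc (cre e).
  by move: (ltW e0); rewrite cle0E => /andP[/eqP h _]; apply: c_eq.
move: e0; rewrite ee rc_lt => e0; have [d d0 hd] := hA _ e0.
apply: (near_nr 0 _).2; exists d => // v; rewrite subr0 => /hd.
by rewrite /df /= !nrE -rcM rc_le (addrC v).
Qed.
Lemma ctn_coords (R : realType) n (T : normedModType (Cplx R)) (F : T -> 'rV[Cplx R]_n.+1) x :
  (forall j, ctn (fun y => F y 0 j) x) -> ctn F x.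
Proof.
move=> h e e0.
have [||d d0 hd] := @fin_radius R 'I_n.+1 (fun (j : 'I_n.+1) d => forall y, nr (y - x) < d -> nr (F y 0 j - F x 0 j) <= e / 2).
- by move=> j d d' _ dd h' y hy; apply: h'; apply: lt_le_trans dd.
- move=> j; have [d d0 hd] := h j (e / 2) ltac:(by rewrite divr_gt0).
  by exists d => // y /hd /ltW.
exists d => // y hy; apply: le_lt_trans (_ : e / 2 < _); last by lra.
by apply: nr_rV => [|j]; [rewrite divr_ge0 // ltW|rewrite !mxE; exact: hd].
Qed.

(** * Coordinates adapted to the hypersurface *)

Section Charts.
Variables (R : realType) (n : nat) (X : complexManifold R n).
Local Notation C := (Cplx R).
Local Notation V := 'rV[C]_n.+1.
Implicit Types (f g : X -> C) (p q x y : X) (a b : chart_index X) (eta : V).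

Lemma chart_near a p e : chart_dom a p -> 0 < e -> \forall q \near p, nr (chart a q - chart a p) < e.
Proof.
move=> hp e0; have h : nbhs (chart a p) (fun eta : V => nr (eta - chart a p) < e).
  by apply: (near_nr (chart a p) (fun eta : V => nr (eta - chart a p) < e)).2; exists e.
exact: (chart_continuous hp h).
Qed.
Lemma chart_inv_near a p (A : set X) : chart_dom a p -> nbhs p A ->
  exists2 d : R, 0 < d & forall eta : V, nr (eta - chart a p) < d -> A (chart_inv a eta).
Proof.
move=> hp hA; have h : nbhs (chart_inv a (chart a p)) A by rewrite chartK.
have := chart_inv_continuous hp h; exact: (near_nr (chart a p) (fun eta => A (chart_inv a eta))).1.
Qed.
Lemma chart_img a p : chart_dom a p -> exists2 d : R, 0 < d & forall eta : V, nr (eta - chart a p) < d ->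
  chart_dom a (chart_inv a eta) /\ chart a (chart_inv a eta) = eta.
Proof.
move=> hp; have : nbhs (chart a p) (chart a @` chart_dom a).
  by apply: open_nbhs_nbhs; split; [exact: chart_img_open|exists p].
move=> /near_nr[d d0 hd]; exists d => // eta /hd[q hq <-]; by rewrite chartK.
Qed.

(** Holomorphy tested in one chart. It agrees with [holo_at], which quantifies over all charts,
    because the transition maps are holomorphic. *)
Definition xhol f p := exists2 a, chart_dom a p & vdiff (f \o chart_inv a) (chart a p).

Lemma xhol_chart a f p : chart_dom a p -> xhol f p -> vdiff (f \o chart_inv a) (chart a p).
Proof.
move=> ha [b hb hf].
have nb : nbhs p (chart_dom b) by apply: open_nbhs_nbhs; split; [exact: chart_dom_open|].
have [d d0 hd] := chart_inv_near ha nb.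
apply: (vdiff_near (f := fun eta => (f \o chart_inv b) (chart b (chart_inv a eta)))).
  by exists d => // eta /hd h /=; rewrite chartK.
apply: (vdiff_comp (X := fun eta => chart b (chart_inv a eta))); first by rewrite chartK.
move=> j; exact: diff_coord (chart_holomorphic ha hb).
Qed.
Lemma holo_xhol f p : holo_at f p -> xhol f p.
Proof.
move=> h; have [a ha] := chart_dom_cover p; exists a => //.
by eexists; exact: diff_wd (h a ha).
Qed.
Lemma xhol_holo f p : xhol f p -> holo_at f p.
Proof. by move=> h a ha; apply: vdiff_diff; exact: xhol_chart. Qed.
Lemma xhol_near f g p : (\forall q \near p, f q = g q) -> xhol f p -> xhol g p.
Proof.
move=> hn [a ha hf]; exists a => //; apply: vdiff_near hf.
by have [d d0 hd] := chart_inv_near ha hn; exists d.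
Qed.
Lemma xhol_cst c p : xhol (fun=> c) p.
Proof. by have [a ha] := chart_dom_cover p; exists a => //; exact: vdiff_cst. Qed.
Lemma xholM f g p : xhol f p -> xhol g p -> xhol (fun x => f x * g x) p.
Proof. by move=> [a ha hf] /(xhol_chart ha) hg; exists a => //; exact: (vdiffM hf hg). Qed.
Lemma xholD f g p : xhol f p -> xhol g p -> xhol (fun x => f x + g x) p.
Proof. by move=> [a ha hf] /(xhol_chart ha) hg; exists a => //; exact: (vdiffD hf hg). Qed.
Lemma xholV f p : f p != 0 -> xhol f p -> xhol (fun x => (f x)^-1) p.
Proof. by move=> h [a ha hf]; exists a => //; apply: (vdiffV _ hf); rewrite /= chartK. Qed.
Lemma xhol_cont m (F : X -> 'rV[C]_m.+1) p e : (forall j, xhol (fun x => F x 0 j) p) -> 0 < e ->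
  \forall q \near p, nr (F q - F p) < e.
Proof.
move=> h e0; have [a ha] := chart_dom_cover p.
have hc : ctn (fun eta => F (chart_inv a eta)) (chart a p).
  apply: ctn_coords => j; exact: (vdiff_ctn (xhol_chart ha (h j))).
have [d d0 hd] := hc e e0; rewrite chartK // in hd.
have na : nbhs p (chart_dom a) by apply: open_nbhs_nbhs; split; [exact: chart_dom_open|].
have nb := chart_near ha d0; near=> q.
have hq : chart_dom a q by near: q.
have := hd (chart a q); rewrite chartK //; apply; by near: q.
Unshelve. all: by end_near.
Qed.

(** Holomorphic coordinates whose image is a full polydisc centred at 0. The inverse is kept as
    [Gam] followed by [chart_inv a], so its holomorphy concerns maps between vector spaces only. *)
Record csys a (O : set X) (r : R) (Gam : V -> V) (Phi : X -> V) : Prop := CSys {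
  cs_r : 0 < r;
  cs_O : open O;
  cs_dom : forall x, O x -> chart_dom a x;
  cs_Phi : forall x, O x -> nr (Phi x) < r;
  cs_Gam : forall x, O x -> Gam (Phi x) = chart a x;
  cs_hol : forall x j, O x -> xhol (fun x => Phi x 0 j) x;
  cs_ex : forall eta, nr eta < r -> exists2 x, O x & Phi x = eta;
  cs_vdiff : forall eta j, nr eta < r -> vdiff (fun eta => Gam eta 0 j) eta }.

Section CSys.
Variables (a : chart_index X) (O : set X) (r : R) (Gam : V -> V) (Phi : X -> V).
Hypothesis hS : csys a O r Gam Phi.
Let G eta := chart_inv a (Gam eta).

Lemma csGK x : O x -> G (Phi x) = x.
Proof. by move=> Ox; rewrite /G (cs_Gam hS Ox) chartK //; exact: (cs_dom hS Ox). Qed.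
Lemma csG eta : nr eta < r -> O (G eta) /\ Phi (G eta) = eta.
Proof. by move=> /(cs_ex hS)[x Ox <-]; rewrite csGK. Qed.
Lemma csGam eta : nr eta < r -> chart_dom a (G eta) /\ chart a (G eta) = Gam eta.
Proof. by move=> /(cs_ex hS)[x Ox <-]; rewrite csGK // (cs_Gam hS Ox); split=> //; exact: (cs_dom hS Ox). Qed.
Lemma cs_ball : vopen [set eta : V | nr eta < r].
Proof.
move=> eta /= h; exists (r - nr eta); first by rewrite subr_gt0.
by move=> y; rewrite ltrBrDr => h'; rewrite -(subrK eta y) /=; exact: le_lt_trans (nrD _ _) h'.
Qed.
Lemma cs_nbhs x : O x -> nbhs x O.
Proof. by move=> Ox; apply: open_nbhs_nbhs; split=> //; exact: (cs_O hS). Qed.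
Lemma cs_comp f eta : nr eta < r -> xhol f (G eta) -> vdiff (fun eta => f (G eta)) eta.
Proof.
move=> he hf; have [h1 h2] := csGam he.
apply: (vdiff_comp (f := f \o chart_inv a) (X := Gam)); last by move=> j; exact: (cs_vdiff hS).
by rewrite -h2; exact: xhol_chart.
Qed.
Lemma cs_cont eta (A : set X) : nr eta < r -> nbhs (G eta) A ->
  exists2 d : R, 0 < d & forall y : V, nr (y - eta) < d -> A (G y).
Proof.
move=> he hA; have [h1 h2] := csGam he.
have [d d0 hd] := chart_inv_near h1 hA.
have hc : ctn Gam eta by apply: ctn_coords => j; exact: (vdiff_ctn (cs_vdiff hS j he)).
have [d' d0' hd'] := hc d d0; exists d' => // y /hd' hy; apply: hd; by rewrite h2.
Qed.
Lemma cs_xhol (F : V -> C) x : O x -> vdiff F (Phi x) -> xhol (fun x => F (Phi x)) x.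
Proof.
move=> Ox hF; have ha := cs_dom hS Ox; exists a => //.
apply: (vdiff_comp (X := fun eta => Phi (chart_inv a eta))); first by rewrite chartK.
move=> j; exact: (xhol_chart ha (cs_hol hS j Ox)).
Qed.
Lemma cs_vopen (A : set X) : open A -> vopen [set eta : V | nr eta < r /\ A (G eta)].
Proof.
move=> oA eta [he hA]; have [d d0 hd] := cs_ball he.
have [d' d0' hd'] := cs_cont he (open_nbhs_nbhs (conj oA hA)).
exists (Num.min d d'); first by rewrite lt_min d0.
by move=> y; rewrite lt_min => /andP[/hd h1 /hd' h2].
Qed.

(** The map from the old coordinates to the new ones is inverted by [local_coord]; the new system is
    centred at the point of old coordinates [eta0]. *)
Lemma recoord (U : set V) (W : V -> C) (eta0 : V) j : vopen U -> (forall eta, U eta -> nr eta < r) ->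
  hol U W -> U eta0 -> W eta0 = 0 -> grad W eta0 0 j != 0 ->
  exists O' r' Gam' Phi', [/\ csys a O' r' Gam' Phi', forall x, O' x -> O x /\ U (Phi x),
    forall x, Phi' x = adj_coord W eta0 j (Phi x) & O' (G eta0)].
Proof.
move=> oU Ur hW U0 W0 g0.
have [r' r0' [rho rho0 [H [h1 h2 h3]]]] := local_coord oU hW U0 W0 g0.
pose Phi' x := adj_coord W eta0 j (Phi x).
pose O' := [set x | [/\ O x, nr (Phi x - eta0) < rho & nr (Phi' x) < r']].
have hol' x l : O x -> nr (Phi x - eta0) < rho -> xhol (fun x => Phi' x 0 l) x.
  move=> Ox hx; have [->|lj] := eqVneq l j.
    apply: xhol_near (cs_xhol Ox (hW _ (h3 _ hx).1)); near=> q; by rewrite mxE eqxx.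
  apply: xhol_near (xholD (cs_hol hS l Ox) (xhol_cst (- eta0 0 l) x)); near=> q.
  by rewrite mxE (negbTE lj) !mxE.
exists O', r', (Gam \o H), Phi'; split.
- split=> //.
  + rewrite openE => x [Ox hx hx'].
    have e1 : 0 < rho - nr (Phi x - eta0) by rewrite subr_gt0.
    have e2 : 0 < r' - nr (Phi' x) by rewrite subr_gt0.
    have n1 := xhol_cont (fun l => cs_hol hS l Ox) e1.
    have n2 := xhol_cont (fun l => hol' x l Ox hx) e2.
    have n3 := cs_nbhs Ox.
    near=> y; split; first by near: y.
      have : nr (Phi y - Phi x) < rho - nr (Phi x - eta0) by near: y.
      have := nr_tri (Phi x) (Phi y) eta0; lra.
    have : nr (Phi' y - Phi' x) < r' - nr (Phi' x) by near: y.
    have := nr_sub (Phi' y) (Phi' x); lra.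
  + by move=> x [Ox _ _]; exact: (cs_dom hS Ox).
  + by move=> x [].
  + by move=> x [Ox hx hx'] /=; rewrite (h3 _ hx).2 // (cs_Gam hS Ox).
  + by move=> x l [Ox hx _]; exact: hol'.
  + move=> eta he; have [k1 k2 k3] := h1 _ he.
    have [Ox px] := csG (Ur _ (h3 _ k1).1).
    by exists (G (H eta)); rewrite /O' /Phi' /= px ?k2.
  + move=> eta l he; have [k1 k2 k3] := h1 _ he.
    apply: (vdiff_comp (f := fun eta => Gam eta 0 l) (X := H) _ k3); apply: (cs_vdiff hS); exact: (Ur _ (h3 _ k1).1).
- by move=> x [Ox hx _]; split=> //; exact: (h3 _ hx).1.
- by [].
- have [Ox px] := csG (Ur _ U0); rewrite /O' /Phi' /= px subrr nr0; split=> //.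
  have -> : adj_coord W eta0 j eta0 = 0; last by rewrite nr0.
  by apply/rowP => l; rewrite !mxE W0 subrr if_same.
Unshelve. all: by end_near.
Qed.
End CSys.

Lemma csys_chart a p (A : set X) : chart_dom a p -> open A -> A p -> exists O r Gam Phi, [/\ csys a O r Gam Phi, O `<=` A,
  O p, Phi p = 0 & forall x, Phi x = chart a x - chart a p].
Proof.
move=> ha oA Ap; have nA : nbhs p A by apply: open_nbhs_nbhs.
have [d d0 hd] := chart_img ha; have [d' d0' hd'] := chart_inv_near ha nA.
pose r := Num.min d d'; have r0 : 0 < r by rewrite lt_min d0.
pose O := [set x | [/\ chart_dom a x, A x & nr (chart a x - chart a p) < r]].
exists O, r, (fun eta => eta + chart a p), (fun x => chart a x - chart a p); split=> //.
- split=> //.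
  + rewrite openE => x [hx Ax hr].
    have e1 : 0 < r - nr (chart a x - chart a p) by rewrite subr_gt0.
    have n1 := chart_near hx e1.
    have n2 : nbhs x (chart_dom a) by apply: open_nbhs_nbhs; split; [exact: chart_dom_open|].
    have n3 : nbhs x A by apply: open_nbhs_nbhs.
    near=> y; split; [by near: y|by near: y|].
    have : nr (chart a y - chart a x) < r - nr (chart a x - chart a p) by near: y.
    have := nr_tri (chart a x) (chart a y) (chart a p); lra.
  + by move=> x [].
  + by move=> x [].
  + by move=> x [hx _ _]; rewrite subrK.
  + move=> x j [hx _ _]; exists a => //.
    apply: (vdiff_near (f := fun eta => (eta 0 j + - chart a p 0 j))).
      have [e e0 he] := chart_img hx; exists e => // y /he[_ hy] /=; by rewrite hy !mxE.
    by apply: vdiffD; [exact: vdiff_coord|exact: vdiff_cst].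
  + move=> eta; rewrite lt_min => /andP[h1 h2].
    have hh : eta + chart a p - chart a p = eta by rewrite addrK.
    have [|k1 k2] := hd (eta + chart a p); first by rewrite hh.
    have k3 := hd' (eta + chart a p) ltac:(by rewrite hh).
    by exists (chart_inv a (eta + chart a p)); rewrite /O /= k2 hh // lt_min h1.
  + move=> eta j _; apply: vdiff_ext (vdiffD (vdiff_coord j eta) (vdiff_cst (chart a p 0 j) eta)) => y.
    by rewrite !mxE.
- by move=> x [].
- by rewrite /O /= subrr nr0.
- by rewrite subrr.
Unshelve. all: by end_near.
Qed.
End Charts.

(** * Local data along the hypersurface and the weight psi *)

Lemma levi_eq (R : realType) n (U : set 'rV[Cplx R]_n.+1) (F F' : 'rV[Cplx R]_n.+1 -> R) : vopen U -> (forall x, U x -> F x = F' x) -> levi U F -> levi U F'.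
Proof.
move=> oU e [A [B [h1 h2]]]; exists A, B; split=> // x Ux; apply: wd_near (h1 _ Ux).
by have [d d0 hd] := oU x Ux; exists d => // y /hd /e ->.
Qed.

Lemma ck_le (R : realType) n k l (U : set 'rV[Cplx R]_n.+1) (F : 'rV[Cplx R]_n.+1 -> R) : (l <= k)%N -> Ck k U F -> Ck l U F.
Proof.
elim: k l F => [|k IH] [|l] F //=; first by move=> _ [h1 _].
by move=> lk [h1 h2]; split=> // v; have [h3 h4] := h2 v; split=> //; exact: IH h4.
Qed.

Lemma ratio_alg (K : fieldType) (a t u c : K) : u != 0 -> t != 0 -> c != 0 ->
  a ^+ 2 / c = (a * t / u) ^+ 2 * (u ^+ 2 / (t ^+ 2 * c)).
Proof. by move=> *; field; apply/and3P. Qed.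

Section Data.
Variables (R : realType) (n : nat) (X : complexManifold R n) (Y : set X) (L : line_bundle [set: X]).
Variables (f : lb_index L -> X -> Cplx R) (h : lb_index L -> X -> R) (rr : option nat) (M : nat).
Local Notation C := (Cplx R).
Local Notation V := 'rV[C]_n.+1.
Hypothesis Hf : forall i, defining_function Y (lb_dom i) (f i).
Hypothesis Hft : forall i j p, lb_dom i p -> lb_dom j p -> f i p = lb_trans i j p * f j p.
Hypothesis Hh : hermitian_metric rr h.
Hypothesis Hs : forall i a p, lb_dom i p -> chart_dom a p -> chern_semipositive_at (h i \o chart_inv a) (chart a p).
Hypothesis HM : le_order M rr.
Hypothesis M2 : (2 <= M)%N.

(* Local coordinates [dP : dO -> ball of radius dr], with inverse [dG] read in
   the chart [da], whose coordinate number [dj] is the defining function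
   [du * f (di)] of the hypersurface. *)
Record datum := Datum { da : chart_index X; dO : set X; dr : R; dG : V -> V; dP : X -> V;
  di : lb_index L; dj : 'I_n.+1; du : X -> C }.
Implicit Types (D E : datum) (eta : V) (a : chart_index X) (i j : lb_index L) (x p : X).
Record valid D : Prop := Okd {
  ok_cs : csys (da D) (dO D) (dr D) (dG D) (dP D);
  ok_dom : forall x, dO D x -> lb_dom (di D) x;
  ok_u : forall x, dO D x -> xhol (du D) x;
  ok_u0 : forall x, dO D x -> du D x != 0;
  ok_w : forall x, dO D x -> dP D x 0 (dj D) = du D x * f (di D) x }.
Definition gD D eta : X := chart_inv (da D) (dG D eta).
(** The quotient |w|^2 / |f|_h^2 for w = u f: the factor |f|^2 has been cancelled, which defines psi
    on the hypersurface as well. *)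
Definition psi D eta : R := nr (du D (gD D eta)) ^+ 2 / h (di D) (gD D eta).
Definition ball0 (r : R) : set V := [set eta | nr eta < r].

Lemma ok_gD D eta : valid D -> nr eta < dr D -> dO D (gD D eta) /\ dP D (gD D eta) = eta.
Proof. by move=> [h0 _ _ _ _]; exact: csG. Qed.
Lemma ok_gK D x : valid D -> dO D x -> gD D (dP D x) = x.
Proof. by move=> hD; exact: (csGK (ok_cs hD)). Qed.
Lemma ok_Y D x : valid D -> dO D x -> (Y x <-> dP D x 0 (dj D) = 0).
Proof.
move=> hD Ox; have [_ hw _] := Hf (di D); rewrite (ok_w hD Ox) -(hw _ (ok_dom hD Ox)).
split=> [->|/eqP]; first by rewrite mulr0.
by rewrite mulf_eq0 (negbTE (ok_u0 hD Ox)) /= => /eqP.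
Qed.
Lemma ok_slice D eta : valid D -> nr eta < dr D -> eta 0 (dj D) = 0 -> Y (gD D eta).
Proof. by move=> hD /(ok_gD hD)[h1 h2] e; apply/(ok_Y hD h1); rewrite h2. Qed.
Lemma h_gt0 i p : lb_dom i p -> 0 < h i p. Proof. by case: Hh => h0 _ _; exact: h0. Qed.
Lemma psi_gt0 D eta : valid D -> nr eta < dr D -> 0 < psi D eta.
Proof.
move=> hD he; have [Ox _] := ok_gD hD he; rewrite divr_gt0 ?h_gt0 //; last exact: (ok_dom hD Ox).
by rewrite exprn_gt0 // nr_gt0 (ok_u0 hD Ox).
Qed.

Lemma chart_vopen a (i : lb_index L) : vopen (chart a @` (chart_dom a `&` lb_dom i)).
Proof.
move=> _ [q [hq hi] <-]; have [d d0 hd] := chart_img hq.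
have ni : nbhs q (lb_dom i) by apply: open_nbhs_nbhs; split; [exact: lb_dom_open|].
have [d' d0' hd'] := chart_inv_near hq ni.
exists (Num.min d d'); first by rewrite lt_min d0.
by move=> y; rewrite lt_min => /andP[/hd[h1 h2] /hd' h3]; exists (chart_inv a y).
Qed.

Lemma ok_uG D eta : valid D -> nr eta < dr D -> vdiff (fun eta => du D (gD D eta)) eta.
Proof.
by move=> hD he; apply: (cs_comp (ok_cs hD) he); apply: (ok_u hD); exact: (ok_gD hD he).1.
Qed.
Lemma ok_ball D : vopen (ball0 (dr D)). Proof. exact: cs_ball. Qed.
Lemma ok_GamU D eta : valid D -> nr eta < dr D -> (chart (da D) @` (chart_dom (da D) `&` lb_dom (di D))) (dG D eta).
Proof.
move=> hD he; have [h1 h2] := csGam (ok_cs hD) he; exists (gD D eta) => //; split=> //.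
by apply: (ok_dom hD); exact: (ok_gD hD he).1.
Qed.
Lemma h_Ck a i : Ck M (chart a @` (chart_dom a `&` lb_dom i)) (h i \o chart_inv a).
Proof. by case: Hh => _ _ h0; exact: h0. Qed.
Lemma h_chart_gt0 a i eta : (chart a @` (chart_dom a `&` lb_dom i)) eta -> 0 < (h i \o chart_inv a) eta.
Proof. by move=> [q [hq hi] <-] /=; rewrite chartK // h_gt0. Qed.

Lemma psi_smooth D : valid D -> smooth M (ball0 (dr D)) (fun eta => rc (psi D eta)).
Proof.
move=> hD; have oB := @ok_ball D.
have s1 := Ck_smooth (@chart_vopen (da D) (di D)) (@h_Ck (da D) (di D)).
have s2 : smooth M (ball0 (dr D)) (fun eta => rc (h (di D) (gD D eta))).
  apply: (smooth_comp (F := fun y => rc ((h (di D) \o chart_inv (da D)) y)) (G := dG D) oB _ _ s1).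
    by move=> eta; exact: ok_GamU.
  by move=> j eta; exact: (cs_vdiff (ok_cs hD)).
have s3 : smooth M (ball0 (dr D)) (fun eta => du D (gD D eta)).
  by apply: smooth_hol => // eta; exact: ok_uG.
have h0 eta : ball0 (dr D) eta -> rc (h (di D) (gD D eta)) != 0.
  move=> he; rewrite -nr_gt0 nr_rc normr_gt0 gt_eqF // h_gt0 //.
  by apply: (ok_dom hD); exact: (ok_gD hD he).1.
apply: smooth_ext (smooth_M (smooth_M s3 (smooth_J s3)) (smooth_V h0 s2)) => x.
by rewrite -nr_sqr -rcV -rcM.
Qed.

(** log psi is log |u|^2, which is pluriharmonic, minus log h, whose negative has a semipositive
    Levi form by the curvature assumption. *)
Lemma psi_levi D : valid D -> levi (ball0 (dr D)) (fun eta => ln (psi D eta)).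
Proof.
move=> hD; have oB := @ok_ball D.
have l1 : levi (chart (da D) @` (chart_dom (da D) `&` lb_dom (di D))) (fun y : V => - ln ((h (di D) \o chart_inv (da D)) y)).
  apply: chern_levi; first exact: chart_vopen.
  - by move=> x; exact: h_chart_gt0.
  - exact: ck_le M2 (@h_Ck (da D) (di D)).
  - by move=> _ [q [hq hi] <-]; exact: Hs.
have l2 : levi (ball0 (dr D)) (fun eta => - ln (h (di D) (gD D eta))).
  apply: (levi_comp (G := dG D) oB _ _ l1) => [eta|j eta]; first exact: ok_GamU.
  exact: (cs_vdiff (ok_cs hD)).
have hu : hol (ball0 (dr D)) (fun eta => du D (gD D eta)) by move=> eta; exact: ok_uG.
have u0 eta : ball0 (dr D) eta -> du D (gD D eta) != 0.
  by move=> he; apply: (ok_u0 hD); exact: (ok_gD hD he).1.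
apply: levi_eq oB _ (levi_log oB hu u0 l2) => eta he /=.
have p1 : 0 < h (di D) (gD D eta) by apply: h_gt0; apply: (ok_dom hD); exact: (ok_gD hD he).1.
by rewrite /psi lnM ?posrE ?invr_gt0 ?exprn_gt0 ?nr_gt0 ?u0 // lnV ?posrE.
Qed.

Lemma psi_sub D z nu : valid D -> (forall t : C, nr t <= 1 -> nr (z + t *: nu) < dr D) ->
  psi D z <= cre (mean (fun t => rc (psi D (z + t *: nu)))).
Proof.
move=> hD hz; apply: (levi_sub_mean (@ok_ball D) _ (psi_levi hD) hz) => x.
exact: psi_gt0.
Qed.

Lemma tr_inv i j p : lb_dom i p -> lb_dom j p -> lb_trans i j p * lb_trans j i p = 1.
Proof. by move=> hi hj; rewrite (@lb_trans_cocycle _ _ _ _ L i j i p) // lb_trans_id. Qed.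
Lemma tr_hol i j p : lb_dom i p -> lb_dom j p -> xhol (lb_trans i j) p.
Proof.
move=> hi hj; have [F hF] := @lb_trans_holo _ _ _ _ L i j p I (conj hi hj).
have [h1 _] := nbhs_singleton hF.
by apply: xhol_near (holo_xhol h1); apply: filterS hF => q [_ h2]; exact: h2.
Qed.

(* The quotient of the two local coordinates, written with the transition
   functions of [Y] so that it is also defined on the hypersurface. *)
Definition ratio D E x : C := du E x * lb_trans (di E) (di D) x / du D x.

Lemma ratio_hol D E x : valid D -> valid E -> dO D x -> dO E x -> xhol (ratio D E) x /\ ratio D E x != 0.
Proof.
move=> hD hE xD xE; have iD := ok_dom hD xD; have iE := ok_dom hE xE; split.
  apply: xholM; last by apply: xholV; [exact: (ok_u0 hD xD)|exact: (ok_u hD xD)].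
  by apply: xholM; [exact: (ok_u hE xE)|exact: tr_hol].
have t0 : lb_trans (di E) (di D) x != 0.
  by apply/eqP => e; have := tr_inv iE iD; rewrite e mul0r => /eqP; rewrite eq_sym oner_eq0.
by rewrite !mulf_neq0 ?invr_neq0 ?(ok_u0 hE xE) ?(ok_u0 hD xD).
Qed.
Lemma ratio_w D E x : valid D -> valid E -> dO D x -> dO E x -> dP E x 0 (dj E) = ratio D E x * dP D x 0 (dj D).
Proof.
move=> hD hE xD xE; rewrite (ok_w hE xE) (ok_w hD xD) (Hft (ok_dom hE xE) (ok_dom hD xD)) /ratio.
by have := ok_u0 hD xD; move: (du D x) (du E x) (lb_trans _ _ x) (f _ x) => *; field.
Qed.
(** The denominator |f|_h^2 of psi does not depend on the datum, so only the squared modulus of the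
    quotient of coordinates appears. *)
Lemma ratio_psi D E x : valid D -> valid E -> dO D x -> dO E x ->
  psi E (dP E x) = nr (ratio D E x) ^+ 2 * psi D (dP D x).
Proof.
move=> hD hE xD xE; have iD := ok_dom hD xD; have iE := ok_dom hE xE.
rewrite /psi (ok_gK hD xD) (ok_gK hE xE) /ratio !nrM nrV.
have /(congr1 (@cre R)) : rc (h (di D) x) = `|lb_trans (di E) (di D) x| ^+ 2 * rc (h (di E) x).
  by case: Hh => _ h1 _; exact: h1.
rewrite nrE -rcX -rcM !cre_rc => ->.
have p1 := h_gt0 iE; have u1 : nr (du D x) != 0 by rewrite nr_eq0 (ok_u0 hD xD).
have t0 : nr (lb_trans (di E) (di D) x) != 0.
  rewrite nr_eq0; apply/eqP => e; have := tr_inv iE iD; rewrite e mul0r => /eqP; rewrite eq_sym oner_eq0 //.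
by apply: ratio_alg => //; rewrite gt_eqF.
Qed.

Definition Wq (j : 'I_n.+1) (q : V -> C) (eta : V) : C := eta 0 j * q eta.

(** Replaces the coordinate w by w q for a nowhere vanishing holomorphic [q]. At a slice point the
    normal derivative of w q is [q eta0], which is not 0, so [recoord] applies. All later
    normalizations of w are instances. *)
Lemma redatum D (U : set V) (q : V -> C) (eta0 : V) : valid D -> vopen U -> (forall eta, U eta -> nr eta < dr D) ->
  hol U q -> (forall eta, U eta -> q eta != 0) -> U eta0 -> eta0 0 (dj D) = 0 ->
  exists E, [/\ valid E, dj E = dj D /\ di E = di D, forall x, dO E x -> dO D x /\ U (dP D x),
    dO E (gD D eta0) /\ dP E (gD D eta0) = 0 &
    forall x, dO E x -> dP E x = adj_coord (Wq (dj D) q) eta0 (dj D) (dP D x) /\ du E x = du D x * q (dP D x)].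
Proof.
move=> hD oU Ur hq q0 U0 e0.
have hW : hol U (Wq (dj D) q) by move=> x Ux; apply: vdiffM (hq _ Ux); exact: vdiff_coord.
have W0 : Wq (dj D) q eta0 = 0 by rewrite /Wq e0 mul0r.
have gW : grad (Wq (dj D) q) eta0 0 (dj D) != 0.
  have := wdM (wd_coord (dj D) eta0) (gradP (hq _ U0)); rewrite !scaler0 addr0 => /gradE ->.
  by rewrite e0 scale0r addr0 !mxE !eqxx mulr1 q0.
have [ O' [r' [G' [P' [h1 h2 h3 h4]]]]] := recoord (ok_cs hD) oU Ur hW U0 W0 gW.
exists (Datum (da D) O' r' G' P' (di D) (dj D) (fun x => du D x * q (dP D x))); split=> //=.
- split=> //= x Ox; have [Dx Ux] := h2 _ Ox.
  + exact: (ok_dom hD Dx).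
  + by apply: xholM; [exact: (ok_u hD Dx)|apply: (cs_xhol (ok_cs hD) Dx); exact: hq].
  + by rewrite mulf_neq0 ?q0 ?(ok_u0 hD Dx).
  + by rewrite h3 mxE eqxx /Wq (ok_w hD Dx) mulrAC.
- split=> //; rewrite h3 (ok_gD hD (Ur _ U0)).2.
  by apply/rowP => l; rewrite !mxE W0 subrr if_same.
Qed.

(** Some partial derivative of the local equation at [p] is nonzero, and the equation replaces the
    corresponding coordinate of a chart. *)
Lemma init_datum i p : Y p -> lb_dom i p -> exists D, [/\ valid D, dO D p, dP D p = 0, di D = i & forall x, du D x = 1].
Proof.
move=> Yp ip; have [a ha] := chart_dom_cover p.
have [ O [r [G0 [P0 [hS OA Op P00 hP]]]]] := csys_chart ha (@lb_dom_open _ _ _ _ L i) ip.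
have [hf1 hf2 hf3] := Hf i; have [v hv] := hf3 a p ip Yp ha.
have dfi : differentiable (f i \o chart_inv a) (chart a p) by exact: hf1.
have hw := diff_wd dfi.
have [j hj] : exists j : 'I_n.+1, ('d (f i \o chart_inv a) (chart a p) (delta_mx 0 j) : C) != 0.
  apply/existsP; apply: contraNT hv => /existsPn h0; rewrite /chart_diff {1}[v]row_sum_delta linear_sum big1 // => j _.
  by rewrite linearZ /=; have /negPn/eqP -> := h0 j; rewrite scaler0.
have r0 := cs_r hS; have Gp : chart_inv a (G0 0) = p by rewrite -P00 (csGK hS).
pose W eta := f i (chart_inv a (G0 eta)).
have hW : hol (ball0 r) W.
  move=> eta he; apply: (cs_comp hS he); apply: holo_xhol; apply: hf1; apply: OA; exact: (csG hS he).1.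
have b0 : ball0 r 0 by rewrite /ball0 /= nr0.
have W0 : W 0 = 0 by rewrite /W Gp; apply/(hf2 _ ip).
have gW : grad W 0 0 j != 0.
  have : wd W 0 (\row_(j < n.+1) ('d (f i \o chart_inv a) (chart a p) (delta_mx 0 j) : C)) 0.
    apply: (lito_near r0) hw => y hy; have := csG hS hy; have [k1 k2] := csGam hS hy.
    move=> [k3]; rewrite hP k2 => k4.
    rewrite add0r W0 /W /= chartK // -[LHS]/(f i (chart_inv a (chart a p + y)) - f i p - _).
    have -> : chart a p + y = G0 y by rewrite -{1}k4 addrC subrK.
    by have /(hf2 _ ip) -> := Yp.
  by move=> /gradE ->; rewrite mxE.
have [ O' [r' [G' [P' [h1 h2 h3 h4]]]]] := recoord hS (@cs_ball _ _ r) (fun eta h => h) hW b0 W0 gW.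
exists (Datum a O' r' G' P' i j (fun=> 1)); split=> //=.
- split=> //= x Ox; have [Dx Ux] := h2 _ Ox.
  + exact: OA.
  + exact: xhol_cst.

  + by rewrite h3 mxE eqxx /W (csGK hS Dx) mul1r.
- by rewrite -Gp.
- by rewrite h3 P00; apply/rowP => l; rewrite !mxE W0 subrr if_same.
Qed.
End Data.

(** * Maximum principle *)

Section MaxPrinciple.
Variables (R : realType) (n : nat) (X : complexManifold R n) (Y : set X) (L : line_bundle [set: X]).
Variables (f : lb_index L -> X -> Cplx R).
Local Notation C := (Cplx R).
Local Notation V := 'rV[C]_n.+1.
Hypothesis Hf : forall i, defining_function Y (lb_dom i) (f i).
Implicit Types (D E : datum L) (z nu eta : V) (x p : X) (b : X -> R).

(** The zero slice of a polydisc is convex, and the image of a segment in it is a connected subset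
    of [Y]. *)
Lemma slice_connected D z z' : valid f D -> nr z < dr D -> nr z' < dr D -> z 0 (dj D) = 0 -> z' 0 (dj D) = 0 ->
  connected_component Y (gD D z) (gD D z').
Proof.
move=> hD hz hz' z0 z0'; pose g (t : R) := gD D (z + rc t *: (z' - z)).
have hb t : 0 <= t <= 1 -> nr (z + rc t *: (z' - z)) < dr D.
  move=> /andP[t0 t1].
  have -> : z + rc t *: (z' - z) = rc t *: (z' - 0) + rc (1 - t) *: (z - 0).
    by rewrite rcB -seg_sub subr0.
  rewrite !subr0; apply: le_lt_trans (nrD _ _) _; rewrite !nrZ !nr_rc !ger0_norm ?subr_ge0 //.
  have [->|tn] := eqVneq t 0; first by lra.
  have tp : 0 < t by rewrite lt_neqAle eq_sym tn.
  have h1 : t * nr z' < t * dr D by rewrite ltr_pM2l.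
  have h2 : (1 - t) * nr z <= (1 - t) * dr D by rewrite ler_wpM2l ?subr_ge0 // ltW.
  by move: h1 h2; lra.
have gY t : 0 <= t <= 1 -> Y (g t).
  move=> ht; apply: (ok_slice Hf hD (hb t ht)); by rewrite !mxE z0 z0' subrr mulr0 addr0.
have cg : {within `[0, 1]%classic, continuous g}.
  apply: continuous_in_subspaceT => t; rewrite inE /= in_itv /= => ht A hA.
  have [d d0 hd] := cs_cont (ok_cs hD) (hb t ht) hA.
  have N0 : 0 < nr (z' - z) + 1 by rewrite ltr_wpDl // nr_ge0.
  have hn : \forall s \near t, `|t - s| < d / (nr (z' - z) + 1).
    by apply/nbhs_ballP; exists (d / (nr (z' - z) + 1)) => //; rewrite /= divr_gt0.
  apply: filterS hn => s; rewrite ltr_pdivlMr // => hs; apply: hd.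
  rewrite opprD addrACA subrr add0r -scalerBl -rcB nrZ nr_rc distrC; apply: le_lt_trans hs.
  by rewrite ler_wpM2l // lerDl.
exists (g @` `[0, 1]%classic); last first.
  by exists 1; [rewrite /= in_itv /= ler01 lexx|rewrite /g rc1 scale1r addrC subrK].
split; last exact: connected_continuous_connected (@segment_connected R 0 1) cg.
- by exists 0; [rewrite /= in_itv /= ler01 lexx|rewrite /g rc0 scale0r addr0].
- by move=> _ [t ht <-]; apply: gY; move: ht; rewrite /= in_itv.
Qed.

Definition slice_cont D b := forall z, nr z < dr D -> z 0 (dj D) = 0 -> forall e, 0 < e ->
  exists2 d : R, 0 < d & forall y, nr (y - z) < d -> y 0 (dj D) = 0 -> `|b (gD D y) - b (gD D z)| < e.
Definition slice_sub D b := forall z nu, z 0 (dj D) = 0 -> nu 0 (dj D) = 0 ->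
  (forall t : C, nr t <= 1 -> nr (z + t *: nu) < dr D) -> b (gD D z) <= cre (mean (fun t => rc (b (gD D (z + t *: nu))))).

Lemma slice_line D z nu (t : C) : z 0 (dj D) = 0 -> nu 0 (dj D) = 0 -> (z + t *: nu) 0 (dj D) = 0.
Proof. by move=> h1 h2; rewrite !mxE h1 h2 mulr0 addr0. Qed.

Lemma slice_circ D b z nu : slice_cont D b -> z 0 (dj D) = 0 -> nu 0 (dj D) = 0 ->
  (forall t : C, nr t <= 1 -> nr (z + t *: nu) < dr D) -> circ (fun t => rc (b (gD D (z + t *: nu)))).
Proof.
move=> hc z0 nu0 hb t ht e e0.
have [d d0 hd] := hc _ (hb t ltac:(by rewrite ht)) (slice_line t z0 nu0) e e0.
have [d' d0' hd'] := @cont_line R V z nu t d d0; exists d' => // s /hd' hs.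
by rewrite -rcB nr_rc; apply: hd => //; exact: slice_line.
Qed.

(* If b attains its maximum on a component of Y at a slice point, sub-mean values force b to be constant around it. *)
Lemma max_spread D b z (B : R) : valid f D -> slice_cont D b -> slice_sub D b -> nr z < dr D -> z 0 (dj D) = 0 ->
  (forall y, connected_component Y (gD D z) y -> b y <= B) -> b (gD D z) = B ->
  \forall y \near gD D z, Y y -> b y = B.
Proof.
move=> hD hc hs hz z0 hB bz.
have [Oz Pz] := ok_gD hD hz; have e0 : 0 < dr D - nr z by rewrite subr_gt0.
have n1 := xhol_cont (fun l => cs_hol (ok_cs hD) l Oz) e0.
have n2 := cs_nbhs (ok_cs hD) Oz.
near=> y => Yy; have Oy : dO D y by near: y.
have : nr (dP D y - dP D (gD D z)) < dr D - nr z by near: y.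
rewrite Pz; set nu := dP D y - z => hnu.
have nu0 : nu 0 (dj D) = 0 by rewrite !mxE z0 subr0; apply/(ok_Y Hf hD Oy).
have hb t : nr t <= 1 -> nr (z + t *: nu) < dr D.
  move=> ht; apply: le_lt_trans (nrD _ _) _; rewrite nrZ.
  have := ler_wpM2r (nr_ge0 nu) ht; rewrite mul1r; move: hnu; lra.
have cu := slice_circ hc z0 nu0 hb.
pose u t := rc B - rc (b (gD D (z + t *: nu))).
have cu' : circ u by apply: circB; [exact: circ_cst|exact: cu].
have hu t : nr t = 1 -> 0 <= cre (u t).
  move=> ht; rewrite /u -rcB cre_rc subr_ge0; apply: hB.
  apply: slice_connected => //; [by apply: hb; rewrite ht|exact: slice_line].
have := mean_posdef cu' hu; rewrite /u meanB ?mean_cst //; last exact: circ_cst.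
rewrite creB cre_rc subr_le0 -bz => /(_ (hs z nu z0 nu0 hb) 1 (nr1 R)).
have -> : z + 1 *: nu = dP D y by rewrite scale1r /nu addrC subrK.
by rewrite -rcB cre_rc (ok_gK hD Oy) => /eqP; rewrite subr_eq0 => /eqP ->.
Unshelve. all: by end_near.
Qed.

(** On the component of a slice point, compact because [Y] is, the maximum is attained; the set
    where it is attained is relatively open by [max_spread] and closed by continuity, so it is the
    whole component, which contains the slice. *)
Lemma max_principle b : compact Y ->
  (forall p, Y p -> exists D, [/\ valid f D, dO D p, slice_cont D b & slice_sub D b]) ->
  forall D, valid f D -> forall z z', nr z < dr D -> nr z' < dr D -> z 0 (dj D) = 0 -> z' 0 (dj D) = 0 ->
    b (gD D z) = b (gD D z').
Proof.
move=> cY hb D hD z z' hz hz' z0 z0'; set p := gD D z.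
have Yp : Y p := ok_slice Hf hD hz z0.
pose K := connected_component Y p.
have clY : closed Y := compact_closed (@cm_hausdorff _ _ X) cY.
have cK : compact K by apply: subclosed_compact cY _; [exact: component_closed|exact: connected_component_sub].
have KY x : K x -> Y x by exact: connected_component_sub.
have bK : {within K, continuous b}.
  apply/subspace_continuousP => x Kx; have [E [hE Ox hc _]] := hb x (KY _ Kx).
  have Px := cs_Phi (ok_cs hE) Ox; have P0 := (ok_Y Hf hE Ox).1 (KY _ Kx).
  apply/cvgrPdist_lt => e e0; have [d d0 hd] := hc _ Px P0 e e0.
  rewrite (ok_gK hE Ox) in hd.
  have n1 := xhol_cont (fun l => cs_hol (ok_cs hE) l Ox) d0.
  have n2 := cs_nbhs (ok_cs hE) Ox.
  have n3 : \forall y \near x, K y -> `|b x - b y| < e.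
    near=> y => Ky; have Oy : dO E y by near: y.
    have := hd (dP E y) _ ((ok_Y Hf hE Oy).1 (KY _ Ky)); rewrite (ok_gK hE Oy) distrC; apply.
    by near: y.
  exact: n3.
have [c cK' hmax] := compact_EVT_max (ex_intro _ p (connected_component_refl Yp)) cK bK.
move: cK'; rewrite inE => Kc; set B := b c.
have hB y : K y -> b y <= B by move=> Ky; apply: hmax; rewrite inE.
have spread x : K x -> b x = B -> \forall y \near x, Y y -> b y = B.
  move=> Kx bx; have [E [hE Ox hc hs]] := hb x (KY _ Kx).
  have Px := cs_Phi (ok_cs hE) Ox; have P0 := (ok_Y Hf hE Ox).1 (KY _ Kx).
  have := @max_spread E b (dP E x) B hE hc hs Px P0; rewrite (ok_gK hE Ox); apply => // y hy.
  by apply: hB; exact: connected_component_trans hy.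
(* Connectedness of the component, with the nonempty, relatively open and relatively closed set of
   maximum points. *)
have KE : K `&` [set x | b x = B] = K.
  apply: (@component_connected _ Y p).
  - by exists c.
  - exists (interior [set x | Y x -> b x = B]); first exact: open_interior.
    apply/seteqP; split=> x [Kx].
      by move=> /= bx; split=> //; exact: spread.
    by move=> /interior_subset /= h; split=> //; apply: h; exact: KY.
  - exists (closure (K `&` [set x | b x = B])); first exact: closed_closure.
    apply/seteqP; split=> x; first by move=> h; split; [exact: h.1|exact: subset_closure].
    move=> [Kx clx]; split=> //=; apply/eqP; rewrite eq_le hB //= leNgt; apply/negP => lt.
    have /subspace_continuousP := bK => /(_ x Kx) /cvgrPdist_lt /(_ (B - b x) ltac:(by rewrite subr_gt0)) hn.
    have [y [[Ky /= by_] hy]] := clx _ hn.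
    have hxy : `|b x - b y| < B - b x := hy Ky.
    by move: hxy; rewrite by_ distrC; have := ler_norm (B - b x); lra.
have bB x : K x -> b x = B by rewrite -{1}KE => -[].
rewrite (bB _ (connected_component_refl Yp)) (bB (gD D z')) //.
exact: slice_connected.
Unshelve. all: by end_near.
Qed.
End MaxPrinciple.

(** * Comparison of expansions in two coordinate systems *)

Section JetTools.
Variable R : realType.
Local Notation C := (Cplx R).
Implicit Types (f g : C -> C) (P Q : {poly {poly C}}) (w : C).

Lemma jet_ev K P : jet K (ev P) P.
Proof. by exists 1 => //; exists 0 => w _; rewrite subrr nr0 mul0r. Qed.

(** The factor [f] is known only to order [K - (k + l)]; the missing orders are supplied by the
    [k + l] factors [om], each O(|w|). This matches the smoothness that the coefficients of an
    expansion retain. *)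
Lemma jet_shift K k l f om P Q (B d : R) : 0 < d -> (forall w, nr w < d -> nr (om w) <= B * nr w) ->
  jet (K - (k + l)) f P -> jet K om Q -> jet K (fun w => f w * om w ^+ k * (om w)^* ^+ l) (P * Q ^+ k * (cJ Q) ^+ l).
Proof.
move=> d0 hom hf hQ; have [d' d0' [B' hB']] := hf.
have h1 := jetM (jetM (jet_ev K P) (jetX k hQ)) (jetX l (jetJ hQ)).
have h2 : jet K (fun w => (f w - ev P w) * om w ^+ k * (om w)^* ^+ l) 0.
  exists (Num.min (Num.min d d') 1); first by rewrite !lt_min d0 d0' ltr01.
  exists (`|B'| * `|B| ^+ (k + l)) => w; rewrite !lt_min => /andP[/andP[/hom w1 /hB' w2] w3].
  have -> : ev 0 w = 0 by rewrite /ev !horner0.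
  rewrite subr0 !nrM !nrX nrJ -mulrA -exprD.
  have w4 : nr (om w) <= `|B| * nr w by apply: le_trans w1 _; rewrite ler_wpM2r ?nr_ge0 // ler_norm.
  have w5 : nr (om w) ^+ (k + l) <= `|B| ^+ (k + l) * nr w ^+ (k + l).
    by rewrite -exprMn lerXn2r ?nnegrE ?nr_ge0 // mulr_ge0 ?nr_ge0.
  have X0 j : 0 <= nr w ^+ j by rewrite exprn_ge0 // nr_ge0.
  have w6 : nr (f w - ev P w) <= `|B'| * nr w ^+ (K - (k + l)).
    by apply: le_trans w2 _; rewrite ler_wpM2r // ler_norm.
  apply: le_trans (ler_pM (nr_ge0 _) (exprn_ge0 _ (nr_ge0 _)) w6 w5) _.
  have -> : `|B'| * nr w ^+ (K - (k + l)) * (`|B| ^+ (k + l) * nr w ^+ (k + l)) = `|B'| * `|B| ^+ (k + l) * nr w ^+ (K - (k + l) + (k + l)).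
    by rewrite [nr w ^+ (K - (k + l) + (k + l))]exprD mulrACA.
  rewrite ler_wpM2l ?mulr_ge0 ?exprn_ge0 // ler_wiXn2l ?nr_ge0 ?(ltW w3) //; lia.
rewrite -[_ * _ * _]add0r; apply: jet_near (jetD h2 h1).
by exists 1 => // w _; ring.
Qed.

(** Congruence modulo the ideal generated by the m-th powers of w and of its conjugate. *)
Definition cong m P Q := forall k l, (k < m)%N -> (l < m)%N -> P`_l`_k = Q`_l`_k.
Lemma congM m P P' Q Q' : cong m P P' -> cong m Q Q' -> cong m (P * Q) (P' * Q').
Proof.
move=> h h' k l km lm; rewrite !coefM !coef_sum; apply: eq_bigr => j _.
rewrite !coefM; apply: eq_bigr => i _; have := ltn_ord i; have := ltn_ord j => jl ik.
by rewrite h ?h' //; lia.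
Qed.
Lemma congX m P P' j : cong m P P' -> cong m (P ^+ j) (P' ^+ j).
Proof. by move=> h; elim: j => [//|j IH]; rewrite !exprS; exact: congM. Qed.
Lemma cong_refl m P : cong m P P. Proof. by []. Qed.
Lemma congJ m P P' : cong m P P' -> cong m (cJ P) (cJ P').
Proof. by move=> h k l km lm; rewrite !cJE h. Qed.

Lemma cJM P Q : cJ (P * Q) = cJ P * cJ Q.
Proof. by rewrite /cJ !rmorphM. Qed.
Lemma cJX P j : cJ (P ^+ j) = cJ P ^+ j.
Proof. by rewrite /cJ !rmorphXn. Qed.
Lemma cJC (c : C) : cJ c%:P%:P = (c^*)%:P%:P.
Proof.
apply/polyP => l; apply/polyP => k; rewrite cJE !coefC.
by case: l k => [|l] [|k] //=; rewrite ?coefC ?coef0 ?rmorph0.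
Qed.
Lemma cJ_X : cJ ('X%:P : {poly {poly C}}) = 'X.
Proof.
apply/polyP => l; apply/polyP => k; rewrite cJE coefC coefX.
case: k => [|k] /=; first by rewrite coefX; case: (l == 1)%N; rewrite ?coef1 ?coef0 ?cj1 ?cj0.
by rewrite coef0 cj0; case: (l == 1)%N; rewrite ?coef1 ?coef0.
Qed.
Lemma coef_mono (c : C) P k l k0 l0 : (P * (c%:P%:P * 'X%:P ^+ k) * 'X ^+ l)`_l0`_k0 =
  if (k <= k0)%N && (l <= l0)%N then c * P`_(l0 - l)`_(k0 - k) else 0.
Proof.
rewrite coefMXn ltnNge; case: (leqP l l0) => hl; rewrite ?andbF ?coef0 // andbT /=.
rewrite -rmorphXn -rmorphM coefMC mulrC -mulrA coefCM coefXnM ltnNge.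
by case: (leqP k k0) => hk /=; rewrite ?mulr0.
Qed.
End JetTools.

(** A polynomial in w alone: constant in the outer variable, which stands for the conjugate of w. *)
Definition gpol (R : realType) M (c : nat -> Cplx R) : {poly {poly (Cplx R)}} := (\poly_(k < M) c k)%:P.
Definition Xh (R : realType) : {poly {poly (Cplx R)}} := 'X%:P.
Arguments Xh {R}.

Section Transfer.
Variables (R : realType) (n : nat) (X : complexManifold R n) (Y : set X) (L : line_bundle [set: X]).
Variables (f : lb_index L -> X -> Cplx R) (h : lb_index L -> X -> R) (rr : option nat) (M : nat).
Local Notation C := (Cplx R).
Local Notation V := 'rV[C]_n.+1.
Hypothesis Hf : forall i, defining_function Y (lb_dom i) (f i).
Hypothesis Hft : forall i j p, lb_dom i p -> lb_dom j p -> f i p = lb_trans i j p * f j p.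
Hypothesis Hh : hermitian_metric rr h.
Implicit Types (D E : datum L) (z nu eta : V) (x p : X).

(* The coefficients of [psi] along the lines in the direction of the defining
   coordinate, with [a k l z] the coefficient of [w ^+ k * w^* ^+ l]. *)
Definition slice_exp D (a : nat -> nat -> V -> C) :=
  [/\ forall k l, (M <= k + l)%N -> forall z, a k l z = 0,
      forall k l, smooth (M - (k + l)) (ball0 (dr D)) (a k l),
      forall z, a 0 0 z = rc (psi h D z) &
      forall z0, ball0 (dr D) z0 -> exists2 r : R, 0 < r & exists B : R, forall z (w : C), nr (z - z0) < r -> nr w < r ->
        ball0 (dr D) (z + w *: delta_mx 0 (dj D)) /\
        nr (rc (psi h D (z + w *: delta_mx 0 (dj D))) - esum M (fun k l => a k l z) w) <= B * nr w ^+ M].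

Lemma slice_exp_jet D a z : slice_exp D a -> nr z < dr D ->
  jet M (fun w => rc (psi h D (z + w *: delta_mx 0 (dj D)))) (bipoly M (fun k l => a k l z)).
Proof.
move=> [_ _ _ hE] hz; have [r r0 [B hB]] := hE _ hz.
by apply: (jet_esum r0) => w hw; apply: (hB z w _ hw).2; rewrite subrr nr0.
Qed.

Lemma slice_exp_real D a z k l : slice_exp D a -> nr z < dr D -> a l k z = (a k l z)^*.
Proof.
move=> hE hz; have hj := slice_exp_jet hE hz.
have [kl|kl] := ltnP (k + l) M; last first.
  by have [h0 _ _ _] := hE; rewrite !h0 ?rmorph0 // addnC.
have hj' : jet M (fun w => rc (psi h D (z + w *: delta_mx 0 (dj D)))) (cJ (bipoly M (fun k l => a k l z))).
  by apply: jet_near (jetJ hj); exists 1 => // w _; rewrite rcJ.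
have lk : (l + k < M)%N by rewrite addnC.
have := jet_uniq hj hj' lk; rewrite cJE !bpE.
by rewrite (leq_ltn_trans (leq_addr _ _) kl) (leq_ltn_trans (leq_addl _ _) kl).
Qed.

Definition change D E eta : V := dP E (gD D eta).
Definition change_dom D E : set V := [set eta | nr eta < dr D /\ dO E (gD D eta)].

Lemma change_hol D E : valid f D -> valid f E -> [/\ vopen (change_dom D E), forall j, hol (change_dom D E) (fun eta => change D E eta 0 j) &
  hol (change_dom D E) (fun eta => ratio D E (gD D eta))].
Proof.
move=> hD hE; split.
- have h1 := cs_vopen (ok_cs hD) (cs_O (ok_cs hE)); exact: h1.
- by move=> j eta [he hO]; have h1 := cs_comp (ok_cs hD) he (cs_hol (ok_cs hE) j hO); exact: h1.
- by move=> eta [he hO]; apply: (cs_comp (ok_cs hD) he); apply: (ratio_hol hD hE _ hO).1; exact: (ok_gD hD he).1.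
Qed.

(** The identity psi_E = |ratio|^2 psi_D is expanded on the line through [x] in the normal direction
    of [D]: on the left with the expansion in [D], on the right with the expansion in [E] at the
    value ratio * w of the other coordinate. Here [g] is the jet of the ratio and [P k l] that of
    the coefficient [a' k l] followed along the line. *)
Lemma transfer D E a a' x : valid f D -> valid f E -> slice_exp D a -> slice_exp E a' -> dO D x -> dO E x -> Y x ->
  exists (c : nat -> C) (P : nat -> nat -> {poly {poly C}}),
  [/\ (0 < M)%N -> c 0 = ratio D E x,
      forall k l, (k + l < M)%N -> (P k l)`_0`_0 = a' k l (dP E x),
      forall k l A, (forall eta, nr eta < dr E -> eta 0 (dj E) = 0 -> a' k l eta = A) -> P k l = A%:P%:P,
      (exists2 d : R, 0 < d & exists B : R, forall w, nr w < d ->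
          nr (ratio D E (gD D (dP D x + w *: delta_mx 0 (dj D))) - \sum_(k < M) c k * w ^+ k) <= B * nr w ^+ M) &
      let g := gpol M c in forall k0 l0, (k0 + l0 < M)%N ->
      (g * cJ g * bipoly M (fun k l => a k l (dP D x)))`_l0`_k0 =
      (\sum_(k < M) \sum_(l < M) P k l * (g * Xh) ^+ k * (cJ (g * Xh)) ^+ l)`_l0`_k0].
Proof.
move=> hD hE ha ha' xD xE Yx; set z := dP D x; set z' := dP E x.
have hz : nr z < dr D := cs_Phi (ok_cs hD) xD; have hz' : nr z' < dr E := cs_Phi (ok_cs hE) xE.
have z0 : z 0 (dj D) = 0 by apply/(ok_Y Hf hD xD).
have z0' : z' 0 (dj E) = 0 by apply/(ok_Y Hf hE xE).
have [oW hT hR] := change_hol hD hE.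
have Gz : gD D z = x := ok_gK hD xD.
have Wz : change_dom D E z by rewrite /change_dom /= Gz.
have Tz : change D E z = z' by rewrite /change Gz.
pose e : V := delta_mx 0 (dj D).
have ne : nr e = 1 by exact: nr_delta.
have [rc1 rc10 [c0 [_ hc]]] := hol_tcoef oW hR Wz ne.
have [Bc hBc] := hc M.
have [h0' hS' _ hE'] := ha'.

(* A line normal to [Y] in the coordinates of [D] may drift along [Y] in those of [E], so the
   coefficients of [E] are followed along the projection of the line to the slice. *)
pose Ak k l eta := a' k l (pr (dj E) (change D E eta)).
have AS k l : smooth (M - (k + l)) (change_dom D E) (Ak k l).
  apply: (smooth_comp (F := a' k l) (G := fun eta => pr (dj E) (change D E eta)) oW _ _ (hS' k l)).
    move=> eta [he hO]; apply: le_lt_trans (pr_le _ _) _; exact: (cs_Phi (ok_cs hE) hO).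
  move=> j eta We; apply: (vdiff_comp (f := fun y => pr (dj E) y 0 j) (X := change D E)); first exact: vdiff_pr.
  by move=> l'; exact: hT.
have prT eta : change_dom D E eta -> nr (pr (dj E) (change D E eta)) < dr E.
  by move=> [he hO]; apply: le_lt_trans (pr_le _ _) _; exact: (cs_Phi (ok_cs hE) hO).
have Akz k l : Ak k l z = a' k l z' by rewrite /Ak Tz pr_id.
have [dw dw0 hdw] := oW _ Wz.
have Ww w : nr w < dw -> change_dom D E (z + w *: e).
  by move=> hw; apply: hdw; rewrite addrAC subrr add0r nrZ ne mulr1.
have /choice[P hP] : forall kl : nat * nat, exists P : {poly {poly C}},
   [/\ jet (M - (kl.1 + kl.2)) (fun w => Ak kl.1 kl.2 (z + w *: e)) P, (kl.1 + kl.2 < M)%N -> P`_0`_0 = a' kl.1 kl.2 z' &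
     forall A, (forall eta, nr eta < dr E -> eta 0 (dj E) = 0 -> a' kl.1 kl.2 eta = A) -> P = A%:P%:P].
  move=> [k l] /=.
  (* For a coefficient constant on the slice the jet is taken to be that constant itself, not an
     expansion of it; the third clause rests on this choice. *)
  have [[A hA]|nA] := pselect (exists A, forall eta, nr eta < dr E -> eta 0 (dj E) = 0 -> a' k l eta = A).
    exists A%:P%:P; split.
    - apply: jet_near (jet_cst _ A); exists dw => // w /Ww We.
      by rewrite /Ak hA ?pr_i //; exact: prT.
    - by move=> _; rewrite !coefC /= hA.
    - by move=> B hB; rewrite -(hA _ hz' z0') -(hB _ hz' z0').
  have [al [_ _ al0 alE]] := expansion (dj D) oW (AS k l).
  have [r1 r10 [B1 hB1]] := alE _ Wz.
  exists (bipoly (M - (k + l)) (fun k l => al k l z)); split.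
  - by apply: (jet_esum r10) => w hw; apply: (hB1 z w _ hw).2; rewrite subrr nr0.
  - by move=> kl; rewrite bpE subn_gt0 kl /= al0 ?subn_gt0.
  - by move=> A hA; case: nA; exists A.
pose c k := c0 k z.
exists c, (fun k l => P (k, l)); split.
- move=> M0; have [_] := hBc z 0 ltac:(by rewrite subrr nr0) ltac:(by rewrite nr0).
  rewrite scale0r addr0 nr0 expr0n (gtn_eqF M0) mulr0 Gz (bigD1 (Ordinal M0)) //= big1 => [|i ni].
    rewrite expr0 mulr1 addr0 => h1; apply/esym/eqP; rewrite -subr_eq0 -nr_eq0 eq_le h1 nr_ge0 //.
  rewrite expr0n; case: eqP => [e0|_]; last by rewrite mulr0.
  by case/eqP: ni; apply/val_inj.
- by move=> k l; case: (hP (k, l)).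
- by move=> k l A hA; case: (hP (k, l)) => _ _; apply.
- exists rc1 => //; exists Bc => w hw; apply: (hBc z w _ hw).2; by rewrite subrr nr0.
move=> g k0 l0 kl.
have jg : jet M (fun w => ratio D E (gD D (z + w *: e))) g.
  by apply: (jet_hol rc10) => w hw; apply: (hBc z w _ hw).2; rewrite subrr nr0.
pose om w := ratio D E (gD D (z + w *: e)) * w.
have jom : jet M om (g * Xh) by exact: jetM jg (jet_id R M).
have omT w : nr w < dw -> change D E (z + w *: e) 0 (dj E) = om w.
  move=> /Ww [he hO]; have [Dw Pw] := ok_gD hD he.
  by rewrite /change (ratio_w Hft hD hE Dw hO) Pw /om !mxE z0 !eqxx /= mulr1 add0r.
have ct : ctn (change D E) z by apply: ctn_coords => j; exact: (vdiff_ctn (hT j _ Wz)).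
have [r' r0' [B' hB']] := hE' _ hz'.
have [d1 d10 hd1] := ct r' r0'.
have [d2 d20 hd2] := vdiff_ctn (hR _ Wz) ltr01.
pose Cg := nr (ratio D E (gD D z)) + 1.
have omB w : nr w < d2 -> nr (om w) <= Cg * nr w.
  move=> hw; rewrite /om nrM ler_wpM2r ?nr_ge0 // /Cg.
  have := hd2 (z + w *: e); rewrite addrAC subrr add0r nrZ ne mulr1 => /(_ hw) h1.
  by rewrite -(subrK (ratio D E (gD D z)) (ratio _ _ (gD D (z + _)))) (le_trans (nrD _ _)) // addrC lerD2l ltW.
have jS : jet M (fun w => esum M (fun k l => Ak k l (z + w *: e)) (om w))
    (\sum_(k < M) \sum_(l < M) P (nat_of_ord k, nat_of_ord l) * (g * Xh) ^+ k * (cJ (g * Xh)) ^+ l).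
  apply: jet_sum => k; apply: jet_sum => l; have [h1 _ _] := hP (nat_of_ord k, nat_of_ord l).
  exact: (jet_shift d20 omB h1 jom).
have jE : jet M (fun w => rc (psi h E (change D E (z + w *: e))))
    (\sum_(k < M) \sum_(l < M) P (nat_of_ord k, nat_of_ord l) * (g * Xh) ^+ k * (cJ (g * Xh)) ^+ l).
  (* The expansion in [E] is applied at the moving base point; its locally uniform remainder is
     O(|w|^M) because the ratio is bounded, so it has jet 0. *)
  rewrite -[X in jet _ _ X]addr0.
  have h2 : jet M (fun w => rc (psi h E (change D E (z + w *: e))) - esum M (fun k l => Ak k l (z + w *: e)) (om w)) 0.
    exists (Num.min (Num.min dw d1) d2); first by rewrite !lt_min dw0 d10.
    exists (`|B'| * `|Cg| ^+ M) => w; rewrite !lt_min => /andP[/andP[w1 w2] w3].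
    have -> : ev 0 w = 0 by rewrite /ev !horner0.
    rewrite subr0; have := hd1 (z + w *: e); rewrite addrAC subrr add0r nrZ ne mulr1 => /(_ w2); rewrite Tz => h1.
    have p1 : nr (pr (dj E) (change D E (z + w *: e)) - z') < r'.
      by rewrite -(pr_id z0') -prB; apply: le_lt_trans (pr_le _ _) h1.
    have p2 : nr (om w) < r'.
      rewrite -(omT _ w1); have := nr_coord (change D E (z + w *: e) - z') (dj E).
      by rewrite !mxE z0' subr0 => h3; exact: le_lt_trans h3 h1.
    have [_] := hB' _ _ p1 p2.
    rewrite -{1}(omT _ w1) -prE => h4; apply: le_trans h4 _.
    apply: le_trans (_ : `|B'| * nr (om w) ^+ M <= _); first by rewrite ler_wpM2r ?ler_norm // exprn_ge0 // nr_ge0.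
    rewrite -mulrA ler_wpM2l // -exprMn lerXn2r ?nnegrE ?nr_ge0 ?mulr_ge0 ?nr_ge0 //.
    by apply: le_trans (omB _ w3) _; rewrite ler_wpM2r ?nr_ge0 // ler_norm.
  by apply: jet_near (jetD jS h2); exists 1 => // w _; ring.
have jD : jet M (fun w => rc (psi h E (change D E (z + w *: e)))) (g * cJ g * bipoly M (fun k l => a k l z)).
  apply: jet_near (jetM (jetM jg (jetJ jg)) (slice_exp_jet ha hz)); exists dw => // w /Ww[he hO].
  have [Dw Pw] := ok_gD hD he.
  by rewrite /change (ratio_psi Hh hD hE Dw hO) Pw rcM nr_sqr.
refine (jet_uniq jD jE kl).
Qed.
End Transfer.

(** * Reading coefficients off the comparison identity *)

Section FirstJet.
Variable R : realType.
Local Notation C := (Cplx R).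
Implicit Types (c : nat -> C) (P : nat -> nat -> {poly {poly C}}) (a : nat -> nat -> C).
Lemma gpol0 M c : (gpol M c).[0] = \poly_(k < M) c k.
Proof. by rewrite /gpol hornerC. Qed.
Lemma cJgpol0 M c : (0 < M)%N -> (cJ (gpol M c)).[0] = ((c 0)^*)%:P.
Proof.
move=> M0; apply/polyP => k; rewrite horner_coef0 cJE /gpol !coefC; case: k => [|k] /=; last by rewrite coef0 cj0.
by rewrite coef_poly M0.
Qed.

(** Setting the conjugate variable to 0 turns the left side into the power series of the ratio times
    conj(c_0), up to order m. On the right every term with k or l positive drops out below order m,
    so the product reduces to 1. *)
Lemma gpol_first M c P a m : (m <= M)%N ->
  P 0 0 = 1%:P%:P -> (forall s, (0 < s < m)%N -> P s 0 = 0) ->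
  a 0 0 = 1 -> (forall s, (0 < s < m)%N -> a s 0 = 0) ->
  (forall k0, (k0 < m)%N -> (gpol M c * cJ (gpol M c) * bipoly M a)`_0`_k0 =
      (\sum_(k < M) \sum_(l < M) P k l * (gpol M c * Xh) ^+ k * (cJ (gpol M c * Xh)) ^+ l)`_0`_k0) ->
  forall k0, (k0 < m)%N -> c k0 * (c 0)^* = (k0 == 0)%:R.
Proof.
move=> mM P0 Ps a00 as0 heq k0 hk.
have M0 : (0 < M)%N by lia.
have b0 k : (k < m)%N -> (bipoly M a).[0]`_k = (k == 0)%:R.
  move=> km; rewrite horner_coef0 bpE M0 (leq_trans km mM) /=.
  by case: k km => [|k] km //=; rewrite as0.
have := heq k0 hk; rewrite -!horner_coef0 !hornerM gpol0 cJgpol0 //.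
have -> : (\poly_(k < M) c k * ((c 0)^*)%:P * (bipoly M a).[0])`_k0 = c k0 * (c 0)^*.
  rewrite coefM (bigD1 ord_max) //= big1 => [|i ni]; last first.
    rewrite b0 ?(leq_ltn_trans (leq_subr _ _) hk) //.
    have : (i < k0)%N by have := ltn_ord i; rewrite ltnS leq_eqVlt => /orP[/eqP e|//]; case/eqP: ni; apply/val_inj.
    by move=> ik; rewrite subn_eq0 leqNgt ik mulr0.
  by rewrite subnn b0 ?(leq_trans _ hk) // mulr1 addr0 coefMC coef_poly (leq_trans hk mM).
have tm k l : (P k l * (gpol M c * Xh) ^+ k * cJ (gpol M c * Xh) ^+ l).[0]`_k0 =
    if (k == 0) && (l == 0) then (k0 == 0)%:R else 0.
  have e1 : (cJ (gpol M c * Xh)).[0] = 0 by rewrite cJM cJ_X hornerM hornerX mulr0.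
  rewrite !hornerM !horner_exp e1; case: l => [|l]; last by rewrite exprS mul0r mulr0 coef0 andbF.
  rewrite expr0 mulr1 andbT hornerM gpol0 /Xh hornerC; case: k => [|k] /=.
    by rewrite expr0 mulr1 P0 hornerC coefC; case: (k0).
  case: (ltnP k.+1 m) => km; first by rewrite Ps // horner0 mul0r coef0.
  rewrite exprMn mulrA coefMXn (leq_trans hk km) //.
move=> ->; rewrite horner_sum coef_sum; pose o0 := Ordinal M0.
have tl k : (\sum_(l < M) P k l * (gpol M c * Xh) ^+ k * cJ (gpol M c * Xh) ^+ l).[0]`_k0 = if k == 0 then (k0 == 0)%:R else 0.
  rewrite horner_sum coef_sum; under eq_bigr => l _ do rewrite tm.
  case: (k == 0) => /=; last by rewrite big1.
  rewrite (bigD1 o0) //= big1 ?addr0 // => i ni; rewrite ifN //.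
under eq_bigr => k _ do rewrite tl.
rewrite (bigD1 o0) //= big1 ?addr0 // => i ni; rewrite ifN //.
Qed.

Lemma gpol_cong M c m : (forall k, (0 < k < m)%N -> c k = 0) -> (m <= M)%N -> cong m (gpol M c) (c 0)%:P%:P.
Proof.
move=> hc mM k l km lm; rewrite /gpol !coefC; case: l lm => [|l] lm /=; last by rewrite !coef0.
rewrite coef_poly coefC (leq_trans km mM); case: k km => [|k] km //=; by rewrite hc.
Qed.

(** Modulo the m-th powers of w and its conjugate the ratio is its constant term c_0, of modulus 1,
    so the change of coordinate is multiplication by c_0. A lower coefficient whose jet is constant
    contributes only to its own monomial; hence just the term (k0, l0) is left. *)
Lemma gpol_mid M c P a m k0 l0 : (m <= M)%N -> (forall k, (0 < k < m)%N -> c k = 0) -> c 0 * (c 0)^* = 1 ->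
  (k0 < m)%N -> (l0 < m)%N -> (k0 + l0 < M)%N ->
  (forall k l, (k < m)%N -> (l < m)%N -> (k + l < k0 + l0)%N -> exists A, P k l = A%:P%:P) ->
  (gpol M c * cJ (gpol M c) * bipoly M a)`_l0`_k0 =
      (\sum_(k < M) \sum_(l < M) P k l * (gpol M c * Xh) ^+ k * (cJ (gpol M c * Xh)) ^+ l)`_l0`_k0 ->
  a k0 l0 = c 0 ^+ k0 * (c 0)^* ^+ l0 * (P k0 l0)`_0`_0.
Proof.
move=> mM hc cc hk hl hkl hP.
have g1 := gpol_cong hc mM; have g2 := congJ g1; rewrite cJC in g2.
have -> : (gpol M c * cJ (gpol M c) * bipoly M a)`_l0`_k0 = a k0 l0.
  rewrite (congM (congM g1 g2) (cong_refl (bipoly M a))) // -!rmorphM cc.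
  by rewrite !coefCM mul1r bpE !(leq_trans _ mM).
move=> ->.
have tm k l : (P k l * (gpol M c * Xh) ^+ k * cJ (gpol M c * Xh) ^+ l)`_l0`_k0 =
   if (k == k0) && (l == l0) then c 0 ^+ k0 * (c 0)^* ^+ l0 * (P k0 l0)`_0`_0 else 0.
  have e1 := congX k (congM g1 (cong_refl Xh)).
  have e2 := congX l (congM g2 (cong_refl 'X)).
  rewrite cJM cJ_X (congM (congM (cong_refl (P k l)) e1) e2) //.
  have -> : P k l * ((c 0)%:P%:P * Xh) ^+ k * (((c 0)^*)%:P%:P * 'X) ^+ l =
     P k l * ((c 0 ^+ k * (c 0)^* ^+ l)%:P%:P * 'X%:P ^+ k) * 'X ^+ l.
    rewrite /Xh !exprMn -!rmorphXn !rmorphM /= !rmorphXn.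
    ring.
  rewrite coef_mono.
  case: eqP => [->|nk]; case: eqP => [->|nl] /=; rewrite ?leqnn /= ?subnn //.
  - case: leqP => // ll; have [A ->] := hP k0 l hk (leq_ltn_trans ll hl) ltac:(lia).
    by rewrite coefC subn_eq0 leqNgt ltn_neqAle ll (introN eqP nl) /= coef0 mulr0.
  - case: leqP => // kk /=; have [A ->] := hP k l0 (leq_ltn_trans kk hk) hl ltac:(lia).
    by rewrite !coefC /= ?coefC subn_eq0 leqNgt ltn_neqAle kk (introN eqP nk) /= mulr0.
  - case: leqP => // kk /=; case: leqP => // ll; have [A ->] := hP k l (leq_ltn_trans kk hk) (leq_ltn_trans ll hl) ltac:(lia).
    by rewrite coefC subn_eq0 leqNgt ltn_neqAle ll (introN eqP nl) /= coef0 mulr0.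
have kM : (k0 < M)%N by lia.
have lM : (l0 < M)%N by lia.
rewrite !coef_sum (bigD1 (Ordinal kM)) //= [X in _ + X]big1 ?addr0 => [|i ni]; last first.
  rewrite !coef_sum big1 // => l _; rewrite tm ifN // negb_and; apply/orP; left; apply: contraNneq ni => e.
  by apply/eqP/val_inj.
rewrite !coef_sum (bigD1 (Ordinal lM)) //= [X in _ + X]big1 ?addr0 => [|i ni]; last first.
  rewrite tm ifN // negb_and; apply/orP; right; apply: contraNneq ni => e.
  by apply/eqP/val_inj.
by rewrite tm !eqxx.
Qed.
End FirstJet.

(** * Rigidity of the normalized coordinates *)

Section Rigid.
Variables (R : realType) (n : nat) (X : complexManifold R n) (Y : set X) (L : line_bundle [set: X]).
Variables (f : lb_index L -> X -> Cplx R) (h : lb_index L -> X -> R) (rr : option nat) (M : nat).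
Local Notation C := (Cplx R).
Local Notation V := 'rV[C]_n.+1.
Hypothesis Hf : forall i, defining_function Y (lb_dom i) (f i).
Hypothesis Hft : forall i j p, lb_dom i p -> lb_dom j p -> f i p = lb_trans i j p * f j p.
Hypothesis Hh : hermitian_metric rr h.
Implicit Types (D E : datum L) (z nu eta : V) (x p : X) (a : nat -> nat -> V -> C).

Definition onslice D (b : V -> C) (A : C) := forall z, nr z < dr D -> z 0 (dj D) = 0 -> b z = A.
(* [psi = 1 + \sum_(k, l > 0) a_kl w^k w^*^l + O(w^m)] with constant [a_kl]. *)
Definition level m D a := [/\ forall k l, (k + l < m)%N -> exists A, onslice D (a k l) A,
  onslice D (a 0 0) 1 & forall s, (0 < s < m)%N -> onslice D (a s 0) 0].

(** By [gpol_first] the first [m] Taylor coefficients of the ratio on the normal line reduce to a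
    unimodular constant, which gives the second clause; [gpol_mid] gives the transformation rule of
    the coefficients. *)
Lemma rigid m D E a a' x : (0 < m)%N -> (m <= M)%N -> valid f D -> valid f E -> slice_exp h M D a -> slice_exp h M E a' ->
  level m D a -> level m E a' -> dO D x -> dO E x -> Y x ->
  [/\ ratio D E x * (ratio D E x)^* = 1,
    exists2 d : R, 0 < d & exists B : R, forall w : C, nr w < d ->
      nr (ratio D E (gD D (dP D x + w *: delta_mx 0 (dj D))) - ratio D E x) <= B * nr w ^+ m &
    forall k0 l0, (k0 < m)%N -> (l0 < m)%N -> (k0 + l0 < M)%N ->
      (forall k l, (k < m)%N -> (l < m)%N -> (k + l < k0 + l0)%N -> exists A, onslice E (a' k l) A) ->
      a k0 l0 (dP D x) = ratio D E x ^+ k0 * (ratio D E x)^* ^+ l0 * a' k0 l0 (dP E x)].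
Proof.
move=> m0 mM hD hE ha ha' [q1 q2 q3] [q1' q2' q3'] xD xE Yx.
have [c [P [hc hP0 hPA hcB heq]]] := transfer Hf Hft Hh hD hE ha ha' xD xE Yx.
have M0 : (0 < M)%N by lia.
have hz : nr (dP D x) < dr D := cs_Phi (ok_cs hD) xD.
have z0 : dP D x 0 (dj D) = 0 by apply/(ok_Y Hf hD xD).
have c0 := hc M0.
have first : forall k0, (k0 < m)%N -> c k0 * (c 0)^* = (k0 == 0)%:R.
  apply: (@gpol_first R M c P (fun k l => a k l (dP D x)) m) => //.
  - exact: (hPA 0 0 1 q2').
  - by move=> s hs; rewrite (hPA s 0 0 (q3' s hs)) !rmorph0.
  - exact: q2.
  - by move=> s hs; exact: (q3 s hs).
  - by move=> k0 hk; apply: heq; lia.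
have cc := first 0 m0; rewrite eqxx in cc.
have c0n : (c 0)^* != 0 by apply/eqP => e; move: cc; rewrite e mulr0 => /eqP; rewrite eq_sym oner_eq0.
have ck k : (0 < k < m)%N -> c k = 0.
  by move=> /andP[k0 km]; have := first k km; rewrite gtn_eqF // => /eqP; rewrite mulf_eq0 (negbTE c0n) orbF => /eqP.
rewrite -c0; split=> //.
  have [d d0 [B hB]] := hcB; exists (Num.min d 1); first by rewrite lt_min d0 ltr01.
  exists (\sum_(k < M) nr (c k) + `|B|) => w; rewrite lt_min => /andP[w1 w2].
  have := hB w w1; set g := ratio _ _ _ => h1.
  have -> : g - c 0 = g - \sum_(k < M) c k * w ^+ k + (\sum_(k < M) c k * w ^+ k - c 0) by rewrite addrA subrK.
  apply: le_trans (nrD _ _) _; rewrite addrC mulrDl lerD //; last first.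
    apply: le_trans h1 _; apply: le_trans (_ : `|B| * nr w ^+ M <= _).
      by rewrite ler_wpM2r ?exprn_ge0 ?nr_ge0 // ler_norm.
    by rewrite ler_wpM2l // ler_wiXn2l ?nr_ge0 // ltW.
  rewrite (bigD1 (Ordinal M0)) //= expr0 mulr1 [c 0 + _]addrC addrK.
  apply: le_trans (nr_sum _ _ _) _.
  rewrite mulr_suml [leRHS](bigD1 (Ordinal M0)) //= -[leLHS]add0r lerD ?mulr_ge0 ?exprn_ge0 ?nr_ge0 //.
  apply: ler_sum => k nk; have k0 : (0 < k)%N.
    rewrite lt0n; apply: contraNneq nk => e; by apply/eqP/val_inj.
  case: (ltnP k m) => km; first by rewrite ck ?k0 // mul0r nr0 mul0r.
  by rewrite nrM nrX ler_wpM2l ?nr_ge0 // ler_wiXn2l ?nr_ge0 // ltW.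
move=> k0 l0 hk hl hkl hlow; rewrite -hP0 //.
apply: (@gpol_mid R M c P (fun k l => a k l (dP D x)) m) => //; last exact: heq.
by move=> k l km lm kl; have [A hA] := hlow k l km lm kl; exists A; exact: hPA.
Qed.
End Rigid.

(** * Forms in w and its conjugate: leading parts, means, variance *)

Section Homog.
Variable R : realType.
Local Notation C := (Cplx R).
Implicit Types (c : nat -> nat -> C) (w : C).

Lemma esumD K c c' w : esum K c w + esum K c' w = esum K (fun k l => c k l + c' k l) w.
Proof. by rewrite /esum -big_split; apply: eq_bigr => k _; rewrite -big_split; apply: eq_bigr => l _ /=; rewrite !mulrDl. Qed.
Lemma esum_eq K c c' w : (forall k l, (k < K)%N -> (l < K)%N -> c k l = c' k l) -> esum K c w = esum K c' w.
Proof. by move=> e; apply: eq_bigr => k _; apply: eq_bigr => l _; rewrite e. Qed.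
Lemma esum_high K N c w : (forall k l, (k + l < N)%N -> c k l = 0) -> nr w <= 1 ->
  nr (esum K c w) <= (\sum_(k < K) \sum_(l < K) nr (c k l)) * nr w ^+ N.
Proof.
move=> h w1; rewrite mulr_suml; apply: le_trans (nr_sum _ _ _) _; apply: ler_sum => k _.
rewrite mulr_suml; apply: le_trans (nr_sum _ _ _) _; apply: ler_sum => l _.
rewrite !nrM !nrX nrJ -mulrA -exprD.
case: (ltnP (k + l) N) => kl; first by rewrite h // nr0 !mul0r.
by rewrite ler_wpM2l ?nr_ge0 // ler_wiXn2l ?nr_ge0.
Qed.

Definition homp N c k l : C := if (k + l == N)%N then c k l else 0.
Lemma homp_scale K N c (s : R) w : esum K (homp N c) (rc s * w) = rc (s ^+ N) * esum K (homp N c) w.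
Proof.
rewrite mulr_sumr; apply: eq_bigr => k _; rewrite mulr_sumr; apply: eq_bigr => l _; rewrite /homp.
case: eqP => [<-|_]; last by rewrite !mul0r mulr0.
rewrite cjM rcJ !exprMn rcX exprD; move: (c k l) (rc s) (w) (w^*) => *; ring.
Qed.

(** On the ray w = s z the form of degree N scales by [s ^+ N], and everything else, the remainder
    included, is O(s^(N+1)). A negative value would prevail for small [s]. *)
Lemma lead_ge0 K N c (B d : R) : (N < K)%N -> (forall k l, (k + l < N)%N -> c k l = 0) -> 0 < d ->
  (forall w, nr w < d -> 0 <= cre (esum K c w) + B * nr w ^+ K) ->
  forall z, nr z = 1 -> 0 <= cre (esum K (homp N c) z).
Proof.
move=> NK c0 d0 hw z z1; set H := cre _.
pose c' k l := if (k + l == N)%N then 0 else c k l.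
have ec w : esum K c w = esum K (homp N c) w + esum K c' w.
  by rewrite esumD; apply: esum_eq => k l _ _; rewrite /homp /c'; case: eqP; rewrite ?addr0 ?add0r.
have c'0 k l : (k + l < N.+1)%N -> c' k l = 0.
  by rewrite ltnS leq_eqVlt /c'; case: eqP => //= _; exact: c0.
pose S := \sum_(k < K) \sum_(l < K) nr (c' k l).
have S0 : 0 <= S by apply: sumr_ge0 => k _; apply: sumr_ge0 => l _; exact: nr_ge0.
rewrite leNgt; apply/negP => Hn.
pose s := Num.min (Num.min (d / 2) 1) (- H / (2 * (S + `|B| + 1))).
have q0 : 0 < 2 * (S + `|B| + 1) by rewrite mulr_gt0 // ltr_wpDl // addr_ge0.
have s0 : 0 < s by rewrite !lt_min divr_gt0 // ltr01 divr_gt0 // oppr_gt0.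
have [sd s1 sH] : [/\ s < d, s <= 1 & s <= - H / (2 * (S + `|B| + 1))].
  have : s <= s by []. rewrite {2}/s !le_min => /andP[/andP[h1 h2] h3]; split=> //.
  by apply: le_lt_trans h1 _; rewrite ltr_pdivrMr // ltr_pMr // ltr1n.
have ns : nr (rc s * z) = s by rewrite nrM z1 mulr1 nr_rc ger0_norm // ltW.
have := hw (rc s * z); rewrite ns => /(_ sd).
rewrite ec creD homp_scale creM cre_rc cim_rc mul0r subr0 -/H => h1.
have h2 : cre (esum K c' (rc s * z)) <= S * s ^+ N.+1.
  by apply: le_trans (cre_ler _) _; have := esum_high (w := rc s * z) K c'0; rewrite ns => /(_ s1).
have h3 : B * s ^+ K <= `|B| * s ^+ N.+1.
  apply: le_trans (_ : `|B| * s ^+ K <= _); first by rewrite ler_wpM2r ?ler_norm // exprn_ge0 // ltW.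
  by rewrite ler_wpM2l // ler_wiXn2l // ltW.
have h4 : 0 <= s ^+ N * (H + (S + `|B|) * s).
  apply: le_trans h1 _; rewrite mulrDr -addrA lerD2l mulrCA -exprSr mulrDl lerD //.
move: h4; rewrite pmulr_rge0 ?exprn_gt0 // => h4.
have h5 : (S + `|B|) * s <= - H / 2.
  move: sH; rewrite ler_pdivlMr // => h5; nra.
lra.
Qed.

Lemma esum_circ K c : circ (esum K c).
Proof.
apply: circ_sum => k; apply: circ_sum => l.
exact: (circM (circM (circ_cst (c k l)) (@circX R k)) (@circJX R l)).
Qed.
Lemma mean_esum K c : mean (esum K c) = \sum_(k < K) c k k.
Proof.
have ct k l : circ (fun z => c k l * z ^+ k * z^* ^+ l).
  exact: (circM (circM (circ_cst (c k l)) (@circX R k)) (@circJX R l)).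
rewrite mean_sum => [|k]; last by apply: circ_sum => l; exact: ct.
apply: eq_bigr => k _; rewrite mean_sum => [|l]; last exact: ct.
have e l : mean (fun z => c k l * z ^+ k * z^* ^+ l) = c k l * (nat_of_ord k == l)%:R.
  rewrite -mean_mono -meanZ; last exact: (circM (@circX R k) (@circJX R l)).
  by apply: mean_eq => z _; rewrite mulrA.
under eq_bigr => l _ do rewrite e.
rewrite (bigD1 k) //= eqxx mulr1 big1 ?addr0 // => l nl; case: eqP => [e'|_]; last by rewrite mulr0.
by case/eqP: nl; apply/val_inj.
Qed.

(** The Hermitian symmetry of the coefficients makes the form real, so the vanishing of its real
    part on the circle kills the form, and [poly2_small] its coefficients. *)
Lemma homp_zero K N c : (N < K)%N -> (forall k l, c l k = (c k l)^*) ->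
  (forall z, nr z = 1 -> cre (esum K (homp N c) z) = 0) -> forall k l, (k + l = N)%N -> c k l = 0.
Proof.
move=> NK cJ h k l kl.
have real w : (esum K (homp N c) w)^* = esum K (homp N c) w.
  rewrite /esum cj_sum exchange_big /=; apply: eq_bigr => i _; rewrite cj_sum; apply: eq_bigr => j _.
  rewrite !cjM !cjX cjK /homp addnC; case: eqP => _; last by rewrite cj0 !mul0r.
  by rewrite -cJ mulrAC.
have z1 z : nr z = 1 -> esum K (homp N c) z = 0.
  move=> /h h0; apply: c_eq => //; have := congr1 (@cim R) (real z); rewrite cimJ.
  by move: (cim _) => x hx; have : cim (0 : C) = 0 by []; move=> ->; lra.
have zw w : esum K (homp N c) w = 0.
  have [->|w0] := eqVneq w 0.
    have e := homp_scale K N c 0 1; rewrite (z1 1) ?nr1 // mulr0 rc0 mul0r in e; exact: e.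
  have nw : nr w != 0 by rewrite nr_eq0.
  have -> : w = rc (nr w) * (rc (nr w)^-1 * w) by rewrite mulrA -rcM divff // mul1r.
  by rewrite homp_scale z1 ?mulr0 // nrM nr_rc ger0_norm ?invr_ge0 ?nr_ge0 // mulVf.
have := @poly2_small R (homp N c) K N.+1 0 1 ltr01.
move=> /(_ _ k l); rewrite /homp kl eqxx; apply; try lia.
by move=> w _; rewrite -/(esum K (homp N c) w) zw nr0 mul0r.
Qed.

(** Variance identity: the mean of |u - c|^2 is the mean of |u|^2 minus |c|^2. Both the inequality
    and its equality case are read off. *)
Lemma mean_sq_gap (u : C -> C) (c : C) : circ u -> mean u = c ->
  nr c ^+ 2 <= cre (mean (fun t => rc (nr (u t) ^+ 2))) /\
  (cre (mean (fun t => rc (nr (u t) ^+ 2))) <= nr c ^+ 2 -> forall t, nr t = 1 -> u t = c).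
Proof.
move=> cu uc.
have cd : circ (fun t => u t - c) by exact: (circB cu (circ_cst c)).
have cs (v : C -> C) : circ v -> circ (fun t => rc (nr (v t) ^+ 2)).
  move=> cv z hz e e0; have [d d0 hd] := circM cv (circJ cv) hz e0; exists d => // y /hd.
  by rewrite !nr_sqr.
have e : mean (fun t => rc (nr (u t - c) ^+ 2)) = mean (fun t => rc (nr (u t) ^+ 2)) - rc (nr c ^+ 2).
  have c1 := circM (circ_cst c^*) cu; have c2 := circM (circ_cst c) (circJ cu).
  rewrite (mean_eq (v := fun t => rc (nr (u t) ^+ 2) - (c^* * u t + c * (u t)^*) + rc (nr c ^+ 2))).
    rewrite meanD ?mean_cst; [|exact: (circB (cs _ cu) (circD c1 c2))|exact: circ_cst].
    rewrite meanB; [|exact: cs|exact: (circD c1 c2)].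
    rewrite meanD // !meanZ //; last exact: circJ.
    by rewrite meanJ // uc nr_sqr; move: (mean _) => q; ring.
  by move=> t _; rewrite !nr_sqr cjB; ring.
have g0 t : nr t = 1 -> 0 <= cre (rc (nr (u t - c) ^+ 2)) by move=> _; rewrite cre_rc exprn_ge0 // nr_ge0.
split.
  have := mean_ge (cs _ cd) g0; rewrite e creB cre_rc subr_ge0 //.
move=> h t ht; have := mean_posdef (cs _ cd) g0; rewrite e creB cre_rc subr_le0 => /(_ h t ht) /eqP.
by rewrite sqrf_eq0 nr_eq0 subr_eq0 => /eqP.
Qed.
End Homog.

(** * Constancy of the coefficients *)

Section Chain.
Variables (R : realType) (n : nat) (X : complexManifold R n) (Y : set X) (L : line_bundle [set: X]).
Variables (f : lb_index L -> X -> Cplx R) (h : lb_index L -> X -> R) (rr : option nat).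
Local Notation C := (Cplx R).
Local Notation V := 'rV[C]_n.+1.
Hypothesis Hf : forall i, defining_function Y (lb_dom i) (f i).
Hypothesis Hft : forall i j p, lb_dom i p -> lb_dom j p -> f i p = lb_trans i j p * f j p.
Hypothesis Hh : hermitian_metric rr h.
Hypothesis Hs : forall i a p, lb_dom i p -> chart_dom a p -> chern_semipositive_at (h i \o chart_inv a) (chart a p).
Variable M : nat.
Hypothesis HM : le_order M rr.
Hypothesis M2 : (2 <= M)%N.
Implicit Types (D E : datum L) (z nu eta : V) (x p : X) (a : nat -> nat -> V -> C).

Definition disc_in D z nu := forall t : C, nr t <= 1 -> nr (z + t *: nu) < dr D.

Lemma slice_exp_ctn D a k l z : slice_exp h M D a -> nr z < dr D -> ctn (a k l) z.
Proof. by move=> [_ hS _ _] hz; exact: (smooth_ctn (hS k l) hz). Qed.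
Lemma slice_exp_circ D a k l z nu : slice_exp h M D a -> disc_in D z nu -> circ (fun t => a k l (z + t *: nu)).
Proof.
move=> ha hd t ht; apply: (ctn_comp (f := fun t : C => z + t *: nu)); first exact: cont_line.
by apply: (slice_exp_ctn _ _ ha); apply: hd; rewrite ht.
Qed.

Lemma slice_exp_ex D : valid f D -> exists a, slice_exp h M D a.
Proof.
move=> hD; have [a [h1 h2 h3 h4]] := expansion (dj D) (@ok_ball _ _ _ _ D) (psi_smooth Hh HM hD).
by exists a; split=> //; apply: h3; lia.
Qed.

(** Makes the radius and the constant of the expansion uniform over a closed disc in the base, by
    [compact_unif] with the constant encoded as [d^-1]. *)
Lemma slice_exp_disc D a z nu : valid f D -> slice_exp h M D a -> disc_in D z nu ->
  exists2 r : R, 0 < r & exists2 B : R, 0 <= B & forall t w : C, nr t <= 1 -> nr w < r ->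
    nr (z + t *: nu + w *: delta_mx 0 (dj D)) < dr D /\
    nr (rc (psi h D (z + t *: nu + w *: delta_mx 0 (dj D))) - esum M (fun k l => a k l (z + t *: nu)) w) <= B * nr w ^+ M.
Proof.
move=> hD [_ _ _ ha] hd.
pose P (d : R) (t : C) := forall w : C, nr w < d -> nr (z + t *: nu + w *: delta_mx 0 (dj D)) < dr D /\
    nr (rc (psi h D (z + t *: nu + w *: delta_mx 0 (dj D))) - esum M (fun k l => a k l (z + t *: nu)) w) <= d^-1 * nr w ^+ M.
have [r r0 hr] : exists2 d, 0 < d & forall t, [set t : C | nr t <= 1] t -> P d t.
  apply: compact_unif; first exact: compact_disc.
    move=> d d' t d0 dd hP w hw; have [h1 h2] := hP w (lt_le_trans hw dd); split=> //.
    apply: le_trans h2 _; rewrite ler_wpM2r ?exprn_ge0 ?nr_ge0 // lef_pV2 ?posrE //; exact: lt_le_trans dd.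
  move=> t /= ht; have [r r0 [B hB]] := ha _ (hd t ht).
  have [d d0 hct] := cont_line z nu t r0.
  exists (Num.min (Num.min r d) (`|B| + 1)^-1); first by rewrite !lt_min r0 d0 invr_gt0 ltr_wpDl.
  set m := Num.min _ _; have m0 : 0 < m by rewrite !lt_min r0 d0 invr_gt0 ltr_wpDl.
  move=> y; rewrite {1}/m !lt_min => /andP[/andP[_ y2] _] w hw.
  have w1 : nr w < r by move: hw; rewrite !lt_min => /andP[/andP[]].
  have [h1 h2] := hB _ _ (hct _ y2) w1; split=> //; apply: le_trans h2 _.
  rewrite ler_wpM2r ?exprn_ge0 ?nr_ge0 // (le_trans (ler_norm _)) //.
  have : m <= (`|B| + 1)^-1 by rewrite /m ge_min lexx orbT.
  have b0 : 0 < `|B| + 1 by rewrite ltr_wpDl.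
  rewrite -{1}[m]invrK lef_pV2 ?posrE ?invr_gt0 //.
  by apply: le_trans; rewrite lerDl.
exists r => //; exists r^-1; first by rewrite invr_ge0 ltW.
by move=> t w ht; exact: hr.
Qed.

(** The sub-mean inequality of psi on the disc tilted by [s] in the normal direction, with psi
    replaced by its truncated expansion on the boundary and at the centre; the two remainders
    account for the last summand. *)
Lemma exp_sub D a z nu : valid f D -> slice_exp h M D a -> disc_in D z nu ->
  exists2 r : R, 0 < r & exists2 B : R, 0 <= B & forall w s : C, nr w < r -> nr s < r ->
    0 <= cre (mean (fun t => esum M (fun k l => a k l (z + t *: nu)) (w + t * s)) - esum M (fun k l => a k l z) w)
         + B * (nr w + nr s) ^+ M.
Proof.
move=> hD ha hd; have [r r0 [B B0 hB]] := slice_exp_disc hD ha hd.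
pose e : V := delta_mx 0 (dj D).
exists (r / 2); first by rewrite divr_gt0.
exists (2 * B); first by rewrite mulr_ge0.
move=> w s hw hs.
have ws (t : C) : nr t <= 1 -> nr (w + t * s) <= nr w + nr s.
  by move=> ht; apply: le_trans (nrD _ _) _; rewrite lerD2l nrM ler_piMl ?nr_ge0.
have wsr (t : C) : nr t <= 1 -> nr (w + t * s) < r.
  by move=> /ws h1; apply: le_lt_trans h1 _; rewrite (splitr r) ltrD.
have eqv (t : C) : z + w *: e + t *: (nu + s *: e) = z + t *: nu + (w + t * s) *: e.
  by rewrite scalerDr scalerA scalerDl addrACA addrA.
have hd' : disc_in D (z + w *: e) (nu + s *: e).
  by move=> t ht; rewrite eqv; exact: (hB _ _ ht (wsr t ht)).1.
have := psi_sub Hh Hs HM M2 hD hd'.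
set P := mean _ => hP.
set Q := mean _.
have cP : circ (fun t => rc (psi h D (z + w *: e + t *: (nu + s *: e)))).
  move=> t ht; apply: (ctn_comp (f := fun t : C => z + w *: e + t *: (nu + s *: e)) (g := fun y => rc (psi h D y))).
    exact: cont_line.
  by apply: (smooth_ctn (psi_smooth Hh HM hD)); apply: hd'; rewrite ht.
have cQ : circ (fun t => esum M (fun k l => a k l (z + t *: nu)) (w + t * s)).
  have c1 : circ (fun t => w + t * s) by exact: (circD (circ_cst w) (circM circ_id (circ_cst s))).
  apply: circ_sum => k; apply: circ_sum => l; apply: circM.
    apply: circM; first exact: (slice_exp_circ _ _ ha hd).
    by move=> t ht; exact: (contX k (c1 t ht)).
  by move=> t ht; exact: (contX l (contJ (c1 t ht))).
have b1 : nr (P - Q) <= B * (nr w + nr s) ^+ M.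
  rewrite /P /Q -meanB //; apply: mean_le; first exact: circB.
  move=> t ht; rewrite eqv; have t1 : nr t <= 1 by rewrite ht.
  apply: le_trans (hB _ _ t1 (wsr t t1)).2 _; rewrite ler_wpM2l // lerXn2r ?nnegrE ?addr_ge0 ?nr_ge0 //; exact: ws.
have n0 : nr (0 : C) <= 1 by rewrite nr0.
have wr : nr w < r by apply: lt_trans hw _; rewrite ltr_pdivrMr // ltr_pMr // ltr1n.
have := (hB 0 w n0 wr).2; rewrite scale0r addr0 => b2.
have b3 : cre (P - Q) <= B * (nr w + nr s) ^+ M by exact: le_trans (cre_ler _) b1.
have b4 : B * nr w ^+ M <= B * (nr w + nr s) ^+ M.
  by rewrite ler_wpM2l // lerXn2r ?nnegrE ?addr_ge0 ?nr_ge0 // lerDl nr_ge0.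
have b5 : - (B * (nr w + nr s) ^+ M) <= cre (rc (psi h D (z + w *: e)) - esum M (fun k l => a k l z) w).
  rewrite lerNl -creN; apply: le_trans (cre_ler _) _; rewrite nrN; exact: le_trans b2 b4.
move: b3 b5 hP; rewrite !creB cre_rc -mulrA; move: (B * _) (cre P) (cre Q) (psi h D _) (cre (esum _ _ _)) => x1 x2 x3 x4 x5 *.
lra.
Qed.

(** The defect of the mean value property of one coefficient on a disc. [gap_sub] is the case of the
    untilted disc, where the defects are the coefficients of a form in w. *)
Definition gap a z nu k l : C := mean (fun t => a k l (z + t *: nu)) - a k l z.
Lemma gap_sub D a z nu : valid f D -> slice_exp h M D a -> disc_in D z nu ->
  exists2 d : R, 0 < d & exists B : R, forall w : C, nr w < d -> 0 <= cre (esum M (gap a z nu) w) + B * nr w ^+ M.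
Proof.
move=> hD ha hd; have [r r0 [B B0 hB]] := exp_sub hD ha hd; exists r => //; exists B => w hw.
have := hB w 0 hw; rewrite nr0 addr0 => /(_ r0); congr (_ <= cre _ + _).
have ct k l : circ (fun t => a k l (z + t *: nu) * w ^+ k * w^* ^+ l).
  exact: (circM (circM (slice_exp_circ k l ha hd) (circ_cst _)) (circ_cst _)).
rewrite (mean_eq (v := fun t => \sum_(k < M) \sum_(l < M) a k l (z + t *: nu) * w ^+ k * w^* ^+ l)); last first.
  by move=> t _; rewrite mulr0 addr0.
rewrite mean_sum => [|k]; last by apply: circ_sum => l; exact: ct.
rewrite /esum -sumrB; apply: eq_bigr => k _; rewrite mean_sum => [|l]; last exact: ct.
rewrite -sumrB; apply: eq_bigr => l _; rewrite /gap !mulrBl; congr (_ - _).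
rewrite -mulrA [RHS]mulrC -meanZ; last exact: (slice_exp_circ _ _ ha hd).
by apply: mean_eq => t _; rewrite -mulrA mulrC.
Qed.
Lemma gapJ D a z nu k l : slice_exp h M D a -> disc_in D z nu -> gap a z nu l k = (gap a z nu k l)^*.
Proof.
move=> ha hd; have hz : nr z < dr D by have := hd 0; rewrite scale0r addr0 nr0; apply.
rewrite /gap cjB -(slice_exp_real _ _ ha hz) -meanJ; last exact: (slice_exp_circ _ _ ha hd).
congr (_ - _); apply: mean_eq => t ht; apply: slice_exp_real ha _; apply: hd; by rewrite ht.
Qed.

(* Coefficients up to total degree N have the mean value property along the
   discs of the slices, and are constant when both exponents are below m. *)
Definition chainD m N D a :=
  (forall k l, (k < m)%N -> (l < m)%N -> (k + l < N)%N -> exists A, onslice D (a k l) A) /\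
  forall z nu, z 0 (dj D) = 0 -> nu 0 (dj D) = 0 -> disc_in D z nu -> forall k l, (k + l < N)%N -> gap a z nu k l = 0.

Definition good m D a := [/\ valid f D, slice_exp h M D a & level m D a].

Lemma disc0 D z : nr z < dr D -> disc_in D 0 z.
Proof.
move=> hz t ht; rewrite add0r nrZ; apply: le_lt_trans hz; by rewrite ler_piMl ?nr_ge0.
Qed.

End Chain.

(** * From locally defined quantities to the maximum principle *)

Section Globalize.
Variables (R : realType) (n : nat) (X : complexManifold R n) (Y : set X) (L : line_bundle [set: X]).
Variables (f : lb_index L -> X -> Cplx R).
Local Notation C := (Cplx R).
Local Notation V := 'rV[C]_n.+1.
Hypothesis Hf : forall i, defining_function Y (lb_dom i) (f i).
Hypothesis cY : compact Y.
Variables (T : Type) (G : datum L -> T -> Prop).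
Hypothesis Gok : forall D a, G D a -> valid f D.
Hypothesis Hgood : forall p, Y p -> exists D a, G D a /\ dO D p.
Implicit Types (D E : datum L) (z nu eta : V) (x p : X) (a : T).

(** A quantity attached to each admissible datum and unchanged on overlaps along [Y] is a function
    on [Y]; continuity and sub-mean values on discs then make it constant on slices. The type [T]
    carries the extra choice, such as an expansion, that comes with a datum. *)
Lemma globalize (F : datum L -> T -> V -> R) :
  (forall D a E a' x, G D a -> G E a' -> dO D x -> dO E x -> Y x -> F D a (dP D x) = F E a' (dP E x)) ->
  (forall D a z, G D a -> nr z < dr D -> ctn (fun y => rc (F D a y)) z) ->
  (forall D a z nu, G D a -> z 0 (dj D) = 0 -> nu 0 (dj D) = 0 -> disc_in D z nu ->
     F D a z <= cre (mean (fun t => rc (F D a (z + t *: nu))))) ->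
  forall D a z z', G D a -> nr z < dr D -> nr z' < dr D -> z 0 (dj D) = 0 -> z' 0 (dj D) = 0 -> F D a z = F D a z'.
Proof.
move=> Finv Fct Fsub.
(* The common value is picked by choice; [bE] shows that any datum around the point computes it. *)
pose b x := xget 0 [set v | exists D a, [/\ G D a, dO D x & v = F D a (dP D x)]].
have bE D a z : G D a -> nr z < dr D -> z 0 (dj D) = 0 -> b (gD D z) = F D a z.
  move=> hg hz z0; have hD := Gok hg; have [Oz Pz] := ok_gD hD hz; have Yz := ok_slice Hf hD hz z0.
  rewrite /b; case: xgetP => [v _ /= [E [a' [hE OE ->]]]|/(_ (F D a z))]; last first.
    by case; exists D, a; rewrite Pz.
  by rewrite -(Finv D a E a' _ hg hE Oz OE Yz) Pz.
move=> D a z z' hg hz hz' z0 z0'; rewrite -!(bE D a) //; have hD := Gok hg.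
apply: (max_principle Hf cY _ hD) => // p Yp.
have [E [a' [hgE Op]]] := Hgood Yp; have hE := Gok hgE; exists E; split=> //.
- move=> y hy y0 e e0; have [d d0 hd] := Fct E a' y hgE hy e e0.
  have [d' d0' hd'] := @ok_ball _ _ _ _ E y hy.
  exists (Num.min d d'); first by rewrite lt_min d0.
  move=> y'; rewrite lt_min => /andP[/hd h1 /hd' h2] y0'.
  by rewrite !(bE E a') // -nr_rc rcB.
- move=> y nu y0 nu0 hd; have n0 : nr (0 : C) <= 1 by rewrite nr0.
  have hy : nr y < dr E by have := hd 0 n0; rewrite scale0r addr0.
  rewrite (bE E a') // (mean_eq (v := fun t => rc (F E a' (y + t *: nu)))); first exact: Fsub.
  by move=> t ht; rewrite (bE E a') //; [apply: hd; rewrite ht|exact: slice_line].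
Qed.

End Globalize.

(** * Induction on the total degree N *)

Section ChainStep.
Variables (R : realType) (n : nat) (X : complexManifold R n) (Y : set X) (L : line_bundle [set: X]).
Variables (f : lb_index L -> X -> Cplx R) (h : lb_index L -> X -> R) (rr : option nat).
Local Notation C := (Cplx R).
Local Notation V := 'rV[C]_n.+1.
Hypothesis Hf : forall i, defining_function Y (lb_dom i) (f i).
Hypothesis Hft : forall i j p, lb_dom i p -> lb_dom j p -> f i p = lb_trans i j p * f j p.
Hypothesis Hh : hermitian_metric rr h.
Hypothesis Hs : forall i a p, lb_dom i p -> chart_dom a p -> chern_semipositive_at (h i \o chart_inv a) (chart a p).
Variables M m : nat.
Hypothesis HM : le_order M rr.
Hypothesis M2 : (2 <= M)%N.
Hypothesis m0 : (0 < m)%N.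
Hypothesis mM : (2 * m <= M)%N.
Hypothesis cY : compact Y.
Implicit Types (D E : datum L) (z nu eta : V) (x p : X) (a : nat -> nat -> V -> C).
Hypothesis Hgood : forall p, Y p -> exists D a, good f h M m D a /\ dO D p.

Lemma good_global (F : datum L -> (nat -> nat -> V -> C) -> V -> R) :
  (forall D a E a' x, good f h M m D a -> good f h M m E a' -> dO D x -> dO E x -> Y x -> F D a (dP D x) = F E a' (dP E x)) ->
  (forall D a z, good f h M m D a -> nr z < dr D -> ctn (fun y => rc (F D a y)) z) ->
  (forall D a z nu, good f h M m D a -> z 0 (dj D) = 0 -> nu 0 (dj D) = 0 -> disc_in D z nu ->
     F D a z <= cre (mean (fun t => rc (F D a (z + t *: nu))))) ->
  forall D a z z', good f h M m D a -> nr z < dr D -> nr z' < dr D -> z 0 (dj D) = 0 -> z' 0 (dj D) = 0 -> F D a z = F D a z'.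
Proof. by apply: (globalize Hf cY) => // D a []. Qed.

Definition chain N := forall D a, good f h M m D a -> chainD m N D a.

Section Step.
Variable N : nat.
Hypothesis NM : (N < 2 * m)%N.
Hypothesis IH : chain N.

Lemma gap_lead D a z nu : good f h M m D a -> z 0 (dj D) = 0 -> nu 0 (dj D) = 0 -> disc_in D z nu ->
  forall t : C, nr t = 1 -> 0 <= cre (esum M (homp N (gap a z nu)) t).
Proof.
move=> hg z0 nu0 hd; have [hD ha _] := hg; have [d d0 [B hB]] := gap_sub Hh Hs HM M2 hD ha hd.
have [_ g0] := IH hg.
by apply: (lead_ge0 (leq_trans NM mM) _ d0 hB); exact: g0.
Qed.

(** The induction hypothesis provides the constancy of the lower coefficients that [rigid] asks for,
    so degree N transforms by a power of a unimodular number. *)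
Lemma good_rigid D E a a' x k0 l0 : good f h M m D a -> good f h M m E a' -> dO D x -> dO E x -> Y x ->
  (k0 < m)%N -> (l0 < m)%N -> (k0 + l0 = N)%N ->
  exists2 tau : C, tau * tau^* = 1 & a k0 l0 (dP D x) = tau ^+ k0 * tau^* ^+ l0 * a' k0 l0 (dP E x).
Proof.
move=> [hD ha qa] hg xD xE Yx km lm kl; have [hE ha' qa'] := hg.
have mM' : (m <= M)%N by lia.
have [t1 _ t2] := rigid Hf Hft Hh m0 mM' hD hE ha ha' qa qa' xD xE Yx.
exists (ratio D E x) => //; apply: t2 => //; first by rewrite kl (leq_trans NM).
by rewrite kl; have [] := IH hg.
Qed.

(** Invariance holds because the diagonal coefficient is real, by the symmetry of the expansion, and
    is multiplied by |tau|^(2k) = 1 under a change of datum. *)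
Lemma diag_const D a z nu k : good f h M m D a -> z 0 (dj D) = 0 -> nu 0 (dj D) = 0 -> disc_in D z nu ->
  (k + k = N)%N -> gap a z nu k k = 0.
Proof.
move=> hg z0 nu0 hd kk; have [hD ha _] := hg.
have km : (k < m)%N by lia.
have real D' a' (y : V) : good f h M m D' a' -> nr y < dr D' -> a' k k y = rc (cre (a' k k y)).
  move=> [hD' ha' _] hy; have := congr1 (@cim R) (slice_exp_real k k ha' hy); rewrite cimJ => e.
  by apply: c_eq; rewrite ?cre_rc ?cim_rc //; lra.
have n0 : nr (0 : C) <= 1 by rewrite nr0.
have disc_c D' (y v : V) : disc_in D' y v -> nr y < dr D' by move=> h1; have := h1 0 n0; rewrite scale0r addr0.
have kst : forall D a z z', good f h M m D a -> nr z < dr D -> nr z' < dr D -> z 0 (dj D) = 0 -> z' 0 (dj D) = 0 ->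
    cre (a k k z) = cre (a k k z').
  apply: (good_global (F := fun D a z => cre (a k k z))).
  - move=> D' a' E' e' x h1 h2 xD xE Yx; have [t t1 ->] := good_rigid h1 h2 xD xE Yx km km kk.
    by rewrite -exprMn t1 expr1n mul1r.
  - move=> D' a' y [hD' ha' _] hy e e0; have [d d0 hd'] := slice_exp_ctn k k ha' hy e0.
    exists d => // y' /hd' h1; rewrite -rcB nr_rc -creB; exact: le_lt_trans (cre_le _) h1.
  - move=> D' a' y v h1 y0 v0 h2; have hp := gap_lead h1 y0 v0 h2; have [_ ha' _] := h1.
    have := mean_ge (@esum_circ R M _) hp; rewrite mean_esum cre_sum.
    have kM : (k < M)%N by lia.
    rewrite (bigD1 (Ordinal kM)) //= {1}/homp kk eqxx big1 ?addr0 => [|i ni]; last first.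
      rewrite /homp ifN //; apply: contra ni => /eqP e; apply/eqP/val_inj => /=; lia.
    rewrite /gap creB subr_ge0 (mean_eq (v := fun t => rc (cre (a' k k (y + t *: v))))) // => t ht.
    by apply: real h1 _; apply: h2; rewrite ht.
rewrite /gap (mean_eq (v := fun=> a k k z)) ?mean_cst ?subrr // => t ht.
have ht' : nr (z + t *: nu) < dr D by apply: hd; rewrite ht.
rewrite (real _ _ _ hg ht') (real _ _ _ hg (disc_c _ _ _ hd)); congr rc.
by apply: (kst D) => //; [exact: disc_c hd|exact: slice_line].
Qed.

(** The mean of the leading form over the circle involves diagonal coefficients only: it is 0 by
    [diag_const], and for odd N there is no such coefficient. A nonnegative form of mean 0 vanishes
    on the circle, hence so do its coefficients. *)
Lemma gap0 D a z nu k l : good f h M m D a -> z 0 (dj D) = 0 -> nu 0 (dj D) = 0 -> disc_in D z nu ->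
  (k + l = N)%N -> gap a z nu k l = 0.
Proof.
move=> hg z0 nu0 hd; have hp := gap_lead hg z0 nu0 hd; have [hD ha _] := hg.
apply: (homp_zero (leq_trans NM mM)); first by move=> i j; exact: (gapJ i j ha hd).
apply: (mean_posdef (@esum_circ R M _) hp); rewrite mean_esum big1 // => i _; rewrite /homp; case: eqP => // e.
exact: (diag_const hg z0 nu0 hd e).
Qed.

(** The squared modulus is global, the factor being unimodular, and sub-mean by the variance
    identity, hence constant. With the mean value property this is the equality case of that
    identity, so the coefficient itself is constant. *)
Lemma offdiag_const D a z k l : good f h M m D a -> nr z < dr D -> z 0 (dj D) = 0 -> (k < m)%N -> (l < m)%N ->
  (k + l = N)%N -> a k l z = a k l 0.
Proof.
move=> hg hz z0 km lm kl.
have sq D' a' (y v : V) : good f h M m D' a' -> y 0 (dj D') = 0 -> v 0 (dj D') = 0 -> disc_in D' y v ->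
    circ (fun t => a' k l (y + t *: v)) /\ mean (fun t => a' k l (y + t *: v)) = a' k l y.
  move=> h1 y0 v0 h2; have [_ ha' _] := h1; split; first exact: (slice_exp_circ _ _ ha' h2).
  by apply/eqP; rewrite -subr_eq0; apply/eqP; exact: (gap0 h1 y0 v0 h2 kl).
have kst : forall D a z z', good f h M m D a -> nr z < dr D -> nr z' < dr D -> z 0 (dj D) = 0 -> z' 0 (dj D) = 0 ->
    nr (a k l z) ^+ 2 = nr (a k l z') ^+ 2.
  apply: (good_global (F := fun D a z => nr (a k l z) ^+ 2)).
  - move=> D' a' E' e' x h1 h2 xD xE Yx; have [t t1 ->] := good_rigid h1 h2 xD xE Yx km lm kl.
    have nt : nr t = 1.
      apply/eqP; rewrite -(@eqrXn2 _ 2) ?nr_ge0 // expr1n; apply/eqP/(@rc_inj R); by rewrite nr_sqr t1.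
    by rewrite !nrM !nrX nrJ nt !expr1n !mul1r.
  - move=> D' a' y [hD' ha' _] hy e e0; have ct := slice_exp_ctn k l ha' hy.
    have [d d0 hd'] := contM ct (contJ ct) e0; exists d => // y' /hd'; by rewrite !nr_sqr.
  - move=> D' a' y v h1 y0 v0 h2; have [c1 c2] := sq _ _ _ _ h1 y0 v0 h2.
    by have [] := mean_sq_gap c1 c2.
have r0 : 0 < dr D by exact: le_lt_trans (nr_ge0 _) hz.
(* The disc centred at 0 with [z] as its boundary point at parameter 1. *)
have hd := disc0 hz; have o0 : (0 : V) 0 (dj D) = 0 by rewrite mxE.
have [c1 c2] := sq _ _ _ _ hg o0 z0 hd; have [_ /(_ _ 1)] := mean_sq_gap c1 c2.
rewrite scale1r add0r nr1; apply=> //.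
rewrite (mean_eq (v := fun=> rc (nr (a k l 0) ^+ 2))) ?mean_cst // => t ht; congr rc.
apply: (kst D) => //; first by apply: hd; rewrite ht.
  by rewrite nr0.
exact: slice_line.
Qed.

Lemma chain_step : chain N.+1.
Proof.
move=> D a hg; have [i1 i2] := IH hg; split.
  move=> k l km lm; rewrite ltnS leq_eqVlt => /orP[/eqP kl|]; last exact: i1.
  by exists (a k l 0) => z hz z0; exact: (offdiag_const hg hz z0 km lm kl).
move=> z nu z0 nu0 hd k l; rewrite ltnS leq_eqVlt => /orP[/eqP kl|]; last exact: i2.
exact: (gap0 hg z0 nu0 hd kl).
Qed.
End Step.

Lemma chain_all : chain (2 * m).
Proof.
have : forall N, (N <= 2 * m)%N -> chain N.
  elim=> [|N IH] hN; first by move=> D a _; split.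
  by apply: chain_step => //; apply: IH; exact: ltnW.
exact.
Qed.
End ChainStep.

(** * Holomorphy of the top coefficient and the new coordinate *)

Section Perturb.
Variable R : realType.
Local Notation C := (Cplx R).
Implicit Types (w u s : C).

Lemma pow_alg (K : comPzRingType) (w u p q k : K) :
  (w + u) * p - (w * q + (q + w * k) * u) = (w + u) * (p - q - k * u) + k * u ^+ 2.
Proof. ring. Qed.
Lemma nr_nat k : nr (k%:R : C) = k%:R.
Proof. by rewrite -rc_nat nr_rc normr_nat. Qed.
Lemma nrX_le1 w k : nr w <= 1 -> nr (w ^+ k) <= 1.
Proof. by move=> hw; rewrite nrX exprn_ile1 ?nr_ge0. Qed.

Lemma pow_quad k : exists2 B : R, 0 <= B & forall w u, nr w <= 1 -> nr u <= 1 ->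
  nr ((w + u) ^+ k - w ^+ k - k%:R * w ^+ k.-1 * u) <= B * nr u ^+ 2.
Proof.
elim: k => [|k [B B0 IH]].
  by exists 0 => // w u _ _; rewrite !expr0 subrr mul0r mul0r subrr nr0 mul0r.
exists (2 * B + k%:R); first by rewrite addr_ge0 ?mulr_ge0 ?ler0n.
move=> w u hw hu; have -> : (w + u) ^+ k.+1 - w ^+ k.+1 - k.+1%:R * w ^+ k.+1.-1 * u =
   (w + u) * ((w + u) ^+ k - w ^+ k - k%:R * w ^+ k.-1 * u) + k%:R * w ^+ k.-1 * u ^+ 2.
  rewrite -pow_alg /= !exprS -[k.+1]addn1 natrD.
  have -> : w * (k%:R * w ^+ k.-1) = k%:R * w ^+ k.
    by case: k {IH} => [|k]; rewrite ?mul0r ?mulr0 // mulrCA -exprS.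
  ring.
apply: le_trans (nrD _ _) _; rewrite [leRHS]mulrDl lerD // !nrM; last first.
  by rewrite nr_nat -expr2 -mulrA ler_wpM2l ?ler0n // ler_piMl ?exprn_ge0 ?nr_ge0 ?nrX_le1.
rewrite -[leRHS]mulrA; apply: ler_pM; rewrite ?nr_ge0 //; last exact: IH.
by apply: le_trans (nrD _ _) _; rewrite (_ : 2 = 1 + 1) // lerD.
Qed.

Lemma prod_alg (K : comPzRingType) (x y x0 y0 x1 y1 : K) :
  x * y - x0 * y0 - (x1 * y0 + x0 * y1) = (x - x0 - x1) * y + (x0 + x1) * (y - y0 - y1) + x1 * y1.
Proof. ring. Qed.

(** First-order expansion of a monomial in the increment [u], uniform on the unit disc; [u] will be
    the tilt times a boundary point of the disc. *)
Lemma mono_quad k l : exists2 B : R, 0 <= B & forall w u, nr w <= 1 -> nr u <= 1 ->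
  nr ((w + u) ^+ k * (w + u)^* ^+ l - w ^+ k * w^* ^+ l -
     (k%:R * w ^+ k.-1 * u * w^* ^+ l + w ^+ k * (l%:R * w^* ^+ l.-1 * u^*))) <= B * nr u ^+ 2.
Proof.
have [B B0 hB] := pow_quad k; have [B' B0' hB'] := pow_quad l.
exists (B * 2 ^+ l + (1 + k%:R) * B' + k%:R * l%:R).
  by rewrite !addr_ge0 ?mulr_ge0 ?exprn_ge0 ?addr_ge0 ?ler0n.
move=> w u hw hu; rewrite prod_alg.
have q1 := hB w u hw hu.
have q2 : nr ((w + u)^* ^+ l - w^* ^+ l - l%:R * w^* ^+ l.-1 * u^*) <= B' * nr u ^+ 2.
  by rewrite cjD -(nrJ u); apply: hB'; rewrite nrJ.
have q3 : nr ((w + u)^* ^+ l) <= 2 ^+ l.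
  rewrite nrX nrJ lerXn2r ?nnegrE ?nr_ge0 //; apply: le_trans (nrD _ _) _; by rewrite (_ : 2 = 1 + 1) // lerD.
have q4 : nr (k%:R * w ^+ k.-1 * u) <= k%:R * nr u.
  by rewrite !nrM nr_nat -mulrA ler_wpM2l ?ler0n // ler_piMl ?nr_ge0 ?nrX_le1.
have q5 : nr (l%:R * w^* ^+ l.-1 * u^*) <= l%:R * nr u.
  by rewrite !nrM nr_nat nrJ -mulrA ler_wpM2l ?ler0n // ler_piMl ?nr_ge0 ?nrX_le1 ?nrJ.
have u2 : nr u ^+ 2 >= 0 by rewrite exprn_ge0 ?nr_ge0.
apply: le_trans (nrD _ _) _; rewrite [leRHS]mulrDl lerD //; last first.
  rewrite nrM expr2 mulrACA; exact: ler_pM (nr_ge0 _) (nr_ge0 _) q4 q5.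
apply: le_trans (nrD _ _) _; rewrite [leRHS]mulrDl lerD // nrM.
  by rewrite [leRHS]mulrAC; exact: ler_pM (nr_ge0 _) (nr_ge0 _) q1 q3.
rewrite -[leRHS]mulrA; apply: ler_pM; rewrite ?nr_ge0 //.
apply: le_trans (nrD _ _) _; rewrite lerD ?nrX_le1 //; apply: le_trans q4 _.
by rewrite ler_piMr ?ler0n.
Qed.

Lemma circ_bound (b : C -> C) : (forall t, nr t <= 1 -> ctn b t) -> exists2 S : R, 0 <= S & forall t, nr t <= 1 -> nr (b t) <= S.
Proof.
move=> hb; have [d d0 hd] : exists2 d : R, 0 < d & forall t, [set t : C | nr t <= 1] t -> nr (b t) <= d^-1.
  apply: (compact_unif (P := fun d t => nr (b t) <= d^-1)); first exact: compact_disc.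
    by move=> d d' t d0 dd h; apply: le_trans h _; rewrite lef_pV2 ?posrE //; exact: lt_le_trans dd.
  move=> t /hb /(_ 1 ltr01)[d d0 hd]; pose e := Num.min d (nr (b t) + 1)^-1.
  have p0 : 0 < nr (b t) + 1 by rewrite ltr_wpDl ?nr_ge0.
  have e0 : 0 < e by rewrite lt_min d0 invr_gt0.
  exists e => // y hy; have := hd y; rewrite (lt_le_trans hy) ?ge_min ?lexx // => /(_ isT) h1.
  apply: le_trans (_ : nr (b t) + 1 <= _).
    rewrite -(subrK (b t) (b y)); apply: le_trans (nrD _ _) _; by rewrite addrC lerD2l ltW.
  by rewrite -[leLHS]invrK lef_pV2 ?posrE ?invr_gt0 // /e ge_min lexx orbT.
by exists d^-1 => //; rewrite invr_ge0 ltW.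
Qed.

(** The rotation by minus the phase of the conjugate makes the product equal to - |c|. *)
Lemma rot_zero (c : C) : (forall s, nr s = 1 -> 0 <= cre (s * c)) -> c = 0.
Proof.
move=> h; apply/eqP; apply: contraT => c0.
have nc : nr c != 0 by rewrite nr_eq0.
have := h (- c^* / rc (nr c)); rewrite nrM nrN nrJ nrV nr_rc ger0_norm ?nr_ge0 // divff // => /(_ erefl).
have -> : - c^* / rc (nr c) * c = rc (- nr c).
  rewrite mulrAC mulNr [c^* * c]mulrC -nr_sqr -rcV -rcN -rcM expr2 mulNr mulfK //.
by rewrite cre_rc oppr_ge0 le_eqVlt (negbTE nc) /= ltNge nr_ge0.
Qed.
End Perturb.

(** * Tilted discs and the antiholomorphic derivative of the top coefficient *)

Section Dbar.
Variables (R : realType) (n : nat) (X : complexManifold R n) (Y : set X) (L : line_bundle [set: X]).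
Variables (f : lb_index L -> X -> Cplx R) (h : lb_index L -> X -> R) (rr : option nat).
Local Notation C := (Cplx R).
Local Notation V := 'rV[C]_n.+1.
Hypothesis Hh : hermitian_metric rr h.
Hypothesis Hs : forall i a p, lb_dom i p -> chart_dom a p -> chern_semipositive_at (h i \o chart_inv a) (chart a p).
Variables m : nat.
Let M := (2 * m)%N.
Hypothesis HM : le_order M rr.
Hypothesis m0 : (0 < m)%N.
Implicit Types (D E : datum L) (z nu eta : V) (x p : X) (a : nat -> nat -> V -> C).

Lemma fo_alg (K : comPzRingType) (A A' c w0 kw s lw s' t t' wform wk : K) :
  A * (kw * (t * s) * wform + wk * (lw * (t' * s'))) = kw * s * wform * (A * t) + wk * lw * s' * (A * t').
Proof. ring. Qed.

Lemma addsub_alg (K : comPzRingType) (p q r t : K) : p + q + r - q - t = p + (r - t).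
Proof. ring. Qed.

(** The exponent on the left is 2 (k - 1) + (2m - 1) + 2 l, at least 4m - 1 once k + l > m. *)
Lemma first_order_bound k l (S e : R) : 0 <= e -> e <= 1 -> 0 <= S -> (m < k + l)%N ->
  k%:R * (e ^+ 2) ^+ k.-1 * e ^+ (2 * m - 1) * (e ^+ 2) ^+ l * S <= k%:R * S * e ^+ (4 * m - 2).
Proof.
case: k => [|k] e0 e1 S0 kl; first by rewrite !mul0r.
have -> : k.+1%:R * (e ^+ 2) ^+ k.+1.-1 * e ^+ (2 * m - 1) * (e ^+ 2) ^+ l * S = k.+1%:R * S * e ^+ (2 * k + (2 * m - 1) + 2 * l).
  rewrite -!exprM !exprD /=; move: (k.+1%:R) (e ^+ (2 * k)) (e ^+ (2 * m - 1)) (e ^+ (2 * l)) => *; ring.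
by rewrite ler_wpM2l ?mulr_ge0 ?ler0n // ler_wiXn2l //; lia.
Qed.

Lemma sum_single K k0 l0 (x : C) : (k0 < K)%N -> (l0 < K)%N ->
  \sum_(k < K) \sum_(l < K) (if (k == k0 :> nat) && (l == l0 :> nat) then x else 0) = x.
Proof.
move=> hk hl; rewrite (bigD1 (Ordinal hk)) //= (bigD1 (Ordinal hl)) //= !eqxx /= big1 => [|l nl]; last first.
  by case: eqP => // e; case/eqP: nl; apply/val_inj.
rewrite ?addr0 big1 ?addr0 // => k nk; rewrite big1 // => l _.
by case: eqP => // e; case/eqP: nk; apply/val_inj.
Qed.

Section Term.
Variables (D : datum L) (a : nat -> nat -> V -> C) (z nu : V).
Hypothesis hD : valid f D.
Hypothesis ha : slice_exp h M D a.
Hypothesis hd : disc_in D z nu.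
Hypothesis hz0 : z 0 (dj D) = 0.
Hypothesis hnu0 : nu 0 (dj D) = 0.
Hypothesis hchain : chainD m (2 * m) D a.
Let u k l (t : C) := a k l (z + t *: nu).
(** The Fourier coefficient of the top coefficient a_m0 that detects its antiholomorphic part on the
    disc. Below, [W e] is the value of w at the centre of the disc and [Sg e s] the tilt. *)
Let c := mean (fun t => u m 0 t * t).
Let W (e : R) : C := rc (e ^+ 2).
Let Sg (e : R) (s : C) : C := s * rc (e ^+ (2 * m - 1)).

(** The mean of the term of a_m0 w^m, or of its conjugate, that is linear in the tilt: m W^(m-1) Sg
    c, with exponent 2 (m - 1) + (2m - 1) = 4m - 3. *)
Definition main_term k l (e : R) (s : C) : C :=
  rc (m%:R * e ^+ (4 * m - 3)) * ((if (k == m) && (l == 0)%N then s * c else 0) + (if (k == 0)%N && (l == m) then (s * c)^* else 0)).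

Let ucirc k l : circ (u k l). Proof. exact: (slice_exp_circ k l ha hd). Qed.
Let hz : nr z < dr D. Proof. by have n0 : nr (0 : C) <= 1 by [rewrite nr0]; have := hd n0; rewrite scale0r addr0. Qed.

Lemma mean_first k l : (k < m)%N -> (l < m)%N ->
  mean (fun t => u k l t * t) = 0 /\ mean (fun t => u k l t * t^*) = 0.
Proof.
move=> km lm; have [h1 _] := hchain; have [A hA] := h1 k l km lm ltac:(lia).
have e t : nr t = 1 -> u k l t = A.
  move=> ht; apply: hA; first by apply: hd; rewrite ht.
  exact: slice_line.
have e1 : mean (fun t : C => t) = 0 by have := @meanX R 1 isT.
split.
  by rewrite (mean_eq (v := fun t => A * t)) => [|t /e -> //]; rewrite meanZ ?e1 ?mulr0 //; exact: circ_id.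
rewrite (mean_eq (v := fun t => A * t^*)) => [|t /e -> //].
by rewrite meanZ ?meanJ ?e1 ?cj0 ?mulr0 //; [exact: circ_id|exact: (circJ circ_id)].
Qed.

(** The monomial is expanded in powers of the tilt. In degree 0 the mean value property cancels the
    term at the centre. In degree 1 the coefficients with k, l < m are constant and average out, the
    pairs (m, 0) and (0, m) give [main_term], and all other pairs have k + l > m, so
    [first_order_bound] applies. From degree 2 on, the square of the tilt gives the exponent 4m -
    2. *)
Lemma term_bound k l : exists2 B : R, 0 <= B & forall (e : R) (s : C), 0 <= e -> e <= 1 -> nr s = 1 ->
  nr (mean (fun t => u k l t * (W e + t * Sg e s) ^+ k * (W e + t * Sg e s)^* ^+ l) - a k l z * W e ^+ k * (W e)^* ^+ l
     - main_term k l e s) <= B * e ^+ (4 * m - 2).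
Proof.
case: (ltnP (k + l) M) => kl; last first.
  have [h0 _ _ _] := ha; exists 0 => // e s _ _ _.
  have -> : main_term k l e s = 0.
    rewrite /main_term; rewrite !ifN ?addr0 ?mulr0 //; apply/negP => /andP[/eqP ? /eqP ?]; rewrite /M in kl; lia.
  rewrite (mean_eq (v := fun=> 0)) => [|t _]; last by rewrite /u h0 // !mul0r.
  by rewrite mean_cst h0 // !mul0r !subrr nr0.
have [_ g0] := hchain.
have mu : mean (u k l) = a k l z.
  by apply/eqP; rewrite -subr_eq0; apply/eqP; exact: (g0 z nu hz0 hnu0 hd k l kl).
have [S S0 hS] : exists2 S : R, 0 <= S & forall t, nr t <= 1 -> nr (u k l t) <= S.
  apply: circ_bound => t ht; apply: (ctn_comp (f := fun t : C => z + t *: nu)); first exact: cont_line.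
  by apply: (slice_exp_ctn _ _ ha); exact: hd.
have [B B0 hB] := mono_quad R k l.
exists (S * B + (k%:R * S + l%:R * S)); first by rewrite !addr_ge0 ?mulr_ge0 ?ler0n.
move=> e s e0 e1 s1.
have w1 : nr (W e) <= 1 by rewrite /W nr_rc ger0_norm ?exprn_ge0 // exprn_ile1.
have nS : nr (Sg e s) = e ^+ (2 * m - 1) by rewrite /Sg nrM s1 mul1r nr_rc ger0_norm ?exprn_ge0.
have t1 t : nr t = 1 -> nr (t * Sg e s) <= 1 by move=> ht; rewrite nrM ht nS mul1r exprn_ile1.
have tS : circ (fun t => t * Sg e s) by exact: (circM circ_id (circ_cst _)).
have wtS : circ (fun t => W e + t * Sg e s) by exact: (circD (circ_cst _) tS).
have cX (b : C -> C) j : circ b -> circ (fun t => b t ^+ j) by move=> hb t ht; exact: (contX j (hb t ht)).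
pose p t := (W e + t * Sg e s) ^+ k * (W e + t * Sg e s)^* ^+ l.
have cp : circ p by exact: (circM (cX _ k wtS) (cX _ l (circJ wtS))).
pose q t := k%:R * W e ^+ k.-1 * (t * Sg e s) * (W e)^* ^+ l + W e ^+ k * (l%:R * (W e)^* ^+ l.-1 * (t * Sg e s)^*).
have cq : circ q.
  exact: (circD (circM (circM (circ_cst _) tS) (circ_cst _)) (circM (circ_cst _) (circM (circ_cst _) (circJ tS)))).
pose w0 := W e ^+ k * (W e)^* ^+ l.
have E1 : mean (fun t => u k l t * (W e + t * Sg e s) ^+ k * (W e + t * Sg e s)^* ^+ l) =
   mean (fun t => u k l t * (p t - w0 - q t)) + a k l z * W e ^+ k * (W e)^* ^+ l + mean (fun t => u k l t * q t).
  have c1 : circ (fun t => u k l t * (p t - w0 - q t)) by exact: (circM (ucirc k l) (circB (circB cp (circ_cst _)) cq)).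
  have c2 : circ (fun t => w0 * u k l t) by exact: (circM (circ_cst _) (ucirc k l)).
  have c3 : circ (fun t => u k l t * q t) by exact: (circM (ucirc k l) cq).
  have -> : a k l z * W e ^+ k * (W e)^* ^+ l = mean (fun t => w0 * u k l t).
    by rewrite meanZ // mu /w0 -mulrA mulrC.
  rewrite -meanD // -meanD //; last exact: circD.
  by apply: mean_eq => t _; rewrite -mulrA -/(p t); clearbody w0; move: (p t) (q t) (u k l t) => *; ring.
have b1 : nr (mean (fun t => u k l t * (p t - w0 - q t))) <= S * B * e ^+ (4 * m - 2).
  apply: mean_le; first exact: (circM (ucirc k l) (circB (circB cp (circ_cst _)) cq)).
  move=> t ht; rewrite nrM -mulrA; apply: ler_pM; rewrite ?nr_ge0 //; first by apply: hS; rewrite ht.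
  have := hB (W e) (t * Sg e s) w1 (t1 t ht); rewrite nrM ht nS mul1r -exprM => h1.
  have -> : (4 * m - 2 = (2 * m - 1) * 2)%N by clear; lia.
  exact: h1.
pose ca := mean (fun t => u k l t * t); pose cb := mean (fun t => u k l t * t^*).
have E2 : mean (fun t => u k l t * q t) = k%:R * W e ^+ k.-1 * Sg e s * (W e)^* ^+ l * ca + W e ^+ k * (l%:R * (W e)^* ^+ l.-1) * (Sg e s)^* * cb.
  have c1 : circ (fun t => u k l t * t) by exact: (circM (ucirc k l) circ_id).
  have c2 : circ (fun t => u k l t * t^*) by exact: (circM (ucirc k l) (circJ circ_id)).
  rewrite /ca /cb -!meanZ // -meanD; [|exact: (circM (circ_cst _) c1)|exact: (circM (circ_cst _) c2)].
  by apply: mean_eq => t _; rewrite /q cjM; exact: fo_alg.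
have b2 : nr (mean (fun t => u k l t * q t) - main_term k l e s) <= (k%:R * S + l%:R * S) * e ^+ (4 * m - 2).
  have ncab : nr ca <= S /\ nr cb <= S.
    split; apply: mean_le; try exact: (circM (ucirc k l) circ_id); try exact: (circM (ucirc k l) (circJ circ_id)).
      by move=> t ht; rewrite nrM ht mulr1 hS ?ht.
    by move=> t ht; rewrite nrM nrJ ht mulr1 hS ?ht.
  have E0 : 0 <= e ^+ (4 * m - 2) by rewrite exprn_ge0.
  have WS : W e ^+ m.-1 * Sg e s = rc (e ^+ (4 * m - 3)) * s.
    rewrite /W /Sg mulrCA -rcX -rcM -exprM -exprD mulrC; congr (rc (_ ^+ _) * _); move: m0; clear; lia.
  rewrite E2 /main_term; case: (boolP ((k == m) && (l == 0)%N)) => [/andP[/eqP km /eqP l0]|n1].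
    rewrite km l0 mul0r !mulr0 ifN ?addr0; last by apply/negP => /andP[/eqP e3 _]; move: m0; rewrite e3.
    rewrite !mul0r addr0.
    have -> : ca = c by rewrite /ca /c km l0.
    rewrite expr0 mulr1 -(mulrA m%:R) WS rcM rc_nat; set x := _ - _.
    have -> : x = 0 by rewrite /x; move: (rc _) c => *; ring.
    by rewrite nr0 addr0 !mulr_ge0 ?ler0n.
  case: (boolP ((k == 0)%N && (l == m))) => [/andP[/eqP k0 /eqP lm]|n2].
    rewrite k0 lm mul0r !mul0r !add0r expr0 mul1r.
    have -> : cb = c^*.
      rewrite /cb /c k0 lm -meanJ; last exact: (circM (ucirc m 0) circ_id).
      apply: mean_eq => t ht; rewrite cjM; congr (_ * _).
      by apply: (slice_exp_real m 0 ha); apply: hd; rewrite ht.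
    have := congr1 Num.conj WS; rewrite [LHS]cjM [RHS]cjM cjX rcJ => WS'.
    rewrite -(mulrA m%:R) WS' rcM rc_nat [(s * c)^*]cjM; set x := _ - _.
    have -> : x = 0 by rewrite /x; move: (rc _) (c^*) (s^*) => *; ring.
    by rewrite nr0 !mulr_ge0 ?ler0n.
  rewrite addr0 mulr0 subr0.
  case: (boolP ((k < m)%N && (l < m)%N)) => [/andP[km lm]|n3].
    have [h1 h2] := mean_first km lm.
    by rewrite /ca /cb h1 h2 !mulr0 addr0 nr0 mulr_ge0 ?addr_ge0 ?mulr_ge0 ?ler0n.
  have kl' : (m < k + l)%N by move/negP: n1 => n1; move/negP: n2 => n2; move/negP: n3 => n3; move: n1 n2 n3; clear; lia.
  have nW : nr (W e) = e ^+ 2 by rewrite /W nr_rc ger0_norm ?exprn_ge0.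
  move: (Sg e s) nS => Se nS.
  apply: le_trans (nrD _ _) _; rewrite mulrDl; apply: lerD.
    apply: le_trans (first_order_bound e0 e1 S0 kl').
    rewrite !nrM !nrX nrJ nW nS nr_nat ler_wpM2l ?ncab.1 // !mulr_ge0 ?ler0n ?exprn_ge0 //; exact: exprn_ge0.
  rewrite addnC in kl'; apply: le_trans (first_order_bound e0 e1 S0 kl').
  rewrite !nrM !nrX !nrJ nW nS nr_nat.
  have -> : l%:R * (e ^+ 2) ^+ l.-1 * e ^+ (2 * m - 1) * (e ^+ 2) ^+ k * S = (e ^+ 2) ^+ k * (l%:R * (e ^+ 2) ^+ l.-1) * e ^+ (2 * m - 1) * S.
    by move: ((e ^+ 2) ^+ l.-1) ((e ^+ 2) ^+ k) (e ^+ (2 * m - 1)) (l%:R) => *; ring.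
  rewrite ler_wpM2l ?ncab.2 // !mulr_ge0 ?ler0n ?exprn_ge0 //; exact: exprn_ge0.
rewrite E1; set A1 := mean _; set A2 := _ * _ * _; set A3 := mean _.
rewrite addsub_alg.
by apply: le_trans (nrD _ _) _; rewrite [leRHS]mulrDl lerD.
Qed.
(** Division by [e ^+ (4 * m - 3)] leaves [H] plus a term linear in [e]. *)
Lemma radial_pos (H B d : R) : 0 < d -> (forall e, 0 < e -> e < d -> 0 <= e ^+ (4 * m - 3) * H + B * e ^+ (4 * m - 2)) -> 0 <= H.
Proof.
move=> d0 hB; rewrite leNgt; apply/negP => Hn.
have q0 : 0 < 2 * (`|B| + 1) by rewrite mulr_gt0 // ltr_wpDl.
pose e := Num.min (d / 2) (- H / (2 * (`|B| + 1))).
have e0 : 0 < e by rewrite lt_min divr_gt0 // divr_gt0 // oppr_gt0.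
have [ed eH] : e < d /\ e <= - H / (2 * (`|B| + 1)).
  have : e <= e by []. rewrite {2}/e le_min => /andP[h1 h2]; split=> //.
  by apply: le_lt_trans h1 _; rewrite ltr_pdivrMr // ltr_pMr // ltr1n.
have := hB e e0 ed; have -> : (4 * m - 2 = (4 * m - 3).+1)%N by lia.
rewrite exprSr mulrCA -mulrDr pmulr_rge0 ?exprn_gt0 // => h1.
move: eH; rewrite ler_pdivlMr // => h2; have h3 := ler_norm B; nra.
Qed.

(** Summing [term_bound] in the inequality of [exp_sub] leaves the real part of s c, up to a factor,
    as the dominant term. It must be nonnegative for every unimodular [s], and [rot_zero]
    concludes. *)
Lemma mean_dbar : c = 0.
Proof.
apply: rot_zero => s s1.
have M2 : (2 <= M)%N by rewrite /M; lia.
have [r r0 [B B0 hB]] := exp_sub Hh Hs HM M2 hD ha hd.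
have /choice[Bk hBk] : forall kl : nat * nat, exists b : R, 0 <= b /\ forall (e : R) (s : C), 0 <= e -> e <= 1 -> nr s = 1 ->
  nr (mean (fun t => u kl.1 kl.2 t * (W e + t * Sg e s) ^+ kl.1 * (W e + t * Sg e s)^* ^+ kl.2) - a kl.1 kl.2 z * W e ^+ kl.1 * (W e)^* ^+ kl.2
     - main_term kl.1 kl.2 e s) <= b * e ^+ (4 * m - 2).
  by move=> [k l]; have [b b0 hb] := term_bound k l; exists b.
pose S := \sum_(k < M) \sum_(l < M) Bk (nat_of_ord k, nat_of_ord l).
have mM : (m < M)%N by rewrite /M; lia.
have M0 : (0 < M)%N by lia.
have main e : \sum_(k < M) \sum_(l < M) main_term k l e s = rc (m%:R * e ^+ (4 * m - 3)) * (s * c + (s * c)^*).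
  rewrite mulrDr -(sum_single (rc (m%:R * e ^+ (4 * m - 3)) * (s * c)) mM M0) -(sum_single (rc (m%:R * e ^+ (4 * m - 3)) * (s * c)^*) M0 mM).
  rewrite -big_split; apply: eq_bigr => k _; rewrite -big_split; apply: eq_bigr => l _ /=.
  by rewrite /main_term mulrDr; congr (_ + _); case: ifP => _; rewrite ?mulr0.
apply: (@radial_pos _ ((S + B * 2 ^+ M) / (2 * m%:R)) (Num.min (r / 2) 1)).
  by rewrite lt_min divr_gt0 ?ltr01.
move=> e e0; rewrite lt_min => /andP[er e1].
have e1' := ltW e1; have e0' := ltW e0.
have nW : nr (W e) = e ^+ 2 by rewrite /W nr_rc ger0_norm ?exprn_ge0.
have nS : nr (Sg e s) = e ^+ (2 * m - 1) by rewrite /Sg nrM s1 mul1r nr_rc ger0_norm ?exprn_ge0.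
have Sr : nr (Sg e s) < r.
  rewrite nS; apply: le_lt_trans (_ : _ <= e) _; last by apply: lt_trans er _; rewrite ltr_pdivrMr // ltr_pMr // ltr1n.
  by rewrite -[leRHS]expr1 ler_wiXn2l //; move: m0; clear; lia.
have Wr : nr (W e) < r.
  rewrite nW; apply: le_lt_trans (_ : _ <= e) _; last by apply: lt_trans er _; rewrite ltr_pdivrMr // ltr_pMr // ltr1n.
  by rewrite -[leRHS]expr1 ler_wiXn2l.
have := hB _ _ Wr Sr.
set Q := mean _; set P := esum _ _ _ => h1.
have ct k l : circ (fun t => u k l t * (W e + t * Sg e s) ^+ k * (W e + t * Sg e s)^* ^+ l).
  have c1 : circ (fun t => W e + t * Sg e s) by exact: (circD (circ_cst _) (circM circ_id (circ_cst _))).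
  apply: circM; first apply: circM; first exact: ucirc.
    by move=> t ht; exact: (contX k (c1 t ht)).
  by move=> t ht; exact: (contX l (contJ (c1 t ht))).
have EQ : Q - P - \sum_(k < M) \sum_(l < M) main_term k l e s = \sum_(k < M) \sum_(l < M)
   (mean (fun t => u k l t * (W e + t * Sg e s) ^+ k * (W e + t * Sg e s)^* ^+ l) - a k l z * W e ^+ k * (W e)^* ^+ l - main_term k l e s).
  rewrite /Q /P /esum mean_sum => [|k]; last by apply: circ_sum => l; exact: ct.
  rewrite -!sumrB; apply: eq_bigr => k _; rewrite mean_sum => [|l]; last exact: ct.
  by rewrite -!sumrB.
have b1 : nr (Q - P - \sum_(k < M) \sum_(l < M) main_term k l e s) <= S * e ^+ (4 * m - 2).
  rewrite EQ /S mulr_suml; apply: le_trans (nr_sum _ _ _) _; apply: ler_sum => k _.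
  rewrite mulr_suml; apply: le_trans (nr_sum _ _ _) _; apply: ler_sum => l _.
  exact: (hBk (nat_of_ord k, nat_of_ord l)).2.
have b2 : B * (nr (W e) + nr (Sg e s)) ^+ M <= B * 2 ^+ M * e ^+ (4 * m - 2).
  rewrite -mulrA ler_wpM2l // nW nS.
  (* For m = 1 the tilt e is larger than w = e^2 and governs the remainder, which then has exactly
     the order e^2 = e^(4m-2). For m > 1 the tilt is at most e^2. *)
  have [m1|m1] := leqP m 1.
    have em : m = 1%N by move: m0 m1; clear; lia.
    rewrite /M em /= -exprMn lerXn2r ?nnegrE ?addr_ge0 ?mulr_ge0 ?exprn_ge0 // (_ : 2 = 1 + 1) // mulrDl mul1r lerD //.
    by rewrite -[leRHS]expr1 ler_wiXn2l.
  apply: le_trans (_ : (2 * e ^+ 2) ^+ M <= _).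
    rewrite lerXn2r ?nnegrE ?addr_ge0 ?mulr_ge0 ?exprn_ge0 // (_ : 2 = 1 + 1) // mulrDl mul1r lerD //.
    by rewrite ler_wiXn2l //; move: m1; clear; lia.
  rewrite exprMn ler_wpM2l ?exprn_ge0 // -exprM ler_wiXn2l // /M; clear; lia.
have b3 := le_trans (cre_ler _) b1.
move: b3; rewrite creB main cre_addJ -rcM cre_rc => b3.
have mpos : 0 < m%:R :> R by rewrite ltr0n.
have e2 : 0 <= m%:R * e ^+ (4 * m - 3) * (2 * cre (s * c)) + (S + B * 2 ^+ M) * e ^+ (4 * m - 2).
  move: h1 b2 b3; move: (cre (Q - P)) (B * (_ + _) ^+ M) (B * 2 ^+ M) (e ^+ (4 * m - 2)) (m%:R * _ * _) => q1 q2 q3 q4 q5 h1 b2 b3.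
  rewrite mulrDl; lra.
have -> : e ^+ (4 * m - 3) * cre (s * c) + (S + B * 2 ^+ M) / (2 * m%:R) * e ^+ (4 * m - 2) =
   (m%:R * e ^+ (4 * m - 3) * (2 * cre (s * c)) + (S + B * 2 ^+ M) * e ^+ (4 * m - 2)) / (2 * m%:R).
  have : m%:R != 0 :> R by rewrite gt_eqF.
  move: (m%:R) (S + _) (cre _) (e ^+ (4 * m - 3)) (e ^+ (4 * m - 2)) => x1 x2 x3 x4 x5 hx; field => //.
by rewrite divr_ge0 // mulr_ge0 // ltW.
Qed.
End Term.
End Dbar.

(** * The coordinate of the next level *)

Section NewDatum.
Variables (R : realType) (n : nat) (X : complexManifold R n) (Y : set X) (L : line_bundle [set: X]).
Variables (f : lb_index L -> X -> Cplx R) (h : lb_index L -> X -> R) (rr : option nat).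
Local Notation C := (Cplx R).
Local Notation V := 'rV[C]_n.+1.
Hypothesis Hf : forall i, defining_function Y (lb_dom i) (f i).
Hypothesis Hh : hermitian_metric rr h.
Hypothesis Hs : forall i a p, lb_dom i p -> chart_dom a p -> chern_semipositive_at (h i \o chart_inv a) (chart a p).
Variables m : nat.
Let M := (2 * m)%N.
Hypothesis HM : le_order M rr.
Hypothesis m0 : (0 < m)%N.
Implicit Types (D E : datum L) (z nu eta : V) (x p : X) (a : nat -> nat -> V -> C).

Lemma wform_split (A B v : V) : wform A B v = wform A 0 v + wform 0 B v.
Proof. by rewrite /wform -big_split; apply: eq_bigr => j _ /=; rewrite !mxE !mul0r addr0 add0r. Qed.

Lemma first_alg (K : comPzRingType) (F t t' r w b : K) :
  (F + (t * r * w + t' * r * b)) * t = F * (t * 1) + r * w * (t ^+ 2 * 1) + r * b * (t * t').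
Proof. ring. Qed.

Lemma cancel_le (r b e k : R) : 0 < r -> r * b <= e * (r * k) -> b <= e * k.
Proof. by move=> r0; rewrite mulrCA ler_pM2l. Qed.
Lemma shrink_le (e k : R) : 0 < e -> 0 <= k -> e / (k + 1) * k <= e.
Proof.
move=> e0 k0; rewrite -mulrA ler_piMr ?(ltW e0) // mulrC ler_pdivrMr ?ltr_wpDl // mul1r lerDl //.
Qed.

(** In the first-order expansion of [F] on the circle of radius rho, the mean against t annihilates
    the constant and the complex-linear part and returns rho times the conjugate part, up to
    o(rho). *)
Lemma dbar_zero (F : V -> C) z nu (A B : V) (d0 : R) : wd F z A B -> 0 < d0 ->
  (forall rho : R, 0 < rho -> rho < d0 -> circ (fun t => F (z + t *: (rc rho *: nu))) /\ mean (fun t => F (z + t *: (rc rho *: nu)) * t) = 0) ->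
  wform 0 B nu = 0.
Proof.
move=> hw d00 hm; set b := wform 0 B nu.
have key (e : R) : 0 < e -> nr b <= e * nr nu.
  move=> e0; have [d d1 hd] := hw e e0.
  have n0 : 0 < nr nu + 1 by rewrite ltr_wpDl ?nr_ge0.
  pose rho := Num.min (d0 / 2) (d / 2 / (nr nu + 1)).
  have r0 : 0 < rho by rewrite lt_min !divr_gt0.
  have [r1 r2] : rho < d0 /\ rho * nr nu < d.
    have : rho <= rho by []. rewrite {2}/rho le_min => /andP[h1 h2]; split.
      by apply: le_lt_trans h1 _; rewrite ltr_pdivrMr // ltr_pMr // ltr1n.
    move: h2; rewrite ler_pdivlMr // => h2; have := nr_ge0 nu; move: (nr nu) h2 => y h2 y0; nra.
  have [cu hm0] := hm rho r0 r1.
  pose l t := F z + (t * rc rho * wform A 0 nu + t^* * rc rho * b).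
  have tv t : t *: (rc rho *: nu) = (t * rc rho) *: nu by rewrite scalerA.
  have hl t : nr t = 1 -> nr (F (z + t *: (rc rho *: nu)) - l t) <= e * (rho * nr nu).
    move=> ht; have nv : nr (t *: (rc rho *: nu)) = rho * nr nu.
      by rewrite !nrZ ht mul1r nr_rc ger0_norm // ltW.
    have := hd (t *: (rc rho *: nu)); rewrite nv => /(_ r2).
    have -> : wform A B (t *: (rc rho *: nu)) = t * rc rho * wform A 0 nu + t^* * rc rho * b by rewrite tv wlZ cjM rcJ.
    by move=> h1; rewrite /l [- (F z + _)]opprD addrA.
  have ct1 : circ (fun t => t * rc rho * wform A 0 nu) by exact: (circM (circM circ_id (circ_cst _)) (circ_cst _)).
  have ct2 : circ (fun t => t^* * rc rho * b) by exact: (circM (circM (circJ circ_id) (circ_cst _)) (circ_cst _)).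
  have cl : circ l by exact: (circD (circ_cst _) (circD ct1 ct2)).
  have ml : mean (fun t => l t * t) = rc rho * b.
    pose l' t := (F z * (t ^+ 1 * t^* ^+ 0) + (rc rho * wform A 0 nu) * (t ^+ 2 * t^* ^+ 0)) + (rc rho * b) * (t ^+ 1 * t^* ^+ 1).
    rewrite (mean_eq (v := l')) => [|t _]; last first.
      by rewrite /l /l' !expr0 !expr1; exact: first_alg.
    have cm k j : circ (fun t : C => t ^+ k * t^* ^+ j) by exact: (circM (@circX R k) (@circJX R j)).
    have cz (q : C) k j : circ (fun t : C => q * (t ^+ k * t^* ^+ j)) by exact: (circM (circ_cst q) (cm k j)).
    rewrite /l' meanD; [|exact: (circD (cz _ 1 0) (cz _ 2 0))|exact: (cz _ 1 1)].
    rewrite meanD; [|exact: (cz _ 1 0)|exact: (cz _ 2 0)].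
    rewrite !meanZ; [|exact: (cm 1 1)|exact: (cm 2 0)|exact: (cm 1 0)].
    by rewrite !mean_mono /= !mulr0 !add0r mulr1.
  have : nr (rc rho * b) <= e * (rho * nr nu).
    have -> : rc rho * b = - mean (fun t => (F (z + t *: (rc rho *: nu)) - l t) * t).
      rewrite (mean_eq (v := fun t => F (z + t *: (rc rho *: nu)) * t - l t * t)) => [|t _]; last by rewrite mulrBl.
      by rewrite meanB ?ml ?hm0 ?sub0r ?opprK //; [exact: (circM cu circ_id)|exact: (circM cl circ_id)].
    rewrite nrN; apply: mean_le; first exact: (circM (circB cu cl) circ_id).
    by move=> t ht; rewrite nrM ht mulr1; exact: hl.
  by rewrite nrM nr_rc ger0_norm ?(ltW r0) //; exact: cancel_le.
apply/eqP; rewrite -nr_eq0 eq_le nr_ge0 andbT; apply/ler_addgt0Pl => e e0; rewrite addr0.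
have n0 : 0 < nr nu + 1 by rewrite ltr_wpDl ?nr_ge0.
apply: le_trans (key (e / (nr nu + 1)) ltac:(by rewrite divr_gt0)) _.
exact: (shrink_le e0 (nr_ge0 nu)).
Qed.

(** Along the slice the conjugate derivative vanishes by [mean_dbar] on all small discs; composing
    with the projection makes the function independent of w, which settles the normal direction. *)
Lemma top_hol D a : good f h M m D a -> chainD m M D a -> hol (ball0 (dr D)) (fun eta => a m 0 (pr (dj D) eta)).
Proof.
move=> [hD ha hq] hc eta he; pose j := dj D; set z := pr j eta.
have hz : nr z < dr D by exact: le_lt_trans (pr_le _ _) he.
have z0 : z 0 j = 0 by rewrite /z mxE eqxx.
have [_ hS _ _] := ha.
(* The coefficient a_m0 keeps M - m = m orders of smoothness, at least one, so it has Wirtinger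
   derivatives. *)
have m1 : (1 <= M - (m + 0))%N by rewrite /M; lia.
have [A [B [hw _]]] := smooth_le m1 (hS m 0%N).
move: (hw z hz); move: (A z) (B z) => {hw} {}A {}B hw.
exists (pr j A).
have B0 (v : V) : wform 0 B (pr j v) = 0.
  set nu := pr j v; have nu0 : nu 0 j = 0 by rewrite mxE eqxx.
  have p0 : 0 < (dr D - nr z) / (nr nu + 1) by rewrite divr_gt0 ?subr_gt0 // ltr_wpDl ?nr_ge0.
  apply: (dbar_zero hw p0) => rho r0 r1.
  have hd : disc_in D z (rc rho *: nu).
    move=> t ht; apply: le_lt_trans (nrD _ _) _; rewrite addrC -ltrBrDr !nrZ nr_rc ger0_norm ?ltW //.
    apply: le_lt_trans (_ : rho * (nr nu + 1) < _); last by rewrite -ltr_pdivlMr // ltr_wpDl ?nr_ge0.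
    apply: le_trans (_ : rho * nr nu <= _); first by rewrite ler_piMl // mulr_ge0 ?nr_ge0 // ltW.
    by rewrite ler_wpM2l ?ltW // ltrDl.
  have v0 : (rc rho *: nu) 0 j = 0 by rewrite mxE nu0 mulr0.
  split; first exact: (slice_exp_circ _ _ ha hd).
  exact: (mean_dbar Hh Hs HM m0 hD ha hd z0 v0 hc).
have e v : wform A B (pr j v) = wform (pr j A) 0 v.
  rewrite wform_split B0 addr0 !wl0E; apply: eq_bigr => l _; rewrite !mxE; case: eqP; rewrite ?mul0r ?mulr0 //.
have hl := lito_sub (k := pr j) ltr01 ltr01 (fun v _ => _) hw.
apply: lito_eq (hl _) => v; first by rewrite prD e.
by rewrite mul1r pr_le.
Qed.

Lemma esum_lip K (c : nat -> nat -> C) : exists2 B : R, 0 <= B & forall w u : C, nr w <= 1 -> nr u <= 1 ->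
  nr (esum K c (w + u) - esum K c w) <= B * nr u.
Proof.
have /choice[Bk hBk] : forall kl : nat * nat, exists b : R, 0 <= b /\ forall w u : C, nr w <= 1 -> nr u <= 1 ->
    nr (c kl.1 kl.2 * (w + u) ^+ kl.1 * (w + u)^* ^+ kl.2 - c kl.1 kl.2 * w ^+ kl.1 * w^* ^+ kl.2) <= b * nr u.
  move=> [k l] /=; have [B B0 hB] := mono_quad R k l.
  exists (nr (c k l) * (B + (k%:R + l%:R))); split; first by rewrite mulr_ge0 ?nr_ge0 ?addr_ge0 ?ler0n.
  move=> w u hw hu; rewrite -!mulrA -mulrBr nrM ler_wpM2l ?nr_ge0 //.
  set x := k%:R * w ^+ k.-1 * u * w^* ^+ l + w ^+ k * (l%:R * w^* ^+ l.-1 * u^*).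
  rewrite -[X in nr X](subrK x); apply: le_trans (nrD _ _) _; rewrite mulrDl lerD //.
    apply: le_trans (hB w u hw hu) _; rewrite ler_wpM2l // expr2 ler_piMr ?nr_ge0 //.
  apply: le_trans (nrD _ _) _; rewrite mulrDl !nrM !nr_nat nrJ lerD //.
    rewrite -!mulrA ler_wpM2l ?ler0n // mulrCA ler_piMr ?nr_ge0 //.
    by rewrite mulr_ile1 ?nr_ge0 ?nrX_le1 ?nrJ.
  rewrite mulrCA -!mulrA ler_wpM2l ?ler0n // mulrA ler_piMl ?nr_ge0 //.
  by rewrite mulr_ile1 ?nr_ge0 ?nrX_le1 ?nrJ.
exists (\sum_(k < K) \sum_(l < K) Bk (nat_of_ord k, nat_of_ord l)).
  by apply: sumr_ge0 => k _; apply: sumr_ge0 => l _; exact: (hBk _).1.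
move=> w u hw hu; rewrite /esum -sumrB mulr_suml; apply: le_trans (nr_sum _ _ _) _; apply: ler_sum => k _.
rewrite -sumrB mulr_suml; apply: le_trans (nr_sum _ _ _) _; apply: ler_sum => l _.
exact: (hBk (nat_of_ord k, nat_of_ord l)).2.
Qed.

Lemma poly_alg (K : comPzRingType) (B x y : K) : (1 - x) * (1 - y) * B = B - B * x - B * y + B * x * y.
Proof. ring. Qed.

(* Why the coordinate [w (1 - a_m0 w^m)] gains one order. *)
Lemma killed_coef (al : C) (c : nat -> nat -> C) k l : (k + l <= m)%N -> c m 0 = al -> c 0 m = al^* -> c 0 0 = 1 ->
  ((1 - al%:P%:P * Xh ^+ m) * (1 - (al^*)%:P%:P * 'X ^+ m) * bipoly M c)`_l`_k =
  if (k == m) || (l == m) then 0 else c k l.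
Proof.
move=> kl c1 c2 c00; rewrite poly_alg /Xh.
have kM : (k < M)%N by rewrite /M; lia.
have lM : (l < M)%N by rewrite /M; lia.
have M0 : (0 < M)%N by lia.
set B := bipoly M c.
have e1 : B * (al%:P%:P * 'X%:P ^+ m) = B * (al%:P%:P * 'X%:P ^+ m) * 'X ^+ 0 by rewrite expr0 mulr1.
have e2 : B * ((al^*)%:P%:P * 'X ^+ m) = B * ((al^*)%:P%:P * 'X%:P ^+ 0) * 'X ^+ m by rewrite expr0 mulr1 mulrA.
have e3 : B * (al%:P%:P * 'X%:P ^+ m) * ((al^*)%:P%:P * 'X ^+ m) = B * ((al * al^*)%:P%:P * 'X%:P ^+ m) * 'X ^+ m.
  rewrite rmorphM rmorphM; ring.
rewrite e3 {1}e1 e2 !coefD !coefN !coef_mono leq0n andbT /= !subn0 bpE kM lM.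
case: (leqP m k) => mk.
  have [km l0] : k = m /\ l = 0%N by move: kl mk m0; clear; lia.
  subst k l; rewrite eqxx subnn leqNgt m0 /= !bpE M0 /= c1 c00 mulr1 !subrr ?subr0 ?addr0 //.
rewrite (ltn_eqF mk) /=; case: (leqP m l) => ml.
  have [lm k0] : l = m /\ k = 0%N by move: kl ml m0; clear; lia.
  by subst k l; rewrite eqxx subnn !bpE M0 /= c2 c00 mulr1 subr0 subrr addr0.
by rewrite (ltn_eqF ml) !subr0 addr0.
Qed.

(** Along a normal line the same function has two jets: one from psi_E = |q|^2 psi_D, computed by
    [killed_coef], the other from the expansion in the new coordinate w q = w + O(w^(m+1)). They
    must agree below degree m + 1. *)
Lemma new_datum D a p : good f h M m D a -> chainD m M D a -> dO D p -> Y p ->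
  exists E a1, [/\ valid f E, slice_exp h M E a1, level m.+1 E a1 & dO E p].
Proof.
move=> hg hc Dp Yp; have [hD ha [q1 q2 q3]] := hg; have hal := top_hol hg hc.
have M2 : (2 <= M)%N by rewrite /M; lia.
pose j := dj D; pose al eta := a m 0 (pr j eta).
pose g eta := al eta * eta 0 j ^+ m; pose q eta := 1 - g eta.
(* Where |a_m0 w^m| < 1 the factor [q] has no zero, as [redatum] requires. *)
pose U : set V := [set eta | nr eta < dr D /\ nr (g eta) < 1].
have hgv eta : nr eta < dr D -> vdiff g eta.
  by move=> he; apply: (vdiffM (hal _ he)); apply: vdiffX; exact: vdiff_coord.
have hq : hol U q.
  move=> eta [he _]; apply: vdiffD; first exact: vdiff_cst.
  by apply: vdiff_ext (vdiffM (vdiff_cst (-1) eta) (hgv eta he)) => y; rewrite mulN1r.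
have q0 eta : U eta -> q eta != 0.
  move=> [_ h1]; rewrite /q subr_eq0; apply/eqP => e; by move: h1; rewrite -e nr1 ltxx.
have oU : vopen U.
  move=> eta [he h1]; have [d d0 hd] := @ok_ball _ _ _ _ D eta he.
  have p0 : 0 < 1 - nr (g eta) by rewrite subr_gt0.
  have [d' d0' hd'] := vdiff_ctn (hgv eta he) p0; exists (Num.min d d'); first by rewrite lt_min d0.
  move=> y; rewrite lt_min => /andP[/hd h2 /hd' h3]; split=> //.
  rewrite -(subrK (g eta) (g y)); apply: le_lt_trans (nrD _ _) _; by rewrite -ltrBrDr.
pose eta0 := dP D p.
have e0 : eta0 0 j = 0 by apply/(ok_Y Hf hD Dp).
have ne0 : nr eta0 < dr D := cs_Phi (ok_cs hD) Dp.
have U0 : U eta0 by split=> //; rewrite /g e0 expr0n (gtn_eqF m0) mulr0 nr0.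
have [E [hE [jE iE] OE [Ep0 _] PE]] := redatum hD oU (fun eta h => h.1) hq q0 U0 e0.
have Ep : dO E p by rewrite -(ok_gK hD Dp).
have [a1 ha1] := slice_exp_ex Hh HM M2 hE.
exists E, a1.
(* The new coefficients at [z'] in terms of the old ones at the slice point [z] of the same point of
   [Y]. The slice coordinates of the two data differ by a translation, so lines normal in [D] are
   normal in [E]. *)
have key z' : nr z' < dr E -> z' 0 (dj E) = 0 -> exists z, [/\ nr z < dr D, z 0 j = 0 &
    forall k l, (k + l <= m)%N -> a1 k l z' = if (k == m) || (l == m) then 0 else a k l z].
  move=> hz' z0'; set x := gD E z'; have [Ex Px] := ok_gD hE hz'.
  have Yx : Y x := ok_slice Hf hE hz' z0'.
  have [Dx Ux] := OE x Ex; pose z := dP D x; exists z.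
  have hz : nr z < dr D := cs_Phi (ok_cs hD) Dx.
  have z0 : z 0 j = 0 by apply/(ok_Y Hf hD Dx).
  split=> // k l kl.
  have gx : gD D z = x := ok_gK hD Dx.
  pose e : V := delta_mx 0 j.
  have ne : nr e = 1 by exact: nr_delta.
  have [d1 d10 hd1] : exists2 d : R, 0 < d & forall y : V, nr (y - z) < d -> dO E (gD D y).
    by apply: (cs_cont (ok_cs hD) hz); rewrite -/(gD D z) gx; exact: (cs_nbhs (ok_cs hE)).
  have [d2 d20 hd2] := @ok_ball _ _ _ _ D z hz.
  have sh (w : C) : nr (z + w *: e - z) = nr w by rewrite addrAC subrr add0r nrZ ne mulr1.
  pose qw (w : C) := 1 - al z * w ^+ m.
  have lz w : (z + w *: e) 0 j = w by rewrite line_i z0 add0r.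
  have pz w : pr j (z + w *: e) = z by rewrite pr_delta pr_id.
  have qE w : q (z + w *: e) = qw w by rewrite /q /g /al pz lz /qw /al pr_id.
  have z0j : z' 0 j = 0 by rewrite -z0' jE.
  have PEw w : nr w < d1 -> nr w < d2 -> dP E (gD D (z + w *: e)) = z' + (w * qw w) *: delta_mx 0 (dj E).
    move=> w1 w2; have hb : nr (z + w *: e) < dr D by apply: hd2; rewrite sh.
    have OEw : dO E (gD D (z + w *: e)) by apply: hd1; rewrite sh.
    have [h1 _] := PE _ OEw; have [h2 _] := PE _ Ex.
    rewrite h1 (ok_gD hD hb).2; apply/rowP => i; rewrite !mxE jE -/j.
    have := congr1 (fun v : V => v 0 i) h2; rewrite Px !mxE -/j -/z.
    case: eqP => [->|ni] h3; last first.
      by rewrite h3 andbF !mulr0 !addr0.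
    by rewrite z0j add0r /Wq qE lz /= mulr1.
  pose F (w : C) : C := rc (psi h E (z' + (w * qw w) *: delta_mx 0 (dj E))).
  have FE w : nr w < d1 -> nr w < d2 -> F w = qw w * (qw w)^* * rc (psi h D (z + w *: e)).
    move=> w1 w2; have hb : nr (z + w *: e) < dr D by apply: hd2; rewrite sh.
    have OEw : dO E (gD D (z + w *: e)) by apply: hd1; rewrite sh.
    have [Ow Pw] := ok_gD hD hb; have [_ h2] := PE _ OEw.
    rewrite /F -PEw // -nr_sqr -rcM; congr rc.
    by rewrite /psi (ok_gK hE OEw) iE h2 Pw qE nrM exprMn mulrAC mulrC.
  have j1 : jet M F ((1 - (al z)%:P%:P * Xh ^+ m) * (1 - ((al z)^*)%:P%:P * 'X ^+ m) * bipoly M (fun k l => a k l z)).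
    have jq : jet M qw (1 - (al z)%:P%:P * Xh ^+ m).
      have -> : 1 - (al z)%:P%:P * Xh ^+ m = 1%:P%:P + (- al z)%:P%:P * Xh ^+ m :> {poly {poly C}}.
        by rewrite !rmorphN mulNr !rmorph1.
      apply: jet_near (jetD (jet_cst M 1) (jetM (jet_cst M (- al z)) (jetX m (jet_id R M)))).
      by exists 1 => // w _; rewrite mulNr.
    have jJ : cJ (1 - (al z)%:P%:P * Xh ^+ m) = 1 - ((al z)^*)%:P%:P * 'X ^+ m.
      have -> : 1 - (al z)%:P%:P * Xh ^+ m = 1%:P%:P + (- al z)%:P%:P * Xh ^+ m :> {poly {poly C}}.
        by rewrite !rmorphN mulNr !rmorph1.
      have cJD (P Q : {poly {poly C}}) : cJ (P + Q) = cJ P + cJ Q by rewrite /cJ !rmorphD.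
      by rewrite cJD cJM cJX cJ_X !cJC cj1 cjN !rmorphN mulNr !rmorph1.
    rewrite -jJ; apply: jet_near (jetM (jetM jq (jetJ jq)) (slice_exp_jet ha hz)).
    by exists (Num.min d1 d2); [rewrite lt_min d10|move=> w; rewrite lt_min => /andP[w1 w2]; rewrite FE].
  (* Replacing w q by w in the new expansion costs O(|w|^(m+1)) by [esum_lip]; this limits the
     comparison to total degree m. *)
  have j2 : jet m.+1 F (bipoly M (fun k l => a1 k l z')).
    have [_ _ _ hE1] := ha1; have [r r0 [B hB]] := hE1 _ hz'.
    have [BL BL0 hL] := esum_lip M (fun k l => a1 k l z').
    pose Q : R := 1 + nr (al z).
    have Q0 : 0 < Q by rewrite ltr_pwDl ?nr_ge0.
    have mM : (m.+1 <= M)%N by rewrite /M; move: m0; clear; lia.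
    exists (Num.min 1 (Num.min (r / Q) Q^-1)); first by rewrite !lt_min ltr01 divr_gt0 // invr_gt0.
    exists (`|B| * Q ^+ M + BL * nr (al z)) => w; rewrite !lt_min => /andP[w1 /andP[w2 w3]].
    rewrite ev_bipoly; have w1' := ltW w1.
    have nqw : nr (qw w) <= Q.
      by apply: le_trans (nrB _ _) _; rewrite nr1 lerD2l nrM ler_piMr ?nr_ge0 // nrX exprn_ile1 ?nr_ge0.
    have nww : nr (w * qw w) <= Q * nr w by rewrite nrM mulrC ler_wpM2r ?nr_ge0.
    have wr : nr (w * qw w) < r by apply: le_lt_trans nww _; rewrite mulrC -ltr_pdivlMr.
    have zz : nr (z' - z') < r by rewrite subrr nr0.
    have [_ b1] := hB z' _ zz wr.
    have we : w * qw w = w + - (al z * w ^+ m.+1) by rewrite /qw exprS mulrBr mulr1 mulrCA.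
    have nu : nr (- (al z * w ^+ m.+1)) = nr (al z) * nr w ^+ m.+1 by rewrite nrN nrM nrX.
    have nu1 : nr (- (al z * w ^+ m.+1)) <= 1.
      rewrite nu exprS mulrA; apply: le_trans (_ : Q * nr w * 1 <= _).
        rewrite ler_pM ?mulr_ge0 ?nr_ge0 ?exprn_ge0 ?nr_ge0 ?exprn_ile1 ?nr_ge0 //.
        by rewrite ler_wpM2r ?nr_ge0 // lerDr.
      by rewrite mulr1 mulrC -ler_pdivlMr // mul1r ltW.
    have b2 := hL w _ w1' nu1; rewrite -we nu mulrA in b2.
    rewrite -(subrK (esum M (fun k l => a1 k l z') (w * qw w)) (F w)) -addrA.
    apply: le_trans (nrD _ _) _; rewrite mulrDl lerD //.
    apply: le_trans b1 _; apply: le_trans (_ : `|B| * (Q * nr w) ^+ M <= _).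
      apply: le_trans (_ : `|B| * nr (w * qw w) ^+ M <= _); first by rewrite ler_wpM2r ?exprn_ge0 ?nr_ge0 // ler_norm.
      by rewrite ler_wpM2l // lerXn2r ?nnegrE ?nr_ge0 ?mulr_ge0 ?nr_ge0 // ltW.
    by rewrite exprMn mulrA ler_wpM2l ?mulr_ge0 ?exprn_ge0 ?(ltW Q0) // ler_wiXn2l ?nr_ge0.
  have kl' : (k + l < m.+1)%N by [].
  have mM : (m.+1 <= M)%N by rewrite /M; move: m0; clear; lia.
  have := jet_uniq j2 (jet_le mM j1) kl'.
  rewrite (killed_coef kl) //.
  - by rewrite bpE (leq_ltn_trans (leq_addr l k) (leq_trans kl' mM)) (leq_ltn_trans (leq_addl k l) (leq_trans kl' mM)).
  - by rewrite /al pr_id.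
  - by rewrite /al pr_id //; exact: (slice_exp_real m 0 ha hz).
  - exact: q2.
split=> //; split.
- move=> k l; rewrite ltnS => kl; case: (boolP ((k == m) || (l == m))) => km.
    exists 0 => z' hz' z0'; have [z [_ _ ->]] := key z' hz' z0' => //; by rewrite km.
  have [k1 l1] : (k < m)%N /\ (l < m)%N by move: kl km; rewrite negb_or => kl /andP[/eqP ? /eqP ?]; lia.
  have [h1 _] := hc; have [A hA] := h1 k l k1 l1 ltac:(by rewrite /M; lia).
  exists A => z' hz' z0'; have [z [hz z0 ->]] := key z' hz' z0' => //; by rewrite (negbTE km) hA.
- move=> z' hz' z0'; have [z [hz z0 ->]] := key z' hz' z0' => //.
  by rewrite eq_sym gtn_eqF //= q2.
- move=> s /andP[s0 sm] z' hz' z0'; have [z [hz z0 ->]] := key z' hz' z0'; last by rewrite addn0.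
  case: eqP => //= sn; rewrite eq_sym gtn_eqF //= q3 // s0 /=; lia.
Qed.
End NewDatum.

(** The product rule at a common zero of [G1] and [G2], where only their differentials survive. *)
Lemma prod_grad (R : realType) n (F1 G1 F2 G2 Q : 'rV[Cplx R]_n.+1 -> Cplx R) y (B1 B2 : 'rV[Cplx R]_n.+1) :
  vdiff F1 y -> vdiff F2 y -> vdiff Q y -> G1 y = 0 -> G2 y = 0 -> wd G1 y B1 0 -> wd G2 y B2 0 ->
  (exists2 d : R, 0 < d & forall x, nr (x - y) < d -> Q x * (F1 x * G1 x) = F2 x * G2 x) ->
  Q y *: (F1 y *: B1) = F2 y *: B2.
Proof.
move=> [A1 h1] [A2 h2] [A3 h3] g1 g2 w1 w2 hn.
have [] := wd_uniq (wd_near hn (wdM h3 (wdM h1 w1))) (wdM h2 w2).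
by rewrite g1 g2 mulr0 !scale0r !add0r.
Qed.

Lemma def_holo (R : realType) n (X : complexManifold R n) (Y V : set X) (w : X -> Cplx R) x : defining_function Y V w -> V x -> holo_at w x.
Proof. by case=> hw _ _; exact: hw. Qed.

Lemma holo_grad (R : realType) n (X : complexManifold R n) (w : X -> Cplx R) a x : holo_at w x -> chart_dom a x ->
  exists B, wd (w \o chart_inv a) (chart a x) B 0 /\ forall v, chart_diff a w x v = wform B 0 v.
Proof.
move=> hw ax; eexists; split; first exact: diff_wd (hw a ax).
move=> v; rewrite wl0E /chart_diff {1}[v]row_sum_delta linear_sum; apply: eq_bigr => j _.
by rewrite linearZ mxE /= mulrC.
Qed.

(** * Unitary flatness gives the first level *)

Section Base.
Variables (R : realType) (n : nat) (X : complexManifold R n) (Y : set X) (L : line_bundle [set: X]) (N : line_bundle Y) (N' : line_bundle Y).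
Variables (f : lb_index L -> X -> Cplx R) (h : lb_index L -> X -> R) (rr : option nat).
Local Notation C := (Cplx R).
Local Notation V := 'rV[C]_n.+1.
Hypothesis Hf : forall i, defining_function Y (lb_dom i) (f i).
Hypothesis Hft : forall i j p, lb_dom i p -> lb_dom j p -> f i p = lb_trans i j p * f j p.
Hypothesis Hh : hermitian_metric rr h.
Hypothesis Hs : forall i a p, lb_dom i p -> chart_dom a p -> chern_semipositive_at (h i \o chart_inv a) (chart a p).
Hypothesis H2 : le_order 2 rr.
Hypothesis cY : compact Y.
Variable g : lb_index N -> X -> C.
Hypothesis Hg : forall i, defining_function Y (lb_dom i) (g i).
Hypothesis Hgt : forall i j a p v, Y p -> lb_dom i p -> lb_dom j p -> chart_dom a p ->
      chart_diff a (g i) p v = lb_trans i j p * chart_diff a (g j) p v.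
Variable c : lb_index N' -> lb_index N -> X -> C.
Hypothesis Hc1 : forall i' i, holo_on Y (lb_dom i' `&` lb_dom i) (c i' i).
Hypothesis Hc2 : forall i' i p, Y p -> lb_dom i' p -> lb_dom i p -> c i' i p != 0.
Hypothesis Hc3 : forall i' j' i j p, Y p -> lb_dom i' p -> lb_dom j' p -> lb_dom i p -> lb_dom j p ->
          c i' i p * lb_trans i j p = lb_trans i' j' p * c j' j p.
Hypothesis Hu : forall (i j : lb_index N') p, Y p -> lb_dom i p -> lb_dom j p -> `|lb_trans i j p| = 1.
Implicit Types (D E : datum L) (z nu eta : V) (x p : X).

(* The coordinate w of the datum induces the unitary flat trivialization of the normal bundle. *)
Definition flat_coord D := exists i i' F, forall x, dO D x -> [/\ lb_dom i x, lb_dom i' x, xhol F x,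
  Y x -> F x = c i' i x & dP D x 0 (dj D) = F x * g i x].

(** Differentiating ratio * F g_i = F' g_j along [Y] and inserting the transition of the normal
    bundle and its isomorphism with the flat bundle, everything cancels except ratio times the
    unimodular transition function, which is 1. *)
Lemma flat_ratio D E x : valid f D -> valid f E -> flat_coord D -> flat_coord E -> dO D x -> dO E x -> Y x -> nr (ratio D E x) = 1.
Proof.
move=> hD hE [i [i' [F hF]]] [j [j' [F' hF']]] xD xE Yx.
have [ix ix' Fx Fc Fw] := hF x xD; have [jx jx' Fx' Fc' Fw'] := hF' x xE.
have [a ax] := chart_dom_cover x; pose y0 := chart a x.
have [hr r0] := ratio_hol hD hE xD xE.
have [B1 [rB1 vB1]] := holo_grad (def_holo (Hg i) ix) ax; have [B2 [rB2 vB2]] := holo_grad (def_holo (Hg j) jx) ax.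
have g0 k : lb_dom k x -> (g k \o chart_inv a) y0 = 0.
  by move=> kx; rewrite /= chartK //; have [_ hh _] := Hg k; apply/(hh x kx).
have near0 : exists2 d : R, 0 < d & forall y : V, nr (y - y0) < d ->
    (ratio D E \o chart_inv a) y * ((F \o chart_inv a) y * (g i \o chart_inv a) y) = (F' \o chart_inv a) y * (g j \o chart_inv a) y.
  have nD := cs_nbhs (ok_cs hD) xD; have nE := cs_nbhs (ok_cs hE) xE.
  have [d d0 hd] := chart_inv_near ax (filterI nD nE); exists d => // y /hd[yD yE] /=.
  by have [_ _ _ _ <-] := hF _ yD; have [_ _ _ _ <-] := hF' _ yE; rewrite (ratio_w Hft hD hE yD yE).
have e1 := prod_grad (xhol_chart ax Fx) (xhol_chart ax Fx') (xhol_chart ax hr) (g0 i ix) (g0 j jx) rB1 rB2 near0.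
have [_ _ hv] := Hg j; have [v hv0] := hv a x jx Yx ax.
have K b : (b \o chart_inv a) y0 = b x :> C by rewrite /= chartK.
have wlZl (b : C) (A0 : V) : wform (b *: A0) 0 v = b * wform A0 0 v.
  by rewrite !wl0E mulr_sumr; apply: eq_bigr => l _; rewrite !mxE mulrA.
have e2 : ratio D E x * (c i' i x * (lb_trans i j x * chart_diff a (g j) x v)) = c j' j x * chart_diff a (g j) x v.
  rewrite -(Hgt v Yx ix jx ax) vB1 vB2 -!wlZl -Fc // -Fc' //; move: e1; rewrite !K => ->; by [].
have e3 := Hc3 Yx ix' jx' ix jx.
have /eqP : ratio D E x * lb_trans i' j' x * (c j' j x * chart_diff a (g j) x v) = 1 * (c j' j x * chart_diff a (g j) x v).
  by rewrite mul1r -[RHS]e2 -mulrA [lb_trans i' j' x * _]mulrA -e3; move: (ratio _ _ _) (c _ _ _) (lb_trans _ _ _) (chart_diff _ _ _ _) => *; ring.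
rewrite -subr_eq0 -mulrBl mulf_eq0 subr_eq0 mulf_eq0 (negbTE hv0) (negbTE (Hc2 Yx jx' jx)) !orbF => /eqP/(congr1 (fun z : C => nr z)).
rewrite nrM nr1; have -> : nr (lb_trans i' j' x) = 1.
  by apply: (@rc_inj R); rewrite -nrE Hu.
by rewrite mulr1.
Qed.

(** The isomorphism [c] lives on [Y] only; a local holomorphic extension [F] of it gives the
    function F g_i, which vanishes on [Y]. Division by the coordinate of an initial datum exhibits
    it as a unit times that coordinate. *)
Lemma flat_datum p : Y p -> exists D, [/\ valid f D, flat_coord D & dO D p].
Proof.
move=> Yp; have [i ip] := @lb_dom_cover _ _ _ _ N p Yp; have [i' ip'] := @lb_dom_cover _ _ _ _ N' p Yp.
have [k kp] := @lb_dom_cover _ _ _ _ L p I.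
have [D [hD Dp P0 _ _]] := init_datum Hf Yp kp.
have [F hF] := Hc1 Yp (conj ip' ip).
have Fp : F p = c i' i p by have [_ h1] := nbhs_singleton hF; exact: h1.
pose j := dj D; pose r := dr D; have r0 : 0 < r := cs_r (ok_cs hD).
have b0 : nr (0 : V) < r by rewrite nr0.
have gp : gD D 0 = p by rewrite -P0 (ok_gK hD Dp).
have nN : nbhs p (lb_dom i `&` lb_dom i' `&` [set q | holo_at F q /\ (Y q -> F q = c i' i q)]).
  apply: filterI => //; apply: filterI; apply: open_nbhs_nbhs; split=> //; exact: lb_dom_open.
have nN' : nbhs (gD D 0) (lb_dom i `&` lb_dom i' `&` [set q | holo_at F q /\ (Y q -> F q = c i' i q)]) by rewrite gp.
have [d1 d10 hd1] := cs_cont (ok_cs hD) b0 nN'.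
pose r1 := Num.min r d1; have r10 : 0 < r1 by rewrite lt_min r0.
have in1 eta : nr eta < r1 -> [/\ nr eta < r, lb_dom i (gD D eta), lb_dom i' (gD D eta), xhol F (gD D eta) & Y (gD D eta) -> F (gD D eta) = c i' i (gD D eta)].
  rewrite lt_min => /andP[h1 h2]; have := hd1 eta; rewrite subr0 => /(_ h2)[[h3 h4] [h5 h6]].
  by split=> //; exact: holo_xhol.
pose Ft eta := F (gD D eta) * g i (gD D eta).
have hFt : hol (ball0 r1) Ft.
  move=> eta /in1[h1 h2 _ h3 _]; apply: vdiffM; first exact: (cs_comp (ok_cs hD) h1 h3).
  by apply: (cs_comp (ok_cs hD) h1); apply: holo_xhol; have [hh _ _] := Hg i; exact: hh.
have oB : vopen (ball0 r1 : set V) by exact: cs_ball.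
have B00 : ball0 r1 (0 : V) by rewrite /ball0 /= nr0.
have z00 : (0 : V) 0 j = 0 by rewrite mxE.
have slice0 : exists2 d : R, 0 < d & forall z : V, nr (z - 0) < d -> z 0 j = 0 -> exists B : R, exists2 d' : R, 0 < d' &
     forall t : C, nr t < d' -> nr (Ft (z + t *: delta_mx 0 j)) <= B * nr t ^+ 1.
  exists r1 => // z; rewrite subr0 => hz z0; have [A hA] := hFt _ hz; have [d d0 hd] := wd_lip hA.
  exists (1 + wform_norm A 0), d => // t ht; have [h1 h2 _ _ _] := in1 _ hz.
  have F0 : Ft z = 0.
    have [_ hh _] := Hg i; have -> : Ft z = F (gD D z) * 0; last by rewrite mulr0.
    by congr (_ * _); apply/(hh _ h2); exact: (ok_slice Hf hD h1).
  have := hd (t *: delta_mx 0 j); rewrite nrZ nr_delta mulr1 => /(_ ht).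
  by rewrite F0 subr0 expr1.
have [r2 r20 [F1 hF1]] := hol_div oB hFt B00 z00 slice0.
have in2 eta : nr eta < r2 -> vdiff F1 eta /\ Ft eta = F1 eta * eta 0 j.
  by move=> he; have := hF1 eta; rewrite subr0 expr1; apply.
(* A zero of [F1] at the centre would make the differential of F g_i vanish at [p], while [F] and
   the differential of g_i are nonzero there. *)
have F10 : F1 0 != 0.
  apply/eqP => e0; have [a ax] := chart_dom_cover p; pose y0 := chart a p.
  have [B [rB vB]] := holo_grad (def_holo (Hg i) ip) ax.
  have n2 : nr (0 : V) < r2 by rewrite nr0.
  have xF1 : xhol (fun x => F1 (dP D x)) p by apply: (cs_xhol (ok_cs hD) Dp); rewrite P0; exact: (in2 0 n2).1.
  have xP : xhol (fun x => dP D x 0 j) p by exact: (cs_hol (ok_cs hD)).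
  have xF : xhol F p by have [hh _] := nbhs_singleton hF; exact: holo_xhol.
  have [B2 rB2] := xhol_chart ax xP.
  have gp0 : (g i \o chart_inv a) y0 = 0 by rewrite /= chartK //; have [_ hh _] := Hg i; apply/(hh p ip).
  have Pp0 : ((fun x => dP D x 0 j) \o chart_inv a) y0 = 0 by rewrite /= chartK // P0 z00.
  have near0 : exists2 d : R, 0 < d & forall y : V, nr (y - y0) < d ->
      (fun=> 1) y * ((F \o chart_inv a) y * (g i \o chart_inv a) y) = ((fun x => F1 (dP D x)) \o chart_inv a) y * ((fun x => dP D x 0 j) \o chart_inv a) y.
    have nD := cs_nbhs (ok_cs hD) Dp.
    have nP := xhol_cont (fun l => cs_hol (ok_cs hD) l Dp) r20.
    have [d d0 hd] := chart_inv_near ax (filterI nD nP); exists d => // y /hd[yD /=]; rewrite P0 subr0 => yP.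
    by have [_ e1] := in2 _ yP; rewrite mul1r -e1 /Ft (ok_gK hD yD).
  have e1 := prod_grad (xhol_chart ax xF) (xhol_chart ax xF1) (vdiff_cst 1 y0) gp0 Pp0 rB rB2 near0.
  have {}e1 : F p *: B = 0.
    by move: e1; rewrite scale1r /= chartK // P0 e0 scale0r.
  have /eqP := e1; rewrite scaler_eq0 Fp (negbTE (Hc2 Yp ip' ip)) /= => /eqP B0.
  have [_ _ hv] := Hg i; have [v] := hv a p ip Yp ax; rewrite vB B0 wl00 eqxx //.
pose r3 := Num.min r1 r2.
pose U : set V := [set eta | nr eta < r3 /\ F1 eta != 0].
have U12 eta : U eta -> nr eta < r1 /\ nr eta < r2 by move=> [h1 _]; apply/andP; rewrite -lt_min.
have oU : vopen U.
  move=> eta [he h1]; have [d d0 hd] := cs_ball he.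
  have he2 : nr eta < r2 by move: he; rewrite lt_min => /andP[].
  have p0 : 0 < nr (F1 eta) by rewrite nr_gt0.
  have [d' d0' hd'] := vdiff_ctn (in2 _ he2).1 p0; exists (Num.min d d'); first by rewrite lt_min d0.
  move=> y; rewrite lt_min => /andP[/hd h2 /hd' h3]; split=> //; apply/eqP => e; move: h3.
  by rewrite e sub0r nrN ltxx.
have U0 : U 0 by split=> //; rewrite nr0 lt_min r10.
have Ur eta : U eta -> nr eta < dr D by move=> /U12[/in1[]].
have hq : hol U F1 by move=> eta /U12[_ /in2[]].
have [E [hE [jE iE] OE [Ep0 _] PE]] := redatum hD oU Ur hq (fun eta h => h.2) U0 z00.
exists E; split=> //; last by rewrite -gp.
exists i, i', F => x Ex; have [Dx Ux] := OE x Ex; have [u1 u2] := U12 _ Ux.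
have [h1 h2 h3 h4 h5] := in1 _ u1; rewrite (ok_gK hD Dx) in h2 h3 h4 h5; split=> //.
have [-> _] := PE x Ex; rewrite jE mxE eqxx /Wq mulrC.
by have [_ <-] := in2 _ u2; rewrite /Ft (ok_gK hD Dx).
Qed.

Lemma flat_psi D z z' : valid f D -> flat_coord D -> nr z < dr D -> nr z' < dr D -> z 0 (dj D) = 0 -> z' 0 (dj D) = 0 ->
  psi h D z = psi h D z'.
Proof.
move=> hD fD; pose G D (_ : unit) := valid f D /\ flat_coord D.
apply: (globalize Hf cY (G := G) (F := fun D _ => psi h D) _ _ _ _ _ (a := tt)) => //.
- by move=> ? ? [].
- by move=> p /flat_datum[E [h1 h2 h3]]; exists E, tt.
- move=> D1 _ E _ x [h1 k1] [h2 k2] xD xE Yx; rewrite (ratio_psi Hh h1 h2 xD xE) (flat_ratio h1 h2 k1 k2 xD xE Yx).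
  by rewrite expr1n mul1r.
- by move=> D1 _ y [h1 _] hy; exact: (smooth_ctn (psi_smooth Hh H2 h1) hy).
- by move=> D1 _ y nu [h1 _] _ _ hd; exact: (psi_sub Hh Hs H2 isT h1 hd).
Qed.

Lemma base_datum p : Y p -> exists D, [/\ valid f D, dO D p & forall z, nr z < dr D -> z 0 (dj D) = 0 -> psi h D z = 1].
Proof.
move=> Yp; have [D [hD fD Dp]] := flat_datum Yp.
pose eta0 := dP D p.
have e0 : eta0 0 (dj D) = 0 by apply/(ok_Y Hf hD Dp).
have ne0 : nr eta0 < dr D := cs_Phi (ok_cs hD) Dp.
pose k := psi h D eta0; have k0 : 0 < k := psi_gt0 Hh hD ne0.
(* Multiplying w by [s] multiplies psi by |s|^2, the inverse of its constant value on the slice. *)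
pose s : C := rc (Num.sqrt k)^-1.
have ns : nr s ^+ 2 = k^-1 by rewrite nr_rc ger0_norm ?invr_ge0 ?sqrtr_ge0 // exprVn sqr_sqrtr // ltW.
have s0 : s != 0.
  by apply/eqP => e; move: ns; rewrite e nr0 expr0n /= => /esym/eqP; rewrite invr_eq0 gt_eqF.
have [E [hE [jE iE] OE [Ep0 _] PE]] := redatum hD (@ok_ball _ _ _ _ D) (fun eta h => h) (fun eta _ => vdiff_cst s eta) (fun eta _ => s0) ne0 e0.
exists E; split=> //; first by rewrite -(ok_gK hD Dp).
move=> z hz z0; have [Ex Px] := ok_gD hE hz; have [Dx _] := OE _ Ex; have [_ ue] := PE _ Ex.
have Yx := ok_slice Hf hE hz z0.
have hz' : nr (dP D (gD E z)) < dr D := cs_Phi (ok_cs hD) Dx.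
have z0' : dP D (gD E z) 0 (dj D) = 0 by apply/(ok_Y Hf hD Dx).
have := flat_psi hD fD hz' ne0 z0' e0; rewrite -/k /psi (ok_gK hD Dx) ue iE nrM exprMn ns => e.
by rewrite mulrAC e divff // gt_eqF.
Qed.
End Base.

(** * Induction on the level *)

Section Climb.
Variables (R : realType) (n : nat) (X : complexManifold R n) (Y : set X) (L : line_bundle [set: X]).
Variables (f : lb_index L -> X -> Cplx R) (h : lb_index L -> X -> R) (rr : option nat).
Local Notation C := (Cplx R).
Local Notation V := 'rV[C]_n.+1.
Hypothesis Hf : forall i, defining_function Y (lb_dom i) (f i).
Hypothesis Hft : forall i j p, lb_dom i p -> lb_dom j p -> f i p = lb_trans i j p * f j p.
Hypothesis Hh : hermitian_metric rr h.
Hypothesis Hs : forall i a p, lb_dom i p -> chart_dom a p -> chern_semipositive_at (h i \o chart_inv a) (chart a p).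
Hypothesis cY : compact Y.
Variable m : nat.
Hypothesis HM : forall M, (M <= maxn 3 (2 * m))%N -> le_order M rr.
Hypothesis Hbase : forall p, Y p -> exists D, [/\ valid f D, dO D p & forall z : V, nr z < dr D -> z 0 (dj D) = 0 -> psi h D z = 1].
Implicit Types (D E : datum L) (z nu eta : V) (x p : X).

(** The coefficients of total degree below [k] are determined by the jet of psi, whatever the order
    of truncation. *)
Lemma level_change M M' k D a a' : slice_exp h M D a -> slice_exp h M' D a' -> (k <= M)%N -> (k <= M')%N -> level k D a -> level k D a'.
Proof.
move=> ha ha' kM kM' [q1 q2 q3].
have e i l z : (i + l < k)%N -> nr z < dr D -> a' i l z = a i l z.
  move=> il hz; have := jet_uniq (jet_le kM' (slice_exp_jet ha' hz)) (jet_le kM (slice_exp_jet ha hz)) il.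
  rewrite !bpE.
  have [b1 b2] : (i < k)%N /\ (l < k)%N by move: il; clear; lia.
  by rewrite !(leq_trans b1) // !(leq_trans b2).
split.
- move=> i l il; have [A hA] := q1 i l il; exists A => z hz z0; rewrite e //; exact: hA.
- move=> z hz z0; case: k kM kM' q1 q2 q3 e => [|k] kM kM' q1 q2 q3 e; last by rewrite e //; exact: q2.
  have [_ _ h0 _] := ha; have [_ _ h0' _] := ha'; rewrite h0' -h0; exact: q2.
- move=> s /andP[s0 sk] z hz z0; rewrite e ?addn0 //; apply: q3 => //; by rewrite s0.
Qed.

(** Each stage must hold around all points of [Y] before the next, since the maximum principle on
    [Y] is used in between. *)
Lemma climb k : (0 < k)%N -> (k <= m)%N -> forall p, Y p -> exists D a, good f h (2 * k) k D a /\ dO D p.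
Proof.
case: k => // k _; elim: k => [|k IH] km p Yp.
  have [D [hD Dp h1]] := Hbase Yp.
  have H2 : le_order 2 rr by apply: HM; lia.
  have [a ha] := slice_exp_ex Hh H2 isT hD; exists D, a; split=> //; split=> //.
  have [_ _ a0 _] := ha; have e z : nr z < dr D -> z 0 (dj D) = 0 -> a 0 0 z = 1 by move=> hz z0; rewrite a0 h1.
  split=> //; last by move=> s; rewrite ltnS => /andP[s0 /(leq_trans s0)].
  by move=> i l il; have [-> ->] : i = 0%N /\ l = 0%N; [lia|exists 1].
have km' : (k.+1 <= m)%N by exact: ltnW.
have {}IH := IH km'.
have HM1 : le_order (2 * k.+1) rr by apply: HM; lia.
have HM2 : le_order (2 * k.+2) rr by apply: HM; lia.
have M2 : (2 <= 2 * k.+1)%N by lia.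
have M2' : (2 <= 2 * k.+2)%N by lia.
have [D [a [hg Dp]]] := IH p Yp.
have hc := chain_all Hf Hft Hh Hs HM1 M2 (ltn0Sn k) (leqnn _) cY IH hg.
have [E [a1 [hE ha1 q1 Ep]]] := new_datum Hf Hh Hs HM1 (ltn0Sn k) hg hc Dp Yp.
(* The datum reached at one stage carries an expansion of order twice that stage; psi is expanded
   afresh to the order of the next one. *)
have [a2 ha2] := slice_exp_ex Hh HM2 M2' hE.
exists E, a2; split=> //; split=> //; apply: (level_change ha1 ha2) q1; lia.
Qed.

Lemma top_datum p : (0 < m)%N -> Y p -> exists D a, [/\ valid f D, slice_exp h (2 * m) D a, level m.+1 D a & dO D p].
Proof.
move=> m0 Yp; have IH := climb m0 (leqnn m).
have HM1 : le_order (2 * m) rr by apply: HM; lia.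
have M2 : (2 <= 2 * m)%N by lia.
have [D [a [hg Dp]]] := IH p Yp.
have hc := chain_all Hf Hft Hh Hs HM1 M2 m0 (leqnn _) cY IH hg.
have [E [a1 [hE ha1 q1 Ep]]] := new_datum Hf Hh Hs HM1 m0 hg hc Dp Yp.
by exists E, a1.
Qed.
End Climb.

(** * The system of defining functions *)

Section Division.
Variables (R : realType) (n : nat).
Local Notation C := (Cplx R).
Local Notation V := 'rV[C]_n.+1.

(** Local quotients come from [hol_div] on the slice and from plain division off it. Two of them
    agree wherever the coordinate is nonzero, hence at the point by continuity, so the value chosen
    pointwise is holomorphic. *)
Lemma glue_div (W : set V) (F : V -> C) i k : vopen W -> hol W F ->
  (forall z, W z -> z 0 i = 0 -> exists B : R, exists2 d' : R, 0 < d' & forall t : C, nr t < d' -> nr (F (z + t *: delta_mx 0 i)) <= B * nr t ^+ k) ->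
  exists2 Q : V -> C, hol W Q & forall z, W z -> F z = Q z * z 0 i ^+ k.
Proof.
move=> oW hF hb.
pose locq z v := exists F1 : V -> C, exists r : R, [/\ 0 < r, forall eta : V, nr (eta - z) < r -> vdiff F1 eta /\ F eta = F1 eta * eta 0 i ^+ k & v = F1 z].
pose Q z := xget 0 [set v | locq z v].
have uniq z v v' : locq z v -> locq z v' -> v = v'.
  move=> [F1 [r [r0 h1 ->]]] [F2 [r' [r0' h2 ->]]].
  have c1 := vdiff_ctn (h1 z ltac:(by rewrite subrr nr0)).1; have c2 := vdiff_ctn (h2 z ltac:(by rewrite subrr nr0)).1.
  apply/eqP; rewrite -subr_eq0 -nr_eq0 eq_le nr_ge0 andbT; apply/ler_addgt0Pl => e e0; rewrite addr0.
  have e2 : 0 < e / 2 by rewrite divr_gt0.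
  have [d1 d10 hd1] := c1 _ e2; have [d2 d20 hd2] := c2 _ e2.
  (* A nearby point off the slice: of the shifts by s / 2 and s / 3 at most one can annihilate the
     coordinate. *)
  have [t [t0 t12 t3 t4 t5]] : exists t : R, [/\ 0 < t, t < Num.min d1 d2, t < r, t < r' & z 0 i + rc t != 0].
    pose s := Num.min (Num.min d1 d2) (Num.min r r'); have s0 : 0 < s by rewrite !lt_min d10 d20 r0.
    have sm : s <= Num.min d1 d2 by rewrite ge_min lexx.
    have [sr sr'] : s <= r /\ s <= r' by apply/andP; rewrite -le_min ge_min lexx orbT.
    have [e1|e1] := eqVneq (z 0 i + rc (s / 2)) 0.
      exists (s / 3); have h3 : s / 3 < s by rewrite ltr_pdivrMr // ltr_pMr // ltr1n.
      split; rewrite ?divr_gt0 //; try exact: lt_le_trans h3 _.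
      apply/eqP => e3; have /(congr1 (@cre R)) : rc (s / 3) = rc (s / 2) by apply: (addrI (z 0 i)); rewrite e1 e3.
      rewrite !cre_rc; lra.
    exists (s / 2); have h3 : s / 2 < s by rewrite ltr_pdivrMr // ltr_pMr // ltr1n.
    by split; rewrite ?divr_gt0 //; try exact: lt_le_trans h3 _.
  have [t1 t2] : t < d1 /\ t < d2 by apply/andP; rewrite -lt_min.
  pose y := z + rc t *: delta_mx 0 i.
  have ny : nr (y - z) = t by rewrite /y addrAC subrr add0r nrZ nr_delta mulr1 nr_rc ger0_norm // ltW.
  have yi : y 0 i ^+ k != 0 by rewrite expf_neq0 // /y line_i.
  have e12 : F1 y = F2 y.
    by apply: (mulIf yi); rewrite -(h1 y ltac:(by rewrite ny)).2 -(h2 y ltac:(by rewrite ny)).2.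
  have a1 := hd1 y; rewrite ny in a1; have a2 := hd2 y; rewrite ny in a2.
  have {}a1 := a1 t1; have {}a2 := a2 t2.
  have -> : F1 z - F2 z = (F2 y - F2 z) - (F1 y - F1 z) by rewrite e12; ring.
  apply: le_trans (nrB _ _) _; rewrite (splitr e); apply: lerD; exact: ltW.
have ex z : W z -> exists v, locq z v.
  move=> Wz; have [z0|z0] := eqVneq (z 0 i) 0.
    have [d d0 hd] := oW z Wz.
    have [r r0 [F1 hF1]] : exists2 r : R, 0 < r & exists F1 : V -> C, forall eta : V, nr (eta - z) < r ->
      vdiff F1 eta /\ F eta = F1 eta * eta 0 i ^+ k.
      by apply: (hol_div oW hF Wz z0); exists d => // y /hd Wy y0; exact: hb.
    by exists (F1 z), F1, r.
  have [d d0 hd] := oW z Wz; have p0 : 0 < nr (z 0 i) by rewrite nr_gt0.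
  exists (F z / z 0 i ^+ k), (fun eta => F eta * (eta 0 i ^+ k)^-1), (Num.min d (nr (z 0 i))).
  split=> //; first by rewrite lt_min d0.
  move=> eta; rewrite lt_min => /andP[/hd We h2].
  have e0 : eta 0 i != 0.
    apply/eqP => e; have := nr_coord (eta - z) i; rewrite !mxE e sub0r nrN leNgt h2 //.
  have e1 : eta 0 i ^+ k != 0 by rewrite expf_neq0.
  split; last by rewrite mulfVK.
  by apply: vdiffM (hF _ We) _; apply: vdiffV => //; apply: vdiffX; exact: vdiff_coord.
have Qspec z : W z -> locq z (Q z) by move=> /ex[v hv]; rewrite /Q; case: xgetP => [v' -> //|/(_ v)].
exists Q => z Wz; have [F1 [r [r0 h1 e1]]] := Qspec z Wz; last first.
  by have [_ ->] := h1 z ltac:(by rewrite subrr nr0); rewrite e1.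
have [d d0 hd] := oW z Wz.
apply: (vdiff_near (f := F1)); last by have [] := h1 z ltac:(by rewrite subrr nr0).
exists (Num.min d (r / 2)); first by rewrite lt_min d0 divr_gt0.
move=> y; rewrite lt_min => /andP[/hd Wy y2]; apply: (uniq y) (Qspec y Wy).
exists F1, (r / 2); split=> //; first by rewrite divr_gt0.
move=> eta h3; apply: h1; rewrite -(subrK y eta) -addrA; apply: le_lt_trans (nrD _ _) _.
by rewrite (splitr r) ltrD.
Qed.

(** Cauchy's formula at the centre is the mean value property; a function of modulus 1 then realizes
    equality in [mean_sq_gap]. *)
Lemma unimod_const (W : set V) (F : V -> C) z nu : vopen W -> hol W F -> (forall t : C, nr t <= 1 -> W (z + t *: nu)) ->
  (forall t : C, nr t <= 1 -> nr (F (z + t *: nu)) = 1) -> F (z + nu) = F z.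
Proof.
move=> oW hF hW h1.
have n0 : nr (0 : C) <= 1 by rewrite nr0.
have n1 : nr (0 : C) < 1 by rewrite nr0.
have fd (t : C) : nr t <= 1 -> cdiff (fun t => F (z + t *: nu)) t by move=> ht; apply: vdiff_cdiff; apply: hF; exact: hW.
have cu : circ (fun t => F (z + t *: nu)) by move=> t ht; apply: cdiff_cont; apply: fd; rewrite ht.
have mF : mean (fun t => F (z + t *: nu)) = F z.
  have := @cauchy_formula R (fun t => F (z + t *: nu)) 1 fd 0 n1; rewrite scale0r addr0 => ->.
  by apply: mean_eq => t ht; rewrite subr0 rc1 mul1r divff ?mulr1 // circ_neq0.
have [_ h2] := mean_sq_gap cu mF; have := h2 _ 1; rewrite scale1r nr1; apply=> //.
rewrite (mean_eq (v := fun=> 1)) => [|t ht]; last by rewrite h1 ?ht // expr1n.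
have := h1 0 n0; rewrite scale0r addr0 => ->; by rewrite mean_cst expr1n.
Qed.
End Division.

Lemma near_seq (T : topologicalType) (I : eqType) (s : seq I) (y : T) (P : I -> T -> Prop) :
  (forall i, i \in s -> \forall x \near y, P i x) -> \forall x \near y, forall i, i \in s -> P i x.
Proof.
elim: s => [|i s IH] hP; first exact: nearW.
have h1 := hP i (mem_head _ _); have h2 : \forall x \near y, forall k, k \in s -> P k x.
  by apply: IH => k ks; apply: hP; rewrite in_cons ks orbT.
apply: filterS (filterI h1 h2) => x [h3 h4] k; rewrite in_cons => /orP[/eqP -> //|]; exact: h4.
Qed.

(** Compactness in near-covering form, along the filter of finite lists containing a given one; the
    centres stay in [K]. *)
Lemma compact_seq_cover (T : topologicalType) (K : set T) (B : T -> set T) : compact K ->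
  (forall p, K p -> open (B p) /\ B p p) ->
  exists2 s : seq T, forall p, p \in s -> K p & forall y : T, K y -> exists2 p, p \in s & B p y.
Proof.
move=> cK hB.
pose F : set_system (seq T) := [set A | exists2 s0 : seq T, (forall p, p \in s0 -> K p) & forall s : seq T, {subset s0 <= s} -> A s].
have FF : Filter F.
  split; first by exists [::].
    move=> A A' [s0 h0 h1] [s0' h0' h1']; exists (s0 ++ s0').
      by move=> p; rewrite mem_cat => /orP[/h0|/h0'].
    by move=> s hs; split; [apply: h1|apply: h1'] => p ps; apply: hs; rewrite mem_cat ps ?orbT.
  by move=> A A' AA' [s0 h0 h1]; exists s0 => // s /h1 /AA'.
have [x Kx|s0 h0 h1] := (compact_near_coveringP K).1 cK (seq T) F (fun (s : seq T) x => exists2 p, p \in s & B p x) FF.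
  have [oBx Bx] := hB x Kx; exists (B x, [set s : seq T | x \in s]).
    split; first exact: open_nbhs_nbhs.
    exists [:: x]; first by move=> p; rewrite inE => /eqP ->.
    by move=> s; apply; rewrite inE.
  by move=> [y s] [/= By xs]; exists x.
by exists s0 => // y /(h1 s0); apply.
Qed.

(** * The cover and its constants *)

Section Final.
Variables (R : realType) (n : nat) (X : complexManifold R n) (Y : set X) (L : line_bundle [set: X]).
Variables (f : lb_index L -> X -> Cplx R) (h : lb_index L -> X -> R) (rr : option nat).
Local Notation C := (Cplx R).
Local Notation V := 'rV[C]_n.+1.
Hypothesis Hf : forall i, defining_function Y (lb_dom i) (f i).
Hypothesis Hft : forall i j p, lb_dom i p -> lb_dom j p -> f i p = lb_trans i j p * f j p.
Hypothesis Hh : hermitian_metric rr h.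
Hypothesis cY : compact Y.
Variable m : nat.
Hypothesis m0 : (0 < m)%N.
Implicit Types (D E : datum L) (z nu eta : V) (x p y : X) (B K : set X).

Definition top_level D := exists a, [/\ valid f D, slice_exp h (2 * m) D a & level m.+1 D a].
Definition wcoord D x : C := dP D x 0 (dj D).

Lemma top_ratio D E x : top_level D -> top_level E -> dO D x -> dO E x -> Y x -> nr (ratio D E x) = 1 /\
  exists2 d : R, 0 < d & exists B : R, forall w : C, nr w < d ->
      nr (ratio D E (gD D (dP D x + w *: delta_mx 0 (dj D))) - ratio D E x) <= B * nr w ^+ m.+1.
Proof.
move=> [a [hD ha qa]] [a' [hE ha' qa']] xD xE Yx.
have mM : (m.+1 <= 2 * m)%N by lia.
have [t1 t2 _] := rigid Hf Hft Hh (ltn0Sn m) mM hD hE ha ha' qa qa' xD xE Yx; split=> //.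
apply/eqP; rewrite -(@eqrXn2 _ 2) ?nr_ge0 // expr1n; apply/eqP/(@rc_inj R); by rewrite nr_sqr t1.
Qed.

Lemma wcoord_defining D (W : set X) : valid f D -> (forall x, W x -> dO D x) -> defining_function Y W (wcoord D).
Proof.
move=> hD WD; have hx x : W x -> xhol (wcoord D) x by move=> /WD Dx; exact: (cs_hol (ok_cs hD)).
split.
- by move=> x /hx; exact: xhol_holo.
- by move=> x /WD Dx; rewrite (ok_Y Hf hD Dx).
- move=> a p Wp Yp ap; have Dp := WD p Wp; have ip := ok_dom hD Dp.
  have [hf1 hf2 hf3] := Hf (di D); have [v hv] := hf3 a p ip Yp ap; exists v.
  have [B1 [rB1 vB1]] := holo_grad (def_holo (Hf (di D)) ip) ap.
  have [B2 [rB2 vB2]] := holo_grad (xhol_holo (hx p Wp)) ap.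
  have [A hA] := xhol_chart ap (ok_u hD Dp).
  have g0 : (f (di D) \o chart_inv a) (chart a p) = 0 by rewrite /= chartK //; apply/(hf2 p ip).
  have near0 : exists2 d : R, 0 < d & forall x : V, nr (x - chart a p) < d ->
     (wcoord D \o chart_inv a) x = (du D \o chart_inv a) x * (f (di D) \o chart_inv a) x.
    have [d d0 hd] := chart_inv_near ap (cs_nbhs (ok_cs hD) Dp); exists d => // x /hd xD /=.
    exact: (ok_w hD xD).
  have [e1 _] := wd_uniq (wd_near near0 rB2) (wdM hA rB1).
  have wlZl (b : C) (A0 : V) : wform (b *: A0) 0 v = b * wform A0 0 v.
    by rewrite !wl0E mulr_sumr; apply: eq_bigr => l _; rewrite !mxE mulrA.
  rewrite vB2 e1 g0 scale0r add0r wlZl -vB1 mulf_neq0 //= chartK //; exact: (ok_u0 hD Dp).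
Qed.

Lemma coord_ball_open D z0 (rho : R) : valid f D -> open [set x | dO D x /\ nr (dP D x - z0) < rho].
Proof.
move=> hD; rewrite openE => x [Dx hx]; have p0 : 0 < rho - nr (dP D x - z0) by rewrite subr_gt0.
have h1 := xhol_cont (fun l => cs_hol (ok_cs hD) l Dx) p0.
apply: filterS (filterI (cs_nbhs (ok_cs hD) Dx) h1) => q [h2 h3]; split=> //.
rewrite -(subrK (dP D x) (dP D q)) -addrA; apply: le_lt_trans (nrD _ _) _; by rewrite -ltrBrDr.
Qed.

(** [K] is the image of a closed polydisc: compact, hence closed because the manifold is
    Hausdorff. *)
Lemma compact_nbhd D p : valid f D -> dO D p -> exists B K, [/\ open B, B p, B `<=` K, closed K & K `<=` dO D].
Proof.
move=> hD Dp; have hp := cs_Phi (ok_cs hD) Dp; have [d d0 hd] := @ok_ball _ _ _ _ D _ hp.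
have d2 : 0 < d / 2 by rewrite divr_gt0.
pose S : set V := [set v : V | forall i, [set t : C | nr t <= d / 2] (v ord0 i)].
have cS : compact S by apply: (@rV_compact C n.+1 (fun=> [set t : C | nr t <= d / 2])) => i; exact: compact_disc.
have Sd v : S v -> nr (dP D p + v) < dr D.
  move=> Sv; apply: hd; rewrite addrAC subrr add0r; apply: le_lt_trans (_ : d / 2 < d).
    by apply: nr_rV => [|i]; [exact: ltW|exact: Sv].
  by rewrite ltr_pdivrMr // ltr_pMr // ltr1n.
pose G v := gD D (dP D p + v).
have cG : {within S, continuous G}.
  apply: continuous_in_subspaceT => v /set_mem Sv A hA.
  have [e e0 he] := cs_cont (ok_cs hD) (Sd v Sv) hA.
  have h0 : exists2 e : R, 0 < e & forall y : V, nr (y - v) < e -> A (G y).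
    exists e => // y hy; apply: he; by rewrite opprD addrACA subrr add0r.
  refine ((near_nr (v : V) (fun y : V => A (G y))).2 h0).
have cK := continuous_compact cG cS.
exists [set x | dO D x /\ nr (dP D x - dP D p) < d / 2], (G @` S); split.
- exact: coord_ball_open.
- by split=> //; rewrite subrr nr0.
- move=> x [Dx hx]; exists (dP D x - dP D p); last by rewrite /G addrC subrK (ok_gK hD Dx).
  by move=> i /=; apply: le_trans (nr_coord _ _) _; exact: ltW.
- by apply: compact_closed cK; exact: cm_hausdorff.
- by move=> _ [v Sv <-]; exact: (ok_gD hD (Sd v Sv)).1.
Qed.

(** On the slice the ratio is holomorphic of modulus 1, and [x] is joined to [y] by a complex disc
    inside the domain of both data. *)
Lemma ratio_const D E y (rho : R) : top_level D -> top_level E -> dO D y -> Y y ->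
  (forall eta, nr (eta - dP D y) < rho -> nr eta < dr D /\ dO E (gD D eta)) ->
  forall x, dO D x -> nr (dP D x - dP D y) < rho -> Y x -> ratio D E x = ratio D E y.
Proof.
move=> tD tE yD Yy hrho x xD hx Yx; have [a [hD _ _]] := tD; have [a' [hE _ _]] := tE.
have [oW _ hR] := change_hol hD hE.
have line t : nr t <= 1 -> nr (dP D y + t *: (dP D x - dP D y) - dP D y) < rho.
  move=> ht; rewrite addrAC subrr add0r nrZ; apply: le_lt_trans hx; by rewrite ler_piMl ?nr_ge0.
have y0 : dP D y 0 (dj D) = 0 by apply/(ok_Y Hf hD yD).
have x0 : dP D x 0 (dj D) = 0 by apply/(ok_Y Hf hD xD).
have := @unimod_const R n (change_dom D E) (fun eta => ratio D E (gD D eta)) (dP D y) (dP D x - dP D y) oW hR.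
rewrite [dP D y + (_ - _)]addrC subrK (ok_gK hD xD) (ok_gK hD yD); apply => t ht; have [h1 h2] := hrho _ (line t ht).
  by split.
have [g1 _] := ok_gD hD h1; apply: (top_ratio tD tE g1 h2 _).1; apply: (ok_slice Hf hD h1).
by rewrite !mxE x0 y0 subrr mulr0 addr0.
Qed.

(** The normalized ratio minus 1 is O(|w|^(m+1)) at every point of the slice, with one and the same
    constant by [ratio_const]; [glue_div] makes this a division, and the factor w of the coordinate
    gives the last order. *)
Lemma trans_vanish D E y (rho : R) (W : set X) : 0 < rho -> top_level D -> top_level E -> dO D y -> Y y ->
  (forall eta, nr (eta - dP D y) < rho -> nr eta < dr D /\ dO E (gD D eta)) ->
  open W -> (forall x, W x -> dO D x /\ nr (dP D x - dP D y) < rho) ->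
  vanishes_to_order W (wcoord D) m.+2 (fun x => (ratio D E y)^-1 * wcoord E x - wcoord D x).
Proof.
move=> rho0 tD tE yD Yy hrho oW hW; have [a [hD _ _]] := tD; have [a' [hE _ _]] := tE.
set tau := ratio D E y.
have yE : dO E y.
  by have [] := hrho (dP D y) ltac:(by rewrite subrr nr0); rewrite (ok_gK hD yD).
have WE x : W x -> dO E x by move=> /hW[xD /hrho[_]]; rewrite (ok_gK hD xD).
pose U : set V := [set eta | nr eta < dr D /\ W (gD D eta)].
have oU : vopen U by exact: (cs_vopen (ok_cs hD) oW).
pose F eta := tau^-1 * ratio D E (gD D eta) - 1.
have hF : hol U F.
  move=> eta [h1 h2]; apply: vdiffD; last exact: vdiff_cst.
  apply: vdiffM; first exact: vdiff_cst.
  by apply: (cs_comp (ok_cs hD) h1); apply: (ratio_hol hD hE _ (WE _ h2)).1; exact: (ok_gD hD h1).1.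
have t1 : nr tau = 1 by exact: (top_ratio tD tE yD yE Yy).1.
have t0 : tau != 0 by rewrite -nr_gt0 t1.
have bF z : U z -> z 0 (dj D) = 0 -> exists B : R, exists2 d' : R, 0 < d' & forall t : C, nr t < d' ->
    nr (F (z + t *: delta_mx 0 (dj D))) <= B * nr t ^+ m.+1.
  move=> [hz Wz] z0; have [gz Pz] := ok_gD hD hz; have Yz := ok_slice Hf hD hz z0.
  have [_ [d d0 [B hB]]] := top_ratio tD tE gz (WE _ Wz) Yz.
  have e1 : ratio D E (gD D z) = tau by apply: (ratio_const tD tE yD Yy hrho gz _ Yz); exact: (hW _ Wz).2.
  exists B, d => // t /hB; rewrite Pz e1 => h1.
  have -> : F (z + t *: delta_mx 0 (dj D)) = tau^-1 * (ratio D E (gD D (z + t *: delta_mx 0 (dj D))) - tau).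
    by rewrite /F mulrBr mulVf.
  by rewrite nrM nrV t1 invr1 mul1r.
have [Q hQ eQ] := glue_div oU hF bF.
exists (fun x => Q (dP D x)).
  move=> x Wx; apply: xhol_holo; have [xD _] := hW x Wx; apply: (cs_xhol (ok_cs hD) xD); apply: hQ.
  by split; [exact: (cs_Phi (ok_cs hD))|rewrite (ok_gK hD xD)].
move=> x Wx; have [xD _] := hW x Wx; have Ux : U (dP D x) by split; [exact: (cs_Phi (ok_cs hD))|rewrite (ok_gK hD xD)].
have := eQ _ Ux; rewrite /F (ok_gK hD xD) => e1.
by rewrite {1}/wcoord (ratio_w Hft hD hE xD (WE x Wx)) -/(wcoord D x) mulrA -[in X in _ - X](mul1r (wcoord D x)) -mulrBl e1 -/(wcoord D x) -mulrA -exprSr.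
Qed.

(** One constant must serve on all of each overlap, which may be disconnected. The cover is
    therefore refined until overlapping members lie in a single domain: finitely many data cover
    [Y], and the members are small balls around the points of [Y]. *)
Lemma top_system : (forall p, Y p -> exists2 D, top_level D & dO D p) ->
  exists (J : Type) (W : J -> set X) (w : J -> X -> C) (t : J -> J -> C), system_of_type Y (m + 1) W w t.
Proof.
move=> Htop.
have okt D : top_level D -> valid f D by case=> a [].
have [[p0 Yp0]|nY] := pselect (exists p, Y p); last first.
  have nY' y : ~ Y y by move=> Yy; apply: nY; exists y.
  (* For empty [Y] the empty system does. *)
  exists void, (fun=> set0), (fun _ _ => 0), (fun _ _ => 1); split=> //; try by case.
  by move=> y /nY'.
have [D0 _ _] := Htop p0 Yp0.
have /choice[S hS] : forall p, exists DBK : datum L * set X * set X, Y p ->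
    [/\ top_level DBK.1.1, open DBK.1.2 & DBK.1.2 p] /\ [/\ DBK.1.2 `<=` DBK.2, closed DBK.2 & DBK.2 `<=` dO DBK.1.1].
  move=> p; have [Yp|nYp] := pselect (Y p); last by exists (D0, set0, set0).
  have [D tD Dp] := Htop p Yp; have [B [K [h1 h2 h3 h4 h5]]] := compact_nbhd (okt D tD) Dp.
  by exists (D, B, K).
pose Dd p := (S p).1.1; pose Bp p := (S p).1.2; pose Kp p := (S p).2.
have tD p : Y p -> top_level (Dd p) by move=> /hS[[]].
have oB p : Y p -> open (Bp p) by move=> /hS[[]].
have Bpp p : Y p -> Bp p p by move=> /hS[[]].
have BK p : Y p -> Bp p `<=` Kp p by move=> /hS[_ []].
have cK p : Y p -> closed (Kp p) by move=> /hS[_ []].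
have KD p : Y p -> Kp p `<=` dO (Dd p) by move=> /hS[_ []].
have [F FY YF] := compact_seq_cover cY (fun p Yp => conj (oB p Yp) (Bpp p Yp)).
(* The condition on points near [y]: they stay in the domain of each datum whose closed set [Kp]
   contains [y], and avoid the other sets [Kp]. For finitely many [p] it holds on a
   neighbourhood. *)
pose P y p x := (Kp p y -> dO (Dd p) x) /\ (~ Kp p y -> ~ Kp p x).
have nearP y : \forall x \near y, forall p, p \in F -> P y p x.
  apply: near_seq => p /FY Yp; have [Ky|nKy] := pselect (Kp p y).
    have := cs_nbhs (ok_cs (okt _ (tD p Yp))) (KD p Yp y Ky); apply: filterS => x Dx; by split.
  have : nbhs y (~` Kp p) by apply: open_nbhs_nbhs; split=> //; apply: closed_openC; exact: cK.
  by apply: filterS => x nKx; split.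
(* The members are indexed by all points of [Y]; each uses one of the finitely many data and a
   radius of its own. *)
pose J := {y : X | Y y}.
have /choice[I hI] : forall j : J, exists ir : X * R, [/\ ir.1 \in F, Bp ir.1 (sval j), 0 < ir.2 &
    forall eta : V, nr (eta - dP (Dd ir.1) (sval j)) < ir.2 -> nr eta < dr (Dd ir.1) /\
      (Bp ir.1 (gD (Dd ir.1) eta) /\ forall p, p \in F -> P (sval j) p (gD (Dd ir.1) eta))].
  move=> [y Yy]; have [i iF By] := YF y Yy; have Yi := FY i iF.
  have hD := okt _ (tD i Yi); have Dy : dO (Dd i) y by apply: (KD i Yi); exact: (BK i Yi).
  have hy := cs_Phi (ok_cs hD) Dy.
  have nA : nbhs (gD (Dd i) (dP (Dd i) y)) (Bp i `&` [set x | forall p, p \in F -> P y p x]).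
    rewrite (ok_gK hD Dy); apply: filterI; last exact: nearP.
    by apply: open_nbhs_nbhs; split=> //; exact: oB.
  have [d d0 hd] := cs_cont (ok_cs hD) hy nA; have [d' d0' hd'] := @ok_ball _ _ _ _ (Dd i) _ hy.
  exists (i, Num.min d d'); split=> //=; first by rewrite lt_min d0.
  by move=> eta; rewrite lt_min => /andP[/hd[h1 h2] /hd' h3].
pose Dj j := Dd (I j).1.
have tDj j : top_level (Dj j) by have [h1 _ _ _] := hI j; apply: tD; exact: FY.
have yD j : dO (Dj j) (sval j).
  by have [h1 h2 _ _] := hI j; apply: KD; [exact: FY|exact: BK (FY _ h1) _ h2].
pose W j : set X := [set x | dO (Dj j) x /\ nr (dP (Dj j) x - dP (Dj j) (sval j)) < (I j).2].
have WP j x : W j x -> Bp (I j).1 x /\ forall p, p \in F -> P (sval j) p x.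
  move=> [Dx hx]; have [_ _ _ /(_ _ hx)[_]] := hI j; rewrite (ok_gK (okt _ (tDj j)) Dx) //.
have oW j : open (W j) by apply: coord_ball_open; exact: okt.
(* For disjoint members the ratio need not be unimodular, or even meaningful, at the centre; the
   constant 1 is then a default. *)
pose t j k : C := let tau := ratio (Dj j) (Dj k) (sval j) in if nr tau == 1 then tau^-1 else 1.
exists J, W, (fun j => wcoord (Dj j)), t; split.
- exact: oW.
- move=> y Yy; exists (exist _ y Yy) => //; split; first exact: (yD (exist _ y Yy)).
  by rewrite subrr nr0; have [] := hI (exist _ y Yy).
- by move=> j; apply: wcoord_defining; [exact: okt|move=> x []].
- move=> j k; rewrite /t; case: ifP => [/eqP h1|_]; last exact: normr1.
  by rewrite nrE nrV h1 invr1.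
- move=> j k; have [[x0 [xj xk]]|nx] := pselect (exists x, W j x /\ W k x); last first.
    by exists (fun=> 0) => p [h1 h2]; case: nx; exists p.
  have [kF _ _ _] := hI k; have Yk := FY _ kF.
  (* A common point of the members j and k lies in the set [Kp] of the datum of k. If the centre of
     j were outside that set, the whole member j would avoid it. *)
  have Kj : Kp (I k).1 (sval j).
    apply: contrapT => nK; have [_ hP] := WP j x0 xj; have [_ h2] := hP _ kF.
    by apply: (h2 nK); apply: (BK _ Yk); exact: (WP k x0 xk).1.
  have hrho eta : nr (eta - dP (Dj j) (sval j)) < (I j).2 -> nr eta < dr (Dj j) /\ dO (Dj k) (gD (Dj j) eta).
    move=> he; have [_ _ _ /(_ _ he)[h1 [_ h2]]] := hI j; split=> //.
    by have [h3 _] := h2 _ kF; exact: h3.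
  have [_ _ r0 _] := hI j.
  have yk : dO (Dj k) (sval j).
    by have [] := hrho (dP (Dj j) (sval j)) ltac:(by rewrite subrr nr0); rewrite (ok_gK (okt _ (tDj j)) (yD j)).
  have n1 := (top_ratio (tDj j) (tDj k) (yD j) yk (svalP j)).1.
  rewrite /t n1 eqxx addn1.
  apply: (trans_vanish r0 (tDj j) (tDj k) (yD j) (svalP j) hrho); first exact: openI.
  by move=> x [].
Qed.
End Final.

Theorem theorem1p2 (R : realType) (n : nat) (X : complexManifold R n)
    (Y : set X) (N : line_bundle Y) (LY : line_bundle (@setT X))
    (r : option nat) (m : nat) :
  compact Y ->
  nonsingular_hypersurface Y ->
  is_normal_bundle N -> unitary_flat N ->
  is_divisor_bundle Y LY ->
  le_order 2 r -> semipositive r LY ->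
  (0 < m)%N -> le_order (maxn 3 (2 * m)) r ->
  exists (J : Type) (V : J -> set X) (w : J -> X -> Cplx R)
         (t : J -> J -> Cplx R),
    system_of_type Y (m + 1) V w t.
Proof.
move=> cY _ [g [Hg Hgt]] [N' [c [Hc1 Hc2 Hc3]] HN'] [f [Hf Hft]] H2 [h Hh Hs] m0 Hm.
have HM M : (M <= maxn 3 (2 * m))%N -> le_order M r.
  by case: r Hm {H2 Hh Hs} => //= r Hm hM; exact: leq_trans hM Hm.
have Hu (i j : lb_index N') p : Y p -> lb_dom i p -> lb_dom j p -> `|lb_trans i j p| = 1.
  by move=> Yp ip jp; have [] := HN' i j p Yp ip jp.
have Hbase := base_datum Hf Hft Hh Hs H2 cY Hg Hgt Hc1 Hc2 Hc3 Hu.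
apply: (top_system Hf Hft Hh cY m0) => p Yp.
have [D [a [hD ha hq Dp]]] := top_datum Hf Hft Hh Hs cY HM Hbase m0 Yp.
by exists D => //; exists a.
Qed.
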